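(* Fix $R>0$, $\ell>0$, $p\in\mathbb{N}$ and a constant $C\in\mathbb{R}$. For each $N\in\mathbb{N}$ let $\Lambda=\Lambda_N=[a,b]\times[0,2\pi R]\subset\mathcal{Z}$ with $-\infty\le a\le C$ and $Np\ell^2/R-C\le b\le\infty$, where $a,b$ may depend on $N$. Then there is a unique family of functions $\rho_n(z_1,\ldots,z_n;z'_1,\ldots,z'_n)$, $n\in\mathbb{N}$, with the following property. There are a function $\varepsilon(d)$ with $\varepsilon(d)\to0$ as $d\to\infty$ and constants $K_n$ such that for all $N$, all $d>0$ and all $z_1,\ldots,z_n,z'_1,\ldots,z'_n\in\Lambda$ with $d\le x_j,x'_j\le pN\ell^2/R-d$ for all $j$, $$\bigl|\rho_n^{N,\Lambda}(z_1,\ldots,z_n;z'_1,\ldots,z'_n)-\rho_n(z_1,\ldots,z_n;z'_1,\ldots,z'_n)\bigr|\le K_n\varepsilon(d).$$ These infinite-volume correlation functions do not depend on the choice of the domains $\Lambda_N$ within this class. They are $p\ell^2/R$-periodic in the following sense. Let $u(s)=e^{is/R}$. Then for all $n$ and all $z_1,\ldots,z'_n\in\mathcal{Z}$, $$\Bigl(\prod_{j=1}^n u(py_j)\Bigr)\,\rho_n\bigl(\{z_j-p\ell^2/R\}_{j=1}^n;\{z'_j-p\ell^2/R\}_{j=1}^n\bigr)\,\prod_{j=1}^n\overline{u(py'_j)}=\rho_n(z_1,\ldots,z_n;z'_1,\ldots,z'_n).$$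
   Context: Setting. $\mathcal{Z}=\mathbb{R}\times[0,2\pi R]$ is a cylinder of radius $R>0$. Its points are written $z=x+iy$ with $x\in\mathbb{R}$ and $y\in[0,2\pi R]$, and it carries the measure $dx\,dy$. Let $\gamma=\ell/R$. Laughlin's function. For $N\in\mathbb{N}$, $$\Psi_N(z_1,\ldots,z_N)=\kappa_N\prod_{1\le j<k\le N}\bigl(e^{z_k/R}-e^{z_j/R}\bigr)^p\exp\Bigl(-\frac{1}{2\ell^2}\sum_{k=1}^N x_k^2\Bigr),$$ where $\kappa_N>0$ is a normalizing constant. It is a fermionic wave function if $p$ is odd and a bosonic one if $p$ is even. Finite-volume correlation functions. For a domain $\Lambda\subset\mathcal{Z}$ and $1\le n\le N$, $$\rho_n^{N,\Lambda}(z_1,\ldots,z_n;z'_1,\ldots,z'_n)=\frac{N!}{(N-n)!}\,\frac{1}{\|\Psi_N\|_\Lambda^2}\int_{\Lambda^{N-n}}\Psi_N(z_1,\ldots,z_n,z_{n+1},\ldots,z_N)\,\overline{\Psi_N(z'_1,\ldots,z'_n,z_{n+1},\ldots,z_N)}\,\prod_{j=n+1}^N dx_j\,dy_j .$$ Here $\|\cdot\|_\Lambda$ denotes the $L^2$ norm over $\Lambda^N$.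
   Formalization: Uniqueness is proved among families that also satisfy the stated periodicity: the approximation property alone only constrains points with all x_j, x'_j > 0, so a family altered at a point with x < 0 would satisfy it too. Here p ≥ 1, N ≥ n ≥ 1. *)

(* Defs.v *)
From HB Require Import structures.
From mathcomp Require Import all_boot all_order all_algebra.
From mathcomp Require Import all_classical all_reals all_analysis.
From mathcomp Require Import complex.

Set Implicit Arguments.
Unset Strict Implicit.
Unset Printing Implicit Defensive.

Import Order.TTheory GRing.Theory Num.Theory.
Local Open Scope classical_set_scope.
Local Open Scope ring_scope.

(* Points z = x + i y of the cylinder are represented as pairs (x, y). *)
Section Laughlin.
Variable R : realType.

Definition in_cyl (Rad : R) (z : R * R) : Prop :=
  0 <= z.2 <= 2 * pi * Rad.

Definition in_Lambda (Rad : R) (a b : \bar R) (z : R * R) : Prop :=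
  ((a <= z.1%:E)%E /\ (z.1%:E <= b)%E) /\ in_cyl Rad z.

Definition cexp_cyl (Rad : R) (z : R * R) : R[i] :=
  Complex (expR (z.1 / Rad) * cos (z.2 / Rad))
          (expR (z.1 / Rad) * sin (z.2 / Rad)).

Definition uphase (Rad : R) (s : R) : R[i] :=
  Complex (cos (s / Rad)) (sin (s / Rad)).

(* Laughlin's function on the points zs = [:: z_1; ...; z_N], with the
   normalizing constant kappa_N taken to be 1 (it cancels in rho^{N,Lambda}). *)
Definition Psi (Rad ell : R) (p : nat) (zs : seq (R * R)) : R[i] :=
  (\prod_(k < size zs) \prod_(j < k)
      (cexp_cyl Rad (nth (0, 0) zs k) - cexp_cyl Rad (nth (0, 0) zs j)) ^+ p)
  * (expR (- (\sum_(z <- zs) z.1 ^+ 2) / (2 * ell ^+ 2)))%:C%C.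

Fixpoint iint (Rad : R) (a b : \bar R) (m : nat) (f : seq (R * R) -> R) : R :=
  match m with
  | 0%N => f [::]
  | m'.+1 =>
      \int[lebesgue_measure]_(x in [set x : R | (a <= x%:E)%E /\ (x%:E <= b)%E])
        \int[lebesgue_measure]_(y in [set y : R | 0 <= y <= 2 * pi * Rad])
           iint Rad a b m' (fun w => f ((x, y) :: w))
  end.

Definition ciint (Rad : R) (a b : \bar R) (m : nat) (f : seq (R * R) -> R[i])
  : R[i] :=
  Complex (iint Rad a b m (fun w => complex.Re (f w))) (iint Rad a b m (fun w => complex.Im (f w))).

Definition normsq_Psi (Rad ell : R) (p N : nat) (a b : \bar R) : R :=
  iint Rad a b N (fun w => Normc.normc (Psi Rad ell p w) ^+ 2).

Definition rhoN (Rad ell : R) (p N : nat) (a b : \bar R)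
  (zs zs' : seq (R * R)) : R[i] :=
  let n := size zs in
  ((N`! %/ (N - n)`!)%:R / normsq_Psi Rad ell p N a b)%:C%C *
  ciint Rad a b (N - n)
    (fun w => Psi Rad ell p (zs ++ w) * conjc (Psi Rad ell p (zs' ++ w))).

Definition shiftx (s : R) (zs : seq (R * R)) : seq (R * R) :=
  map (fun z => (z.1 - s, z.2)) zs.

Definition periodic_family (Rad ell : R) (p : nat)
  (rho : nat -> seq (R * R) -> seq (R * R) -> R[i]) : Prop :=
  forall (n : nat) (zs zs' : seq (R * R)),
    (1 <= n)%N -> size zs = n -> size zs' = n ->
    (forall z, z \in zs -> in_cyl Rad z) ->
    (forall z, z \in zs' -> in_cyl Rad z) ->
    (\prod_(z <- zs) uphase Rad (p%:R * z.2))
      * rho n (shiftx (p%:R * ell ^+ 2 / Rad) zs) (shiftx (p%:R * ell ^+ 2 / Rad) zs')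
      * (\prod_(z <- zs') conjc (uphase Rad (p%:R * z.2)))
    = rho n zs zs'.

Definition admissible_domains (Rad ell : R) (p : nat) (C : R)
  (a b : nat -> \bar R) : Prop :=
  forall N : nat, (a N <= C%:E)%E /\ ((N%:R * p%:R * ell ^+ 2 / Rad - C)%:E <= b N)%E.

Definition approximates (Rad ell : R) (p : nat) (a b : nat -> \bar R)
  (rho : nat -> seq (R * R) -> seq (R * R) -> R[i]) : Prop :=
  exists (eps : R -> R) (K : nat -> R),
    eps d @[d --> +oo] --> 0 /\
    forall (n N : nat) (d : R) (zs zs' : seq (R * R)),
      (1 <= n)%N -> (n <= N)%N -> 0 < d ->
      size zs = n -> size zs' = n ->
      (forall z, z \in zs ->
         in_Lambda Rad (a N) (b N) z /\
         d <= z.1 <= N%:R * p%:R * ell ^+ 2 / Rad - d) ->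
      (forall z, z \in zs' ->
         in_Lambda Rad (a N) (b N) z /\
         d <= z.1 <= N%:R * p%:R * ell ^+ 2 / Rad - d) ->
      Normc.normc (rhoN Rad ell p N (a N) (b N) zs zs' - rho n zs zs') <= K n * eps d.

End Laughlin.

(* Main.v *)
Require Import Defs.
From HB Require Import structures.
From mathcomp Require Import all_boot all_order all_algebra.
From mathcomp Require Import all_classical all_reals all_analysis.
From mathcomp Require Import measurable_realfun complex ring lra zify.
Set Implicit Arguments.
Unset Strict Implicit.
Unset Printing Implicit Defensive.
Import Order.TTheory GRing.Theory Num.Theory.
Import numFieldNormedType.Exports.
Local Open Scope ring_scope.

(** Expanding the power of the Vandermonde product into monomials writes
    Laughlin's function as a superposition of products of the Gaussian orbitals
    psi_k, centred at k ell^2 / R, which stay orthogonal on every domain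
    [a, b] x [0, 2 pi R].  Hence rho_n^{N,Lambda} is the sum over orbital indices
    of products of orbitals weighted by the reduced density matrix of the
    occupation words, and the domain enters only through the mass tau_k of the
    k-th orbital in it, which is exponentially close to 1 away from the edges.

    The expansion coefficients factorize at renewal points: the k such that
    exactly k particles sit in the first p k orbitals, with the least possible
    total momentum.  The normalizations C_N therefore solve a renewal equation.
    Ordering the particles along the cylinder and comparing their Gaussian energy
    with their interaction gives
    C_N <= K sum_(k1 <= k0 < k2) Q^(k2 - k1) C_k1 C_(N - k2) for every Q > 0,
    which forces the renewal process to be positive recurrent, so that C_N r^N
    has a positive limit.  By a second-moment estimate every long window then
    contains its share of renewal points; inserting one window of them on each
    side of the bulk shows that the bulk density matrix depends neither on N nor
    on the domain, up to a small error, and is invariant under shifts by p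
    orbitals.  Gaussian decay of the orbitals carries this over to the functions
    on the cylinder.  A periodic family is determined by its values in the bulk,
    which gives uniqueness. *)

(** * Sums over words *)

(** The expansion coefficients are not known explicitly, and the renewal equation alone allows C_N
    r^N to tend to 0; the missing information is taken from the integral of |Psi|^2 in position
    space. A cut between two consecutive particles counts as good when every particle deviates from
    its lattice site by at most an allowance [kap] plus half its lattice distance to the cut.
    Cutting there costs a bounded factor, while a stretch without good cuts costs Gaussian energy
    proportional to its length, at a rate that grows with [kap]. The other costs per particle do not
    depend on [kap], which is why every Q > 0 can be reached. The same integral with a test factor 1
    + Gaussian bounds exponential moments of the occupation numbers, uniformly in N and in the
    orbital; these moments control every error made in the density matrices. States are sums over
    all words divided by N!, without ordering or exclusion: coefficients change only by a sign under
    permutations and enter in pairs, so both parities of p are treated alike. *)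

Fixpoint nsum (K : nmodType) (D N : nat) (f : seq nat -> K) : K :=
  if N is N'.+1 then \sum_(i < D) nsum D N' (fun m => f (val i :: m)) else f [::].

Lemma nsum_nil (K : nmodType) D (f : seq nat -> K) : nsum D 0 f = f [::].
Proof. by []. Qed.

Lemma nsumS (K : nmodType) D N (f : seq nat -> K) :
  nsum D N.+1 f = \sum_(i < D) nsum D N (fun m => f (val i :: m)).
Proof. by []. Qed.

Section NsumNmod.
Variable K : nmodType.
Implicit Types (f g : seq nat -> K) (D N : nat).

Lemma eq_nsum D N f g :
  (forall m, size m = N -> all (ltn^~ D) m -> f m = g m) -> nsum D N f = nsum D N g.
Proof.
elim: N f g => [|N IH] f g fg /=; first exact: fg.
apply: eq_bigr => i _; apply: IH => m sm am; apply: fg; rewrite /= ?sm //.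
by rewrite ltn_ord.
Qed.

Lemma nsumD D N f g : nsum D N (fun m => f m + g m) = nsum D N f + nsum D N g.
Proof.
elim: N f g => [|N IH] f g //=; rewrite -big_split /=.
by apply: eq_bigr => i _; rewrite IH.
Qed.

Lemma nsum0 D N : nsum D N (fun=> 0 : K) = 0.
Proof. by elim: N => [|N IH] //=; rewrite big1. Qed.

Lemma nsum_sum (I : Type) (r : seq I) (P : pred I) D N (F : I -> seq nat -> K) :
  nsum D N (fun m => \sum_(i <- r | P i) F i m) = \sum_(i <- r | P i) nsum D N (F i).
Proof.
elim: r => [|i r IH].
  rewrite big_nil -[RHS](nsum0 D N); apply: eq_nsum => m _ _; exact: big_nil.
rewrite big_cons; case Pi: (P i).
  by rewrite -IH -nsumD; apply: eq_nsum => m _ _; rewrite big_cons Pi.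
by rewrite -IH; apply: eq_nsum => m _ _; rewrite big_cons Pi.
Qed.

Lemma nsum_cat D N1 N2 f :
  nsum D (N1 + N2) f = nsum D N1 (fun m1 => nsum D N2 (fun m2 => f (m1 ++ m2))).
Proof. by elim: N1 f => [|N IH] f //=; apply: eq_bigr => i _; rewrite IH. Qed.

Lemma nsum_exch D1 N1 D2 N2 (F : seq nat -> seq nat -> K) :
  nsum D1 N1 (fun m1 => nsum D2 N2 (F m1)) =
  nsum D2 N2 (fun m2 => nsum D1 N1 (fun m1 => F m1 m2)).
Proof.
elim: N1 F => [|N IH] F //=.
by rewrite nsum_sum; apply: eq_bigr => i _; rewrite IH.
Qed.

Lemma nsum_widen D D' N f : (D <= D')%N ->
  (forall m, size m = N -> ~~ all (ltn^~ D) m -> f m = 0) ->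
  nsum D' N f = nsum D N f.
Proof.
move=> DD'; elim: N f => [|N IH] f f0 //=.
rewrite (big_ord_widen _ (fun i : nat => nsum D N (fun m => f (i :: m))) DD').
rewrite [RHS]big_mkcond /=; apply: eq_bigr => i _; case: ifP => iD.
  by apply: IH => m sm am; apply: f0; rewrite /= ?sm // iD.
rewrite -[RHS](nsum0 D' N); apply: eq_nsum => m sm _.
by apply: f0; rewrite /= ?sm // iD.
Qed.

Lemma nsum_delta D N f m0 : size m0 = N -> all (ltn^~ D) m0 ->
  nsum D N (fun m => if m == m0 then f m else 0) = f m0.
Proof.
elim: N f m0 => [|N IH] f [|x m0] //= [sm] /andP[xD am].
rewrite (bigD1 (Ordinal xD)) //= big1 ?addr0.
  rewrite -(IH (fun m => f (x :: m)) m0) //; apply: eq_nsum => m _ _.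
  by rewrite eqseq_cons eqxx.
move=> i /negP ix; rewrite -[RHS](nsum0 D N); apply: eq_nsum => m _ _.
by rewrite eqseq_cons; case: eqP => // xi; case: ix; apply/eqP/val_inj.
Qed.

(** Used to remove the orbitals below a renewal point, so that the particles to its right form a
    system of their own. *)
Lemma nsum_shift D c N f :
  nsum (c + D) N (fun m => if all (leq c) m then f [seq (x - c)%N | x <- m] else 0) =
  nsum D N f.
Proof.
elim: N f => [|N IH] f //=.
rewrite -(big_mkord xpredT (fun i => nsum (c + D) N (fun m =>
   if (c <= i)%N && all (leq c) m then f ((i - c)%N :: [seq (x - c)%N | x <- m]) else 0))).
rewrite (@big_cat_nat _ _ _ c) ?leq_addr //= big_nat big1 ?add0r.
  rewrite -[in index_iota c _](add0n c) big_addn addKn big_mkord; apply: eq_bigr => i _.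
  rewrite -(IH (fun m => f (val i :: m))); apply: eq_nsum => m _ _.
  by rewrite leq_addl addnK.
move=> i /andP[_ ic]; rewrite -[RHS](nsum0 (c + D) N); apply: eq_nsum => m _ _.
by rewrite leqNgt ic.
Qed.

End NsumNmod.

Section NsumRing.
Variable K : pzRingType.
Implicit Types (f g : seq nat -> K) (D N : nat).

Lemma nsumZ D N c f : nsum D N (fun m => c * f m) = c * nsum D N f.
Proof.
elim: N f => [|N IH] f //=; rewrite mulr_sumr.
by apply: eq_bigr => i _; rewrite IH.
Qed.

Lemma nsumZr D N c f : nsum D N (fun m => f m * c) = nsum D N f * c.
Proof.
elim: N f => [|N IH] f //=; rewrite mulr_suml.
by apply: eq_bigr => i _; rewrite IH.
Qed.

Lemma nsumM D1 N1 D2 N2 f g :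
  nsum D1 N1 (fun m1 => nsum D2 N2 (fun m2 => f m1 * g m2)) = nsum D1 N1 f * nsum D2 N2 g.
Proof. by rewrite -nsumZr; apply: eq_nsum => m _ _; rewrite nsumZ. Qed.

Lemma nsumN D N f : nsum D N (fun m => - f m) = - nsum D N f.
Proof.
rewrite -mulN1r -nsumZ; apply: eq_nsum => m _ _; exact/esym/mulN1r.
Qed.

End NsumRing.

Lemma rmorph_nsum (K L : pzRingType) (h : {rmorphism K -> L}) D N (f : seq nat -> K) :
  h (nsum D N f) = nsum D N (fun m => h (f m)).
Proof.
elim: N f => [|N IH] f //=; rewrite rmorph_sum; by apply: eq_bigr => i _; rewrite IH.
Qed.

Lemma nsum_prod (K : comPzRingType) (T : Type) D (phi : T -> nat -> K) (zs : seq T) :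
  nsum D (size zs) (fun m => \prod_(x <- zip zs m) phi x.1 x.2) =
  \prod_(z <- zs) \sum_(i < D) phi z i.
Proof.
elim: zs => [|z zs IH] /=; first by rewrite !big_nil.
rewrite big_cons -IH mulr_suml; apply: eq_bigr => i _.
by rewrite -nsumZ; apply: eq_nsum => m _ _; rewrite big_cons.
Qed.

Section NsumNum.
Variable K : numDomainType.
Implicit Types (f g : seq nat -> K) (D N : nat).

Lemma le_nsum D N f g : (forall m, size m = N -> all (ltn^~ D) m -> f m <= g m) ->
  nsum D N f <= nsum D N g.
Proof.
elim: N f g => [|N IH] f g fg /=; first exact: fg.
apply: ler_sum => i _; apply: IH => m sm am; apply: fg; rewrite /= ?sm //.
by rewrite ltn_ord.
Qed.

Lemma nsum_ge0 D N f : (forall m, size m = N -> all (ltn^~ D) m -> 0 <= f m) ->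
  0 <= nsum D N f.
Proof. by move=> f0; rewrite -(nsum0 K D N); apply: le_nsum. Qed.

Lemma ler_norm_nsum D N f : `|nsum D N f| <= nsum D N (fun m => `|f m|).
Proof.
elim: N f => [|N IH] f //=; apply: le_trans (ler_norm_sum _ _ _) _.
by apply: ler_sum => i _.
Qed.

End NsumNum.

Definition symfun (K : Type) (F : seq nat -> K) :=
  forall s t, perm_eq s t -> F s = F t.

Lemma symfun_cons (K : Type) (F : seq nat -> K) x : symfun F -> symfun (fun s => F (x :: s)).
Proof. by move=> sF s t st; apply: sF; rewrite perm_cons. Qed.

Arguments nsum : simpl never.

(* Selecting the entries satisfying P: the binomial counts their positions. *)
Lemma nsum_select (K : pzRingType) (P : pred nat) D N k (F : seq nat -> K) : symfun F ->
  nsum D N (fun m => (count P m == k)%:R * F m) =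
  'C(N, k)%:R * nsum D k (fun m1 => nsum D (N - k) (fun m2 =>
     (all P m1 && all (predC P) m2)%:R * F (m1 ++ m2))).
Proof.
elim: N k F => [|N IH] k F sF.
  by case: k => [|k]; rewrite !nsum_nil ?bin0 ?bin0n ?mul1r ?mul0r.
have stepT i : P i -> nsum D N (fun m => (count P (i :: m) == k)%:R * F (i :: m)) =
   if k is k'.+1 then 'C(N, k')%:R * nsum D k' (fun m1 => nsum D (N - k') (fun m2 =>
     (all P (i :: m1) && all (predC P) m2)%:R * F ((i :: m1) ++ m2))) else 0.
  move=> Pi; case: k => [|k'].
    by rewrite -[RHS](nsum0 K D N); apply: eq_nsum => m _ _; rewrite /= Pi mul0r.
  rewrite (_ : nsum _ _ _ = nsum D N (fun m => (count P m == k')%:R * F (i :: m))).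
    rewrite (IH k' (fun m => F (i :: m))); last exact: symfun_cons.
    by rewrite /= Pi.
  by apply: eq_nsum => m _ _; rewrite /= Pi.
have stepF i : ~~ P i -> nsum D N (fun m => (count P (i :: m) == k)%:R * F (i :: m)) =
   'C(N, k)%:R * nsum D k (fun m1 => nsum D (N - k) (fun m2 =>
     (all P m1 && all (predC P) (i :: m2))%:R * F (m1 ++ i :: m2))).
  move=> Pi; rewrite (_ : nsum _ _ _ = nsum D N (fun m => (count P m == k)%:R * F (i :: m))).
    rewrite (IH k (fun m => F (i :: m))); last exact: symfun_cons.
    congr (_ * _); apply: eq_nsum => m1 _ _; apply: eq_nsum => m2 _ _.
    rewrite /= Pi; congr (_ * _); apply: sF.
    by rewrite -cat1s perm_catCA.
  by apply: eq_nsum => m _ _; rewrite /= (negbTE Pi).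
rewrite nsumS (bigID (fun i : 'I_D => P i)) /=.
rewrite (eq_bigr _ (fun (i : 'I_D) Pi => stepT i Pi)).
rewrite (eq_bigr _ (fun (i : 'I_D) Pi => stepF i Pi)).
have -> : \sum_(i < D | ~~ P i) 'C(N, k)%:R * nsum D k (fun m1 => nsum D (N - k) (fun m2 =>
     (all P m1 && all (predC P) (val i :: m2))%:R * F (m1 ++ val i :: m2))) =
   'C(N, k)%:R * nsum D k (fun m1 => nsum D (N.+1 - k) (fun m2 =>
     (all P m1 && all (predC P) m2)%:R * F (m1 ++ m2))).
  have [kN|kN] := leqP k N; last first.
    by rewrite bin_small // mul0r big1 // => i _; rewrite mul0r.
  rewrite -mulr_sumr; congr (_ * _); rewrite -nsum_sum; apply: eq_nsum => m1 _ _.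
  rewrite subSn // nsumS [RHS](bigID (fun i : 'I_D => P i)) /= [X in _ = X + _]big1 ?add0r //.
  move=> i Pi; rewrite -[RHS](nsum0 K D (N - k)); apply: eq_nsum => m2 _ _.
  by rewrite Pi /= andbF mul0r.
case: k {stepT stepF} => [|k]; first by rewrite big1 // add0r !bin0.
rewrite -mulr_sumr binS natrD mulrDl addrC subSS; congr (_ + _ * _).
rewrite nsumS [RHS](bigID (fun i : 'I_D => P i)) /= [X in _ = _ + X]big1 ?addr0 //.
move=> i /negbTE Pi; rewrite -[RHS](nsum0 K D k); apply: eq_nsum => m1 _ _.
by rewrite -[RHS](nsum0 K D (N - k)); apply: eq_nsum => m2 _ _; rewrite Pi mul0r.
Qed.

(** By symmetry each of the [N.+1] positions contributes equally to the count. *)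
Lemma nsum_count (K : pzRingType) D N k (F : seq nat -> K) : symfun F -> (k < D)%N ->
  nsum D N.+1 (fun s => (count_mem k s)%:R * F s) =
  N.+1%:R * nsum D N (fun r => F (k :: r)).
Proof.
move=> sF kD; elim: N F sF => [|N IH] F sF.
  rewrite nsumS mul1r (bigD1 (Ordinal kD)) //= !nsum_nil /= eqxx mul1r big1 ?addr0 // => i.
  move=> /negP ik; rewrite nsum_nil /= addn0; case: eqP => [e|_]; last by rewrite mul0r.
  by case: ik; apply/eqP/val_inj.
have e1 : nsum D N.+2 (fun s => (count_mem k s)%:R * F s) =
  \sum_(i < D) (nsum D N.+1 (fun r => ((val i == k) : nat)%:R * F (val i :: r)) +
                nsum D N.+1 (fun r => (count_mem k r)%:R * F (val i :: r))).
  rewrite nsumS; apply: eq_bigr => i _.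
  rewrite -[RHS](nsumD D N.+1).
  by apply: (@eq_nsum K D N.+1) => m _ _; rewrite /= natrD mulrDl.
have eA : \sum_(i < D) nsum D N.+1 (fun r => ((val i == k) : nat)%:R * F (val i :: r)) =
    nsum D N.+1 (fun r => F (k :: r)).
  rewrite (bigD1 (Ordinal kD)) //= big1 ?addr0 => [|i ik].
    by apply: (@eq_nsum K D N.+1) => m _ _; rewrite eqxx mul1r.
  rewrite -[RHS](nsum0 K D N.+1); apply: (@eq_nsum K D N.+1) => m _ _.
  case: eqP => [e|_]; last by rewrite mul0r.
  by case/negP: ik; apply/eqP/val_inj.
rewrite e1 big_split eA -[N.+2]add1n natrD mulrDl mul1r; congr (_ + _).
under eq_bigr => i _ do rewrite (IH _ (symfun_cons (val i) sF)).
rewrite -mulr_sumr; congr (_ * _); rewrite nsumS; apply: eq_bigr => i _.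
by apply: eq_nsum => m _ _; apply: sF; rewrite (perm_catCA [:: val i] [:: k] m).
Qed.

(** The left side is a factorial moment: it counts the injective placements of the letters of [m] in
    the word. Admitting coinciding positions replaces it by a product of counts. This is how
    diagonal density matrices are bounded by moments of occupation numbers. *)
Lemma nsum_marked (K : numDomainType) D n N (F : seq nat -> K) (m : seq nat) : symfun F ->
  (forall s, 0 <= F s) -> all (ltn^~ D) m -> size m = n ->
  ((N + n) ^_ n)%:R * nsum D N (fun r => F (m ++ r)) <=
  nsum D (N + n) (fun s => (\prod_(k <- m) (count_mem k s)%:R) * F s).
Proof.
elim: m n F => [|k m IH] n F sF F0 /= => [_ <-|/andP[kD am] <-].
  by rewrite addn0 ffactn0 mul1r; apply: le_nsum => s _ _; rewrite big_nil mul1r.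
rewrite addnS ffactnS natrM -mulrA /=.
have := IH (size m) (fun s => F (k :: s)) (symfun_cons k sF) (fun s => F0 _) am erefl.
move=> /(ler_wpM2l (ler0n K (N + size m).+1)) => /le_trans -> //.
pose F' s := (\prod_(j <- m) (count_mem j s)%:R) * F s : K.
have sF' : symfun F'.
  move=> s t st; rewrite /F' (sF _ _ st); congr (_ * _).
  by apply: eq_bigr => j _; move/permP: st => ->.
rewrite (_ : (fun s => _ * F s) = (fun s => (count_mem k s)%:R * F' s)); last first.
  by apply/funext => s; rewrite big_cons /F' mulrA.
rewrite (nsum_count _ sF' kD) ler_wpM2l // le_nsum // => s _ _.
rewrite /F' ler_wpM2r // ler_prod // => j _; rewrite ler0n ler_nat.
exact: leq_addl.
Qed.

Lemma prodr_const_seq (K : comPzRingType) (T : Type) (r : seq T) (c : K) :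
  \prod_(i <- r) c = c ^+ size r.
Proof. by elim: r => [|x r IH]; rewrite ?big_nil ?expr0 // big_cons IH exprS. Qed.

(** * Powers of the Vandermonde product *)

Section Vandermonde.
Variable p : nat.

Fixpoint vdm (K : comPzRingType) (w : seq K) : K :=
  if w is x :: w' then vdm w' * \prod_(v <- w') (v - x) ^+ p else 1.

Definition vcross (K : comPzRingType) (w1 w2 : seq K) : K :=
  \prod_(u <- w1) \prod_(v <- w2) (v - u) ^+ p.

Section Ring.
Variable K : comPzRingType.
Implicit Types w : seq K.

Lemma vdm_cat w1 w2 : vdm (w1 ++ w2) = vdm w1 * vdm w2 * vcross w1 w2.
Proof.
rewrite /vcross; elim: w1 => [|x w1 IH] /=; first by rewrite big_nil mul1r mulr1.
by rewrite IH big_cat big_cons /=; ring.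
Qed.

Lemma vcross_catr w1 w2 w3 : vcross w1 (w2 ++ w3) = vcross w1 w2 * vcross w1 w3.
Proof. by rewrite /vcross -big_split; apply: eq_bigr => i _; rewrite big_cat. Qed.

Lemma vcross_sym w1 w2 :
  vcross w1 w2 = (-1) ^+ (p * size w1 * size w2) * vcross w2 w1.
Proof.
rewrite /vcross [in RHS]exchange_big /= [X in X * _](_ : _ =
  \prod_(u <- w1) \prod_(v <- w2) (-1) ^+ p).
  rewrite -big_split /=; apply: eq_bigr => u _; rewrite -big_split /=.
  by apply: eq_bigr => v _; rewrite -exprMn mulN1r opprB.
under eq_bigr do rewrite prodr_const_seq.
by rewrite prodr_const_seq -!exprM -mulnA (mulnC (size w1)) mulnA.
Qed.

Lemma vdm_swap w0 w1 w2 w3 : vdm (w0 ++ w1 ++ w2 ++ w3) =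
  (-1) ^+ (p * size w1 * size w2) * vdm (w0 ++ w2 ++ w1 ++ w3).
Proof.
by rewrite !vdm_cat !vcross_catr (vcross_sym w1 w2); ring.
Qed.

Lemma vdm_scale t w :
  vdm [seq t * x | x <- w] = t ^+ (p * 'C(size w, 2)) * vdm w.
Proof.
elim: w => [|x w IH] /=; first by rewrite muln0 mul1r.
rewrite IH big_map (eq_bigr (fun v => t ^+ p * (v - x) ^+ p)); last first.
  by move=> v _; rewrite -mulrBr exprMn.
rewrite big_split /= prodr_const_seq.
by rewrite -exprM binS bin1 mulnDr exprD; ring.
Qed.

End Ring.

Lemma rmorph_vdm (K L : comPzRingType) (h : {rmorphism K -> L}) w :
  h (vdm w) = vdm [seq h x | x <- w].
Proof.
elim: w => [|x w IH] /=; first exact: rmorph1.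
rewrite rmorphM IH rmorph_prod big_map; congr (_ * _).
by apply: eq_bigr => v _; rewrite rmorphXn rmorphB.
Qed.

End Vandermonde.

(** * Monomials and the uniqueness of their coefficients *)

Definition mon (K : pzRingType) (w : seq K) (m : seq nat) : K :=
  \prod_(x <- zip w m) x.1 ^+ x.2.

Lemma mon_cons (K : pzRingType) x (w : seq K) k m :
  mon (x :: w) (k :: m) = x ^+ k * mon w m.
Proof. by rewrite /mon big_cons. Qed.

Lemma mon_cat (K : pzRingType) (w1 w2 : seq K) m1 m2 : size w1 = size m1 ->
  mon (w1 ++ w2) (m1 ++ m2) = mon w1 m1 * mon w2 m2.
Proof. by move=> s1; rewrite /mon zip_cat // big_cat. Qed.

Lemma mon_scale (K : comPzRingType) t (w : seq K) m : size w = size m ->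
  mon [seq t * x | x <- w] m = t ^+ sumn m * mon w m.
Proof.
elim: w m => [|x w IH] [|k m] //= => [_|[sw]]; first by rewrite /mon big_nil mulr1.
by rewrite !mon_cons IH // exprMn exprD; ring.
Qed.

Lemma mon_shift (K : comPzRingType) c (w : seq K) m : size w = size m ->
  mon w [seq (c + k)%N | k <- m] = (\prod_(x <- w) x ^+ c) * mon w m.
Proof.
elim: w m => [|x w IH] [|k m] //= => [_|[sw]]; first by rewrite /mon !big_nil mulr1.
by rewrite !mon_cons IH // big_cons exprD; ring.
Qed.

Lemma rmorph_mon (K L : pzRingType) (h : {rmorphism K -> L}) w m :
  h (mon w m) = mon [seq h x | x <- w] m.
Proof.
elim: w m => [|x w IH] [|k m] /=; rewrite /mon ?big_nil ?rmorph1 //=.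
by rewrite !big_cons rmorphM rmorphXn /= -/(mon w m) IH.
Qed.

(** For fixed remaining variables the sum is a polynomial in the first variable with too many roots.
    Each of its coefficients is a sum of the same kind in one variable less, so induction
    applies. *)
Lemma mon_nsum_eq0 (K : numFieldType) D N (a : seq nat -> K) :
  (forall w, size w = N -> nsum D N (fun m => a m * mon w m) = 0) ->
  forall m, size m = N -> all (ltn^~ D) m -> a m = 0.
Proof.
elim: N a => [|N IH] a a0 [|k m] //=.
  by move=> _ _; have := a0 [::] erefl; rewrite nsum_nil /mon big_nil mulr1.
case=> sm /andP[kD am]; apply: (IH (fun m => a (k :: m))) => // w sw.
pose P := \poly_(i < D) nsum D N (fun m => a (i :: m) * mon w m).
have P0 x : P.[x] = 0.
  rewrite horner_poly -[RHS](a0 (x :: w)) /= ?sw // nsumS; apply: eq_bigr => i _.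
  by rewrite -nsumZr; apply: eq_nsum => m' _ _; rewrite mon_cons; ring.
have Pz : P = 0.
  apply/eqP/negPn/negP => nz.
  have := @max_poly_roots K P [seq n%:R | n <- iota 0 (size P)] nz.
  rewrite size_map size_iota ltnn => H; apply/notF/H.
    by apply/allP => x _; rewrite /root P0.
  rewrite map_inj_uniq ?iota_uniq // => i j /eqP; by rewrite eqr_nat => /eqP.
by have := congr1 (fun q : {poly K} => q`_k) Pz; rewrite coef_poly kD coef0.
Qed.

Lemma raddf_nsum (K L : zmodType) (h : {additive K -> L}) D N (f : seq nat -> K) :
  h (nsum D N f) = nsum D N (fun m => h (f m)).
Proof.
elim: N f => [|N IH] f; first by rewrite !nsum_nil.
by rewrite !nsumS raddf_sum; apply: eq_bigr => i _; rewrite IH.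
Qed.

Lemma poly_fun_eq (K : numFieldType) (P Q : {poly K}) : (forall t, P.[t] = Q.[t]) -> P = Q.
Proof.
move=> PQ; apply/eqP; rewrite -subr_eq0; apply/eqP/eqP/negPn/negP => nz.
have := @max_poly_roots K (P - Q) [seq n%:R | n <- iota 0 (size (P - Q))] nz.
rewrite size_map size_iota ltnn => H; apply/notF/H.
  by apply/allP => x _; rewrite /root hornerD hornerN PQ subrr.
by rewrite map_inj_uniq ?iota_uniq // => i j /eqP; rewrite eqr_nat => /eqP.
Qed.

Lemma mon_nsum_inj2 (K : numFieldType) D1 D2 n1 n2 (A B : seq nat -> seq nat -> K) :
  (forall w1 w2, size w1 = n1 -> size w2 = n2 ->
    nsum D1 n1 (fun m1 => nsum D2 n2 (fun m2 => A m1 m2 * (mon w1 m1 * mon w2 m2))) =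
    nsum D1 n1 (fun m1 => nsum D2 n2 (fun m2 => B m1 m2 * (mon w1 m1 * mon w2 m2)))) ->
  forall m1 m2, size m1 = n1 -> all (ltn^~ D1) m1 -> size m2 = n2 -> all (ltn^~ D2) m2 ->
  A m1 m2 = B m1 m2.
Proof.
move=> AB m1 m2 s1 a1 s2 a2; apply/eqP; rewrite -subr_eq0; apply/eqP.
apply: (@mon_nsum_eq0 _ D2 n2 (fun m2 => A m1 m2 - B m1 m2)) => // w2 sw2.
apply: (@mon_nsum_eq0 _ D1 n1 (fun m1 =>
  nsum D2 n2 (fun m2 => (A m1 m2 - B m1 m2) * mon w2 m2))) => // w1 sw1.
transitivity (nsum D1 n1 (fun m1 => nsum D2 n2 (fun m2 => A m1 m2 * (mon w1 m1 * mon w2 m2)))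
  - nsum D1 n1 (fun m1 => nsum D2 n2 (fun m2 => B m1 m2 * (mon w1 m1 * mon w2 m2)))).
  rewrite -nsumN -nsumD; apply: eq_nsum => m _ _.
  by rewrite -nsumN -nsumD -nsumZr; apply: eq_nsum => m' _ _; ring.
by rewrite AB // subrr.
Qed.

(** * Coefficients of the power of the Vandermonde product: symmetry, homogeneity, factorization *)

Section Coef.
Variables (R : realType) (p : nat).
Notation RtoC := (@real_complex R).

(** Polynomials in N variables as explicit lists of terms. The coefficients are recorded as real
    although the variables are complex; this makes [acoef], and with it all density matrices,
    real. *)
Definition isPoly (N : nat) (f : seq R[i] -> R[i]) := exists2 L : seq (R * seq nat),
  all (fun cm => size cm.2 == N) L &
  forall w, size w = N -> f w = \sum_(cm <- L) RtoC cm.1 * mon w cm.2.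

Lemma isPoly_mul N f g : isPoly N f -> isPoly N g -> isPoly N (fun w => f w * g w).
Proof.
move=> [L1 /allP s1 e1] [L2 /allP s2 e2].
exists [seq (c1.1 * c2.1, [seq (x.1 + x.2)%N | x <- zip c1.2 c2.2]) | c1 <- L1, c2 <- L2].
  apply/allP => _ /allpairsP[[c1 c2] [/= /s1/eqP h1 /s2/eqP h2 ->]] /=.
  by rewrite size_map size_zip h1 h2 minnn.
move=> w sw; rewrite e1 // e2 // big_allpairs_dep /= mulr_suml big_seq [RHS]big_seq.
apply: eq_bigr => c1 /s1/eqP h1; rewrite mulr_sumr big_seq [RHS]big_seq.
apply: eq_bigr => c2 /s2/eqP h2; rewrite rmorphM /=.
have -> : mon w [seq (x.1 + x.2)%N | x <- zip c1.2 c2.2] = mon w c1.2 * mon w c2.2.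
  move: h1 h2; rewrite -sw; move: (c1.2) (c2.2); elim: w {sw} => [|x w IH] [|k m] [|k' m'] //=.
    by rewrite /mon !big_nil mulr1.
  by move=> [h1] [h2]; rewrite !mon_cons IH // exprD; ring.
by ring.
Qed.

Lemma mon_nseq0 (w : seq R[i]) : mon w (nseq (size w) 0%N) = 1.
Proof.
elim: w => [|x w IH]; first by rewrite /mon big_nil.
by rewrite [nseq _ _]/= mon_cons IH mul1r.
Qed.

Lemma isPoly1 N : isPoly N (fun=> 1).
Proof.
exists [:: (1, nseq N 0%N)]; first by rewrite /= size_nseq eqxx.
by move=> w <-; rewrite big_seq1 rmorph1 mul1r mon_nseq0.
Qed.

Lemma isPoly_exp N f k : isPoly N f -> isPoly N (fun w => f w ^+ k).
Proof.
move=> fP; elim: k => [|k IH]; first exact: isPoly1.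
by have [L sL eL] := isPoly_mul fP IH; exists L => // w sw; rewrite exprS eL.
Qed.

Lemma isPoly_prod N (T : Type) (r : seq T) (f : T -> seq R[i] -> R[i]) :
  (forall i, isPoly N (f i)) -> isPoly N (fun w => \prod_(i <- r) f i w).
Proof.
move=> fP; elim: r => [|i r IH].
  by have [L sL eL] := isPoly1 N; exists L => // w sw; rewrite big_nil; exact: eL.
by have [L sL eL] := isPoly_mul (fP i) IH; exists L => // w sw; rewrite big_cons eL.
Qed.

Lemma isPoly_sub N f g : isPoly N f -> isPoly N g -> isPoly N (fun w => f w - g w).
Proof.
move=> [L1 s1 e1] [L2 s2 e2].
exists (L1 ++ [seq (- cm.1, cm.2) | cm <- L2]).
  by rewrite all_cat s1 all_map.
move=> w sw; rewrite big_cat big_map /= e1 // e2 //; congr (_ + _).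
by rewrite raddf_sum; apply: eq_bigr => cm _; rewrite rmorphN mulNr.
Qed.

Lemma isPoly_behead N f : isPoly N f -> isPoly N.+1 (fun w => f (behead w)).
Proof.
move=> [L s e]; exists [seq (cm.1, 0%N :: cm.2) | cm <- L].
  by rewrite all_map; apply: sub_all s => cm /= /eqP ->.
move=> [|x w] //= [sw]; rewrite e // big_map; apply: eq_bigr => cm _.
by rewrite mon_cons mul1r.
Qed.

Lemma isPoly_nth N k : (k < N)%N -> isPoly N (fun w => nth 0 w k).
Proof.
elim: N k => [|N IH] [|k] // kN.
  exists [:: (1, 1%N :: nseq N 0%N)]; first by rewrite /= size_nseq eqxx.
  move=> [|x w] //= [sw]; rewrite big_seq1 rmorph1 mul1r mon_cons.
  by rewrite -sw mon_nseq0 mulr1.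
have [L sL eL] := isPoly_behead (IH k kN).
by exists L => // w sw; rewrite -eL // nth_behead.
Qed.

Lemma isPoly_vdm N : isPoly N (@vdm p R[i]).
Proof.
elim: N => [|N IH].
  have [L sL eL] := isPoly1 0; exists L => // w sw.
  by rewrite -eL //; case: w sw.
have h1 : isPoly N.+1 (fun w => \prod_(j <- enum 'I_N) (nth 0 w j.+1 - nth 0 w 0) ^+ p).
  apply: isPoly_prod => j; apply: isPoly_exp.
  by apply: isPoly_sub; apply: isPoly_nth; rewrite ?ltnS.
have [L sL eL] := isPoly_mul (isPoly_behead IH) h1.
exists L => // w sw; rewrite -eL //; case: w sw => [|x w] //= [sw]; congr (_ * _).
rewrite big_enum (big_nth 0) big_mkord sw.
by apply: eq_bigr => j _.
Qed.

Definition vlist N : seq (R * seq nat) :=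
  projT1 (cid2 (isPoly_vdm N)).

(* Coefficient of the monomial with exponents m in prod_(j<k) (w_k - w_j)^p. *)
Definition acoef (m : seq nat) : R := \sum_(cm <- vlist (size m) | cm.2 == m) cm.1.

Lemma vdm_expandC N : exists D0, forall D, (D0 <= D)%N -> forall w : seq R[i], size w = N ->
  vdm p w = nsum D N (fun m => RtoC (acoef m) * mon w m).
Proof.
have [D0 D0P] : exists D0, all (fun cm => all (ltn^~ D0) cm.2) (vlist N).
  elim: (vlist N) => [|cm L [D0 h]]; first by exists 0%N.
  exists (maxn D0 (\max_(x <- cm.2) x).+1); rewrite /= ; apply/andP; split.
    apply/allP => x xm; rewrite /= leq_max ltnS; apply/orP; right.
    by rewrite (big_rem x xm) leq_maxl.
  apply: sub_all h => c; apply: sub_all => x /= xD; by rewrite leq_max xD.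
exists D0 => D D0D w sw.
rewrite /acoef /vlist in D0P *.
transitivity (\sum_(cm <- vlist N) RtoC cm.1 * mon w cm.2).
  by rewrite /vlist; case: (cid2 _) => L /= sL ->.
transitivity (nsum D N (fun m => \sum_(cm <- vlist N)
    if m == cm.2 then RtoC cm.1 * mon w m else 0)).
  rewrite nsum_sum big_seq [RHS]big_seq; apply: eq_bigr => cm cmL.
  rewrite (nsum_delta (fun m => RtoC cm.1 * mon w m)) //.
    move: cmL; rewrite /vlist; case: (cid2 _) => L /= sL _ cmL.
    exact/eqP/(allP sL).
  apply: sub_all (allP D0P _ cmL) => x /= xD; exact: leq_trans xD D0D.
apply: eq_nsum => m sm _; rewrite sm rmorph_sum mulr_suml big_mkcond [RHS]big_mkcond /=.
rewrite big_mkcond; apply: eq_bigr => cm _; rewrite eq_sym.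
by case: eqP.
Qed.

Lemma vdm_expand N : exists D0, forall D, (D0 <= D)%N -> forall w : seq R, size w = N ->
  vdm p w = nsum D N (fun m => acoef m * mon w m).
Proof.
have [D0 h] := vdm_expandC N; exists D0 => D D0D w sw; apply: (@fmorph_inj _ _ RtoC).
rewrite rmorph_vdm (h D) ?size_map // rmorph_nsum; apply: eq_nsum => m _ _.
by rewrite rmorphM rmorph_mon.
Qed.

Lemma bounded_seq (m : seq nat) : exists D0, forall D, (D0 <= D)%N -> all (ltn^~ D) m.
Proof.
exists (\max_(x <- m) x).+1 => D h; apply/allP => x xm /=; apply: leq_trans h.
by rewrite ltnS (big_rem x xm) leq_maxl.
Qed.

(** Doubling all variables multiplies the product by 2 to the power of its degree and each monomial
    by 2 to the power of its own; coefficients are unique. *)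
Lemma acoef_homog m : acoef m != 0 -> sumn m = (p * 'C(size m, 2))%N.
Proof.
move=> am; have [D1 h1] := vdm_expand (size m); have [D2 h2] := bounded_seq m.
pose D := maxn D1 D2; have {}h1 := h1 D (leq_maxl _ _); have {}h2 := h2 D (leq_maxr _ _).
have : (2 ^+ sumn m - 2 ^+ (p * 'C(size m, 2))) * acoef m = 0.
  apply: (@mon_nsum_eq0 R D (size m) (fun m' => (2 ^+ sumn m' - 2 ^+ (p * 'C(size m, 2)))
    * acoef m')) => // w sw.
  transitivity (vdm p [seq 2 * x | x <- w] - 2 ^+ (p * 'C(size w, 2)) * vdm p w).
    rewrite !h1 ?size_map // -nsumZ -nsumN -nsumD; apply: eq_nsum => m' sm' _.
    by rewrite mon_scale ?sm' // sw; ring.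
  by rewrite vdm_scale subrr.
move/eqP; rewrite mulf_eq0 (negbTE am) orbF subr_eq0 => /eqP.
by apply: ieexprIn; rewrite ?ltr0n // ; apply/eqP => /(congr1 (fun x : R => x - 1)); lra.
Qed.

Lemma acoef_swap m0 m1 m2 m3 : acoef (m0 ++ m1 ++ m2 ++ m3) =
  (-1) ^+ (p * size m1 * size m2) * acoef (m0 ++ m2 ++ m1 ++ m3).
Proof.
pose n0 := size m0; pose n1 := size m1; pose n2 := size m2; pose n3 := size m3.
have [D1 h1] := vdm_expand (n0 + (n1 + (n2 + n3))).
have [D2 h2] := bounded_seq (m0 ++ m1 ++ m2 ++ m3).
pose D := maxn D1 D2; have {}h1 := h1 D (leq_maxl _ _); have {}h2 := h2 D (leq_maxr _ _).
have h1' : forall w : seq R, size w = (n0 + (n2 + (n1 + n3)))%N ->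
    vdm p w = nsum D (n0 + (n2 + (n1 + n3))) (fun m => acoef m * mon w m).
  by move=> w sw; rewrite h1 ?sw; [congr (nsum _ _ _)|]; lia.
move: h2; rewrite !all_cat => /and4P[a0 a1 a2 a3].
pose S := (-1) ^+ (p * n1 * n2) : R.
apply: (@mon_nsum_inj2 R D D n1 n2 (fun x y => acoef (m0 ++ x ++ y ++ m3))
  (fun x y => S * acoef (m0 ++ y ++ x ++ m3))) => // w1 w2 sw1 sw2.
rewrite (eq_nsum (g := fun x => nsum D n2 (fun y =>
  (acoef (m0 ++ x ++ y ++ m3) * (mon w1 x * mon w2 y))))) //.
pose A x y := nsum D n1 (fun m1' => nsum D n2 (fun m2' =>
    acoef (x ++ m1' ++ m2' ++ y) * (mon w1 m1' * mon w2 m2'))).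
pose B x y := nsum D n1 (fun m1' => nsum D n2 (fun m2' =>
    S * acoef (x ++ m2' ++ m1' ++ y) * (mon w1 m1' * mon w2 m2'))).
apply: (@mon_nsum_inj2 R D D n0 n3 A B) => // w0 w3 sw0 sw3.
transitivity (vdm p (w0 ++ w1 ++ w2 ++ w3)).
  rewrite h1 ?size_cat ?sw0 ?sw1 ?sw2 ?sw3 // nsum_cat; apply: eq_nsum => x sx _.
  rewrite [RHS]nsum_cat; symmetry.
  transitivity (nsum D n1 (fun m1' => nsum D n2 (fun m2' => nsum D n3 (fun y =>
    acoef (x ++ m1' ++ m2' ++ y) * mon (w0 ++ w1 ++ w2 ++ w3) (x ++ m1' ++ m2' ++ y))))).
    by apply: eq_nsum => m1' _ _; rewrite nsum_cat.
  transitivity (nsum D n1 (fun m1' => nsum D n3 (fun y => nsum D n2 (fun m2' =>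
    acoef (x ++ m1' ++ m2' ++ y) * mon (w0 ++ w1 ++ w2 ++ w3) (x ++ m1' ++ m2' ++ y))))).
    by apply: eq_nsum => m1' _ _; rewrite nsum_exch.
  rewrite nsum_exch; apply: eq_nsum => y sy _; rewrite /A -nsumZr; apply: eq_nsum => m1' s1 _.
  rewrite -nsumZr; apply: eq_nsum => m2' s2 _.
  by rewrite !mon_cat ?sw0 ?sw1 ?sw2 //; ring.
rewrite vdm_swap sw1 sw2 -/S h1' ?size_cat ?sw0 ?sw1 ?sw2 ?sw3 // nsum_cat -nsumZ.
apply: eq_nsum => x sx _; rewrite nsum_cat -nsumZ.
transitivity (nsum D n2 (fun m2' => nsum D n1 (fun m1' => nsum D n3 (fun y =>
   S * (acoef (x ++ m2' ++ m1' ++ y) * mon (w0 ++ w2 ++ w1 ++ w3) (x ++ m2' ++ m1' ++ y)))))).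
  apply: eq_nsum => m2' _ _; rewrite nsum_cat -nsumZ.
  by apply: eq_nsum => m1' _ _; rewrite -nsumZ.
rewrite nsum_exch; transitivity (nsum D n1 (fun m1' => nsum D n3 (fun y =>
  nsum D n2 (fun m2' =>
   S * (acoef (x ++ m2' ++ m1' ++ y) * mon (w0 ++ w2 ++ w1 ++ w3) (x ++ m2' ++ m1' ++ y)))))).
  by apply: eq_nsum => m1' _ _; rewrite nsum_exch.
rewrite nsum_exch; apply: eq_nsum => y sy _; rewrite /B -nsumZr; apply: eq_nsum => m1' s1 _.
rewrite -nsumZr; apply: eq_nsum => m2' s2 _.
by rewrite !mon_cat ?sw0 ?sw1 ?sw2 //; ring.
Qed.

(** One sign [eps] serves all prefixes [m]. Hence a product of two coefficients with the same tail
    is symmetric in that tail, also off the diagonal. *)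
Lemma acoef_perm s t : perm_eq s t ->
  exists2 eps : R, eps ^+ 2 = 1 & forall m, acoef (m ++ s) = eps * acoef (m ++ t).
Proof.
elim: s t => [|x s IH] t st.
  exists 1; first by rewrite expr1n.
  by move=> m; rewrite mul1r; move: st; rewrite perm_sym => /perm_nilP ->.
have xt : x \in t by rewrite -(perm_mem st) mem_head.
move: st; case/splitPr: xt => t1 t2.
rewrite -cat1s perm_sym -[x :: t2]cat1s perm_catCA perm_cat2l perm_sym => /IH[eps e1 e2].
exists (eps * (-1) ^+ (p * 1 * size t1)).
  by rewrite exprMn e1 mul1r -exprM mulnC exprM sqrrN !expr1n.
by move=> m; rewrite catA e2 -catA (acoef_swap m [:: x] t1 t2) mulrA.
Qed.

(** Scale the first k variables by t. The product becomes t^e times a polynomial in t whose value at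
    0 is [vdm p w1 * vdm p w2] times the (p k)-th powers of the variables in [w2]. Powers of t below
    e are therefore absent, and the coefficient of t^e factorizes. *)
Lemma acoef_split_aux k l m1 m2 : size m1 = k -> size m2 = l ->
  ((sumn m1 < p * 'C(k, 2))%N -> acoef (m1 ++ m2) = 0) /\
  (sumn m1 = (p * 'C(k, 2))%N -> acoef (m1 ++ m2) =
    acoef m1 * (if all (leq (p * k)) m2 then acoef [seq (x - p * k)%N | x <- m2] else 0)).
Proof.
move=> s1 s2; set e := (p * 'C(k, 2))%N.
have [D1 h1] := vdm_expand (k + l); have [D2 h2] := bounded_seq (m1 ++ m2).
have [D3 h3] := vdm_expand k; have [D4 h4] := vdm_expand l.
pose D := maxn (maxn D1 D2) (maxn D3 D4); pose E := (p * k + D)%N.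
have {}h1 := h1 E ltac:(rewrite /E /D; lia).
have {}h2 := h2 E ltac:(rewrite /E /D; lia).
have {}h3 := h3 E ltac:(rewrite /E /D; lia).
have {}h4 := h4 D ltac:(rewrite /E /D; lia).
move: h2; rewrite all_cat => /andP[a1 a2].
have key : forall w1 w2 : seq R, size w1 = k -> size w2 = l -> forall d,
   nsum E k (fun m1 => nsum E l (fun m2 => (acoef (m1 ++ m2) * (d == sumn m1)%:R) *
      (mon w1 m1 * mon w2 m2))) =
   if (d < e)%N then 0 else if d == e then vdm p w1 * vdm p w2 * \prod_(v <- w2) v ^+ (p * k)
   else nsum E k (fun m1 => nsum E l (fun m2 => (acoef (m1 ++ m2) * (d == sumn m1)%:R) *
      (mon w1 m1 * mon w2 m2))).
  move=> w1 w2 sw1 sw2 d.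
  pose P : {poly R} := nsum E k (fun m1 => nsum E l (fun m2 =>
    (acoef (m1 ++ m2) * (mon w1 m1 * mon w2 m2)) *: 'X^(sumn m1))).
  pose Q : {poly R} := (vdm p w1 * vdm p w2) *:
    \prod_(u <- w1) \prod_(v <- w2) (v%:P - u *: 'X) ^+ p.
  have PQ : P = 'X^e * Q.
    apply: poly_fun_eq => t.
    transitivity (vdm p ([seq t * x | x <- w1] ++ w2)).
      rewrite h1 ?size_cat ?size_map ?sw1 ?sw2 // nsum_cat.
      rewrite -[P.[t]]/(horner_eval t P) raddf_nsum; apply: eq_nsum => x sx _.
      rewrite raddf_nsum; apply: eq_nsum => y sy _.
      rewrite /= /horner_eval hornerZ hornerXn mon_cat ?size_map ?sw1 // mon_scale ?sw1 //.
      by ring.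
    rewrite vdm_cat vdm_scale sw1 /Q hornerM hornerXn hornerZ !mulrA; congr (_ * _).
    rewrite /vcross big_map horner_prod; apply: eq_bigr => u _.
    rewrite horner_prod; apply: eq_bigr => v _.
    by rewrite horner_exp !hornerE mulrC.
  have cP : nsum E k (fun m1 => nsum E l (fun m2 => (acoef (m1 ++ m2) * (d == sumn m1)%:R) *
      (mon w1 m1 * mon w2 m2))) = P`_d.
    rewrite -[P`_d]/(coefp d P) raddf_nsum; apply: eq_nsum => x _ _.
    rewrite raddf_nsum; apply: eq_nsum => y _ _.
    by rewrite /= coefZ coefXn; ring.
  case: ltnP => de; first by rewrite cP PQ coefXnM de.
  case: eqP => // de'; rewrite cP PQ coefXnM ltnNge de /= de' subnn -horner_coef0.
  rewrite /Q hornerZ horner_prod; congr (_ * _).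
  rewrite [LHS](eq_bigr (fun=> \prod_(v <- w2) v ^+ p)); last first.
    move=> u _; rewrite horner_prod; apply: eq_bigr => v _.
    by rewrite horner_exp !hornerE subr0.
  by rewrite prodr_const_seq sw1 -prodrXl; apply: eq_bigr => v _; rewrite exprM.
split=> hs.
  have := @mon_nsum_inj2 R E E k l (fun x y => acoef (x ++ y) * (sumn m1 == sumn x)%:R)
     (fun _ _ => 0) _ m1 m2 s1 a1 s2 a2.
  rewrite eqxx mulr1; apply => w1 w2 sw1 sw2; rewrite key // hs.
  rewrite -[LHS](nsum0 R E k); apply: eq_nsum => x _ _.
  by rewrite -[LHS](nsum0 R E l); apply: eq_nsum => y _ _; rewrite mul0r.
have := @mon_nsum_inj2 R E E k l (fun x y => acoef (x ++ y) * (e == sumn x)%:R)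
     (fun x y => acoef x *
       (if all (leq (p * k)) y then acoef [seq (z - p * k)%N | z <- y] else 0))
      _ m1 m2 s1 a1 s2 a2.
rewrite hs eqxx mulr1; apply => w1 w2 sw1 sw2; rewrite key // ltnn eqxx.
rewrite h3 // -mulrA -nsumZr; apply: eq_nsum => x sx _.
rewrite h4 // -nsumZr -nsumZ -(nsum_shift D (p * k)).
apply: eq_nsum => y sy _; case: ifP => ay; last by rewrite !mulr0 mul0r.
have -> : mon w2 y = (\prod_(v <- w2) v ^+ (p * k)) * mon w2 [seq (z - p * k)%N | z <- y].
  rewrite -mon_shift ?size_map ?sw2 //; congr (mon _ _).
  rewrite -map_comp -[LHS]map_id; apply/eq_in_map => z zy /=.
  by rewrite subnKC // (allP ay).
by ring.
Qed.

Lemma acoef_small m1 m2 : (sumn m1 < p * 'C(size m1, 2))%N -> acoef (m1 ++ m2) = 0.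
Proof. by case: (@acoef_split_aux (size m1) (size m2) m1 m2 erefl erefl). Qed.

Lemma acoef_split m1 m2 : sumn m1 = (p * 'C(size m1, 2))%N -> acoef (m1 ++ m2) =
  acoef m1 * (if all (leq (p * size m1)) m2 then acoef [seq (x - p * size m1)%N | x <- m2]
              else 0).
Proof. by case: (@acoef_split_aux (size m1) (size m2) m1 m2 erefl erefl). Qed.

(** Without the letter x the other N - 1 letters still carry at least the least momentum p C(N - 1,
    2), which leaves at most p (N - 1) for x. *)
Lemma acoef_range m : (0 < p)%N -> acoef m != 0 -> all (ltn^~ (p * size m)%N) m.
Proof.
move=> p0 am; apply/allP => x xm /=; have hm := acoef_homog am.
move: am hm; case/splitPr: xm => m1 m2 am hm.
have : acoef ((m1 ++ m2) ++ [:: x]) != 0.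
  have h : perm_eq (m1 ++ x :: m2) ((m1 ++ m2) ++ [:: x]).
    by rewrite -cat1s perm_catCA perm_sym perm_catC.
  have [eps _ /(_ [::]) /= e] := acoef_perm h.
  by move: am; rewrite e mulf_eq0 negb_or => /andP[].
case: (ltnP (sumn (m1 ++ m2)) (p * 'C(size (m1 ++ m2), 2))) => [h|h _].
  by rewrite acoef_small ?eqxx.
move: h hm; rewrite !sumn_cat !size_cat /= addnS binS bin1.
move: 'C(_, _) => c; nia.
Qed.

Lemma acoef_nil : acoef [::] = 1.
Proof.
have [D h] := vdm_expand 0; have := h D (leqnn _) [::] erefl.
by rewrite /= nsum_nil /mon big_nil mulr1.
Qed.

End Coef.

(** * Occupation words and renewal points *)

Section Weights.
Variables (R : realType) (p : nat) (g2 : R).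
Hypothesis p_gt0 : (0 < p)%N.
Notation acoef := (acoef R p).

(** The energy is measured from that of the word 0, p, 2p, ...; with this reference the coefficients
    [bb] factorize at renewal points without extra prefactors. *)
Definition qenergy (m : seq nat) : R :=
  \sum_(x <- m) x%:R ^+ 2 - \sum_(j < size m) (p * j)%:R ^+ 2.

(* Coefficient of Laughlin's function in the normalized orbitals: the Gaussian
   factor of the orbital with momentum x contributes exp(g2 x^2 / 2). *)
Definition bb (m : seq nat) : R := acoef m * expR (g2 / 2 * qenergy m).

Lemma bb_eq0 m : (bb m == 0) = (acoef m == 0).
Proof. by rewrite /bb mulf_eq0 [expR _ == 0]gt_eqF ?expR_gt0 // orbF. Qed.

Lemma bb_homog m : bb m != 0 -> sumn m = (p * 'C(size m, 2))%N.
Proof. by rewrite bb_eq0; apply: acoef_homog. Qed.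

Lemma bb_range m : bb m != 0 -> all (ltn^~ (p * size m)%N) m.
Proof. by rewrite bb_eq0; apply: acoef_range. Qed.

Lemma bb_nil : bb [::] = 1.
Proof. by rewrite /bb acoef_nil /qenergy big_nil big_ord0 subrr mulr0 expR0 mulr1. Qed.

Lemma bb_perm s t : perm_eq s t ->
  exists2 eps : R, eps ^+ 2 = 1 & forall m, bb (m ++ s) = eps * bb (m ++ t).
Proof.
move=> st; have [eps e1 e2] := acoef_perm R p st; exists eps => // m.
rewrite /bb e2 mulrA; congr (_ * expR (_ * _)); rewrite /qenergy !size_cat (perm_size st).
by rewrite !big_cat; congr (_ + _ - _); apply: perm_big.
Qed.

Lemma symfun_bb m m' : symfun (fun r => bb (m ++ r) * bb (m' ++ r)).
Proof.
move=> s t /bb_perm[eps e1 e2]; rewrite !e2.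
by transitivity (eps ^+ 2 * (bb (m ++ t) * bb (m' ++ t))); [ring|rewrite e1 mul1r].
Qed.

Lemma bb_swap m m' s r : size m = size m' ->
  bb (m ++ s ++ r) * bb (m' ++ s ++ r) = bb (s ++ m ++ r) * bb (s ++ m' ++ r).
Proof.
move=> mm'; rewrite /bb.
have h x : acoef (x ++ s ++ r) = (-1) ^+ (p * size x * size s) * acoef (s ++ x ++ r).
  exact: (acoef_swap R p [::] x s r).
have q x : qenergy (x ++ s ++ r) = qenergy (s ++ x ++ r).
  by rewrite /qenergy !big_cat /= !size_cat addnCA addrCA.
rewrite !h !q mm'; set S := (-1) ^+ _.
have : S ^+ 2 = 1 by rewrite /S -exprM mulnC exprM sqrrN !expr1n.
move=> S2; transitivity (S ^+ 2 * (acoef (s ++ m ++ r) * expR (g2 / 2 * qenergy (s ++ m ++ r)) *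
  (acoef (s ++ m' ++ r) * expR (g2 / 2 * qenergy (s ++ m' ++ r))))); first by ring.
by rewrite S2 mul1r.
Qed.

(** Shifting the letters of [m2] by p k changes their energy by terms depending only on their number
    and their total momentum. Homogeneity fixes the latter, so the change is exactly that of the
    reference energy. *)
Lemma bb_split m1 m2 : sumn m1 = (p * 'C(size m1, 2))%N -> bb (m1 ++ m2) =
  bb m1 * (if all (leq (p * size m1)) m2 then bb [seq (x - p * size m1)%N | x <- m2] else 0).
Proof.
move=> h1; rewrite /bb acoef_split //; case: ifP => h2; last by rewrite !mulr0 mul0r.
set k := size m1; set m2' := [seq (x - _)%N | x <- m2].
have [->|a2] := eqVneq (acoef m2') 0; first by rewrite !(mulr0, mul0r).
have h3 := acoef_homog a2; have s2 : size m2' = size m2 by rewrite size_map.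
rewrite mulrACA -expRD -mulrDr; congr (_ * expR (_ * _)); rewrite /qenergy.
have e2 : \sum_(x <- m2) x%:R ^+ 2 = \sum_(x <- m2') x%:R ^+ 2 +
    2 * (p * k)%:R * (sumn m2')%:R + (size m2)%:R * (p * k)%:R ^+ 2 :> R.
  rewrite /m2' -/k; move: h2; rewrite -/k; elim: m2 {m2' a2 h3 s2} => [|x m IH] /=.
    by rewrite !big_nil !mulr0 mul0r !addr0.
  move=> /andP[kx am]; rewrite !big_cons IH // natrD (natrB _ kx) -natr1.
  by ring.
have e3 : \sum_(j < size (m1 ++ m2)) (p * j)%:R ^+ 2 = \sum_(j < k) (p * j)%:R ^+ 2 +
  (\sum_(j < size m2) (p * j)%:R ^+ 2 + 2 * (p * k)%:R * (p * 'C(size m2, 2))%:R +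
    (size m2)%:R * (p * k)%:R ^+ 2) :> R.
  rewrite size_cat big_split_ord /=; congr (_ + _); elim: (size m2) => [|l IH].
    by rewrite !big_ord0 muln0 mulr0 mul0r !addr0.
  by rewrite !big_ord_recr /= IH binS bin1 -natr1 !natrM !natrD; ring.
rewrite big_cat /= e2 e3 s2 h3 s2; ring.
Qed.

Definition tw (tau : nat -> R) (s : seq nat) : R := \prod_(x <- s) tau x.

Lemma tw_cat tau s t : tw tau (s ++ t) = tw tau s * tw tau t.
Proof. exact: big_cat. Qed.

Lemma tw_shift tau c s : all (leq c) s ->
  tw tau s = tw (fun x => tau (c + x)%N) [seq (x - c)%N | x <- s].
Proof.
move=> /allP h; rewrite /tw big_map big_seq [RHS]big_seq; apply: eq_bigr => x xs.
by rewrite subnKC // h.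
Qed.

Lemma tw1 s : tw (fun=> 1) s = 1.
Proof. by rewrite /tw big1. Qed.

Lemma symfun_tw tau : symfun (tw tau).
Proof. by move=> s t st; apply: perm_big. Qed.

(* CT is the squared norm and GT (with X = 1) the unnormalized reduced density
   matrix of the N-particle state when orbital k has mass tau k in the domain. *)
Definition CT (tau : nat -> R) (N : nat) : R :=
  nsum (p * N) N (fun s => bb s ^+ 2 * tw tau s) / N`!%:R.

Definition GT (tau : nat -> R) (N : nat) (m m' : seq nat) (X : seq nat -> R) : R :=
  nsum (p * N) (N - size m) (fun r => bb (m ++ r) * bb (m' ++ r) * tw tau r * X r)
  / (N - size m)`!%:R.

Lemma GT_nil tau N : GT tau N [::] [::] (fun=> 1) = CT tau N.
Proof.
rewrite /GT /CT subn0; congr (_ / _); apply: eq_nsum => s _ _.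
by rewrite /= mulr1 -expr2.
Qed.

(* Renewal point: p 'C(k, 2) is the least total momentum of k particles, and the
   coefficients bb factorize when it is attained below p k, see bb_split. *)
Definition ren (k : nat) (s : seq nat) : bool :=
  (count (ltn^~ (p * k)%N) s == k) &&
  (sumn (seq.filter (ltn^~ (p * k)%N) s) == p * 'C(k, 2))%N.

Definition leftfun k (X : seq nat -> R) :=
  symfun X /\ forall r, X r = X (seq.filter (ltn^~ (p * k)%N) r).

Lemma ren_filter j k s : (j <= k)%N -> ren j (seq.filter (ltn^~ (p * k)%N) s) = ren j s.
Proof.
move=> jk; rewrite /ren -!size_filter -!filter_predI.
have -> : [seq x <- s | predI (ltn^~ (p * j)%N) (ltn^~ (p * k)%N) x] =
  [seq x <- s | (ltn^~ (p * j)%N) x] => //.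
apply: eq_filter => x /=; case: ltnP => //= xj.
by apply: leq_trans xj _; rewrite leq_mul2l jk orbT.
Qed.

Lemma ren_sym k : symfun (ren k).
Proof.
move=> s t st; rewrite /ren; move/permP: (st) => ->; congr (_ && (_ == _)).
exact/perm_sumn/perm_filter.
Qed.

Lemma leftfun_ren j k : (j <= k)%N -> leftfun k (fun s => (ren j s)%:R).
Proof.
move=> jk; split; first by move=> s t st; rewrite (ren_sym j st).
by move=> r; rewrite ren_filter.
Qed.

Lemma leftfun1 k : leftfun k (fun=> 1). Proof. by []. Qed.

Lemma filter_split (P : pred nat) (s t : seq nat) : all P s -> all (predC P) t ->
  seq.filter P (s ++ t) = s.
Proof.
move=> /all_filterP sP tP; rewrite filter_cat sP.
suff -> : seq.filter P t = [::] by rewrite cats0.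
by apply/eqP; rewrite -(negbK (_ == _)) -has_filter -all_predC.
Qed.

Lemma binom_fact_div N k (x : R) : (k <= N)%N ->
  'C(N, k)%:R * x / N`!%:R = x / (k`!%:R * (N - k)`!%:R).
Proof.
move=> kN; rewrite -(bin_fact kN) !natrM.
have h1 : 'C(N, k)%:R != 0 :> R by rewrite pnatr_eq0 -lt0n bin_gt0.
have h2 : k`!%:R != 0 :> R by rewrite pnatr_eq0 -lt0n fact_gt0.
have h3 : (N - k)`!%:R != 0 :> R by rewrite pnatr_eq0 -lt0n fact_gt0.
by field; rewrite h1 h2 h3.
Qed.

(** At a renewal point exactly k particles lie below orbital p k. Choosing their positions in the
    word turns 1/N! into the product of the two factorial weights, and [bb_split] separates the
    coefficients. *)
Lemma GT_right tau N k m m' X : size m' = size m -> (size m <= k)%N -> (k <= N)%N ->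
  all (ltn^~ (p * k)%N) m -> all (ltn^~ (p * k)%N) m' -> leftfun k X ->
  GT tau N m m' (fun r => (ren k (m ++ r))%:R * X r) =
  GT tau k m m' X * CT (fun x => tau (p * k + x)%N) (N - k).
Proof.
move=> sm nk kN am am' [sX fX]; set n := size m.
(* For different total momenta the two coefficients are never both nonzero and both sides vanish.
   Otherwise the renewal condition, imposed on [m ++ r] only, holds for [m' ++ r] as well. *)
have [smm'|/negP neq] := boolP (sumn m == sumn m'); last first.
  have z r : size (m ++ r) = size (m' ++ r) -> bb (m ++ r) * bb (m' ++ r) = 0.
    move=> ss; apply/eqP; apply: contraT; rewrite mulf_eq0 negb_or => /andP[h h'].
    case: neq; move: (bb_homog h) (bb_homog h'); rewrite -ss !sumn_cat => <- /eqP.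
    by rewrite eqn_add2r eq_sym.
  rewrite /GT [nsum _ _ _](_ : _ = 0).
    rewrite [X in _ = X / _ * _](_ : _ = 0) ?mul0r //.
    rewrite -[RHS](nsum0 R (p * k) (k - n)); apply: eq_nsum => r _ _.
    by rewrite z ?size_cat ?sm // !mul0r.
  rewrite -[RHS](nsum0 R (p * N) (N - n)); apply: eq_nsum => r _ _.
  by rewrite z ?size_cat ?sm // !mul0r.
pose P := (ltn^~ (p * k)%N) : pred nat.
pose F r := bb (m ++ r) * bb (m' ++ r) * tw tau r * X r *
  (sumn (m ++ seq.filter P r) == p * 'C(k, 2))%N%:R.
have sF : symfun F.
  move=> s t st; rewrite /F (symfun_bb m m' st) (symfun_tw tau st) (sX _ _ st).
  by congr (_ * _%:R); rewrite !sumn_cat (perm_sumn (perm_filter P st)).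
have cmP : count P m = n by apply/eqP; rewrite -all_count.
have fmP : seq.filter P m = m by apply/all_filterP.
rewrite {1}/GT (_ : nsum _ _ _ = nsum (p * N) (N - n) (fun r => (count P r == k - n)%N%:R * F r)).
  rewrite nsum_select // binom_fact_div; last by lia.
  have -> : (N - n - (k - n))%N = (N - k)%N by lia.
  rewrite /GT /CT mulf_div -nsumM; congr (_ / _).
  have kNE : (p * N = p * k + p * (N - k))%N by rewrite -mulnDr subnKC.
  rewrite -[RHS](@nsum_widen _ (p * k) (p * N)); first last.
  - move=> r sr.
    move=> nr; rewrite -[RHS](nsum0 R (p * (N - k)) (N - k)); apply: eq_nsum => s _ _.
    suff -> : bb (m ++ r) = 0 by rewrite !mul0r.
    apply/eqP; apply: contraNT nr => /bb_range; rewrite size_cat sr -/n subnKC //.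
    by rewrite all_cat => /andP[].
  - by rewrite leq_mul2l kN orbT.
  apply: eq_nsum => r1 s1 _; rewrite -[RHS](@nsum_shift _ _ (p * k)) -kNE.
  apply: eq_nsum => r2 s2 _.
  have -> : all (predC P) r2 = all (leq (p * k)) r2.
    by apply: eq_all => x; rewrite /P /= -leqNgt.
  have [a2|_] := boolP (all (leq (p * k)) r2); last by rewrite andbF mul0r.
  have a2' : all (predC P) r2 by rewrite (sub_all _ a2) // => x /=; rewrite -leqNgt.
  rewrite andbT; have [a1|a1] := boolP (all P r1); last first.
    rewrite mul0r; suff -> : bb (m ++ r1) = 0 by rewrite !mul0r.
    apply/eqP; apply: contraNT a1 => /bb_range; rewrite size_cat s1 -/n subnKC //.
    by rewrite all_cat => /andP[].
  rewrite mul1r /F filter_split // (fX (r1 ++ r2)) filter_split //.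
  have s1' : size (m ++ r1) = k by rewrite size_cat s1 -/n subnKC.
  have s1'' : size (m' ++ r1) = k by rewrite size_cat sm s1 -/n subnKC.
  case: eqP => [e1|ne1]; last first.
    rewrite mulr0; suff -> : bb (m ++ r1) = 0 by rewrite !mul0r.
    by apply/eqP; apply: contraT => /bb_homog; rewrite s1'.
  have e1' : sumn (m' ++ r1) = (p * 'C(k, 2))%N by rewrite sumn_cat -(eqP smm') -sumn_cat.
  have B x : size (x ++ r1) = k -> sumn (x ++ r1) = (p * 'C(k, 2))%N ->
      bb (x ++ r1 ++ r2) = bb (x ++ r1) * bb [seq (y - p * k)%N | y <- r2].
    by move=> sx ex; rewrite catA bb_split sx // a2.
  rewrite !B // tw_cat (tw_shift tau a2).
  by rewrite mulr1; ring.
apply: eq_nsum => r _ _; rewrite /F /ren !count_cat !filter_cat -!/P cmP fmP.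
have -> : (n + count P r == k)%N = (count P r == k - n)%N by apply/eqP/eqP; lia.
by case: (_ == (k - n)%N); rewrite ?mul0r ?mulr0 //= mul1r; ring.
Qed.

(** The mirror case, with the marked letters to the right of the renewal point: [bb_swap] first
    brings the k particles on the left in front of them, and the two signs cancel. *)
Lemma GT_left tau N k m m' : size m' = size m -> (k + size m <= N)%N ->
  all (leq (p * k)) m -> all (leq (p * k)) m' ->
  GT tau N m m' (fun r => (ren k (m ++ r))%:R) = CT tau k *
  GT (fun x => tau (p * k + x)%N) (N - k) [seq (x - p * k)%N | x <- m]
    [seq (x - p * k)%N | x <- m'] (fun=> 1).
Proof.
move=> sm knN am am'; set n := size m.
pose P := (ltn^~ (p * k)%N) : pred nat.
pose F r := bb (m ++ r) * bb (m' ++ r) * tw tau r *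
  (sumn (seq.filter P r) == p * 'C(k, 2))%N%:R.
have sF : symfun F.
  move=> s t st; rewrite /F (symfun_bb m m' st) (symfun_tw tau st).
  by rewrite (perm_sumn (perm_filter P st)).
have fmP : seq.filter P m = [::].
  apply/eqP; rewrite -(negbK (_ == _)) -has_filter -all_predC.
  by apply: sub_all am => x /=; rewrite -leqNgt.
have cmP : count P m = 0%N by rewrite -size_filter fmP.
rewrite {1}/GT (_ : nsum _ _ _ = nsum (p * N) (N - n) (fun r => (count P r == k)%N%:R * F r)).
  rewrite nsum_select // binom_fact_div; last by lia.
  have -> : (N - n - k = N - k - n)%N by lia.
  rewrite /GT /CT size_map mulf_div -nsumM; congr (_ / _).
  have kN : (k <= N)%N by lia.
  have kNE : (p * N = p * k + p * (N - k))%N by rewrite -mulnDr subnKC.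
  rewrite -[RHS](@nsum_widen _ (p * k) (p * N)); first last.
  - move=> r sr nr; rewrite -[RHS](nsum0 R (p * (N - k)) (N - k - n)); apply: eq_nsum => s _ _.
    suff -> : bb r = 0 by rewrite expr2 !mul0r.
    by apply/eqP; apply: contraNT nr => /bb_range; rewrite sr.
  - by rewrite leq_mul2l kN orbT.
  apply: eq_nsum => r1 s1 _; rewrite -[RHS](@nsum_shift _ _ (p * k)) -kNE.
  apply: eq_nsum => r2 s2 _.
  have -> : all (predC P) r2 = all (leq (p * k)) r2.
    by apply: eq_all => x; rewrite /P /= -leqNgt.
  have [a2|_] := boolP (all (leq (p * k)) r2); last by rewrite andbF mul0r.
  have a2' : all (predC P) r2 by rewrite (sub_all _ a2) // => x /=; rewrite -leqNgt.
  rewrite andbT; have [a1|a1] := boolP (all P r1); last first.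
    rewrite mul0r; suff -> : bb r1 = 0 by rewrite expr2 !mul0r.
    by apply/eqP; apply: contraNT a1 => /bb_range; rewrite s1.
  rewrite mul1r /F filter_split //.
  case: eqP => [e1|ne1]; last first.
    rewrite mulr0; suff -> : bb r1 = 0 by rewrite expr2 !mul0r.
    by apply/eqP; apply: contraT => /bb_homog; rewrite s1.
  have B x : all (leq (p * k)) x -> bb (r1 ++ x ++ r2) = bb r1 *
      bb ([seq (y - p * k)%N | y <- x] ++ [seq (y - p * k)%N | y <- r2]).
    by move=> ax; rewrite bb_split s1 // all_cat ax a2 map_cat.
  rewrite bb_swap ?sm // !B //.
  by rewrite tw_cat (tw_shift tau a2) !mulr1 expr2; ring.
apply: eq_nsum => r _ _; rewrite /F /ren !count_cat !filter_cat -!/P cmP fmP add0n /=.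
by case: (_ == k); rewrite ?mul0r ?mulr0 //= mul1r; ring.
Qed.

Lemma CT_ge0 tau N : (forall x, 0 <= tau x) -> 0 <= CT tau N.
Proof.
move=> t0; rewrite /CT divr_ge0 ?ler0n // nsum_ge0 // => s _ _.
by rewrite mulr_ge0 ?sqr_ge0 // prodr_ge0.
Qed.

Definition Cn (N : nat) : R := CT (fun=> 1) N.

Lemma CT0 tau : CT tau 0 = 1.
Proof. by rewrite /CT nsum_nil bb_nil expr1n /tw big_nil mul1r divr1. Qed.

Lemma Cn0 : Cn 0 = 1. Proof. exact: CT0. Qed.

Lemma bb_full s : bb s != 0 -> ren (size s) s.
Proof.
move=> h; have a := bb_range h; rewrite /ren -all_count a.
by move/all_filterP: a => ->; apply/eqP/bb_homog.
Qed.

Lemma Cn1 : Cn 1 = 1.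
Proof.
rewrite /Cn /CT muln1 divr1 nsumS.
have b0 : bb [:: 0%N] = 1.
  rewrite /bb; have [D h] := vdm_expand R p 1.
  have := h D.+1 (leqnSn _) [:: 1] erefl; rewrite /= big_nil mulr1 nsumS.
  rewrite (bigD1 (@Ordinal D.+1 0 isT)) //= big1 ?addr0 => [|i i0].
    rewrite nsum_nil mon_cons /mon big_nil !mulr1 => <-; rewrite !mul1r /qenergy.
    by rewrite big_seq1 big_ord1 muln0 subrr mulr0 expR0.
  rewrite nsum_nil; have [->|/acoef_homog /=] := eqVneq (acoef [:: val i]) 0.
    by rewrite mul0r.
  by rewrite addn0 muln0 => i0'; case/negP: i0; apply/eqP/val_inj.
case: p p_gt0 b0 => // p' _ b0; rewrite (bigD1 (@Ordinal p'.+1 0 isT)) //= big1 ?addr0.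
  by rewrite nsum_nil tw1 mulr1 b0 expr1n.
move=> i i0; rewrite nsum_nil tw1 mulr1; apply/eqP; rewrite expf_eq0 /=.
apply: contraNT i0 => /bb_homog /=; rewrite addn0 muln0 => i0.
by apply/eqP/val_inj.
Qed.

Notation one := (fun=> 1 : R).

(** Expectation over occupation words, kept unnormalized with total mass [Cn N], so that
    conditioning on a renewal point gives plain products. *)
Definition EX N X : R := GT one N [::] [::] X.

Lemma EX_ren N k X : (k <= N)%N -> leftfun k X ->
  EX N (fun s => (ren k s)%:R * X s) = EX k X * Cn (N - k).
Proof. by move=> kN lX; rewrite /EX (@GT_right one N k [::] [::] X). Qed.

Lemma EX1 N : EX N (fun=> 1) = Cn N.
Proof. exact: GT_nil. Qed.

Lemma EX_le N X Y : (forall s, size s = N -> all (ltn^~ (p * N)%N) s -> bb s != 0 -> X s <= Y s) ->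
  EX N X <= EX N Y.
Proof.
move=> XY; rewrite /EX /GT subn0 ler_wpM2r ?invr_ge0 ?ler0n // le_nsum // => s ss as_ /=.
have [->|b0] := eqVneq (bb s) 0; first by rewrite !mul0r.
by rewrite tw1 mulr1 ler_wpM2l -?expr2 ?sqr_ge0 // XY.
Qed.

Lemma eq_EX N X Y : (forall s, size s = N -> all (ltn^~ (p * N)%N) s -> bb s != 0 -> X s = Y s) ->
  EX N X = EX N Y.
Proof.
by move=> XY; apply/eqP; rewrite eq_le; apply/andP; split; apply: EX_le => s h1 h2 h3;
  rewrite XY.
Qed.

Lemma EXD N X Y : EX N (fun s => X s + Y s) = EX N X + EX N Y.
Proof.
rewrite /EX /GT -mulrDl -nsumD; congr (_ / _); apply: eq_nsum => s _ _.
by rewrite mulrDr.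
Qed.

Lemma EXZ N c X : EX N (fun s => c * X s) = c * EX N X.
Proof.
rewrite /EX /GT mulrA -nsumZ; congr (_ / _); apply: eq_nsum => s _ _.
by ring.
Qed.

Lemma EX_sum N (T : Type) (r : seq T) (F : T -> seq nat -> R) :
  EX N (fun s => \sum_(i <- r) F i s) = \sum_(i <- r) EX N (F i).
Proof.
rewrite /EX /GT -mulr_suml -nsum_sum; congr (_ / _); apply: eq_nsum => s _ _.
by rewrite mulr_sumr.
Qed.

Lemma Cn_ge0 N : 0 <= Cn N. Proof. by apply: CT_ge0 => x; apply: ler01. Qed.

(** The left side is the mass of the words of N + M particles that have a renewal point at N. *)
Lemma Cn_super N M : Cn N * Cn M <= Cn (N + M).
Proof.
have := @EX_ren (N + M) N (fun=> 1) (leq_addr _ _) (leftfun1 _).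
rewrite EX1 addKn => <-; rewrite -(EX1 (N + M)); apply: EX_le => s _ _ _.
by rewrite mulr1 lern1 leq_b1.
Qed.

Lemma Cn_ge1 N : 1 <= Cn N.
Proof.
elim: N => [|N IH]; first by rewrite Cn0.
by rewrite -addn1 (le_trans _ (Cn_super N 1)) // Cn1 mulr1.
Qed.

Definition noren k s : bool := all (fun j => ~~ ren j s) (iota 1 k.-1).

(** The interarrival weight of the renewal process: words that are irreducible, with no renewal
    point strictly inside. *)
Definition alphan k : R := EX k (fun s => (noren k s)%:R).

Lemma alphan_ge0 k : 0 <= alphan k.
Proof.
have -> : 0 = EX k (fun=> 0) :> R.
  rewrite -[LHS](mul0r (EX k (fun=> 1))) -EXZ; apply: eq_EX => s _ _ _; exact: mul0r.
by apply: EX_le => s _ _ _.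
Qed.

Lemma leftfun_noren k : leftfun k (fun s => (noren k s)%:R).
Proof.
split; first by move=> s t st; congr (nat_of_bool _)%:R; apply: eq_all => j; rewrite (ren_sym j st).
move=> r; congr (nat_of_bool _)%:R; rewrite /noren.
apply: eq_in_all => j; rewrite mem_iota => /andP[_ jk].
by rewrite ren_filter //; case: k jk => [|k] /=; lia.
Qed.

(** Decomposition by the first renewal point, which exists because N itself is one for every word
    with nonzero coefficient. *)
Lemma Cn_renewal N : (0 < N)%N -> Cn N = \sum_(1 <= k < N.+1) alphan k * Cn (N - k).
Proof.
move=> N0; rewrite -EX1.
transitivity (EX N (fun s => \sum_(k <- index_iota 1 N.+1) (ren k s)%:R * (noren k s)%:R)).
  apply: eq_EX => s ss _ bs; have := bb_full bs; rewrite ss => rN.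
  have ex : exists k, (0 < k)%N && ren k s by exists N; rewrite N0.
  case: (ex_minnP ex) => k /andP[k0 rk] kmin.
  have kN : (k <= N)%N by apply: kmin; rewrite N0.
  rewrite (bigD1_seq k) ?iota_uniq ?mem_index_iota ?k0 //= rk mul1r.
  have -> : noren k s.
    apply/allP => j; rewrite mem_iota => /andP[j0 jk]; apply/negP => rj.
    have := kmin j; rewrite j0 rj => /(_ isT); lia.
  rewrite big_seq_cond big1 ?addr0 // => j; rewrite mem_index_iota => /andP[/andP[j0 jN] jk].
  case rj: (ren j s); last by rewrite mul0r.
  have kj : (k < j)%N by rewrite ltn_neqAle eq_sym jk kmin // j0.
  suff -> : noren j s = false by rewrite mulr0.
  apply/negP => /allP /(_ k); rewrite rk mem_iota => /(_ _)/negP; apply => //.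
  by case: (j) kj => [|j'] //= kj; lia.
rewrite EX_sum big_seq [RHS]big_seq; apply: eq_bigr => k.
rewrite mem_index_iota => /andP[k0 kN].
by rewrite EX_ren //; apply: leftfun_noren.
Qed.

End Weights.

Ltac nlia := repeat match goal with
  | H : context [@Order.le] |- _ => clear H
  | H : context [@Order.lt] |- _ => clear H
  end; lia.

Lemma geo_small (R : realType) (q e : R) : 0 <= q < 1 -> 0 < e ->
  exists n0, forall n, (n0 <= n)%N -> q ^+ n <= e.
Proof.
move=> /andP[q0 q1] e0; have : `|q| < 1 by rewrite ger0_norm.
move=> /cvg_expr /cvgrPdist_le /(_ e e0)[n0 _ h]; exists n0 => n n0n.
by have := h n n0n; rewrite /= sub0r normrN ger0_norm ?exprn_ge0.
Qed.

Lemma bernoulli_ge (R : realType) (d : R) n : 0 <= d <= 1 -> 1 - n%:R * d <= (1 - d) ^+ n.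
Proof.
move=> /andP[d0 d1]; elim: n => [|n IH]; first by rewrite expr0; lra.
rewrite exprS; apply: le_trans (ler_wpM2l _ IH); last by lra.
rewrite -natr1; have : 0 <= n%:R * d * d by rewrite !mulr_ge0.
nra.
Qed.

Lemma sum_half_le (R : realType) n : \sum_(i < n) (2^-1 : R) ^+ i <= 2.
Proof.
suff -> : \sum_(i < n) (2^-1 : R) ^+ i = 2 - 2 * 2^-1 ^+ n.
  by rewrite gerBl mulr_ge0 ?exprn_ge0 // invr_ge0.
elim: n => [|n IH]; first by rewrite big_ord0 expr0; ring.
by rewrite big_ord_recr IH /= exprS; field.
Qed.

(** * A renewal theorem *)

Section Limsup.
Variables (R : realType) (v : nat -> R).
Hypothesis v1 : forall n, `|v n| <= 1.

Lemma limsup_ex : exists L, (forall e, 0 < e -> exists n0, forall n, (n0 <= n)%N -> v n <= L + e) /\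
  (forall e n0, 0 < e -> exists2 n, (n0 <= n)%N & L - e <= v n).
Proof.
pose S := [set x : R | exists n0, forall n, (n0 <= n)%N -> v n <= x]%classic.
have S0 : (S !=set0)%classic by exists 1, 0%N => n _; rewrite (le_trans (ler_norm _)).
have Slb : has_lbound S.
  exists (-1) => x [n0 /(_ n0 (leqnn _)) h]; apply: le_trans h.
  by have := v1 n0; rewrite ler_norml => /andP[].
exists (inf S); split=> [e e0|e n0 e0].
  have [x [n0 h] xe] := inf_adherent e0 (conj S0 Slb).
  by exists n0 => n /h /le_trans -> //; apply/ltW.
apply: contrapT => H.
have : inf S <= inf S - e.
  apply: ge_inf => //; exists n0 => n n0n; rewrite leNgt; apply/negP => h.
  by apply: H; exists n => //; apply/ltW.
by rewrite lerBrDr gerDl leNgt e0.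
Qed.

Variable f : nat -> R.
Hypothesis f0 : forall k, 0 <= f k.
Hypothesis f1 : 0 < f 1%N.
Hypothesis fsum : forall n, \sum_(1 <= k < n.+1) f k <= 1.
Hypothesis vrec : forall n, (0 < n)%N -> v n = \sum_(1 <= k < n.+1) f k * v (n - k)%N.

Lemma ftail e : 0 < e -> exists M, forall n, (M <= n)%N -> \sum_(M.+1 <= k < n.+1) f k <= e.
Proof.
move=> e0; pose A := [set x | exists n, x = \sum_(1 <= k < n.+1) f k]%classic.
have hA : has_sup A.
  split; first by exists (\sum_(1 <= k < 1) f k), 0%N.
  by exists 1 => x [n ->].
have [_ [M ->] h] := sup_adherent e0 hA.
exists M => n Mn; have : \sum_(1 <= k < n.+1) f k <= sup A.
  by apply: ub_le_sup; [exact: hA.2 | exists n].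
rewrite (@big_cat_nat _ _ _ M.+1) //=; lra.
Qed.

(** If [v N] is close to the limsup L, then so is the weighted average of earlier values, none of
    which exceeds L by much; as [f 1] is positive, [v (N - 1)] must be close to L too. Iterating
    gives J consecutive values near L. The last assumption on L follows from [fsum] when L >= 0; for
    L < 0 it asks that the weights have total mass 1. *)
Lemma limsup_back L : (forall e, 0 < e -> exists n0, forall n, (n0 <= n)%N -> v n <= L + e) ->
  (forall e n0, 0 < e -> exists2 n, (n0 <= n)%N & L - e <= v n) ->
  (forall e, 0 < e -> exists M0, forall M, (M0 <= M)%N ->
     L * \sum_(2 <= k < M.+1) f k <= L * (1 - f 1%N) + e) ->
  forall J e n0, 0 < e -> exists2 n, (n0 + J <= n)%N & forall j, (j <= J)%N -> L - e <= v (n - j)%N.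
Proof.
move=> Lub Llb LM; elim=> [|J IH] e n0 e0.
  have [n n0n h] := Llb e n0 e0; exists n; first by rewrite addn0.
  by move=> j; rewrite leqn0 => /eqP ->; rewrite subn0.
have f11 : f 1%N <= 1 by have := fsum 1; rewrite big_nat1.
(* Four errors of size at most d add up below, and the result is divided by [f 1]. *)
pose d := f 1%N * e / 4.
have d0 : 0 < d by rewrite /d divr_gt0 ?mulr_gt0.
have de : d <= e by rewrite /d; nra.
have [M0 hM0] := LM d d0; have [M1 hM1] := ftail d0; have [n1 hn1] := Lub d d0.
(* Beyond lag M the weights are negligible, up to lag M the values are at most L + d. *)
pose M := maxn (maxn M0 M1) 1.
have [n nn hn] := IH d (n0 + n1 + M + 1)%N d0.
exists n; first by nlia.
move=> j; rewrite leq_eqVlt => /orP[/eqP->|]; last first.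
  by rewrite ltnS => /hn h; apply: le_trans h; lra.
set N := (n - J)%N; have NJ : (n - J.+1 = N - 1)%N by rewrite /N; nlia.
have hN : L - d <= v N by apply: hn.
rewrite NJ; have N0 : (0 < N)%N by rewrite /N; nlia.
move: hN; rewrite {1}vrec // big_ltn // (@big_cat_nat _ _ _ M.+1) //=; [|nlia..].
have s1 : \sum_(2 <= k < M.+1) f k * v (N - k)%N <= (L + d) * \sum_(2 <= k < M.+1) f k.
  rewrite mulr_sumr big_nat [X in _ <= X]big_nat; apply: ler_sum => k /andP[k2 kM].
  by rewrite mulrC ler_wpM2r // hn1 // /N; nlia.
have s2 : \sum_(M.+1 <= k < N.+1) f k * v (N - k)%N <= d.
  have : \sum_(M.+1 <= k < N.+1) f k <= d.
    have := hM1 N; rewrite (@big_cat_nat _ _ _ M.+1) //=; [|nlia..].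
    move=> /(_ ltac:(nlia)); apply: le_trans; rewrite lerDr sumr_ge0 //.
  apply: le_trans; apply: ler_sum => k _.
  by rewrite ler_piMr // (le_trans (ler_norm _)).
have s3 := hM0 M ltac:(nlia).
have s4 : \sum_(2 <= k < M.+1) f k <= 1.
  have := fsum M; rewrite big_ltn; last by nlia.
  by move=> h; apply: le_trans h; rewrite lerDr.
have s5 : f 1%N * (L - e) = f 1%N * L - 4 * d by rewrite /d; field.
move=> h; rewrite -(ler_pM2l f1) s5; nra.
Qed.

End Limsup.

(** * Convergence of the renewal sequence from supermultiplicativity and the convolution bound *)

Section Renewal.
Variables (R : realType) (C al : nat -> R).
Hypothesis C0 : C 0%N = 1.
Hypothesis C1 : C 1%N = 1.
Hypothesis Cge1 : forall N, 1 <= C N.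
Hypothesis Csup : forall N M, C N * C M <= C (N + M)%N.
Hypothesis al0 : forall k, 0 <= al k.
Hypothesis Cren : forall N, (0 < N)%N -> C N = \sum_(1 <= k < N.+1) al k * C (N - k)%N.
Hypothesis Cconv : forall Q, 0 < Q -> exists K, forall N k0, (k0 < N)%N ->
  C N <= \sum_(k1 < k0.+1) \sum_(k0.+1 <= k2 < N.+1)
     K * Q ^+ (k2 - k1) * C k1 * C (N - k2)%N.

Lemma Cge0 N : 0 <= C N. Proof. exact: le_trans ler01 (Cge1 N). Qed.

Lemma Cconv1 Q : 0 < Q -> exists2 K, 1 <= K & forall N k0, (k0 < N)%N ->
  C N <= \sum_(k1 < k0.+1) \sum_(k0.+1 <= k2 < N.+1)
     K * Q ^+ (k2 - k1) * C k1 * C (N - k2)%N.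
Proof.
move=> Q0; have [K h] := Cconv Q0; exists (Num.max K 1); first by rewrite le_max lexx orbT.
move=> N k0 k0N; apply: le_trans (h _ _ k0N) _; apply: ler_sum => k1 _; apply: ler_sum => k2 _.
rewrite !ler_wpM2r ?Cge0 ?exprn_ge0 ?(ltW Q0) //.
by rewrite le_max lexx.
Qed.

(** Cutting before the last particle with Q = 1 bounds each term by K times the sum of all earlier
    ones, so growth is at most geometric. *)
Lemma Cgrowth : exists2 B, 1 <= B & forall N, C N <= B ^+ N.
Proof.
have [K K1 hK] := Cconv1 (@ltr01 R); exists (1 + K); first by lra.
elim/ltn_ind => -[|N] IH; first by rewrite C0.
apply: le_trans (hK N.+1 N (ltnSn _)) _.
apply: (@le_trans _ _ (K * \sum_(k1 < N.+1) (1 + K) ^+ k1)).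
  rewrite mulr_sumr; apply: ler_sum => k1 _; rewrite big_nat1 subnn C0 mulr1 expr1n mulr1.
  by rewrite ler_wpM2l ?IH //; lra.
have -> : K * \sum_(k1 < N.+1) (1 + K) ^+ k1 = (1 + K) ^+ N.+1 - 1.
  by rewrite subrX1; congr (_ * _); ring.
by rewrite gerBl.
Qed.

Let S := [set x : R | 0 <= x /\ forall N, C N * x ^+ N <= 1]%classic.
Let r := sup S.

Let hasS : has_sup S.
Proof.
split; first by exists 0; split=> // -[|N]; rewrite ?expr0 ?C0 ?mulr1 // expr0n mulr0.
by exists 1 => x [x0 /(_ 1%N)]; rewrite C1 mul1r expr1.
Qed.

Let r_gt0 : 0 < r.
Proof.
have [B B1 hB] := Cgrowth; have B0 : 0 < B by lra.
apply: (@lt_le_trans _ _ B^-1); first by rewrite invr_gt0.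
apply: ub_le_sup; first exact: hasS.2.
split=> [|N]; first by rewrite invr_ge0 ltW.
by rewrite exprVn ler_pdivrMr ?exprn_gt0 // mul1r.
Qed.

Let r_le1 : r <= 1.
Proof.
apply: ge_sup; first exact: hasS.1.
by move=> x [x0 /(_ 1%N)]; rewrite C1 mul1r expr1.
Qed.

Let u n := C n * r ^+ n.

Let u_ge0 n : 0 <= u n. Proof. by rewrite mulr_ge0 ?Cge0 // exprn_ge0 // ltW. Qed.

(** The supremum r is attained: if [u n] exceeded 1, Bernoulli's inequality would keep C_n x^n above
    1 for some x in S slightly below r. *)
Let u_le1 n : u n <= 1.
Proof.
rewrite leNgt; apply/negP => un.
pose d := (1 - (u n)^-1) / (n.+1%:R).
have u0 : 0 < u n by lra.
have dn : n.+1%:R * d = 1 - (u n)^-1 by rewrite /d mulrC divfK // pnatr_eq0.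
have ui : 0 < 1 - (u n)^-1 <= 1.
  by rewrite subr_gt0 invf_lt1 // un /= gerBl invr_ge0 ltW.
have d0 : 0 < d by rewrite /d divr_gt0 ?ltr0n //; lra.
have d1 : d <= 1.
  rewrite /d ler_pdivrMr ?ltr0n // mul1r (le_trans _ (_ : 1 <= _)) ?ler1n //; lra.
have [x [x0 hx] xr] := sup_adherent (mulr_gt0 r_gt0 d0) hasS.
have : C n * (r * (1 - d)) ^+ n <= C n * x ^+ n.
  rewrite ler_wpM2l ?Cge0 // lerXn2r ?nnegrE //; first by rewrite mulr_ge0 ?(ltW r_gt0) //; lra.
  by rewrite -/r in xr; lra.
rewrite leNgt => /negP; apply; apply: le_lt_trans (hx n) _.
rewrite exprMn mulrA -/(u n).
have h := @bernoulli_ge _ d n ltac:(lra).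
apply: (@lt_le_trans _ _ (u n * (1 - n%:R * d))); last by rewrite ler_wpM2l.
have : n%:R * d < 1 - (u n)^-1 by rewrite -dn ltr_pM2r // ltr_nat.
move=> h'; have : u n * (u n)^-1 < u n * (1 - n%:R * d) by rewrite ltr_pM2l //; lra.
by rewrite divff // gt_eqF.
Qed.

Let u_super N M : u N * u M <= u (N + M)%N.
Proof.
rewrite /u exprD mulrACA ler_wpM2r ?Csup // mulr_ge0 ?exprn_ge0 // ltW //.
Qed.

Let u_superX N j : u N ^+ j <= u (N * j)%N.
Proof.
elim: j => [|j IH]; first by rewrite muln0 expr0 /u C0 expr0 mulr1.
rewrite exprS mulnS; apply: le_trans (u_super _ _).
by rewrite ler_wpM2l.
Qed.

(** The value 1/4 offers two factors 1/2 per step: one is spent against a rate [rho] close to 1, the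
    other on summing over k1 and k2. The power of r left over is dropped since r <= 1. *)
Let u_conv : exists2 K, 1 <= K & forall N k0, (k0 < N)%N ->
  u N <= \sum_(k1 < k0.+1) \sum_(k0.+1 <= k2 < N.+1)
     K * 4^-1 ^+ (k2 - k1) * u k1 * u (N - k2)%N.
Proof.
have [K K1 hK] := @Cconv1 4^-1 ltac:(by rewrite invr_gt0).
exists K => // N k0 k0N.
apply: le_trans (ler_wpM2r (exprn_ge0 N (ltW r_gt0)) (hK N k0 k0N)) _.
rewrite mulr_suml; apply: ler_sum => k1 _; rewrite mulr_suml big_nat [X in _ <= X]big_nat.
apply: ler_sum => k2 /andP[kk kN].
have k1k0 := ltn_ord k1.
have -> : r ^+ N = r ^+ (k2 - k1) * (r ^+ k1 * r ^+ (N - k2)).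
  by rewrite -!exprD; congr (_ ^+ _); nlia.
rewrite /u; set a := 4^-1 ^+ _; set c1 := C k1; set c2 := C _; set x1 := r ^+ k1.
set x2 := r ^+ (N - k2); have xx : r ^+ (k2 - k1) <= 1 by rewrite exprn_ile1 // ltW.
have -> : K * a * c1 * c2 * (r ^+ (k2 - k1) * (x1 * x2)) =
  (K * a * (c1 * x1) * (c2 * x2)) * r ^+ (k2 - k1) by ring.
rewrite ler_piMr // !mulr_ge0 ?Cge0 ?exprn_ge0 ?invr_ge0 ?(ltW r_gt0) //; lra.
Qed.

(* If u tended to 0, cutting at N/2 would make the decay self-improving, hence
   exponential, contradicting the maximality of r. *)
Let u_not0 : exists2 c, 0 < c & forall n0, exists2 n, (n0 <= n)%N & c <= u n.
Proof.
apply: contrapT => H.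
have uto0 c : 0 < c -> exists n0, forall n, (n0 <= n)%N -> u n <= c.
  move=> c0; apply: contrapT => H'; apply: H; exists c => // n0; apply: contrapT => H2.
  apply: H'; exists n0 => n n0n; rewrite leNgt; apply/negP => h.
  by apply: H2; exists n => //; apply: ltW.
have [K K1 hK] := u_conv.
(* With K A = 1/4 the quadratic term of the convolution uses half of the bound A rho^N to be proved;
   the terms close to an end of the system use the other half. *)
pose A := (4 * K)^-1; have K0 : 0 < K by lra.
have A0 : 0 < A by rewrite invr_gt0; lra.
have KA : K * A = 1 / 4 by rewrite /A; field; lra.
have A1 : A <= 1 by rewrite invf_le1; lra.
have [ks hks] := uto0 (A / 2) ltac:(lra).
have [h1 hh1] := @geo_small R (2 / 3) (3 / 8 * A / (2 * K * 2 ^+ ks)) ltac:(lra)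
  ltac:(by rewrite divr_gt0 ?mulr_gt0 ?exprn_gt0 //; lra).
(* [rho] is so close to 1 that rho^N1 >= 1/2; up to N1 the bound u <= A / 2 then suffices. Beyond N1
   the cut at N/2 lies past [h1]. *)
pose N1 := (2 * h1 + ks + 1)%N; pose d := (8 * N1.+1%:R)^-1 : R.
have d0 : 0 < d by rewrite invr_gt0 mulr_gt0 ?ltr0n.
have dN : N1.+1%:R * d = 1 / 8 by rewrite /d invfM mulrCA divff ?mulr1 ?div1r // pnatr_eq0.
have dN1 : N1%:R * d <= 1 / 8 by rewrite -dN ler_wpM2r ?ler_nat // ltW.
have d8 : d <= 1 / 8 by rewrite -dN -{1}[d]mul1r ler_wpM2r ?ler1n // ltW.
pose rho := 1 - d.
have rho1 : 0 < rho < 1 by rewrite /rho; lra.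
have [r0 r1] := andP rho1; have rn := ltW r0; have Kn := ltW K0; have An := ltW A0.
have rho2 : 3 / 4 <= rho ^+ 2 by rewrite /rho expr2; nra.
have rhoN1 : 1 / 2 <= rho ^+ N1.
  by apply: le_trans (bernoulli_ge N1 _); lra.
have dec : forall N, (ks <= N)%N -> u N <= A * rho ^+ N.
  elim/ltn_ind => N IH ksN; have [NN1|NN1] := leqP N N1.
    apply: le_trans (hks _ ksN) _.
    have : rho ^+ N1 <= rho ^+ N by rewrite ler_wiXn2l //; lra.
    by move=> h; have := le_trans rhoN1 h; nra.
  pose k0 := (N./2)%N; have k0N : (k0 < N)%N by rewrite /k0; nlia.
  have k0d : (k0 + k0 <= N)%N by rewrite /k0; nlia.
  apply: le_trans (hK N k0 k0N) _.
  pose T := K * A ^+ 2 * rho ^+ N + K * 2 ^+ ks * 2^-1 ^+ k0.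
  have T0 : 0 <= T.
    by rewrite addr_ge0 // !mulr_ge0 ?exprn_ge0 ?invr_ge0 //; lra.
  apply: (@le_trans _ _ (\sum_(k1 < k0.+1) \sum_(k0.+1 <= k2 < N.+1) T * 2^-1 ^+ (k2 - k1))).
    apply: ler_sum => k1 _; rewrite big_nat [X in _ <= X]big_nat.
    apply: ler_sum => k2 /andP[kk kN]; have k1k0 := ltn_ord k1; set n := (k2 - k1)%N.
    have n4 : 4^-1 ^+ n = 2^-1 ^+ n * 2^-1 ^+ n :> R.
      by rewrite -exprMn; congr (_ ^+ _); field.
    have [/andP[k1s k2s]|] := boolP ((ks <= k1)%N && (ks <= N - k2)%N).
      have i1 := IH k1 ltac:(nlia) k1s; have i2 := IH (N - k2)%N ltac:(nlia) k2s.
      have : K * 4^-1 ^+ n * u k1 * u (N - k2)%N <=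
             K * 4^-1 ^+ n * (A * rho ^+ k1) * (A * rho ^+ (N - k2)).
        have k4 : 0 <= K * 4^-1 ^+ n by rewrite mulr_ge0 ?exprn_ge0 ?invr_ge0 ?(ltW K0).
        by apply: ler_pM => //; [rewrite mulr_ge0|rewrite ler_wpM2l].
      move=> /le_trans; apply.
      apply: (@le_trans _ _ (K * A ^+ 2 * rho ^+ N * 2^-1 ^+ n)); last first.
        rewrite ler_wpM2r ?exprn_ge0 ?invr_ge0 // lerDl !mulr_ge0 ?exprn_ge0 ?invr_ge0 //; lra.
      have -> : rho ^+ N = rho ^+ n * (rho ^+ k1 * rho ^+ (N - k2)).
        by rewrite -!exprD; congr (_ ^+ _); rewrite /n; nlia.
      have rr : 2^-1 ^+ n <= rho ^+ n.
        by rewrite lerXn2r ?nnegrE ?invr_ge0 //; rewrite /rho; lra.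
      rewrite n4; set X := rho ^+ k1 * _.
      have X0 : 0 <= X by rewrite mulr_ge0 // exprn_ge0.
      have -> : K * (2^-1 ^+ n * 2^-1 ^+ n) * (A * rho ^+ k1) * (A * rho ^+ (N - k2)) =
        K * A ^+ 2 * X * 2^-1 ^+ n * 2^-1 ^+ n by rewrite /X; ring.
      have -> : K * A ^+ 2 * (rho ^+ n * X) * 2^-1 ^+ n =
        K * A ^+ 2 * X * 2^-1 ^+ n * rho ^+ n by ring.
      by rewrite ler_wpM2l // !mulr_ge0 ?exprn_ge0 ?invr_ge0 //; lra.
    (* One end of the block is within [ks] of an end of the system, so the block is almost half as
       long as the system and its weight alone is small enough. *)
    move=> hn; have nk : (k0 <= n + ks)%N.
      by move: hn; rewrite negb_and -!ltnNge /n; clearbody k0; move=> /orP[] ?; nlia.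
    apply: (@le_trans _ _ (K * 4^-1 ^+ n)).
      rewrite -mulrA ler_piMr ?mulr_ge0 ?exprn_ge0 ?invr_ge0 ?(ltW K0) //.
      by rewrite mulr_ile1.
    apply: (@le_trans _ _ (K * 2 ^+ ks * 2^-1 ^+ k0 * 2^-1 ^+ n)); last first.
      rewrite ler_wpM2r ?exprn_ge0 ?invr_ge0 // lerDr !mulr_ge0 ?exprn_ge0 //; lra.
    rewrite n4 !mulrA ler_wpM2r ?exprn_ge0 ?invr_ge0 // -mulrA ler_wpM2l ?(ltW K0) //.
    rewrite !exprVn ler_pdivlMr ?exprn_gt0 // mulrC ler_pdivrMr ?exprn_gt0 // -exprD.
    by rewrite ler_eXn2l ?ltr1n // addnC.
  apply: (@le_trans _ _ (T * 2)).
    have -> : \sum_(k1 < k0.+1) \sum_(k0.+1 <= k2 < N.+1) T * 2^-1 ^+ (k2 - k1) =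
      T * ((\sum_(k1 < k0.+1) 2^-1 ^+ (k0 - k1)) * (\sum_(k0.+1 <= k2 < N.+1) 2^-1 ^+ (k2 - k0))).
      rewrite mulr_suml mulr_sumr; apply: eq_bigr => k1 _; rewrite !mulr_sumr.
      rewrite big_nat [RHS]big_nat; apply: eq_bigr => k2 /andP[kk _].
      by rewrite -exprD; congr (_ * _ ^+ _); have := ltn_ord k1; nlia.
    rewrite ler_wpM2l //.
    have -> : \sum_(k1 < k0.+1) 2^-1 ^+ (k0 - k1) = \sum_(i < k0.+1) 2^-1 ^+ i :> R.
      rewrite (reindex_inj rev_ord_inj) /=; apply: eq_bigr => i _; congr (_ ^+ _).
      by have := ltn_ord i; nlia.
    have -> : \sum_(k0.+1 <= k2 < N.+1) 2^-1 ^+ (k2 - k0) =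
       2^-1 * \sum_(i < N - k0) 2^-1 ^+ i :> R.
      rewrite -[k0.+1]add0n big_addn mulr_sumr big_mkord subSS; apply: eq_bigr => i _.
      by rewrite -exprS; congr (_ ^+ _); nlia.
    have h2 := sum_half_le R k0.+1; have h3 := sum_half_le R (N - k0).
    have h20 : 0 <= \sum_(i < k0.+1) 2^-1 ^+ i :> R.
      by apply: sumr_ge0 => i _; rewrite exprn_ge0 // invr_ge0.
    have h30 : 0 <= \sum_(i < N - k0) 2^-1 ^+ i :> R.
      by apply: sumr_ge0 => i _; rewrite exprn_ge0 // invr_ge0.
    by nra.
  have k0h1 : (h1 <= k0)%N by rewrite /k0 /N1 in NN1 *; nlia.
  have := hh1 k0 k0h1; rewrite ler_pdivlMr ?mulr_gt0 ?exprn_gt0 // => hb.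
  have rhoN : (3 / 4) ^+ k0 * (3 / 4) <= rho ^+ N.
    apply: (@le_trans _ _ (rho ^+ (2 * k0 + 2))).
      rewrite exprD exprM ler_pM ?exprn_ge0 //; try lra.
      by rewrite lerXn2r ?nnegrE ?exprn_ge0 //; lra.
    by rewrite ler_wiXn2l ?(ltW r1) //; rewrite /k0; nlia.
  have e23 : 2^-1 ^+ k0 = (2 / 3) ^+ k0 * (3 / 4) ^+ k0 :> R.
    by rewrite -exprMn; congr (_ ^+ _); field.
  rewrite /T; set P := rho ^+ N in rhoN *; rewrite e23.
  set y := (2 / 3) ^+ k0 in hb *; set z := (3 / 4) ^+ k0 in rhoN *.
  have y0 : 0 <= y by rewrite exprn_ge0 //; lra.
  have z0 : 0 <= z by rewrite exprn_ge0 //; lra.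
  set w := 2 ^+ ks in hb *; have w0 : 0 < w by rewrite exprn_gt0.
  have -> : (K * A ^+ 2 * P + K * w * (y * z)) * 2 = 2 * (K * A) * A * P + (y * (2 * K * w)) * z.
    by ring.
  rewrite KA.
  have : (y * (2 * K * w)) * z <= 3 / 8 * A * z by rewrite ler_wpM2r.
  have : z * (A / 2) <= P * (4 / 3) * (A / 2) by nra.
  by nra.
(* Supermultiplicativity removes the prefactor A and the restriction to large N; then r / rho
   belongs to S, although r is its supremum. *)
have uM M : u M <= rho ^+ M.
  rewrite leNgt; apply/negP => h; pose j := (maxn ks 1)%N.
  have M0 : (0 < M)%N.
    by case: M h => // ; rewrite expr0 /u C0 mul1r ltxx.
  have := u_superX M j; rewrite leNgt => /negP; apply.
  have := dec (M * j)%N (leq_trans (leq_maxl ks 1) (leq_pmull j M0)).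
  move=> /le_lt_trans; apply.
  apply: (@le_lt_trans _ _ (rho ^+ (M * j))).
    rewrite ler_piMl // exprn_ge0 //; lra.
  by rewrite exprM ltrXn2r ?nnegrE ?exprn_ge0 //; rewrite /j; nlia.
have : r / rho <= r.
  apply: ub_le_sup; first exact: hasS.2.
  split=> [|N]; first by rewrite divr_ge0 ?(ltW r_gt0) //; lra.
  by rewrite expr_div_n mulrA ler_pdivrMr ?exprn_gt0 ?mul1r ?uM //; lra.
rewrite ler_pdivrMr // => h; have : r * rho < r by rewrite -[X in _ < X]mulr1 ltr_pM2l.
by move=> /(le_lt_trans h); rewrite ltxx.
Qed.

Let f k := al k * r ^+ k.

Let f0 k : 0 <= f k. Proof. by rewrite mulr_ge0 ?exprn_ge0 // ltW. Qed.

Let f1 : 0 < f 1%N.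
Proof.
have := Cren (ltnSn 0); rewrite big_nat1 subnn C0 C1 mulr1 => h.
by rewrite /f -h mul1r expr1.
Qed.

Let urec n : (0 < n)%N -> u n = \sum_(1 <= k < n.+1) f k * u (n - k)%N.
Proof.
move=> n0; rewrite /u Cren // mulr_suml big_nat [RHS]big_nat; apply: eq_bigr => k /andP[k1 kn].
have -> : r ^+ n = r ^+ k * r ^+ (n - k) by rewrite -exprD; congr (_ ^+ _); nlia.
by rewrite /f; ring.
Qed.

Let u_gt0 n : 0 < u n.
Proof.
by rewrite mulr_gt0 ?exprn_gt0 //; apply: lt_le_trans ltr01 (Cge1 n).
Qed.

Let fsum n : \sum_(1 <= k < n.+1) f k <= 1.
Proof.
rewrite leNgt; apply/negP; set s := \sum_(1 <= k < n.+1) f k => s1.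
have n0 : (0 < n)%N by case: n @s s1 => // s; rewrite /s big_geq // ltr10.
(* The minimum of u over a window of length n is multiplied by s after each window. *)
have [m m0 hm] : exists2 m, 0 < m & forall i, (i < n)%N -> m <= u i.
  suff : forall k, exists2 m, 0 < m & forall i, (i < k)%N -> m <= u i by apply.
  elim=> [|k [m m0 h]]; first by exists 1.
  exists (Num.min m (u k)); first by rewrite lt_min m0 u_gt0.
  move=> i; rewrite ltnS leq_eqVlt => /orP[/eqP->|ik]; first by rewrite ge_min lexx orbT.
  by rewrite ge_min h.
have grow : forall t i, (t * n <= i)%N -> s ^+ t * m <= u i.
  elim=> [|t IHt].
    rewrite expr0 mul1r; elim/ltn_ind => i IHi _; have [ii|ni] := ltnP i n; first exact: hm.
    rewrite urec; last by nlia.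
    rewrite (@big_cat_nat _ _ _ n.+1) //=.
    apply: (@le_trans _ _ (\sum_(1 <= k < n.+1) f k * m)).
      by rewrite -mulr_suml ler_peMl // ltW.
    rewrite -[X in X <= _]addr0 lerD //; last by apply: sumr_ge0 => k _; rewrite mulr_ge0.
    apply: ler_sum_nat => k /andP[k1 kn].
    by rewrite ler_wpM2l // IHi //; nlia.
  elim/ltn_ind => i IHi ti; have ni : (n <= i)%N by apply: leq_trans ti; rewrite leq_pmull.
  rewrite urec; last by nlia.
  rewrite (@big_cat_nat _ _ _ n.+1) //=.
  apply: (@le_trans _ _ (\sum_(1 <= k < n.+1) f k * (s ^+ t * m))).
    by rewrite -mulr_suml exprS mulrA.
  rewrite -[X in X <= _]addr0 lerD //; last by apply: sumr_ge0 => k _; rewrite mulr_ge0.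
  apply: ler_sum_nat => k /andP[k1 kn].
  rewrite ler_wpM2l // IHt // leq_subRL; last by nlia.
  by apply: leq_trans ti; rewrite mulSn leq_add2r; nlia.
have [t0 ht] := @geo_small R s^-1 (m / 2) ltac:(by rewrite invr_ge0 invf_lt1; lra) ltac:(lra).
have := grow t0 (t0 * n)%N (leqnn _); have := ht t0 (leqnn _).
rewrite exprVn => h1 h2; have := le_trans h2 (u_le1 _).
have st : 0 < s ^+ t0 by rewrite exprn_gt0 //; lra.
move: h1; rewrite -div1r ler_pdivrMr // => h1 h3; nra.
Qed.

Let F j := 1 - \sum_(1 <= k < j.+1) f k.

Let F0 j : 0 <= F j. Proof. by rewrite subr_ge0 fsum. Qed.

(** Decomposition by the last renewal up to time n: [F j] is the probability that the following
    waiting time exceeds j. *)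
Let FT n : \sum_(j < n.+1) F j * u (n - j)%N = 1.
Proof.
elim: n => [|n IH].
  by rewrite big_ord1 /F big_geq // /u C0 subr0 expr0 !mulr1.
rewrite big_ord_recl /= /F big_geq // subr0 mul1r subn0 urec //.
rewrite -[RHS]IH big_add1 big_mkord /= -big_split /=; apply: eq_bigr => i _.
rewrite /bump /= add1n subSS -mulrDl; congr (_ * _).
by rewrite /F [X in f _ + (1 - X)]big_nat_recr //=; ring.
Qed.

Let u_norm n : `|u n| <= 1. Proof. by rewrite ger0_norm. Qed.

(** Inserting long stretches of values close to the limsup L, and then to the liminf -l, into [FT]
    gives L mu <= 1 <= -l mu, where mu is the mean waiting time. The order matters: L > 0, from
    [u_not0], makes mu finite, and only then does [limsup_back] apply to -u. *)
Theorem renewal_limit : exists r0 uinf c : R, [/\ 0 < r0 <= 1, 0 < uinf, 0 < c,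
  (forall n, c <= C n * r0 ^+ n <= 1) &
  (forall e, 0 < e -> exists n0, forall n, (n0 <= n)%N -> `|C n * r0 ^+ n - uinf| <= e)].
Proof.
have [L [Lub Llb]] := limsup_ex u_norm.
have [c c0 hc] := u_not0.
have Lc : c <= L.
  apply/ler_addgt0Pr => e e0; have [n0 h] := Lub e e0; have [n n0n cn] := hc n0.
  exact: le_trans cn (h n n0n).
have L0 : 0 < L by lra.
have f11 : f 1%N <= 1 by have := fsum 1; rewrite big_nat1.
have backL : forall J e n0, 0 < e ->
    exists2 n, (n0 + J <= n)%N & forall j, (j <= J)%N -> L - e <= u (n - j)%N.
  apply: (limsup_back u_norm f0 f1 fsum urec Lub Llb) => e e0; exists 1%N => M M1.
  have := fsum M; rewrite big_ltn; last by nlia.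
  by move=> h; rewrite -[X in X <= _]addr0 lerD ?(ltW e0) // ler_wpM2l ?(ltW L0) //; lra.
have FL J : L * \sum_(j < J) F j <= 1.
  apply/ler_addgt0Pr => e e0.
  have Fb : \sum_(j < J) F j <= J%:R.
    rewrite -[X in _ <= X%:R]card_ord -sumr_const ler_sum // => i _.
    by rewrite /F gerBl sumr_ge0.
  have [n nJ hn] := @backL J (e / J.+1%:R) 0%N ltac:(by rewrite divr_gt0).
  have := FT n; rewrite -(big_mkord xpredT (fun j => F j * u (n - j)%N)).
  rewrite (@big_cat_nat _ _ _ J) //=; last by nlia.
  rewrite [X in X + _]big_mkord.
  have s1 : 0 <= \sum_(J <= i < n.+1) F i * u (n - i)%N.
    by apply: sumr_ge0 => i _; rewrite mulr_ge0.
  have s2 : (L - e / J.+1%:R) * \sum_(j < J) F j <= \sum_(i < J) F i * u (n - i)%N.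
    rewrite mulr_sumr; apply: ler_sum => i _; rewrite mulrC ler_wpM2l // hn //.
    by have := ltn_ord i; nlia.
  have s3 : e / J.+1%:R * \sum_(j < J) F j <= e.
    apply: (@le_trans _ _ (e / J.+1%:R * J.+1%:R)); last by rewrite divfK // pnatr_eq0.
    rewrite ler_wpM2l ?divr_ge0 ?(ltW e0) //; apply: le_trans Fb _.
    by rewrite ler_nat.
  move=> h; rewrite mulrBl lerBlDr in s2; apply: le_trans s2 _.
  by rewrite lerD // -h lerDl.
pose A := [set x | exists J, x = \sum_(j < J) F j]%classic.
have hA : has_sup A.
  split; first by exists (\sum_(j < 0) F j), 0%N.
  by exists L^-1 => x [J ->]; rewrite -(ler_pM2l L0) divff ?FL // gt_eqF.
pose mu := sup A.
have muJ J : \sum_(j < J) F j <= mu by apply: ub_le_sup; [exact: hA.2|exists J].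
have mu1 : 1 <= mu by have := muJ 1%N; rewrite big_ord1 /F big_geq // subr0.
have Lmu : L * mu <= 1.
  rewrite -ler_pdivlMl // mulr1; apply: ge_sup; first exact: hA.1.
  by move=> x [J ->]; rewrite -(ler_pM2l L0) divff ?FL // gt_eqF.
have Fdec i j : (i <= j)%N -> F j <= F i.
  move=> ij; rewrite /F lerD2l lerN2 [X in _ <= X](@big_cat_nat _ _ _ i.+1) //= lerDl.
  exact: sumr_ge0.
(* F is decreasing with bounded sums, hence tends to 0: the interarrival law has total mass 1, as
   the argument for the liminf requires. *)
have Fto0 e : 0 < e -> exists M0, forall M, (M0 <= M)%N -> F M <= e.
  move=> e0; have [M0 hM0] : exists M0 : nat, mu / e <= M0%:R.
    exists (Num.truncn (mu / e)).+1; apply/ltW.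
    exact: truncnS_gt.
  exists M0 => M M0M; rewrite leNgt; apply/negP => h.
  have : M0.+1%:R * e <= mu.
    apply: le_trans (muJ M0.+1); rewrite mulr_natl -[X in e *+ X](card_ord M0.+1) -sumr_const.
    apply: ler_sum => i _; apply: le_trans (ltW h) _; apply: Fdec.
    by have := ltn_ord i; nlia.
  move: hM0; rewrite ler_pdivrMr // -natr1 mulrDl mul1r => h1 h2; lra.
pose v n := - u n.
have v_norm n : `|v n| <= 1 by rewrite normrN.
have vrec n : (0 < n)%N -> v n = \sum_(1 <= k < n.+1) f k * v (n - k)%N.
  by move=> n0; rewrite /v urec // raddf_sum; apply: eq_bigr => k _; rewrite mulrN.
have [l [lub llb]] := limsup_ex v_norm.
have l0 : - 1 <= l <= 0.
  apply/andP; split.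
    apply/ler_addgt0Pr => e e0; have [n0 h] := lub e e0; apply: le_trans (h n0 (leqnn _)).
    by rewrite lerN2.
  apply/ler_addgt0Pr => e e0; have [n _ h] := llb e 0%N e0.
  by have := u_ge0 n; rewrite /v in h; lra.
have backl : forall J e n0, 0 < e ->
    exists2 n, (n0 + J <= n)%N & forall j, (j <= J)%N -> l - e <= v (n - j)%N.
  apply: (limsup_back v_norm f0 f1 fsum vrec lub llb) => e e0.
  have [M0 hM0] := Fto0 e e0; exists (maxn M0 1) => M M1.
  have := hM0 M ltac:(nlia); rewrite /F big_ltn; last by nlia.
  by move=> h; nra.
have lmu : 1 <= - l * mu.
  apply/ler_addgt0Pr => e e0; pose d := e / (2 * mu).
  have d0 : 0 < d by rewrite divr_gt0 //; lra.
  have dmu : d * mu = e / 2 by rewrite /d; field; lra.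
  have [_ [J ->] hJ] := @sup_adherent _ A (e / 2) ltac:(lra) hA.
  have [n nJ hn] := backl J d 0%N d0.
  have := FT n; rewrite -(big_mkord xpredT (fun j => F j * u (n - j)%N)).
  rewrite (@big_cat_nat _ _ _ J) //=; last by nlia.
  have s1 : \sum_(J <= i < n.+1) F i * u (n - i)%N <= mu - \sum_(j < J) F j.
    have := muJ n.+1; rewrite -(big_mkord xpredT F) (@big_cat_nat _ _ _ J) //=; last by nlia.
    rewrite big_mkord => h; apply: (@le_trans _ _ (\sum_(J <= i < n.+1) F i)); last by lra.
    by apply: ler_sum => i _; rewrite ler_piMr.
  have s2 : \sum_(0 <= i < J) F i * u (n - i)%N <= (- l + d) * mu.
    apply: (@le_trans _ _ ((- l + d) * \sum_(j < J) F j)); last first.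
      by rewrite ler_wpM2l ?muJ //; lra.
    rewrite big_mkord mulr_sumr; apply: ler_sum => i _; rewrite mulrC ler_wpM2r //.
    by have := hn i ltac:(have := ltn_ord i; nlia); rewrite /v; lra.
  rewrite -/mu in hJ; move=> h; rewrite mulrDl dmu in s2; lra.
have Ll : L <= - l by rewrite -(ler_pM2r (lt_le_trans ltr01 mu1)) (le_trans Lmu).
have cv e : 0 < e -> exists n0, forall n, (n0 <= n)%N -> `|u n - L| <= e.
  move=> e0; have [n1 h1] := Lub e e0; have [n2 h2] := lub e e0.
  exists (maxn n1 n2) => n nn; rewrite ler_norml.
  have := h1 n ltac:(nlia); have := h2 n ltac:(nlia); rewrite /v; lra.
have [n0 hn0] := cv (L / 2) ltac:(lra).
(* Before [n0] the lower bound comes from C_n >= 1. *)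
exists r, L, (Num.min (L / 2) (r ^+ n0)); split => //.
- by rewrite r_gt0.
- by rewrite lt_min exprn_gt0 // andbT; lra.
move=> n; rewrite u_le1 andbT ge_min; have [n0n|nn0] := leqP n0 n.
  have := hn0 n n0n; rewrite ler_norml -/(u n) => /andP[h _].
  by apply/orP; left; lra.
apply/orP; right; apply: (@le_trans _ _ (r ^+ n)).
  by rewrite ler_wiXn2l ?(ltW r_gt0) // ltnW.
by rewrite ler_peMl ?exprn_ge0 // ltW.
Qed.

End Renewal.

(** * Gaussian integrals on the cylinder *)

Section Gauss.
Variable R : realType.
Notation mu := (@lebesgue_measure R).

(** Unnormalized, with v twice the variance: v = 2 ell^2 for an orbital and v = ell^2 for its
    square. *)
Definition gau (v c x : R) : R := expR (- (x - c) ^+ 2 / v).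

Lemma gau_ge0 v c x : 0 <= gau v c x. Proof. exact: expR_ge0. Qed.

Lemma gau_le1 v c x : 0 < v -> gau v c x <= 1.
Proof.
by move=> v0; rewrite -expR0 ler_expR mulNr oppr_le0 divr_ge0 ?sqr_ge0 // ltW.
Qed.

Lemma gau_shift v c s x : gau v c (x - s) = gau v (c + s) x.
Proof. by rewrite /gau opprD addrA addrAC. Qed.

Lemma gau_normal v c : 0 < v -> gau v c = normal_fun c (Num.sqrt (v / 2)).
Proof.
move=> v0; apply/funext => x; rewrite /gau /normal_fun; congr (expR (_ / _)).
by rewrite sqr_sqrtr ?divr_ge0 ?(ltW v0) // -mulr_natr divfK // pnatr_eq0.
Qed.

Lemma measurable_gau v c : 0 < v -> measurable_fun [set: R]%classic (gau v c).
Proof. by move=> v0; rewrite gau_normal //; apply: measurable_normal_fun. Qed.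

Lemma integral_gau v c : 0 < v ->
  mu.-integrable [set: R]%classic (EFin \o gau v c) /\
  \int[mu]_(x in [set: R]%classic) gau v c x = Num.sqrt (v * pi).
Proof.
move=> v0; pose s := Num.sqrt (v / 2).
have s0 : s != 0 by rewrite gt_eqF // sqrtr_gt0 divr_gt0.
have pk : normal_peak s = (Num.sqrt (v * pi))^-1.
  rewrite /normal_peak /s sqr_sqrtr ?divr_ge0 ?(ltW v0) //.
  by rewrite -mulr_natr mulrAC divfK // pnatr_eq0.
have P0 : 0 < Num.sqrt (v * pi) by rewrite sqrtr_gt0 mulr_gt0 // pi_gt0.
have e : gau v c = (fun x => Num.sqrt (v * pi) * normal_pdf c s x).
  apply/funext => x; rewrite normal_pdfE // pk mulrA divff ?mul1r ?gt_eqF //.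
  by rewrite gau_normal.
have int := integrable_normal_pdf c s.
split.
  rewrite e (_ : _ \o _ = (fun x => (Num.sqrt (v * pi))%:E * (normal_pdf c s x)%:E)%E).
    by apply: integrableZl.
  by apply/funext => x /=; rewrite EFinM.
rewrite e RintegralZl //.
by rewrite /Rintegral integral_normal_pdf mulr1.
Qed.

Lemma integrable_dom (g : R -> R) (M v c : R) : 0 < v ->
  measurable_fun [set: R]%classic g -> (forall x, `|g x| <= M * gau v c x) ->
  mu.-integrable [set: R]%classic (EFin \o g).
Proof.
move=> v0 mg gM.
apply: (@le_integrable _ _ _ mu _ measurableT _ (fun x => M%:E * (gau v c x)%:E)%E).
- exact/measurable_EFinP.
- move=> x _ /=; rewrite lee_fin; apply: le_trans (gM x) _.
  by rewrite ler_norm.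
by apply: integrableZl => //; exact: (integral_gau c v0).1.
Qed.

Lemma Rintegral_lincomb (D : set R) (I : Type) (r : seq I) (c : I -> R) (f : I -> R -> R) :
  measurable D -> (forall i, mu.-integrable D (EFin \o f i)) ->
  mu.-integrable D (EFin \o (fun x => \sum_(i <- r) c i * f i x)) /\
  \int[mu]_(x in D) (\sum_(i <- r) c i * f i x) = \sum_(i <- r) c i * \int[mu]_(x in D) f i x.
Proof.
move=> mD fi; elim: r => [|i r [IH1 IH2]].
  split.
    rewrite (_ : _ \o _ = cst 0%E); first exact: integrable0.
    by apply/funext => x /=; rewrite big_nil.
  rewrite big_nil; under eq_Rintegral do rewrite big_nil.
  by rewrite Rintegral_cst // mul0r.
have iZ : mu.-integrable D (EFin \o (fun x => c i * f i x)).
  rewrite (_ : _ \o _ = (fun x => (c i)%:E * (EFin \o f i) x)%E); first exact: integrableZl.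
  by apply/funext => x /=; rewrite EFinM.
have e : (fun x => \sum_(j <- i :: r) c j * f j x) =
  (fun x => c i * f i x + \sum_(j <- r) c j * f j x).
  by apply/funext => x; rewrite big_cons.
split.
  rewrite e (_ : _ \o _ = (fun x => (EFin \o (fun x => (c i * f i x)%R)) x +
    (EFin \o (fun x => (\sum_(j <- r) c j * f j x)%R)) x)%E); last by apply/funext.
  exact: integrableD.
by rewrite e RintegralD // IH2 RintegralZl // big_cons.
Qed.

Lemma trig_nat n : sin (n%:R * (2 * pi)) = 0 :> R /\ cos (n%:R * (2 * pi)) = 1 :> R.
Proof.
elim: n => [|n [IH1 IH2]]; first by rewrite mul0r sin0 cos0.
have s2 : sin (2 * pi) = 0 :> R by rewrite mulr_natl sin2pi.
have c2 : cos (2 * pi) = 1 :> R by rewrite mulr_natl cos2pi.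
by rewrite -natr1 mulrDl mul1r sinD cosD IH1 IH2 s2 c2; split; ring.
Qed.

Lemma sin_int (q : int) : sin (q%:~R * (2 * pi)) = 0 :> R.
Proof.
case: q => n; first by have [] := trig_nat n.
rewrite NegzE mulrNz mulNr sinN -pmulrn.
by have [-> _] := trig_nat n.+1; rewrite oppr0.
Qed.

Lemma cos_int (q : int) : cos (q%:~R * (2 * pi)) = 1 :> R.
Proof.
case: q => n; first by have [] := trig_nat n.
rewrite NegzE mulrNz mulNr cosN -pmulrn.
by have [_ ->] := trig_nat n.+1.
Qed.

Lemma is_derive_sinM (w x : R) : is_derive x 1 (fun y => sin (w * y)) (w * cos (w * x)).
Proof.
have h : is_derive x 1 (fun y => w * y) w.
  by apply: is_derive_eq; rewrite mulr1 || rewrite /GRing.scale /= mulr1.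
by rewrite mulrC; exact: (@is_derive1_comp _ sin ( *%R w) x _ _ (is_derive_sin _) h).
Qed.

Lemma is_derive_cosM (w x : R) : is_derive x 1 (fun y => cos (w * y)) (- (w * sin (w * x))).
Proof.
have h : is_derive x 1 (fun y => w * y) w.
  by apply: is_derive_eq; rewrite mulr1 || rewrite /GRing.scale /= mulr1.
have -> : - (w * sin (w * x)) = - sin (w * x) * w by ring.
exact: (@is_derive1_comp _ cos ( *%R w) x _ _ (is_derive_cos _) h).
Qed.

Lemma continuous_sinM (w : R) : continuous (fun y : R => sin (w * y)).
Proof.
move=> x; apply: differentiable_continuous; apply/derivable1_diffP.
by have [] := is_derive_sinM w x.
Qed.

Lemma continuous_cosM (w : R) : continuous (fun y : R => cos (w * y)).
Proof.
move=> x; apply: differentiable_continuous; apply/derivable1_diffP.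
by have [] := is_derive_cosM w x.
Qed.

Lemma FTC_smooth (f F : R -> R) (b : R) : 0 < b -> continuous f -> continuous F ->
  (forall x : R, is_derive x 1 F (f x)) ->
  \int[mu]_(x in `[0, b]%classic) f x = F b - F 0.
Proof.
move=> b0 cf cF dF; rewrite /Rintegral (@continuous_FTC2 _ f F) //.
- exact: continuous_subspaceT.
- split; first by move=> x _; have [] := dF x.
  + by apply: cvg_at_right_filter; apply: cF.
  + by apply: cvg_at_left_filter; apply: cF.
- by move=> x _; rewrite derive1E; have [_ ->] := dF x.
Qed.

Lemma integral_cos (q : int) (b : R) : 0 < b ->
  \int[mu]_(y in `[0, 2 * pi * b]%classic) cos (q%:~R * (y / b)) =
  if q == 0 then 2 * pi * b else 0.
Proof.
move=> b0; have L0 : 0 < 2 * pi * b by rewrite !mulr_gt0 // pi_gt0.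
have [->|q0] := eqVneq q 0.
  under eq_Rintegral do rewrite mul0r cos0.
  by rewrite Rintegral_cst //= lebesgue_measure_itv /= lte_fin L0 mul1r sube0.
pose w : R := q%:~R / b.
have w0 : w != 0 by rewrite mulf_neq0 ?intr_eq0 // invr_neq0 // gt_eqF.
rewrite (_ : (fun y => cos _) = (fun y => cos (w * y))); last first.
  by apply/funext => y; rewrite /w; congr (cos _); field; rewrite gt_eqF.
have cF : continuous (fun y : R => w^-1 * sin (w * y)).
  by move=> x; apply: cvgM; [exact: cvg_cst|exact: continuous_sinM].
have dF (x : R) : is_derive x 1 (fun y : R => w^-1 * sin (w * y)) (cos (w * x)).
  have h := is_deriveZ w^-1 (is_derive_sinM w x).
  by move: h; rewrite /GRing.scale /= mulrA mulVf // mul1r.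
rewrite (FTC_smooth L0 (@continuous_cosM w) cF dF).
rewrite mulr0 sin0 mulr0 subr0 /w (_ : q%:~R / b * (2 * pi * b) = q%:~R * (2 * pi)).
  by rewrite sin_int mulr0.
by field; rewrite gt_eqF.
Qed.

Lemma integral_sin (q : int) (b : R) : 0 < b ->
  \int[mu]_(y in `[0, 2 * pi * b]%classic) sin (q%:~R * (y / b)) = 0.
Proof.
move=> b0; have L0 : 0 < 2 * pi * b by rewrite !mulr_gt0 // pi_gt0.
have [->|q0] := eqVneq q 0.
  under eq_Rintegral do rewrite mul0r sin0.
  by rewrite Rintegral_cst // mul0r.
pose w : R := q%:~R / b.
have w0 : w != 0 by rewrite mulf_neq0 ?intr_eq0 // invr_neq0 // gt_eqF.
rewrite (_ : (fun y => sin _) = (fun y => sin (w * y))); last first.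
  by apply/funext => y; rewrite /w; congr (sin _); field; rewrite gt_eqF.
have cF : continuous (fun y : R => - w^-1 * cos (w * y)).
  by move=> x; apply: cvgM; [exact: cvg_cst|exact: continuous_cosM].
have dF (x : R) : is_derive x 1 (fun y : R => - w^-1 * cos (w * y)) (sin (w * x)).
  have h := is_deriveZ (- w^-1) (is_derive_cosM w x).
  by move: h; rewrite /GRing.scale /= mulrNN mulrA mulVf // mul1r.
rewrite (FTC_smooth L0 (@continuous_sinM w) cF dF).
rewrite mulr0 cos0 /w (_ : q%:~R / b * (2 * pi * b) = q%:~R * (2 * pi)).
  by rewrite cos_int subrr.
by field; rewrite gt_eqF.
Qed.

Definition xdom (a b : \bar R) : set R := [set x : R | (a <= x%:E)%E /\ (x%:E <= b)%E]%classic.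

Lemma measurable_xdom a b : measurable (xdom a b).
Proof.
have -> : xdom a b = ([set: R] `&` (EFin @^-1` [set` `[a, b]%O]))%classic.
  by apply/seteqP; split => x /=; rewrite in_itv /=; [move=> [-> ->]|move=> [_ /andP[]]].
by apply: EFin_measurable => //; exact: emeasurable_itv.
Qed.

End Gauss.

(** * Iterated integrals of sums of products of one-particle functions *)

Section Iint.
Variables (R : realType) (Rad : R).
Hypothesis Rad_gt0 : 0 < Rad.
Notation mu := (@lebesgue_measure R).
Notation RtoC := (@real_complex R).

Definition cis (t : R) : R[i] := Complex (cos t) (sin t).

Definition oneval (gq : (R -> R) * int) (z : R * R) : R[i] :=
  RtoC (gq.1 z.1) * cis (gq.2%:~R * (z.2 / Rad)).

Definition oneint (a b : \bar R) (gq : (R -> R) * int) : R :=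
  (\int[mu]_(x in xdom a b) gq.1 x) * (if gq.2 == 0 then 2 * pi * Rad else 0).

Definition gprop (g : R -> R) : Prop := mu.-integrable [set: R]%classic (EFin \o g).

Fixpoint allg (L : seq ((R -> R) * int)) : Prop :=
  if L is gq :: L' then gprop gq.1 /\ allg L' else True.

Lemma ydomE : [set y : R | 0 <= y <= 2 * pi * Rad]%classic = `[0, 2 * pi * Rad]%classic.
Proof. by apply/seteqP; split => y /=; rewrite in_itv. Qed.

Lemma eq_iint a b N (f g : seq (R * R) -> R) : (forall w, size w = N -> f w = g w) ->
  iint Rad a b N f = iint Rad a b N g.
Proof.
elim: N f g => [|N IH] f g fg /=; first exact: fg.
apply: eq_Rintegral => x _; apply: eq_Rintegral => y _.
by apply: IH => w sw; apply: fg; rewrite /= sw.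
Qed.

Lemma iint_ge0 a b N (f : seq (R * R) -> R) : (forall w, size w = N -> 0 <= f w) ->
  0 <= iint Rad a b N f.
Proof.
elim: N f => [|N IH] f f0 /=; first exact: f0.
apply: Rintegral_ge0 => x _; apply: Rintegral_ge0 => y _.
by apply: IH => w sw; apply: f0; rewrite /= sw.
Qed.

Lemma RtoCM (x : R) (z : R[i]) : RtoC x * z = Complex (x * complex.Re z) (x * complex.Im z).
Proof.
case: z => u v; apply/eqP; rewrite eq_complex /=.
by apply/andP; split; apply/eqP; ring.
Qed.

Lemma Re_cisM (z : R[i]) t : complex.Re (z * cis t) = complex.Re z * cos t - complex.Im z * sin t.
Proof. by case: z. Qed.

Lemma Im_cisM (z : R[i]) t : complex.Im (z * cis t) = complex.Re z * sin t + complex.Im z * cos t.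
Proof. by case: z. Qed.

Lemma Re_sum (T : Type) (r : seq T) (F : T -> R[i]) :
  complex.Re (\sum_(t <- r) F t) = \sum_(t <- r) complex.Re (F t).
Proof.
elim: r => [|t r IH]; first by rewrite !big_nil.
by rewrite !big_cons -IH; case: (F t); case: (\sum_(j <- r) F j).
Qed.

Lemma Im_sum (T : Type) (r : seq T) (F : T -> R[i]) :
  complex.Im (\sum_(t <- r) F t) = \sum_(t <- r) complex.Im (F t).
Proof.
elim: r => [|t r IH]; first by rewrite !big_nil.
by rewrite !big_cons -IH; case: (F t); case: (\sum_(j <- r) F j).
Qed.

Lemma integral_trig a b (I : Type) (r : seq I) (A B : I -> R) (gq : I -> (R -> R) * int) :
  (forall i, gprop (gq i).1) ->
  \int[mu]_(x in xdom a b) \int[mu]_(y in [set y : R | 0 <= y <= 2 * pi * Rad]%classic)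
    (\sum_(i <- r) (gq i).1 x * (A i * cos ((gq i).2%:~R * (y / Rad)) +
      B i * sin ((gq i).2%:~R * (y / Rad)))) =
  \sum_(i <- r) A i * oneint a b (gq i).
Proof.
move=> gi; rewrite ydomE.
have mY : measurable (`[0, 2 * pi * Rad]%classic : set R) by exact: measurable_itv.
have icos (q : int) : mu.-integrable `[0, 2 * pi * Rad]%classic
    (EFin \o (fun y => cos (q%:~R * (y / Rad)))).
  apply: continuous_compact_integrable; first exact: segment_compact.
  apply: continuous_subspaceT => y.
  rewrite (_ : (fun y => cos _) = (fun y => cos ((q%:~R / Rad) * y))).
    exact: continuous_cosM.
  by apply/funext => t; congr (cos _); field; rewrite gt_eqF.
have isin (q : int) : mu.-integrable `[0, 2 * pi * Rad]%classic
    (EFin \o (fun y => sin (q%:~R * (y / Rad)))).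
  apply: continuous_compact_integrable; first exact: segment_compact.
  apply: continuous_subspaceT => y.
  rewrite (_ : (fun y => sin _) = (fun y => sin ((q%:~R / Rad) * y))).
    exact: continuous_sinM.
  by apply/funext => t; congr (sin _); field; rewrite gt_eqF.
have inner x : \int[mu]_(y in `[0, 2 * pi * Rad]%classic)
    (\sum_(i <- r) (gq i).1 x * (A i * cos ((gq i).2%:~R * (y / Rad)) +
      B i * sin ((gq i).2%:~R * (y / Rad)))) =
    \sum_(i <- r) (A i * (if (gq i).2 == 0 then 2 * pi * Rad else 0)) * (gq i).1 x.
  pose c (i : I + I) := match i with inl i => (gq i).1 x * A i | inr i => (gq i).1 x * B i end.
  pose f (i : I + I) y := match i with inl i => cos ((gq i).2%:~R * (y / Rad))
    | inr i => sin ((gq i).2%:~R * (y / Rad)) end.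
  have fi i : mu.-integrable `[0, 2 * pi * Rad]%classic (EFin \o f i).
    by case: i => i; [exact: icos|exact: isin].
  have [_] := Rintegral_lincomb (map inl r ++ map inr r) c mY fi.
  rewrite (_ : (fun y => \sum_(i <- r) _) =
    (fun y => \sum_(i <- map inl r ++ map inr r) c i * f i y)).
    move=> ->; rewrite big_cat !big_map /= -big_split /=; apply: eq_bigr => i _.
    by rewrite integral_cos // integral_sin // mulr0 addr0; case: ifP => _; ring.
  apply/funext => y; rewrite big_cat !big_map /= -big_split /=; apply: eq_bigr => i _.
  by ring.
under eq_Rintegral do rewrite inner.
have gi' i : mu.-integrable (xdom a b) (EFin \o (gq i).1).
  by apply: integrableS (gi i) => //; exact: measurable_xdom.
have [_ ->] := Rintegral_lincomb r (fun i => A i * (if (gq i).2 == 0 then 2 * pi * Rad else 0))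
  (measurable_xdom a b) gi'.
by apply: eq_bigr => i _; rewrite /oneint; case: ifP => _; ring.
Qed.

Lemma iint_terms a b N (I : Type) (r : seq I) (c : I -> R[i])
    (L : I -> seq ((R -> R) * int)) : (forall i, size (L i) = N) -> (forall i, allg (L i)) ->
  iint Rad a b N (fun w => complex.Re (\sum_(i <- r) c i *
      \prod_(x <- zip (L i) w) oneval x.1 x.2)) =
    complex.Re (\sum_(i <- r) c i * \prod_(gq <- L i) RtoC (oneint a b gq)) /\
  iint Rad a b N (fun w => complex.Im (\sum_(i <- r) c i *
      \prod_(x <- zip (L i) w) oneval x.1 x.2)) =
    complex.Im (\sum_(i <- r) c i * \prod_(gq <- L i) RtoC (oneint a b gq)).
Proof.
elim: N c L => [|N IH] c L sL gL.
  have L0 i : L i = [::] by apply: size0nil.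
  suff e : \sum_(i <- r) c i * \prod_(x <- zip (L i) [::]) oneval x.1 x.2 =
    \sum_(i <- r) c i * \prod_(gq <- L i) RtoC (oneint a b gq) by rewrite /= e.
  by apply: eq_bigr => i _; rewrite L0 !big_nil.
pose h i := head (fun=> 0, 0) (L i); pose L' i := behead (L i).
have LE i : L i = h i :: L' i by rewrite /h /L'; case: (L i) (sL i).
have sL' i : size (L' i) = N by have := sL i; rewrite LE => -[].
have gh i : gprop (h i).1 by have := gL i; rewrite LE => -[].
have gL' i : allg (L' i) by have := gL i; rewrite LE => -[].
pose J i := c i * \prod_(gq <- L' i) RtoC (oneint a b gq).
have eI : \sum_(i <- r) c i * \prod_(gq <- L i) RtoC (oneint a b gq) =
    \sum_(i <- r) RtoC (oneint a b (h i)) * J i.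
  by apply: eq_bigr => i _; rewrite LE big_cons /J; ring.
have eV x y w : \sum_(i <- r) c i * \prod_(z <- zip (L i) ((x, y) :: w)) oneval z.1 z.2 =
    \sum_(i <- r) (c i * oneval (h i) (x, y)) * \prod_(z <- zip (L' i) w) oneval z.1 z.2.
  by apply: eq_bigr => i _; rewrite LE big_cons /=; ring.
have eS x y : \sum_(i <- r) (c i * oneval (h i) (x, y)) *
    \prod_(gq <- L' i) RtoC (oneint a b gq) =
    \sum_(i <- r) RtoC ((h i).1 x) * (J i * cis ((h i).2%:~R * (y / Rad))).
  by apply: eq_bigr => i _; rewrite /J /oneval /=; ring.
rewrite eI; split.
  transitivity (\int[mu]_(x in xdom a b)
    \int[mu]_(y in [set y : R | 0 <= y <= 2 * pi * Rad]%classic)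
      (\sum_(i <- r) (h i).1 x * (complex.Re (J i) * cos ((h i).2%:~R * (y / Rad)) +
        (- complex.Im (J i)) * sin ((h i).2%:~R * (y / Rad))))).
    apply: eq_Rintegral => x _; apply: eq_Rintegral => y _.
    transitivity (iint Rad a b N (fun w => complex.Re (\sum_(i <- r) (c i * oneval (h i) (x, y)) *
      \prod_(z <- zip (L' i) w) oneval z.1 z.2))); first by apply: eq_iint => w _; rewrite eV.
    have [-> _] := IH (fun i => c i * oneval (h i) (x, y)) L' sL' gL'.
    rewrite eS Re_sum; apply: eq_bigr => i _; rewrite RtoCM /= Re_cisM.
    by rewrite mulNr.
  rewrite integral_trig // Re_sum; apply: eq_bigr => i _.
  by rewrite RtoCM /= mulrC.
transitivity (\int[mu]_(x in xdom a b)
    \int[mu]_(y in [set y : R | 0 <= y <= 2 * pi * Rad]%classic)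
      (\sum_(i <- r) (h i).1 x * (complex.Im (J i) * cos ((h i).2%:~R * (y / Rad)) +
        complex.Re (J i) * sin ((h i).2%:~R * (y / Rad))))).
  apply: eq_Rintegral => x _; apply: eq_Rintegral => y _.
  transitivity (iint Rad a b N (fun w => complex.Im (\sum_(i <- r) (c i * oneval (h i) (x, y)) *
    \prod_(z <- zip (L' i) w) oneval z.1 z.2))); first by apply: eq_iint => w _; rewrite eV.
  have [_ ->] := IH (fun i => c i * oneval (h i) (x, y)) L' sL' gL'.
  rewrite eS Im_sum; apply: eq_bigr => i _; rewrite RtoCM /= Im_cisM.
  by rewrite addrC.
rewrite integral_trig // Im_sum; apply: eq_bigr => i _.
by rewrite RtoCM /= mulrC.
Qed.

(** Iterated integrals are additive only for integrable integrands. The relation generates a class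
    of functions for which this is guaranteed, finite sums of products of one-particle functions,
    and carries the value of the integral along. Only values on words of length N matter. *)
Inductive repI (a b : \bar R) : nat -> (seq (R * R) -> R[i]) -> R[i] -> Prop :=
| repI0 N : repI a b N (fun=> 0) 0
| repI_term c L : allg L -> repI a b (size L)
    (fun w => c * \prod_(x <- zip L w) oneval x.1 x.2) (c * \prod_(gq <- L) RtoC (oneint a b gq))
| repID N F G V W : repI a b N F V -> repI a b N G W -> repI a b N (fun w => F w + G w) (V + W)
| repI_eq N F G V : (forall w, size w = N -> F w = G w) -> repI a b N F V -> repI a b N G V.

Section RepI.
Variables (a b : \bar R).
Notation repI := (repI a b).

Lemma repI_ciint N F V : repI N F V -> ciint Rad a b N F = V.
Proof.
pose T n := {t : R[i] * seq ((R -> R) * int) | size t.2 = n /\ allg t.2}.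
pose c n (t : T n) := (sval t).1; pose L n (t : T n) := (sval t).2.
suff H n G W : repI n G W -> exists r : seq (T n),
    (forall w, size w = n -> G w = \sum_(t <- r) c n t * \prod_(x <- zip (L n t) w) oneval x.1 x.2) /\
    W = \sum_(t <- r) c n t * \prod_(gq <- L n t) RtoC (oneint a b gq).
  move=> /H[r [e ->]].
  have [e1 e2] := iint_terms a b r (c N) (fun t => (svalP t).1) (fun t => (svalP t).2).
  transitivity (ciint Rad a b N (fun w => \sum_(t <- r) c N t *
      \prod_(x <- zip (L N t) w) oneval x.1 x.2)).
    by rewrite /ciint; congr Complex; apply: eq_iint => w sw; rewrite e.
  by rewrite /ciint e1 e2; case: (\sum_(i <- r) _).
elim=> {n G W} [n|d l gl|n F1 F2 V1 V2 _ [r1 [e1 ->]] _ [r2 [e2 ->]]|n F1 F2 V1 e _ [r [e1 ->]]].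
- by exists [::]; split=> [w _|]; rewrite big_nil.
- exists [:: (exist _ (d, l) (conj erefl gl) : T (size l))].
  by split=> [w _|]; rewrite big_seq1.
- by exists (r1 ++ r2); split=> [w sw|]; rewrite big_cat // e1 // e2.
- by exists r; split=> [w sw|//]; rewrite -e // e1.
Qed.

Lemma repIZ N F V (k : R[i]) : repI N F V -> repI N (fun w => k * F w) (k * V).
Proof.
elim=> {N F V} [n|d l gl|n F1 F2 V1 V2 _ h1 _ h2|n F1 F2 V1 e _ h].
- by rewrite mulr0; exact: repI0.
- by rewrite mulrA; apply: repI_eq (repI_term a b (k * d) gl) => w _; rewrite mulrA.
- by rewrite mulrDr; apply: repI_eq (repID h1 h2) => w _; rewrite mulrDr.
- by apply: repI_eq h => w sw; rewrite e.
Qed.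

Lemma repI_sum N (I : Type) (r : seq I) (P : pred I) (F : I -> seq (R * R) -> R[i]) V :
  (forall i, P i -> repI N (F i) (V i)) ->
  repI N (fun w => \sum_(i <- r | P i) F i w) (\sum_(i <- r | P i) V i).
Proof.
move=> h; elim: r => [|i r IH].
  by rewrite big_nil; apply: repI_eq (repI0 _ _ N) => w _; rewrite big_nil.
rewrite big_cons; case: ifP => Pi; last first.
  by apply: repI_eq IH => w _; rewrite big_cons Pi.
by apply: repI_eq (repID (h i Pi) IH) => w _; rewrite big_cons Pi.
Qed.

Lemma repI_nsum D n N (F : seq nat -> seq (R * R) -> R[i]) V :
  (forall m, size m = n -> repI N (F m) (V m)) ->
  repI N (fun w => nsum D n (fun m => F m w)) (nsum D n V).
Proof.
elim: n F V => [|n IH] F V h.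
  by rewrite nsum_nil; apply: repI_eq (h [::] _) => // w _; rewrite nsum_nil.
rewrite nsumS; apply: (@repI_eq a b _ (fun w => \sum_(i < D) nsum D n (fun m => F (nat_of_ord i :: m) w))).
  by move=> w _; rewrite nsumS.
apply: repI_sum => i _; apply: (IH (fun m => F (nat_of_ord i :: m))) => m sm.
by apply: h; rewrite /= sm.
Qed.

(** Interleaves two lists of one-particle functions, inverse to extracting the entries marked by [c]
    and those marked by its complement. *)
Fixpoint merge_mask (T : Type) (c : bitseq) (L M : seq T) : seq T :=
  match c, L, M with
  | true :: c', x :: L', _ => x :: merge_mask c' L' M
  | false :: c', _, y :: M' => y :: merge_mask c' L M'
  | _, _, _ => [::]
  end.

Lemma merge_maskP (T : Type) c (L M : seq T) (K : comPzSemiRingType) (f : T -> K)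
    (Z : Type) (w : seq Z) (g : T * Z -> K) :
  size L = count id c -> size M = count negb c -> size w = size c ->
  [/\ size (merge_mask c L M) = size c,
      \prod_(x <- merge_mask c L M) f x = (\prod_(x <- L) f x) * \prod_(x <- M) f x &
      \prod_(x <- zip (merge_mask c L M) w) g x =
      (\prod_(x <- zip L (mask c w)) g x) * \prod_(x <- zip M (mask (map negb c) w)) g x].
Proof.
elim: c L M w => [|[] c IH] [|x L] [|y M] [|z w] //= sL sM sw;
  rewrite ?add0n ?add1n ?big_nil ?mulr1 // in sL sM sw *.
- case: sL => sL; case: sw => sw; have [e1 e2 e3] := IH L [::] w sL sM sw.
  by rewrite !big_cons e1 e2 e3 !big_nil !mulr1 !mulrA; split.
- case: sL => sL; case: sw => sw; have [e1 e2 e3] := IH L (y :: M) w sL sM sw.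
  by rewrite !big_cons e1 e2 e3 !big_cons !mulrA; split.
- case: sM => sM; case: sw => sw; have [e1 e2 e3] := IH [::] M w sL sM sw.
  by rewrite !big_cons e1 e2 e3 !big_nil !mul1r mulrCA; split.
- case: sM => sM; case: sw => sw; have [e1 e2 e3] := IH (x :: L) M w sL sM sw.
  by rewrite !(big_cons, e1, e2, e3) /= ![f y * _]mulrCA ![g (y, z) * _]mulrCA; split.
Qed.

Lemma allg_merge c L M : allg L -> allg M -> allg (merge_mask c L M).
Proof.
elim: c L M => [|[] c IH] [|x L] [|y M] //= gL gM; (split;
  [by case: gL | by apply: IH => //; case: gL]) || (split; [by case: gM | by apply: IH => //; case: gM]).
Qed.

(** Fubini's theorem for two complementary groups of variables that interlace arbitrarily. *)
Lemma repI_mask (c : bitseq) F G V W : repI (count id c) F V -> repI (count negb c) G W ->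
  repI (size c) (fun w => F (mask c w) * G (mask (map negb c) w)) (V * W).
Proof.
move E : (count id c) => n rF; move: E; elim: rF => {n F V}
  [n|d l gl|n F1 F2 V1 V2 _ h1 _ h2|n F1 F2 V1 e _ h] E rG.
- by rewrite mul0r; apply: repI_eq (repI0 _ _ _) => w _; rewrite ?mul0r.
- move E' : (count negb c) rG => n' rG; move: E'; elim: rG => {n' G W}
    [n'|d' l' gl'|n' F1 F2 V1 V2 _ h1 _ h2|n' F1 F2 V1 e _ h] E'.
  + by rewrite mulr0; apply: repI_eq (repI0 _ _ _) => w _; rewrite mulr0.
  + have [w0 sw0] : exists w0 : seq (R * R), size w0 = size c.
      by exists (nseq (size c) (0, 0)); rewrite size_nseq.
    have [sz eI _] := merge_maskP (fun x => RtoC (oneint a b x))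
      (fun x => oneval x.1 x.2) (esym E) (esym E') sw0.
    rewrite mulrACA -eI -{1}sz.
    apply: repI_eq (repI_term a b (d * d') (allg_merge c gl gl')) => w sw.
    have [_ _ ->] := merge_maskP (fun x => RtoC (oneint a b x))
      (fun x => oneval x.1 x.2) (esym E) (esym E') (etrans sw sz).
    by rewrite mulrACA.
  + by rewrite mulrDr; apply: repI_eq (repID (h1 E') (h2 E')) => w _; rewrite mulrDr.
  + apply: repI_eq (h E') => w sw; rewrite e // size_mask ?size_map // -E' count_map.
    by apply: eq_count => -[].
- by rewrite mulrDl; apply: repI_eq (repID (h1 E rG) (h2 E rG)) => w _; rewrite mulrDl.
- by apply: repI_eq (h E rG) => w sw; rewrite e // size_mask.
Qed.

Definition isI N (F : seq (R * R) -> R) (v : R) := repI N (fun w => RtoC (F w)) (RtoC v).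

Lemma isI_eq N F G v : (forall w, size w = N -> F w = G w) -> isI N F v -> isI N G v.
Proof. by move=> e; apply: repI_eq => w sw; rewrite e. Qed.

Lemma isI_iint N F v : isI N F v -> iint Rad a b N F = v.
Proof. by move=> /repI_ciint; rewrite /ciint /= => -[]. Qed.

Lemma isIZ N F v k : isI N F v -> isI N (fun w => k * F w) (k * v).
Proof.
move=> /(repIZ (RtoC k)); rewrite /isI rmorphM; apply: repI_eq => w _.
by rewrite rmorphM.
Qed.

Lemma isID N F G v v' : isI N F v -> isI N G v' -> isI N (fun w => F w + G w) (v + v').
Proof.
move=> h1 h2; have := repID h1 h2; rewrite /isI rmorphD; apply: repI_eq => w _.
by rewrite rmorphD.
Qed.

Lemma isI_sum N (I : Type) (r : seq I) (P : pred I) F v : (forall i, P i -> isI N (F i) (v i)) ->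
  isI N (fun w => \sum_(i <- r | P i) F i w) (\sum_(i <- r | P i) v i).
Proof.
move=> /(repI_sum r) h; rewrite /isI rmorph_sum; apply: repI_eq h => w _.
by rewrite rmorph_sum.
Qed.

Lemma isI_mask (c : bitseq) F G v v' : isI (count id c) F v -> isI (count negb c) G v' ->
  isI (size c) (fun w => F (mask c w) * G (mask (map negb c) w)) (v * v').
Proof.
move=> h1 h2; have := repI_mask h1 h2; rewrite /isI rmorphM; apply: repI_eq => w _.
by rewrite rmorphM.
Qed.

(** The difference of the two integrands is again in the class, so positivity of the iterated
    integral is enough. *)
Lemma isI_le N F G v v' : isI N F v -> isI N G v' ->
  (forall w, size w = N -> F w <= G w) -> v <= v'.
Proof.
move=> h1 h2 le; have h := isID h2 (isIZ (- 1) h1).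
rewrite -subr_ge0 (_ : v' - v = v' + -1 * v); last by rewrite mulN1r.
rewrite -(isI_iint h); apply: iint_ge0 => w sw; rewrite mulN1r subr_ge0; exact: le.
Qed.

Lemma isI_prod N (g : R -> R) : gprop g ->
  isI N (fun w => \prod_(z <- w) g z.1) ((\int[mu]_(x in xdom a b) g x * (2 * pi * Rad)) ^+ N).
Proof.
move=> gg; have gN : allg (nseq N (g, 0 : int)) by elim: N.
have := repI_term a b 1 gN; rewrite size_nseq mul1r; rewrite /isI.
have -> : \prod_(gq <- nseq N (g, 0)) RtoC (oneint a b gq) =
  RtoC ((\int[mu]_(x in xdom a b) g x * (2 * pi * Rad)) ^+ N).
  by rewrite big_nseq iter_mulr_1 rmorphXn /oneint /=.
apply: repI_eq => w; rewrite mul1r => <- {gN}.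
elim: w => [|z w IH]; first by rewrite /= !big_nil.
by rewrite /= !big_cons IH rmorphM /oneval /= mul0r /cis cos0 sin0 mulr1.
Qed.

End RepI.

End Iint.

Fixpoint words (D N : nat) : seq (seq nat) :=
  if N is N'.+1 then [seq i :: m | i <- iota 0 D, m <- words D N'] else [:: [::]].

Lemma nsum_words (K : nmodType) D N (f : seq nat -> K) :
  nsum D N f = \sum_(m <- words D N) f m.
Proof.
elim: N f => [|N IH] f; first by rewrite nsum_nil big_seq1.
rewrite nsumS /= big_allpairs_dep /= -(subn0 D) -/(index_iota 0 D) big_mkord subn0.
by apply: eq_bigr => i _; rewrite IH.
Qed.

(** * Orbital expansion of Laughlin's function *)

Section PsiExpansion.
Variables (R : realType) (Rad ell : R) (p : nat).
Hypothesis Rad_gt0 : 0 < Rad.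
Hypothesis ell_gt0 : 0 < ell.
Hypothesis p_gt0 : (0 < p)%N.
Notation mu := (@lebesgue_measure R).
Notation RtoC := (@real_complex R).

Definition a0 : R := ell ^+ 2 / Rad.
Definition g2 : R := ell ^+ 2 / Rad ^+ 2.
Notation bb := (bb p g2).

(** The label k is real so that momenta can later be counted from an arbitrary origin. *)
Definition psi (k : R) (z : R * R) : R[i] :=
  RtoC (gau (2 * ell ^+ 2) (k * a0) z.1) * cis (k * (z.2 / Rad)).

Arguments psi : simpl never.
Local Arguments conjc : simpl never.

Definition psiprod (zs : seq (R * R)) (m : seq nat) : R[i] :=
  \prod_(x <- zip zs m) psi x.2%:R x.1.

(** Restores the reference energy that [qenergy] subtracts. *)
Definition sqA (N : nat) : R := expR (g2 / 2 * \sum_(j < N) (p * j)%:R ^+ 2).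

Lemma cisD s t : cis (s + t) = cis s * cis t :> R[i].
Proof. by rewrite /cis cosD sinD; apply/eqP; rewrite eq_complex /= eqxx /= addrC. Qed.

Lemma cis0 : cis 0 = 1 :> R[i].
Proof. by rewrite /cis cos0 sin0. Qed.

Lemma conj_cis t : conjc (cis t) = cis (- t) :> R[i].
Proof. by rewrite /cis cosN sinN. Qed.

Lemma conjcM (x y : R[i]) : conjc (x * y) = conjc x * conjc y.
Proof. exact: rmorphM. Qed.

Lemma cisX t n : cis t ^+ n = cis (n%:R * t) :> R[i].
Proof.
elim: n => [|n IH]; first by rewrite mul0r cis0.
by rewrite exprS IH -cisD; congr cis; rewrite -natr1; ring.
Qed.

Lemma cexp_cylE z : cexp_cyl Rad z = RtoC (expR (z.1 / Rad)) * cis (z.2 / Rad).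
Proof. by rewrite RtoCM. Qed.

Lemma PsiE zs : Psi Rad ell p zs = vdm p [seq cexp_cyl Rad z | z <- zs] *
  RtoC (expR (- (\sum_(z <- zs) z.1 ^+ 2) / (2 * ell ^+ 2))).
Proof.
rewrite /Psi; congr (_ * _).
rewrite (_ : \prod_(k < size zs) _ = \prod_(k < size [seq cexp_cyl Rad z | z <- zs])
  \prod_(j < k) (nth 0 [seq cexp_cyl Rad z | z <- zs] k -
      nth 0 [seq cexp_cyl Rad z | z <- zs] j) ^+ p); last first.
  rewrite size_map; apply: eq_bigr => k _; apply: eq_bigr => j _.
  by rewrite !(nth_map (0, 0)) // (ltn_trans (ltn_ord j)).
elim: [seq cexp_cyl Rad z | z <- zs] => [|x w IH] /=; first by rewrite big_ord0.
rewrite big_ord_recl big_ord0 mul1r -IH (big_nth 0) big_mkord -big_split /=.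
by apply: eq_bigr => k _; rewrite big_ord_recl /= mulrC; congr (_ * _).
Qed.

(** Completing the square: the factor e^(k x / Rad) times the Gaussian of Psi is exp(g2 k^2 / 2)
    times a Gaussian centred at k a0. *)
Lemma Psi_expand zs : Psi Rad ell p zs = RtoC (sqA (size zs)) *
  nsum (p * size zs) (size zs) (fun m => RtoC (bb m) * psiprod zs m).
Proof.
set N := size zs; have [D0 h] := vdm_expandC R p N.
pose D := maxn D0 (p * N).
rewrite PsiE (h D) ?leq_maxl ?size_map //.
rewrite (@nsum_widen _ (p * N) D) ?leq_maxr //; last first.
  move=> m sm am; suff -> : acoef R p m = 0 by rewrite mul0r.
  by apply/eqP; apply: contraNT am => /(acoef_range p_gt0); rewrite sm.
rewrite -nsumZr -nsumZ; apply: eq_nsum => m sm _; rewrite -mulrA.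
have -> : mon [seq cexp_cyl Rad z | z <- zs] m *
    RtoC (expR (- (\sum_(z <- zs) z.1 ^+ 2) / (2 * ell ^+ 2))) =
    RtoC (expR (g2 / 2 * \sum_(x <- m) x%:R ^+ 2)) * psiprod zs m.
  rewrite /psiprod; move: sm; rewrite /N; elim: zs {N h D} m => [|z zs IH] [|k m] //= sm.
    rewrite /mon !big_nil oppr0 mul0r mulr0 expR0; by [].
  move: sm => [sm]; rewrite mon_cons !big_cons.
  have -> : - (z.1 ^+ 2 + \sum_(j <- zs) j.1 ^+ 2) / (2 * ell ^+ 2) =
    - z.1 ^+ 2 / (2 * ell ^+ 2) + - (\sum_(j <- zs) j.1 ^+ 2) / (2 * ell ^+ 2).
    by rewrite opprD mulrDl.
  rewrite expRD rmorphM /= mulrACA IH // mulrDr expRD rmorphM /=.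
  suff -> : cexp_cyl Rad z ^+ k * RtoC (expR (- z.1 ^+ 2 / (2 * ell ^+ 2))) =
    RtoC (expR (g2 / 2 * k%:R ^+ 2)) * psi k%:R z by ring.
  rewrite cexp_cylE exprMn cisX -(rmorphXn RtoC) -expRM_natl /psi.
  have key : RtoC (expR (k%:R * (z.1 / Rad))) * RtoC (expR (- z.1 ^+ 2 / (2 * ell ^+ 2))) =
    RtoC (expR (g2 / 2 * k%:R ^+ 2)) * RtoC (gau (2 * ell ^+ 2) (k%:R * a0) z.1).
    rewrite -!(rmorphM RtoC) -!expRD; congr (RtoC (expR _)); rewrite /g2 /a0.
    by field; rewrite !gt_eqF.
  by rewrite mulrAC key; ring.
rewrite /bb rmorphM /= /qenergy -/N sm.
have -> : expR (g2 / 2 * (\sum_(x <- m) x%:R ^+ 2 - \sum_(j < N) (p * j)%:R ^+ 2)) =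
   expR (g2 / 2 * \sum_(x <- m) x%:R ^+ 2) / sqA N.
  by rewrite mulrBr expRB.
have A0 : RtoC (sqA N) != 0 by rewrite fmorph_eq0 gt_eqF // expR_gt0.
rewrite fmorph_div /=; set X := RtoC (expR _); set Y := psiprod _ _.
by set a := RtoC (acoef _ _ _); field.
Qed.

Variables (s : R) (t : R -> R) (M : R).
Hypothesis mt : measurable_fun [set: R]%classic t.
Hypothesis t_le : forall x, 0 <= t x <= M.

(** Mass of the k-th orbital, translated by s and weighted by t. The translation serves blocks of
    particles that begin away from the origin, the weight serves the test factor. *)
Definition TT (a b : \bar R) (k : nat) : R := 2 * pi * Rad *
  \int[mu]_(x in xdom a b) (gau (ell ^+ 2) (k%:R * a0 + s) x * t x).

Lemma gauM c x : gau (2 * ell ^+ 2) c x * gau (2 * ell ^+ 2) c x = gau (ell ^+ 2) c x.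
Proof. by rewrite /gau -expRD; congr expR; field; rewrite gt_eqF. Qed.

Definition gker (k k' : nat) (x : R) : R :=
  gau (2 * ell ^+ 2) (k%:R * a0 + s) x * gau (2 * ell ^+ 2) (k'%:R * a0 + s) x * t x.

Lemma gker_int k k' : gprop (gker k k').
Proof.
have v0 : 0 < 2 * ell ^+ 2 by rewrite mulr_gt0 // exprn_gt0.
apply: (@integrable_dom _ _ M (2 * ell ^+ 2) (k%:R * a0 + s)) => //.
  by apply: measurable_funM => //; apply: measurable_funM; exact: measurable_gau.
move=> x; have /andP[t0 tM] := t_le x.
rewrite /gker ger0_norm ?mulr_ge0 ?gau_ge0 // mulrC mulrA.
apply: (@le_trans _ _ (t x * gau (2 * ell ^+ 2) (k%:R * a0 + s) x)).
  by rewrite ler_piMr ?gau_le1 // mulr_ge0 ?gau_ge0.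
by rewrite ler_wpM2r ?gau_ge0.
Qed.

Definition LL (r r' : seq nat) : seq ((R -> R) * int) :=
  [seq (gker x.1 x.2, Posz x.1 - Posz x.2) | x <- zip r r'].

Lemma allg_LL r r' : allg (LL r r').
Proof.
rewrite /LL; elim: (zip r r') => [//|x l IH] /=; split => //; exact: gker_int.
Qed.

Lemma psiprod_cat zs w m r : size zs = size m ->
  psiprod (zs ++ w) (m ++ r) = psiprod zs m * psiprod w r.
Proof. by move=> h; rewrite /psiprod zip_cat // big_cat. Qed.

Lemma LL_val w r r' : size r = size w -> size r' = size w ->
  \prod_(x <- zip (LL r r') w) oneval Rad x.1 x.2 =
  psiprod (shiftx s w) r * conjc (psiprod (shiftx s w) r') * RtoC (\prod_(z <- w) t z.1).
Proof.
rewrite /psiprod /LL; elim: w r r' => [|z w IH] [|k r] [|k' r'] //=.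
  by move=> _ _; rewrite !big_nil rmorph1 !mulr1.
move=> [sr] [sr']; rewrite !big_cons IH // conjcM (rmorphM RtoC) /=.
suff -> : oneval Rad (gker k k', Posz k - Posz k') z =
  psi k%:R (z.1 - s, z.2) * conjc (psi k'%:R (z.1 - s, z.2)) * RtoC (t z.1) by ring.
rewrite /oneval /psi /gker /= conjcM conj_cis.
have rr (x : R) : conjc (RtoC x) = RtoC x by rewrite /conjc /= oppr0.
rewrite !gau_shift rr !(rmorphM RtoC).
have -> : (Posz k - Posz k')%:~R * (z.2 / Rad) = k%:R * (z.2 / Rad) + - (k'%:R * (z.2 / Rad)) :> R.
  by rewrite rmorphB /= -!pmulrn; ring.
by rewrite cisD; ring.
Qed.

(** Different momenta are orthogonal through the integral over y alone, so orthogonality survives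
    the restriction of x to any interval and any weight depending on x. *)
Lemma LL_int a b r r' : size r = size r' ->
  \prod_(gq <- LL r r') oneint Rad a b gq = if r' == r then tw (TT a b) r else 0.
Proof.
rewrite /LL /tw; elim: r r' => [|k r IH] [|k' r'] //=; first by rewrite !big_nil.
move=> [sr]; rewrite !big_cons IH // eqseq_cons.
rewrite /oneint /= subr_eq0 eqz_nat eq_sym.
case: eqP => [->|_] /=; last by rewrite mulr0 mul0r.
case: eqP => _; rewrite ?mulr0 //; congr (_ * _); rewrite /TT mulrC; congr (_ * _).
by apply: eq_Rintegral => x _; rewrite /gker gauM.
Qed.

Lemma size_shiftx w : size (shiftx s w) = size w. Proof. exact: size_map. Qed.

Lemma shiftx_cat w w' : shiftx s (w ++ w') = shiftx s w ++ shiftx s w'.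
Proof. exact: map_cat. Qed.

Lemma conjc_nsum D N (f : seq nat -> R[i]) : conjc (nsum D N f) = nsum D N (fun m => conjc (f m)).
Proof. exact: (@rmorph_nsum R[i] R[i] conjc). Qed.

Lemma conjcR (x : R) : conjc (RtoC x) = RtoC x.
Proof. by rewrite /conjc /= oppr0. Qed.

Lemma repI_Psi a b (zs zs' : seq (R * R)) l : size zs' = size zs ->
  let N := (size zs + l)%N in
  repI Rad a b l (fun w => Psi Rad ell p (shiftx s (zs ++ w)) *
     conjc (Psi Rad ell p (shiftx s (zs' ++ w))) * RtoC (\prod_(z <- w) t z.1))
  (RtoC (sqA N ^+ 2) * nsum (p * N) (size zs) (fun m => nsum (p * N) (size zs) (fun m' =>
    psiprod (shiftx s zs) m * conjc (psiprod (shiftx s zs') m') *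
    RtoC (nsum (p * N) l (fun r => bb (m ++ r) * bb (m' ++ r) * tw (TT a b) r))))).
Proof.
move=> szs N; set n := size zs.
pose c m m' r r' := RtoC (bb (m ++ r)) * RtoC (bb (m' ++ r')) *
  (psiprod (shiftx s zs) m * conjc (psiprod (shiftx s zs') m')).
pose val (r r' : seq nat) (w : seq (R * R)) := \prod_(x <- zip (LL r r') w) oneval Rad x.1 x.2.
pose int r r' := \prod_(gq <- LL r r') RtoC (oneint Rad a b gq).
have H : repI Rad a b l
   (fun w => RtoC (sqA N ^+ 2) * nsum (p * N) n (fun m => nsum (p * N) n (fun m' =>
      nsum (p * N) l (fun r => nsum (p * N) l (fun r' => c m m' r r' * val r r' w)))))
   (RtoC (sqA N ^+ 2) * nsum (p * N) n (fun m => nsum (p * N) n (fun m' =>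
      nsum (p * N) l (fun r => nsum (p * N) l (fun r' => c m m' r r' * int r r'))))).
  apply: repIZ.
  apply: (@repI_nsum _ _ a b (p * N) n l (fun m w => nsum (p * N) n (fun m' =>
      nsum (p * N) l (fun r => nsum (p * N) l (fun r' => c m m' r r' * val r r' w))))) => m _.
  apply: (@repI_nsum _ _ a b (p * N) n l (fun m' w =>
      nsum (p * N) l (fun r => nsum (p * N) l (fun r' => c m m' r r' * val r r' w)))) => m' _.
  apply: (@repI_nsum _ _ a b (p * N) l l (fun r w =>
      nsum (p * N) l (fun r' => c m m' r r' * val r r' w))) => r sr.
  apply: (@repI_nsum _ _ a b (p * N) l l (fun r' w => c m m' r r' * val r r' w)) => r' sr'.
  have sL : size (LL r r') = l by rewrite size_map size_zip sr sr' minnn.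
  by rewrite -sL; apply: repI_term; exact: allg_LL.
set V := (X in repI _ _ _ _ _ X); set V' := (X in repI _ _ _ _ _ X) in H.
have -> : V = V'.
  rewrite /V /V'; congr (_ * _); apply: eq_nsum => m _ _; apply: eq_nsum => m' _ _.
  rewrite rmorph_nsum /= -nsumZ; apply: eq_nsum => r sr ar.
  rewrite (eq_nsum (g := fun r' => if r' == r then c m m' r r' * RtoC (tw (TT a b) r) else 0)).
    rewrite (nsum_delta (fun r' => c m m' r r' * RtoC (tw (TT a b) r))) // /c !rmorphM /=.
    by ring.
  move=> r' sr' _; rewrite /int -rmorph_prod /= LL_int ?sr //.
  by case: eqP => // _; rewrite rmorph0 mulr0.
apply: repI_eq H => w sw.
rewrite !Psi_expand !size_shiftx !size_cat sw szs -/n -/N conjcM conjcR conjc_nsum.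
rewrite mulrACA -rmorphM -expr2 -mulrA; congr (_ * _).
rewrite [in RHS]/N !nsum_cat -nsumM -nsumZr; apply: eq_nsum => m sm _.
rewrite -!nsumZr; apply: eq_nsum => m' sm' _.
rewrite -nsumM -nsumZr; apply: eq_nsum => r sr _; rewrite -nsumZr; apply: eq_nsum => r' sr' _.
rewrite /val /c LL_val ?sr ?sr' ?sw // !shiftx_cat !psiprod_cat ?size_shiftx ?sm ?sm' ?szs //.
by rewrite !conjcM conjcR; ring.
Qed.

Lemma normc_sq (z : R[i]) : RtoC (Normc.normc z ^+ 2) = z * conjc z.
Proof.
case: z => x y; rewrite /Normc.normc sqr_sqrtr ?addr_ge0 ?sqr_ge0 //.
by apply/eqP; rewrite eq_complex /=; apply/andP; split; apply/eqP; ring.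
Qed.

Lemma isI_Psi a b N : isI Rad a b N
  (fun w => Normc.normc (Psi Rad ell p (shiftx s w)) ^+ 2 * \prod_(z <- w) t z.1)
  (sqA N ^+ 2 * nsum (p * N) N (fun r => bb r ^+ 2 * tw (TT a b) r)).
Proof.
have := @repI_Psi a b [::] [::] N erefl; rewrite /= add0n !nsum_nil /= => h.
rewrite /isI rmorphM; move: h.
have -> : psiprod (shiftx s [::]) [::] = 1 by rewrite /psiprod big_nil.
rewrite (_ : conjc 1 = 1); last by rewrite -(rmorph1 RtoC) conjcR.
rewrite !mul1r => h.
rewrite (eq_nsum (g := fun r => bb r * bb r * tw (TT a b) r)) //.
by apply: repI_eq h => w _; rewrite -normc_sq -rmorphM.
Qed.

End PsiExpansion.

(** * Energy estimates *)

Section SumDist.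
Variable R : realType.

Definition dst (i j : nat) : nat := ((i - j) + (j - i))%N.

Lemma dst_sym i j : dst i j = dst j i. Proof. by rewrite /dst addnC. Qed.

Lemma sum_dst (f : nat -> R) (B : R) i n : (forall d, 0 <= f d) ->
  (forall m, \sum_(d < m) f d <= B) -> \sum_(j < n) f (dst i j) <= B + B.
Proof.
move=> f0 fB; rewrite (bigID (fun j : 'I_n => (j <= i)%N)) /=; apply: lerD.
  apply: le_trans (fB i.+1).
  have -> : \sum_(d < i.+1) f d = \sum_(0 <= j < i.+1) f (i - j)%N.
    rewrite big_mkord (reindex_inj rev_ord_inj) /=.
    by apply: eq_bigr => j _; rewrite subSS.
  rewrite -(big_mkord (fun j => (j <= i)%N) (fun j => f (dst i j))).
  have [ni|ni] := leqP n i.+1.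
    rewrite [X in _ <= X](big_cat_nat (n := n)) //= -[X in X <= _]addr0 lerD ?sumr_ge0 //.
    rewrite big_mkcond /= ler_sum_nat // => j /andP[_ jn]; case: ifP => // ji.
    by rewrite /dst (_ : j - i = 0)%N ?addn0 //; lia.
  rewrite (big_cat_nat (n := i.+1)) //=; last by lia.
  rewrite [X in _ + X]big_nat_cond [X in _ + X]big_pred0 ?addr0.
    rewrite big_mkcond /= ler_sum_nat // => j /andP[_ jn]; rewrite ifT; last by lia.
    by rewrite /dst (_ : j - i = 0)%N ?addn0 //; lia.
  by move=> j; apply/negbTE; lia.
apply: le_trans (fB n).
rewrite -(big_mkord (fun j => ~~ (j <= i)%N) (fun j => f (dst i j))) -(big_mkord xpredT f).
have [ni|ni] := leqP n i.
  rewrite big_nat_cond big_pred0; first exact: sumr_ge0.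
  by move=> j; apply/negbTE; lia.
rewrite (big_cat_nat (n := i)) //=; last by lia.
rewrite [X in X + _]big_nat_cond [X in X + _]big_pred0 ?add0r; last first.
  by move=> j; apply/negbTE; lia.
rewrite -[in index_iota i _](add0n i) big_addn big_mkcond /=.
rewrite [X in _ <= X](big_cat_nat (n := (n - i)%N)) //=; last by lia.
rewrite -[X in X <= _]addr0 lerD ?sumr_ge0 //; apply: ler_sum_nat => j /andP[_ jn].
case: ifP => // _; rewrite /dst (_ : i - (j + i) + (j + i - i) = j)%N //; lia.
Qed.

Lemma geo_sum_le (q : R) m : 0 <= q < 1 -> \sum_(d < m) q ^+ d <= (1 - q)^-1.
Proof.
move=> /andP[q0 q1]; have h : 0 < 1 - q by lra.
rewrite -div1r ler_pdivlMr //.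
have -> : (\sum_(d < m) q ^+ d) * (1 - q) = 1 - q ^+ m.
  have := subrX1 q m; lra.
by rewrite gerBl exprn_ge0.
Qed.

Lemma count_lt_le (T : R) m : 0 <= T ->
  \sum_(d < m) ((0 < d)%N && (d%:R < T))%:R <= T.
Proof.
move=> T0.
suff H : \sum_(d < m) ((0 < d)%N && (d%:R < T))%:R <= T /\
  \sum_(d < m) ((0 < d)%N && (d%:R < T))%:R <= (m.-1)%:R :> R by case: H.
elim: m => [|m [IH1 IH2]]; first by rewrite big_ord0.
rewrite big_ord_recr /=; case: m IH1 IH2 => [|m] IH1 IH2; first by rewrite /= addr0.
case: ltP => /= h; last first.
  by rewrite addr0; split=> //; apply: le_trans IH2 _; rewrite ler_nat.
rewrite /= in IH2; have e : m.+1%:R = m%:R + 1 :> R by rewrite natr1.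
by split; lra.
Qed.

(** Telescoping: with x = k + b d, 1/x^2 <= 1/(x (x - b)) = (1/(x - b) - 1/x) / b. *)
Lemma sum_inv_sq (k b : R) m : 0 < b -> b < k ->
  \sum_(d < m) ((k + b * d%:R) ^+ 2)^-1 <= (b * (k - b))^-1.
Proof.
move=> b0 bk.
suff H : \sum_(d < m) ((k + b * d%:R) ^+ 2)^-1 <= b^-1 * ((k - b)^-1 - (k - b + b * m%:R)^-1).
  apply: le_trans H _; rewrite invfM ler_wpM2l ?invr_ge0 ?(ltW b0) //.
  rewrite gerBl invr_ge0 addr_ge0 ?mulr_ge0 ?(ltW b0) //; lra.
elim: m => [|m IH]; first by rewrite big_ord0 mulr0 addr0 subrr mulr0.
rewrite big_ord_recr /=; set x := k + b * m%:R.
have m0 : 0 <= b * m%:R by rewrite mulr_ge0 // ltW.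
have x0 : b < x by rewrite /x; lra.
have e1 : k - b + b * m%:R = x - b by rewrite /x; ring.
have e2 : k - b + b * m.+1%:R = x by rewrite /x -natr1; ring.
rewrite e1 in IH; rewrite e2; apply: (le_trans (lerD IH (lexx _))).
rewrite -lerBrDl -mulrBr.
have -> : (k - b)^-1 - x^-1 - ((k - b)^-1 - (x - b)^-1) = (x - b)^-1 - x^-1 by ring.
have -> : b^-1 * ((x - b)^-1 - x^-1) = (x * (x - b))^-1.
  by field; rewrite !gt_eqF //; lra.
rewrite lef_pV2 ?posrE ?exprn_gt0 ?mulr_gt0 //; [|lra..].
by rewrite expr2 ler_wpM2l //; lra.
Qed.

End SumDist.

(** * Particles ordered along the cylinder, their lattice sites and good cuts *)

Section Cuts.
Variables (R : realType) (Rad b kap : R).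
Hypothesis Rad_gt0 : 0 < Rad.
Hypothesis b_gt0 : 0 < b.
Hypothesis kap_gt : b < kap.
Variables (X : nat -> R) (N : nat).

(** Decay per lattice step at half the spacing b; the other half is left to the deviations of the
    particles. *)
Definition qq : R := expR (- (b / (2 * Rad))).

Lemma qq_bd : 0 < qq < 1.
Proof.
by rewrite expR_gt0 /= -expR0 ltr_expR oppr_lt0 divr_gt0 // mulr_gt0.
Qed.

Lemma expR_qq (c : R) (n : nat) :
  expR (- ((n%:R * (b / 2) - c) / Rad)) = expR (c / Rad) * qq ^+ n.
Proof.
by rewrite /qq -expRM_natl -expRD; congr expR; field; rewrite gt_eqF.
Qed.

Definition dev (j : nat) : R := `|X j - j%:R * b|.

Lemma dev_le j c : dev j <= c -> j%:R * b - c <= X j <= j%:R * b + c.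
Proof. by rewrite /dev ler_distl. Qed.

(* Crowding costs a Gaussian energy cubic in the number of particles, the
   short-range interaction only a quadratic one; here in the form "linear in dev". *)
Lemma crowding : (forall i j, (j <= i < N)%N -> X j <= X i) ->
  \sum_(i < N) \sum_(j < i) expR (- ((X i - X j) / Rad)) <=
  N%:R * (2 / (1 - qq)) + 16 / b * \sum_(j < N) dev j.
Proof.
move=> Xs; have /andP[q0 q1] := qq_bd.
(* If both deviations are at most b/4 times the lattice distance, the pair keeps half of its
   distance and falls under the geometric series. Any other pair is charged to a particle that
   deviates too much; each particle is charged at most 2 T times in either role. *)
pose T j := 4 * dev j / b.
have T0 j : 0 <= T j by rewrite !mulr_ge0 ?normr_ge0 ?invr_ge0 // ltW.
pose ind (t : R) (d : nat) : R := ((0 < d)%N && (d%:R < t))%:R.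
have pair i j : (j < i)%N -> (i < N)%N -> expR (- ((X i - X j) / Rad)) <=
    qq ^+ dst i j + ind (T i) (dst i j) + ind (T j) (dst i j).
  move=> ji iN; have dE : dst i j = (i - j)%N by rewrite /dst; nlia.
  have d0 : (0 < dst i j)%N by rewrite dE subn_gt0.
  have dR : (dst i j)%:R = i%:R - j%:R :> R by rewrite dE natrB // ltnW.
  rewrite /ind d0 /=.
  have e1 : expR (- ((X i - X j) / Rad)) <= 1.
    rewrite -expR0 ler_expR oppr_le0 divr_ge0 ?(ltW Rad_gt0) // subr_ge0 Xs //.
    by rewrite iN ltnW.
  have qd : 0 <= qq ^+ dst i j by rewrite exprn_ge0 // ltW.
  case: ltP => [_|hi] /=; first by case: (_ < _) => /=; lra.
  case: ltP => [_|hj] /=; first by lra.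
  rewrite !addr0 -[qq ^+ _]mul1r -(expR0 R) -(mul0r (Rad^-1)) -expR_qq ler_expR lerN2.
  rewrite ler_pM2r ?invr_gt0 // subr0 dR.
  move: hi hj; rewrite /T !ler_pdivrMr // dR => hi hj.
  have := dev_le (lexx (dev i)); have := dev_le (lexx (dev j)); nra.
apply: (@le_trans _ _ (\sum_(i < N) \sum_(j < N)
   (qq ^+ dst i j + ind (T i) (dst i j) + ind (T j) (dst i j)))).
  apply: ler_sum => i _.
  rewrite (big_ord_widen _ (fun j => expR (- ((X i - X j) / Rad))) (ltnW (ltn_ord i))).
  rewrite big_mkcond /=; apply: ler_sum => j _; case: ifP => ji; first exact: pair.
  by rewrite !addr_ge0 // ?exprn_ge0 ?(ltW q0) // /ind; case: (_ && _).
under eq_bigr => i _ do rewrite !big_split /=.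
rewrite !big_split /=.
have sA : \sum_(i < N) \sum_(j < N) qq ^+ dst i j <= N%:R * (2 / (1 - qq)).
  rewrite -[N in N%:R]card_ord mulr_natl -sumr_const; apply: ler_sum => i _.
  have -> : 2 / (1 - qq) = (1 - qq)^-1 + (1 - qq)^-1 by ring.
  apply: (sum_dst (f := fun d => qq ^+ d)) => [d|m]; first by rewrite exprn_ge0 // ltW.
  by apply: geo_sum_le; rewrite (ltW q0).
have sB : \sum_(i < N) \sum_(j < N) ind (T i) (dst i j) <= 8 / b * \sum_(j < N) dev j.
  rewrite mulr_sumr; apply: ler_sum => i _.
  have -> : 8 / b * dev i = T i + T i by rewrite /T; ring.
  apply: (sum_dst (f := ind (T i))) => [d|m]; first by rewrite /ind.
  exact: count_lt_le.
have sC : \sum_(i < N) \sum_(j < N) ind (T j) (dst i j) <= 8 / b * \sum_(j < N) dev j.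
  rewrite exchange_big /=; apply: le_trans sB; apply: ler_sum => i _; apply: ler_sum => j _.
  by rewrite dst_sym.
have -> : 16 / b * \sum_(j < N) dev j = 8 / b * \sum_(j < N) dev j + 8 / b * \sum_(j < N) dev j.
  by ring.
by lra.
Qed.

(** The allowance widens like a cone around the cut. The slope b/2 leaves half of the lattice
    distance between any two particles on different sides, up to 2 kap, so the interaction across
    the cut is bounded uniformly in N. *)
Definition good_cut (k : nat) : bool :=
  [forall j : 'I_N, dev j <= kap + b / 2 * (dst j k)%:R].

Lemma good_cutP k j : good_cut k -> (j < N)%N -> dev j <= kap + b / 2 * (dst j k)%:R.
Proof. by move=> /forallP h jN; apply: (h (Ordinal jN)). Qed.

Lemma good_cut_cross k : good_cut k ->
  \sum_(j < k | (j < N)%N) \sum_(k <= i < N) expR (- ((X i - X j) / Rad)) <=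
  expR (2 * kap / Rad) * (1 - qq)^-1 ^+ 2.
Proof.
move=> gk; have /andP[q0 q1] := qq_bd.
apply: (@le_trans _ _ (\sum_(j < k) \sum_(k <= i < N) expR (2 * kap / Rad) *
  (qq ^+ (k - j) * qq ^+ (i - k)))).
  rewrite big_mkcond; apply: ler_sum => j _; case: ifP => jN; last first.
    apply: sumr_ge0 => i _; rewrite !mulr_ge0 ?expR_ge0 ?exprn_ge0 ?(ltW q0) //.
  apply: ler_sum_nat => i /andP[ki iN].
  have jk := ltn_ord j.
  rewrite -exprD -expR_qq ler_expR lerN2 ler_pM2r ?invr_gt0 //.
  have /dev_le := good_cutP gk jN; have /dev_le := good_cutP gk iN.
  have -> : dst i k = (i - k)%N by rewrite /dst; nlia.
  have -> : dst j k = (k - j)%N by rewrite /dst; nlia.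
  rewrite natrD !natrB //; [|exact: ltnW]; nra.
have -> : \sum_(j < k) \sum_(k <= i < N) expR (2 * kap / Rad) * (qq ^+ (k - j) * qq ^+ (i - k)) =
  expR (2 * kap / Rad) * ((\sum_(j < k) qq ^+ (k - j)) * \sum_(k <= i < N) qq ^+ (i - k)).
  rewrite mulr_suml mulr_sumr; apply: eq_bigr => j _.
  by rewrite mulr_sumr mulr_sumr.
rewrite ler_wpM2l ?expR_ge0 // expr2.
have s1 : \sum_(j < k) qq ^+ (k - j) <= (1 - qq)^-1.
  apply: le_trans (geo_sum_le k _); last by rewrite (ltW q0).
  rewrite (reindex_inj rev_ord_inj) /=; apply: ler_sum => j _.
  rewrite ler_wiXn2l ?(ltW q0) ?(ltW q1) //; have := ltn_ord j; nlia.
have s2 : \sum_(k <= i < N) qq ^+ (i - k) <= (1 - qq)^-1.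
  apply: le_trans (geo_sum_le (N - k) _); last by rewrite (ltW q0).
  rewrite -{1}[k]add0n big_addn big_mkord le_eqVlt; apply/orP; left; apply/eqP.
  by apply: eq_bigr => i _; rewrite addnK.
by apply: ler_pM => //; apply: sumr_ge0 => i _; rewrite exprn_ge0 // ltW.
Qed.

Lemma bracket k0 : (k0 < N)%N -> exists k1 k2, [/\ (k1 <= k0 < k2)%N, (k2 <= N)%N,
  (k1 == 0)%N || good_cut k1, (k2 == N) || good_cut k2 &
  forall k, (k1 < k < k2)%N -> ~~ good_cut k].
Proof.
move=> k0N.
have ex1 : exists k, ((k == 0)%N || good_cut k) && (k <= k0)%N by exists 0%N.
have ub1 k : ((k == 0)%N || good_cut k) && (k <= k0)%N -> (k <= k0)%N by case/andP.
case: (ex_maxnP ex1 ub1) => k1 /andP[g1 k10] max1.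
have ex2 : exists k, ((k == N) || good_cut k) && (k0 < k)%N by exists N; rewrite eqxx.
case: (ex_minnP ex2) => k2 /andP[g2 k02] min2.
exists k1, k2; split=> //; first by rewrite k10.
  by apply: min2; rewrite eqxx.
move=> k /andP[k1k kk2]; apply/negP => gk; have [kk0|k0k] := leqP k k0.
  by have := max1 k; rewrite gk orbT kk0 leqNgt k1k => /(_ isT).
by have := min2 k; rewrite gk orbT k0k leqNgt kk2 => /(_ isT).
Qed.

(* A bad cut inside the block is caused by a particle of the block itself. *)
Lemma block_energy k1 k2 : (k2 <= N)%N -> (k1 == 0)%N || good_cut k1 -> (k2 == N) || good_cut k2 ->
  (forall k, (k1 < k < k2)%N -> ~~ good_cut k) ->
  (k2 - k1.+1)%:R <= 2 * (b / 2 * (kap - b / 2))^-1 * \sum_(k1 <= j < k2) dev j ^+ 2.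
Proof.
move=> k2N g1 g2 bad; have b20 : 0 < b / 2 by rewrite divr_gt0.
(* A particle outside the block has a larger allowance at k than at the end of the block nearest to
   it, and respects the latter because that end is a good cut. *)
have cause k : (k1 < k < k2)%N -> exists2 j, (k1 <= j < k2)%N &
    kap + b / 2 * (dst j k)%:R < dev j.
  move=> kk; have := bad k kk; rewrite negb_forall => /existsP[[j jN] /=].
  rewrite -ltNge => hj; exists j => //; move/andP: kk => [k1k kk2].
  apply/andP; split; rewrite leqNgt; apply/negP => h.
    case/orP: g1 => [/eqP k10|g1]; first by nlia.
    have := good_cutP g1 jN; rewrite leNgt => /negP; apply; apply: le_lt_trans hj.
    by rewrite lerD2l ler_wpM2l ?(ltW b20) // ler_nat /dst; nlia.
  case/orP: g2 => [/eqP k20|g2]; first by nlia.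
  have := good_cutP g2 jN; rewrite leNgt => /negP; apply; apply: le_lt_trans hj.
  by rewrite lerD2l ler_wpM2l ?(ltW b20) // ler_nat /dst; nlia.
have kp (d : nat) : 0 < kap + b / 2 * d%:R 
  by apply: ltr_pwDl; [exact: (lt_trans b_gt0 kap_gt)|by rewrite mulr_ge0 // ltW].
(* Each bad cut contributes at least 1 through the particle causing it; for fixed j the inverse
   squares of the allowances are summable over k. *)
apply: (@le_trans _ _ (\sum_(k1.+1 <= k < k2) \sum_(k1 <= j < k2)
   dev j ^+ 2 * ((kap + b / 2 * (dst j k)%:R) ^+ 2)^-1)).
  have -> : (k2 - k1.+1)%:R = \sum_(k1.+1 <= k < k2) 1 :> R.
    by rewrite sumr_const_nat.
  apply: ler_sum_nat => k kk; have [j jj hj] := cause k kk.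
  rewrite (bigD1_seq j) ?mem_index_iota ?iota_uniq //=.
  rewrite -[X in X <= _]addr0 lerD //.
    rewrite ler_pdivlMr ?exprn_gt0 // mul1r lerXn2r ?nnegrE ?(ltW (kp _)) ?normr_ge0 //.
    exact: ltW.
  by apply: sumr_ge0 => i _; rewrite mulr_ge0 ?sqr_ge0 // invr_ge0 sqr_ge0.
rewrite exchange_big /= mulr_sumr; apply: ler_sum => j _.
rewrite -mulr_sumr mulrC ler_wpM2r ?sqr_ge0 //.
apply: (@le_trans _ _ (\sum_(k < k2) ((kap + b / 2 * (dst j k)%:R) ^+ 2)^-1)).
  rewrite -(big_mkord xpredT (fun k => ((kap + b / 2 * (dst j k)%:R) ^+ 2)^-1)).
  have [h|h] := leqP k2 k1.+1.
    by rewrite [X in X <= _]big_geq //; apply: sumr_ge0 => i _; rewrite invr_ge0 sqr_ge0.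
  rewrite [X in _ <= X](big_cat_nat (n := k1.+1)) //=; last by nlia.
  by rewrite lerDr; apply: sumr_ge0 => i _; rewrite invr_ge0 sqr_ge0.
have -> : 2 * (b / 2 * (kap - b / 2))^-1 = (b / 2 * (kap - b / 2))^-1 + (b / 2 * (kap - b / 2))^-1.
  by ring.
apply: (sum_dst (f := fun d => ((kap + b / 2 * d%:R) ^+ 2)^-1)) => [d|m].
  by rewrite invr_ge0 sqr_ge0.
by apply: sum_inv_sq => //; apply: (lt_trans _ kap_gt); rewrite gtr_pMr // invf_lt1 // ltr1n.
Qed.

Lemma exp_window (ell y c : R) : 0 < ell -> c <= y ->
  expR (- y ^+ 2 / ell ^+ 2) <= expR 1 * expR (- (2 * c / ell)).
Proof.
move=> l0 cy; rewrite -expRD ler_expR.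
have -> : - y ^+ 2 / ell ^+ 2 = - (y / ell) ^+ 2 by rewrite expr_div_n mulNr.
have : 2 * c / ell <= 2 * (y / ell).
  by rewrite -mulrA ler_wpM2l // ler_wpM2r // invr_ge0 ltW.
have := sqr_ge0 (y / ell - 1); rewrite sqrrB1; lra.
Qed.

(** The point x0 lies in the lattice cell of k0, inside the block, and the good cuts at both ends
    keep the outer particles away from it at a distance growing linearly, up to kap. *)
Lemma outside_sum (ell x0 : R) k0 k1 k2 : 0 < ell -> (k1 <= k0 < k2)%N -> (k2 <= N)%N ->
  (k1 == 0)%N || good_cut k1 -> (k2 == N) || good_cut k2 ->
  k0%:R * b <= x0 <= k0.+1%:R * b ->
  \sum_(j < k1) expR (- (X j - x0) ^+ 2 / ell ^+ 2) +
  \sum_(k2 <= i < N) expR (- (X i - x0) ^+ 2 / ell ^+ 2) <=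
  2 * (expR (1 + 2 * kap / ell) * (1 - expR (- (b / ell)))^-1).
Proof.
move=> l0 /andP[k10 k02] k2N g1 g2 /andP[x0l x0u].
set q := expR (- (b / ell)); set E := expR _.
have q01 : 0 <= q < 1 by rewrite expR_ge0 /= -expR0 ltr_expR oppr_lt0 divr_gt0.
have e (n : nat) : expR 1 * expR (- (2 * (b / 2 * n%:R - kap) / ell)) = E * q ^+ n.
  rewrite /E /q -expRM_natl -!expRD; congr expR; field; by rewrite gt_eqF.
have -> : 2 * (E * (1 - q)^-1) = E * (1 - q)^-1 + E * (1 - q)^-1 by ring.
apply: lerD.
  apply: (@le_trans _ _ (\sum_(j < k1) E * q ^+ (k1 - j))).
    apply: ler_sum => j _; have jk := ltn_ord j; rewrite -e -sqrrN opprB.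
    apply: exp_window => //; case/orP: g1 => [/eqP k10'|g1]; first by nlia.
    have jN : (j < N)%N by nlia.
    have /dev_le/andP[_] := good_cutP g1 jN.
    have -> : dst j k1 = (k1 - j)%N by rewrite /dst; nlia.
    rewrite natrB; last exact: ltnW.
    have : k1%:R <= k0%:R :> R by rewrite ler_nat.
    nra.
  rewrite -mulr_sumr ler_wpM2l ?expR_ge0 //; apply: le_trans (geo_sum_le k1 q01).
  rewrite (reindex_inj rev_ord_inj) /=; apply: ler_sum => j _.
  case/andP: q01 => q0 q1; rewrite ler_wiXn2l ?(ltW q1) //; have := ltn_ord j; nlia.
apply: (@le_trans _ _ (\sum_(k2 <= i < N) E * q ^+ (i - k2))).
  apply: ler_sum_nat => i /andP[ki iN]; rewrite -e.
  apply: exp_window => //; case/orP: g2 => [/eqP k20'|g2]; first by nlia.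
  have /dev_le/andP[h _] := good_cutP g2 iN; move: h.
  have -> : dst i k2 = (i - k2)%N by rewrite /dst; nlia.
  rewrite natrB //.
  have : k0.+1%:R <= k2%:R :> R by rewrite ler_nat.
  nra.
rewrite -mulr_sumr ler_wpM2l ?expR_ge0 //; apply: le_trans (geo_sum_le (N - k2) q01).
rewrite -{1}[k2]add0n big_addn big_mkord le_eqVlt; apply/orP; left; apply/eqP.
by apply: eq_bigr => i _; rewrite addnK.
Qed.

End Cuts.

Lemma vdm_perm p (K : comNzRingType) (w w' : seq K) : perm_eq w w' ->
  exists e, vdm p w = (-1) ^+ e * vdm p w'.
Proof.
elim: w w' => [|x w IH] w'.
  by rewrite perm_sym => /perm_nilP ->; exists 0%N; rewrite mul1r.
move=> pw; have : x \in w' by rewrite -(perm_mem pw) mem_head.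
move=> /splitPr xw; case: xw pw => w1 w2 pw.
have pw' : perm_eq w (w1 ++ w2).
  by rewrite -(perm_cons x); apply: perm_trans pw _; rewrite -cat1s perm_catCA.
have [e he] := IH _ pw'.
exists (e + p * size w1 * 1)%N; rewrite -cat1s.
rewrite -[w1 ++ _]cat0s (vdm_swap p [::] w1 [:: x] w2) /= he (perm_big _ pw') exprD /=.
set i := (p * size w1 * 1)%N.
have ii : (-1) ^+ i * (-1) ^+ i = 1 :> K by rewrite -exprD addnn -mul2n exprM sqrrN expr1n expr1n.
by rewrite -!mulrA; congr (_ * _); rewrite mulrA ii mul1r.
Qed.

Lemma sum_cst (R : pzRingType) n (c : R) : \sum_(j < n) c = n%:R * c.
Proof. by rewrite sumr_const card_ord mulr_natl. Qed.

(** * Approximate factorization of the squared modulus of Laughlin's function at cuts *)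

Section Phi.
Variables (R : realType) (Rad ell : R) (p : nat).
Hypothesis Rad_gt0 : 0 < Rad.
Hypothesis ell_gt0 : 0 < ell.
Hypothesis p_gt0 : (0 < p)%N.
Notation RtoC := (@real_complex R).
Notation a0 := (a0 Rad ell).
Notation sqA := (sqA Rad ell p).

(** Lattice spacing of the particles: one particle per p orbitals. *)
Definition pitch : R := p%:R * a0.
Notation b := pitch.

Lemma pitch_gt0 : 0 < b.
Proof. by rewrite /pitch mulr_gt0 ?ltr0n // divr_gt0 // exprn_gt0. Qed.

Definition nV (w : seq (R * R)) : R := Normc.normc (vdm p [seq cexp_cyl Rad z | z <- w]) ^+ 2.

Definition Phi (w : seq (R * R)) : R :=
  Normc.normc (Psi Rad ell p w) ^+ 2 / sqA (size w) ^+ 2.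

Lemma normcRe (x : R) : 0 <= x -> Normc.normc (RtoC x) = x.
Proof. by move=> x0; rewrite /Normc.normc /= expr0n /= addr0 sqrtr_sqr ger0_norm. Qed.

Lemma normc_ge0 (z : R[i]) : 0 <= Normc.normc z.
Proof. by case: z => x y; rewrite /Normc.normc sqrtr_ge0. Qed.

Lemma normc_1 : Normc.normc (1 : R[i]) = 1.
Proof. exact: Normc.normc1. Qed.

Lemma normcX (z : R[i]) n : Normc.normc (z ^+ n) = Normc.normc z ^+ n.
Proof.
elim: n => [|n IH]; first by rewrite !expr0 normc_1.
by rewrite !exprS Normc.normcM IH.
Qed.

Lemma normc_prod (T : Type) (r : seq T) (F : T -> R[i]) :
  Normc.normc (\prod_(i <- r) F i) = \prod_(i <- r) Normc.normc (F i).
Proof.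
elim: r => [|i r IH]; first by rewrite !big_nil normc_1.
by rewrite !big_cons Normc.normcM IH.
Qed.

Lemma normc_cis (t : R) : Normc.normc (cis t) = 1.
Proof. by rewrite /Normc.normc /cis cos2Dsin2 sqrtr1. Qed.

Lemma normc_cexp z : Normc.normc (cexp_cyl Rad z) = expR (z.1 / Rad).
Proof. by rewrite cexp_cylE Normc.normcM normc_cis mulr1 normcRe ?expR_ge0. Qed.

Definition ener (w : seq (R * R)) : R :=
  (\sum_(z <- w) z.1 ^+ 2 + \sum_(j < size w) (j%:R * b) ^+ 2) / ell ^+ 2.

Lemma PhiE w : Phi w = nV w * expR (- ener w).
Proof.
rewrite /Phi PsiE Normc.normcM normcRe ?expR_ge0 // exprMn -mulrA; congr (_ * _).
rewrite -!expRM_natl -expRB; congr expR; rewrite /ener.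
have -> : \sum_(j < size w) (p * j)%:R ^+ 2 = (\sum_(j < size w) (j%:R * b) ^+ 2) / a0 ^+ 2.
  rewrite mulr_suml; apply: eq_bigr => j _; rewrite /pitch natrM.
  by rewrite /a0; field; rewrite !gt_eqF.
by rewrite /g2 /a0; field; rewrite !gt_eqF.
Qed.

Lemma nV_ge0 w : 0 <= nV w. Proof. by rewrite sqr_ge0. Qed.

Lemma Phi_ge0 w : 0 <= Phi w.
Proof. by rewrite PhiE mulr_ge0 ?nV_ge0 ?expR_ge0. Qed.

Lemma Phi_perm w w' : perm_eq w w' -> Phi w = Phi w'.
Proof.
move=> pw; rewrite !PhiE /ener (perm_big _ pw) (perm_size pw); congr (_ * _).
rewrite /nV; have [e ->] := vdm_perm p (perm_map (cexp_cyl Rad) pw).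
by rewrite Normc.normcM normcX normcN normc_1 expr1n mul1r.
Qed.

Lemma nV_shift c w : nV (shiftx c w) = expR (- (c / Rad) * (2 * p * 'C(size w, 2))%:R) * nV w.
Proof.
rewrite /nV /shiftx -map_comp.
have -> : [seq (cexp_cyl Rad \o (fun z : R * R => (z.1 - c, z.2))) z | z <- w] =
   [seq RtoC (expR (- (c / Rad))) * x | x <- [seq cexp_cyl Rad z | z <- w]].
  rewrite -map_comp; apply: eq_map => z; rewrite /= !cexp_cylE mulrA -(rmorphM RtoC) -expRD /=.
  by congr (RtoC (expR _) * _); field; rewrite gt_eqF.
rewrite vdm_scale Normc.normcM normcX normcRe ?expR_ge0 // exprMn size_map; congr (_ * _).
by rewrite -exprM -expRM_natr; congr (expR (_ * _%:R)); rewrite mulnC mulnA.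
Qed.

Definition Er (s1 s2 : seq (R * R)) : R :=
  \sum_(u <- s1) \sum_(v <- s2) expR (- ((v.1 - u.1) / Rad)).

(** For each pair |e^v - e^u| <= e^v (1 + e^(u - v)), up to the scale Rad, and 1 + x <= e^x. *)
Lemma cross_le s1 s2 : Normc.normc (vcross p [seq cexp_cyl Rad z | z <- s1]
     [seq cexp_cyl Rad z | z <- s2]) ^+ 2 <=
  expR ((2 * p)%:R * ((size s1)%:R * (\sum_(v <- s2) v.1) / Rad + Er s1 s2)).
Proof.
have -> : (2 * p)%:R * ((size s1)%:R * (\sum_(v <- s2) v.1) / Rad + Er s1 s2) =
  \sum_(u <- s1) \sum_(v <- s2) (2 * p)%:R * (v.1 / Rad + expR (- ((v.1 - u.1) / Rad))).
  have -> : (size s1)%:R * (\sum_(v <- s2) v.1) / Rad =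
      \sum_(u <- s1) \sum_(v <- s2) (v.1 / Rad).
    rewrite -mulrA mulr_natl mulr_suml.
    elim: s1 => [|u s1 IH]; first by rewrite big_nil.
    by rewrite big_cons -IH mulrS.
  rewrite /Er -big_split mulr_sumr; apply: eq_bigr => u _ /=.
  by rewrite -big_split mulr_sumr; apply: eq_bigr => v _.
rewrite /vcross normc_prod expR_sum -prodrXl !big_map; apply: ler_prod => u _.
rewrite sqr_ge0 /= expR_sum normc_prod -prodrXl big_map; apply: ler_prod => v _.
rewrite sqr_ge0 /= normcX -exprM mulnC expRM_natl lerXn2r ?nnegrE ?normc_ge0 ?expR_ge0 //.
rewrite (le_trans (le_normcD _ _)) // normcN !normc_cexp expRD.
apply: (@le_trans _ _ (expR (v.1 / Rad) * (1 + expR (- ((v.1 - u.1) / Rad))))).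
  rewrite mulrDr mulr1 lerD2l -expRD le_eqVlt; apply/orP; left; apply/eqP; congr expR.
  by field; rewrite gt_eqF.
by rewrite ler_wpM2l ?expR_ge0 // expR_ge1Dx.
Qed.

Lemma sum_ord2 l : 2 * \sum_(j < l) (j%:R : R) = (2 * 'C(l, 2))%:R.
Proof.
elim: l => [|l IH]; first by rewrite big_ord0 mulr0.
by rewrite big_ord_recr /= mulrDr IH binS bin1 mulnDr natrD -natrM.
Qed.

Lemma sumsq_shift c (s : seq (R * R)) : \sum_(z <- s) (z.1 - c) ^+ 2 =
   \sum_(z <- s) z.1 ^+ 2 - 2 * c * (\sum_(v <- s) v.1) + (size s)%:R * c ^+ 2.
Proof.
elim: s => [|v s IH] /=; first by rewrite !big_nil; ring.
by rewrite !big_cons IH -natr1; ring.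
Qed.

(** The leading parts e^(v / Rad) of the cross factors translate the Gaussians of the second block
    by k b on completing the square, and the reference energies cancel. Only the corrections [Er]
    remain. *)
Lemma Phi_cat s1 s2 : Phi (s1 ++ s2) <=
  Phi s1 * Phi (shiftx ((size s1)%:R * b) s2) * expR ((2 * p)%:R * Er s1 s2).
Proof.
rewrite !PhiE nV_shift /nV map_cat vdm_cat !Normc.normcM !exprMn -/(nV s1) -/(nV s2).
set k := size s1; set l := size s2; set c := k%:R * b.
apply: (@le_trans _ _ (nV s1 * nV s2 * expR ((2 * p)%:R *
   (k%:R * (\sum_(v <- s2) v.1) / Rad + Er s1 s2)) * expR (- ener (s1 ++ s2)))).
  apply: ler_wpM2r; first exact: expR_ge0.
  by apply: ler_wpM2l; [rewrite mulr_ge0 ?nV_ge0 | exact: cross_le].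
set A := nV s1; set B := nV s2; rewrite -mulrA -expRD.
have -> (x y z t : R) : A * x * (y * B * z) * t = A * B * (x * y * z * t) by ring.
rewrite -!expRD; apply: ler_wpM2l; first by apply: mulr_ge0; exact: nV_ge0.
rewrite ler_expR le_eqVlt; apply/orP; left; apply/eqP.
rewrite /ener /shiftx size_cat size_map big_map -/k -/l !big_cat /= big_split_ord /=.
have -> : \sum_(z <- s2) (z.1 - c) ^+ 2 =
   \sum_(z <- s2) z.1 ^+ 2 - 2 * c * (\sum_(v <- s2) v.1) + l%:R * c ^+ 2.
  exact: sumsq_shift.
have -> : \sum_(i < l) ((k + i)%:R * b) ^+ 2 =
   l%:R * c ^+ 2 + c * b * (2 * 'C(l, 2))%:R + \sum_(j < l) (j%:R * b) ^+ 2.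
  rewrite -sum_ord2 -(sum_cst l (c ^+ 2)) !mulr_sumr -!big_split /=; apply: eq_bigr => i _.
  by rewrite natrD /c; ring.
rewrite !natrM; set S := \sum_(v <- s2) v.1; set T := ('C(l, 2))%:R.
set Q1 := \sum_(i < k) _; set Q2 := \sum_(i < l) _.
by rewrite /c /pitch /a0; field; rewrite !gt_eqF.
Qed.

Notation xx s := (fun j : nat => (nth (0, 0) s j).1).

Lemma nV_nil : nV [::] = 1.
Proof. by rewrite /nV (_ : vdm p _ = 1) // normc_1 expr1n. Qed.

Lemma nV_seq1 z : nV [:: z] = 1.
Proof. by rewrite /nV (_ : vdm p _ = 1) ?normc_1 ?expr1n //= big_nil mulr1. Qed.

Lemma Phi_nil : Phi [::] = 1.
Proof. by rewrite PhiE nV_nil /ener big_nil big_ord0 addr0 mul0r oppr0 expR0 mulr1. Qed.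

(** Particles are appended one at a time: after j particles the next one sees a Gaussian centred at
    its lattice site j b. *)
Lemma Phi_crude s : Phi s <= expR (- (\sum_(j < size s) dev b (xx s) j ^+ 2) / ell ^+ 2 +
  (2 * p)%:R * \sum_(i < size s) \sum_(j < i) expR (- ((xx s i - xx s j) / Rad))).
Proof.
elim/last_ind: s => [|s z IH].
  by rewrite Phi_nil !big_ord0 oppr0 mul0r mulr0 addr0 expR0.
rewrite -cats1; apply: (le_trans (Phi_cat _ _)).
set E := (t in expR t) in IH.
apply: (@le_trans _ _ (expR E * Phi (shiftx ((size s)%:R * b) [:: z]) *
    expR ((2 * p)%:R * Er s [:: z]))).
  by rewrite ler_wpM2r ?expR_ge0 // ler_wpM2r // Phi_ge0.
rewrite PhiE nV_seq1 /ener big_seq1 big_ord1 /= mul1r -!expRD.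
rewrite ler_expR le_eqVlt; apply/orP; left; apply/eqP.
rewrite size_cat addn1 !big_ord_recr /=.
have nt j : (j < size s)%N -> nth (0, 0) (s ++ [:: z]) j = nth (0, 0) s j.
  by move=> js; rewrite nth_cat js.
have -> : \sum_(i < size s) dev b (xx (s ++ [:: z])) i ^+ 2 = \sum_(i < size s) dev b (xx s) i ^+ 2.
  by apply: eq_bigr => i _; rewrite /dev nt.
have -> : \sum_(i < size s) \sum_(j < i) expR (- ((xx (s ++ [:: z]) i - xx (s ++ [:: z]) j) / Rad)) =
   \sum_(i < size s) \sum_(j < i) expR (- ((xx s i - xx s j) / Rad)).
  apply: eq_bigr => i _; apply: eq_bigr => j _; rewrite !nt //.
  exact: ltn_trans (ltn_ord i).
have lst : nth (0, 0) (s ++ [:: z]) (size s) = z by rewrite nth_cat ltnn subnn.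
have -> : \sum_(i < size s) expR (- ((xx (s ++ [:: z]) (size s) - xx (s ++ [:: z]) i) / Rad)) = Er s [:: z].
  rewrite lst /Er (big_nth (0, 0)) big_mkord; apply: eq_bigr => i _.
  by rewrite big_seq1 nt.
have -> : dev b (xx (s ++ [:: z])) (size s) ^+ 2 = (z.1 - (size s)%:R * b) ^+ 2.
  by rewrite /dev lst real_normK // num_real.
by rewrite /E mul0r; ring.
Qed.

(** Cost per particle, independent of [kap]. The squared term comes from absorbing the linear bound
    of [crowding] into a quarter of the Gaussian energy. Of the remaining three quarters, [Phi_mid]
    spends one on the bad cuts and keeps two for integrability. *)
Definition C1 : R := expR ((2 * p)%:R * (2 / (1 - qq Rad b)) + ((2 * p)%:R * (16 / b)) ^+ 2 * ell ^+ 2).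

Definition xsorted (s : seq (R * R)) :=
  forall i j, (j <= i < size s)%N -> xx s j <= xx s i.

Lemma Phi_crude_sorted s : xsorted s -> Phi s <=
  C1 ^+ size s * expR (- (3 / 4 * (\sum_(j < size s) dev b (xx s) j ^+ 2) / ell ^+ 2)).
Proof.
move=> ss; apply: (le_trans (Phi_crude s)).
rewrite /C1 -expRM_natl -expRD ler_expR.
have h := crowding Rad_gt0 pitch_gt0 ss.
set n := size s in h *; set c := (2 * p)%:R.
apply: (@le_trans _ _ (- (\sum_(j < n) dev b (xx s) j ^+ 2) / ell ^+ 2 +
   c * (n%:R * (2 / (1 - qq Rad b)) + 16 / b * \sum_(j < n) dev b (xx s) j))).
  by rewrite lerD2l ler_wpM2l // /c.
have am : c * (16 / b) * \sum_(j < n) dev b (xx s) j <=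
  n%:R * ((c * (16 / b)) ^+ 2 * ell ^+ 2) + (\sum_(j < n) dev b (xx s) j ^+ 2) / (4 * ell ^+ 2).
  rewrite -(sum_cst n (_ * ell ^+ 2)) mulr_sumr mulr_suml.
  rewrite -big_split /=; apply: ler_sum => j _.
  have -> : dev b (xx s) j ^+ 2 / (4 * ell ^+ 2) = (dev b (xx s) j / (2 * ell)) ^+ 2.
    by field; rewrite gt_eqF.
  have -> : c * (16 / b) * dev b (xx s) j = 2 * ((c * (16 / b) * ell) * (dev b (xx s) j / (2 * ell))).
    by field; rewrite !gt_eqF ?pitch_gt0.
  rewrite -exprMn; have := sqr_ge0 (c * (16 / b) * ell - dev b (xx s) j / (2 * ell)).
  by rewrite sqrrB -mulr_natl; lra.
set S := \sum_(j < n) dev b (xx s) j ^+ 2 in am *; set D := \sum_(j < n) dev b (xx s) j in am *.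
have e1 : S / (4 * ell ^+ 2) = S / ell ^+ 2 / 4 by field; rewrite gt_eqF.
set B := 16 / b in am *; set A := 2 / (1 - _); rewrite e1 in am.
have -> : 3 / 4 * S / ell ^+ 2 = S / ell ^+ 2 - S / ell ^+ 2 / 4 by field; rewrite gt_eqF.
rewrite mulNr !mulrDr; set U := S / ell ^+ 2 in am *.
have -> : c * (B * D) = c * B * D by ring.
have -> : n%:R * (c * A) = c * (n%:R * A) by ring.
by lra.
Qed.

Lemma Er_take s k : (k <= size s)%N -> Er (take k s) (drop k s) =
  \sum_(j < k | (j < size s)%N) \sum_(k <= i < size s) expR (- ((xx s i - xx s j) / Rad)).
Proof.
move=> ks; rewrite /Er (big_nth (0, 0)) size_takel // big_mkord.
rewrite [RHS](eq_bigl xpredT); last by move=> j; rewrite (leq_trans (ltn_ord j)).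
apply: eq_bigr => j _; rewrite (big_nth (0, 0)) size_drop nth_take // big_mkord.
rewrite -[in index_iota k _](add0n k) big_addn big_mkord.
by apply: eq_bigr => i _; rewrite nth_drop addnC.
Qed.

Variable kap : R.
Hypothesis kap_gt : b < kap.

Definition Kcut : R := expR ((2 * p)%:R * (expR (2 * kap / Rad) * (1 - qq Rad b)^-1 ^+ 2)).

Lemma Phi_cut s k : (k <= size s)%N -> (k == 0)%N || (k == size s) || good_cut b kap (xx s) (size s) k ->
  Phi s <= Kcut * (Phi (take k s) * Phi (shiftx (k%:R * b) (drop k s))).
Proof.
move=> ks gk; have K1 : 1 <= Kcut.
  have /andP[_ q1] := qq_bd Rad_gt0 pitch_gt0.
  rewrite -expR0 ler_expR; apply: mulr_ge0 => //; apply: mulr_ge0; first exact: expR_ge0.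
  by apply: exprn_ge0; rewrite invr_ge0 subr_ge0 ltW.
have P0 : 0 <= Phi (take k s) * Phi (shiftx (k%:R * b) (drop k s)) by rewrite mulr_ge0 ?Phi_ge0.
case/orP: gk => [/orP[]/eqP k0|gk].
- rewrite k0 take0 drop0 mul0r Phi_nil mul1r in P0 *.
  have e : shiftx 0 s = s by rewrite /shiftx -[RHS]map_id; apply: eq_map => -[x y]; rewrite /= subr0.
  by rewrite e in P0 *; rewrite ler_peMl.
- rewrite k0 take_size drop_size (_ : shiftx _ [::] = [::]) // Phi_nil mulr1 in P0 *.
  by rewrite ler_peMl ?Phi_ge0.
rewrite -{1}(cat_take_drop k s) (le_trans (Phi_cat _ _)) // size_takel // mulrC.
rewrite ler_wpM2r // ler_expR ler_wpM2l // Er_take //.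
by apply: good_cut_cross => //; exact: pitch_gt0.
Qed.

(** Summing over all sites of the block makes the bound symmetric in its particles, so that it can
    be integrated without regard to their order. *)
Definition theta (n : nat) (x : R) : R := \sum_(i < n) gau (2 * ell ^+ 2) (i%:R * b) x.

(** Energy per bad cut: the inverse of the constant in [block_energy] times the quarter of the
    Gaussian energy reserved for it. It grows linearly with [kap]. *)
Definition lam : R := b / 2 * (kap - b / 2) / (8 * ell ^+ 2).

Lemma xsorted_block s k1 k2 c : xsorted s -> (k1 <= k2 <= size s)%N ->
  xsorted (shiftx c (drop k1 (take k2 s))).
Proof.
move=> ss /andP[k12 k2s] i j; rewrite size_map size_drop size_takel // => /andP[ji ik].
have jk := leq_ltn_trans ji ik.
rewrite !(nth_map (0, 0)) /= ?size_drop ?size_takel // lerD2r !nth_drop !nth_take.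
- by apply: ss; rewrite leq_add2l ji /=; apply: leq_trans k2s; rewrite -ltn_subRL.
- by rewrite -ltn_subRL.
- by rewrite -ltn_subRL.
Qed.

Lemma Phi_mid s k1 k2 : xsorted s -> (k1 < k2)%N -> (k2 <= size s)%N ->
  (k1 == 0)%N || good_cut b kap (xx s) (size s) k1 -> (k2 == size s) || good_cut b kap (xx s) (size s) k2 ->
  (forall k, (k1 < k < k2)%N -> ~~ good_cut b kap (xx s) (size s) k) ->
  Phi (shiftx (k1%:R * b) (drop k1 (take k2 s))) <=
  C1 ^+ (k2 - k1) * expR (- (lam * (k2 - k1.+1)%:R)) *
  \prod_(z <- drop k1 (take k2 s)) theta (k2 - k1) (z.1 - k1%:R * b).
Proof.
move=> ss k12 k2s g1 g2 bad; have k12' := ltnW k12.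
set s2 := drop k1 (take k2 s); have sz : size s2 = (k2 - k1)%N by rewrite size_drop size_takel.
set n := (k2 - k1)%N in sz *.
have l2 : 0 < ell ^+ 2 by rewrite exprn_gt0.
apply: (le_trans (Phi_crude_sorted _)); first by apply: xsorted_block => //; rewrite k12'.
rewrite size_map sz -[X in _ <= X]mulrA; apply: ler_wpM2l; first by apply: exprn_ge0; exact: expR_ge0.
set w := shiftx _ _.
have nw j : (j < n)%N -> (nth (0, 0) w j).1 = xx s (k1 + j)%N - k1%:R * b.
  move=> jn; rewrite (nth_map (0, 0)) ?sz //= nth_drop nth_take //.
  by rewrite -ltn_subRL.
have dE j : (j < n)%N -> dev b (xx w) j = dev b (xx s) (k1 + j)%N.
  by move=> jn; rewrite /dev nw // natrD; congr (`| _ |); ring.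
set S := \sum_(j < n) dev b (xx w) j ^+ 2.
have SE : S = \sum_(k1 <= j < k2) dev b (xx s) j ^+ 2.
  rewrite -[in index_iota k1 _](add0n k1) big_addn big_mkord; apply: eq_bigr => j _.
  by rewrite dE // addnC.
have -> : - (3 / 4 * S / ell ^+ 2) = - (S / (4 * ell ^+ 2)) + \sum_(j < n) - (dev b (xx w) j ^+ 2 / (2 * ell ^+ 2)).
  by rewrite sumrN -mulr_suml -/S; field; rewrite gt_eqF.
rewrite expRD; apply: ler_pM; rewrite ?expR_ge0 //.
  have := block_energy pitch_gt0 kap_gt k2s g1 g2 bad; rewrite -SE.
  set c := b / 2 * (kap - b / 2); have c0 : 0 < c.
    rewrite mulr_gt0 ?divr_gt0 ?pitch_gt0 // subr_gt0 (lt_trans _ kap_gt) //.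
    by rewrite gtr_pMr ?pitch_gt0 // invf_lt1 // ltr1n.
  move=> h; rewrite ler_expR lerN2 /lam -/c.
  have -> : S / (4 * ell ^+ 2) = c / (8 * ell ^+ 2) * (2 / c * S).
    by field; rewrite !gt_eqF.
  by rewrite ler_wpM2l // divr_ge0 ?(ltW c0) // mulr_ge0 // ltW.
rewrite expR_sum [X in _ <= X](big_nth (0, 0)) sz big_mkord; apply: ler_prod => j _.
rewrite expR_ge0 /= /theta (bigD1 j) //= -[X in X <= _]addr0 lerD ?sumr_ge0 //; last first.
  by move=> i _; exact: gau_ge0.
rewrite /gau le_eqVlt; apply/orP; left; apply/eqP; congr expR.
rewrite -mulNr; congr (- _ / _); rewrite /dev real_normK ?num_real // nw //.
by rewrite nth_drop nth_take // -ltn_subRL.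
Qed.

Definition Ktest : R := expR (2 * (expR (1 + 2 * kap / ell) * (1 - expR (- (b / ell)))^-1)).

(** Inside the block each test factor is at most 2; outside, the Gaussians have a bounded sum by
    [outside_sum]. *)
Lemma test_le (s : seq (R * R)) x0 k0 k1 k2 : (k1 <= k0 < k2)%N -> (k2 <= size s)%N ->
  (k1 == 0)%N || good_cut b kap (xx s) (size s) k1 -> (k2 == size s) || good_cut b kap (xx s) (size s) k2 ->
  k0%:R * b <= x0 <= k0.+1%:R * b ->
  \prod_(z <- s) (1 + gau (ell ^+ 2) x0 z.1) <= 2 ^+ (k2 - k1) * Ktest.
Proof.
move=> kk k2s g1 g2 hx; have /andP[k10 k02] := kk.
have k12 : (k1 <= k2)%N by exact: ltnW (leq_ltn_trans k10 k02).
have g0 x : 0 <= gau (ell ^+ 2) x0 x by exact: gau_ge0.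
rewrite (big_nth (0, 0)) (big_cat_nat (n := k1)) //=; last exact: leq_trans k2s.
rewrite (big_cat_nat (m := k1) (n := k2)) //= mulrCA.
have [t1 t2] : \prod_(0 <= i < k1) (1 + gau (ell ^+ 2) x0 (xx s i)) <=
    expR (\sum_(j < k1) expR (- (xx s j - x0) ^+ 2 / ell ^+ 2)) /\
   \prod_(k2 <= i < size s) (1 + gau (ell ^+ 2) x0 (xx s i)) <=
    expR (\sum_(k2 <= i < size s) expR (- (xx s i - x0) ^+ 2 / ell ^+ 2)).
  split; rewrite expR_sum ?big_mkord; apply: ler_prod => i _;
  by rewrite addr_ge0 //= expR_ge1Dx.
apply: ler_pM.
- by apply: prodr_ge0 => i _; rewrite addr_ge0.
- by apply: mulr_ge0; apply: prodr_ge0 => i _; rewrite addr_ge0.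
- rewrite -prodr_const_nat; apply: ler_prod => i _; rewrite addr_ge0 //=.
  have : gau (ell ^+ 2) x0 (nth (0, 0) s i).1 <= 1 by apply: gau_le1; rewrite exprn_gt0.
  by lra.
apply: (@le_trans _ _ (expR (\sum_(j < k1) expR (- (xx s j - x0) ^+ 2 / ell ^+ 2)) *
   expR (\sum_(k2 <= i < size s) expR (- (xx s i - x0) ^+ 2 / ell ^+ 2)))).
  by apply: ler_pM => //; apply: prodr_ge0 => i _; rewrite addr_ge0.
rewrite -expRD ler_expR; apply: outside_sum kk k2s g1 g2 hx => //; exact: pitch_gt0.
Qed.

(** A block of n particles contains n - 1 interior cuts, all bad. *)
Definition Kn (n : nat) : R := Kcut ^+ 2 * Ktest * (2 * C1) ^+ n * expR (- (lam * n.-1%:R)).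

Definition Fcut (k1 k2 : nat) (u v w : seq (R * R)) : R :=
  Phi u * (\prod_(z <- v) theta (k2 - k1) (z.1 - k1%:R * b)) * Phi (shiftx (k2%:R * b) w).

Lemma Fcut_ge0 k1 k2 u v w : 0 <= Fcut k1 k2 u v w.
Proof.
apply: mulr_ge0; last exact: Phi_ge0.
apply: mulr_ge0; first exact: Phi_ge0.
by apply: prodr_ge0 => z _; apply: sumr_ge0 => i _; exact: gau_ge0.
Qed.

(** The configuration is cut at the good cuts nearest to k0 on both sides. The outer parts keep
    their exact weight [Phi], which integrates back to C_k1 and C_(N - k2); only the middle block is
    estimated pointwise. *)
Lemma sorted_bound s x0 k0 : xsorted s -> (k0 < size s)%N ->
  k0%:R * b <= x0 <= k0.+1%:R * b ->
  exists k1 k2, [/\ (k1 <= k0 < k2)%N, (k2 <= size s)%N &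
  Phi s * \prod_(z <- s) (1 + gau (ell ^+ 2) x0 z.1) <=
  Kn (k2 - k1) * Fcut k1 k2 (take k1 s) (drop k1 (take k2 s)) (drop k2 s)].
Proof.
move=> ss k0s hx.
have [k1 [k2 [kk k2s g1 g2 bad]]] := bracket b kap (xx s) k0s.
exists k1, k2; split=> //; have /andP[k10 k02] := kk; have k12 := leq_ltn_trans k10 k02.
have h1 := test_le kk k2s g1 g2 hx.
have h2 : Phi s <= Kcut * (Phi (take k2 s) * Phi (shiftx (k2%:R * b) (drop k2 s))).
  by apply: Phi_cut => //; rewrite -orbA g2 orbT.
have k1s : (k1 <= size s)%N := leq_trans (ltnW k12) k2s.
have h3 : Phi (take k2 s) <= Kcut * (Phi (take k1 s) * Phi (shiftx (k1%:R * b) (drop k1 (take k2 s)))).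
  have -> : take k1 s = take k1 (take k2 s) by rewrite take_takel // ltnW.
  apply: Phi_cut; rewrite size_takel //; first exact: ltnW.
  case/orP: g1 => [->//|g1]; apply/orP; right.
  apply/forallP => j; have := good_cutP g1 (leq_trans (ltn_ord j) k2s).
  by rewrite /dev nth_take.
have h4 := Phi_mid ss k12 k2s g1 g2 bad.
have K0 : 0 <= Kcut by exact: expR_ge0.
apply: (@le_trans _ _ ((Kcut * ((Kcut * (Phi (take k1 s) * (C1 ^+ (k2 - k1) * expR (- (lam * (k2 - k1.+1)%:R)) *
  \prod_(z <- drop k1 (take k2 s)) theta (k2 - k1) (z.1 - k1%:R * b)))) *
   Phi (shiftx (k2%:R * b) (drop k2 s)))) * (2 ^+ (k2 - k1) * Ktest))).
  apply: ler_pM => //; first exact: Phi_ge0.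
    apply: prodr_ge0 => z _; rewrite addr_ge0 //; exact: gau_ge0.
  apply: (le_trans h2); rewrite ler_wpM2l // ler_wpM2r ?Phi_ge0 //.
  by apply: (le_trans h3); rewrite ler_wpM2l // ler_wpM2l ?Phi_ge0.
rewrite /Kn /Fcut exprMn (_ : (k2 - k1).-1 = (k2 - k1.+1)%N); last by rewrite subnS.
by rewrite le_eqVlt; apply/orP; left; apply/eqP; ring.
Qed.

End Phi.

(** * Distributing unordered particles over the two sides of a cut *)

Fixpoint masks (N k : nat) : seq bitseq :=
  match N, k with
  | 0%N, 0%N => [:: [::]]
  | 0%N, _.+1 => [::]
  | N'.+1, 0%N => [seq false :: c | c <- masks N' 0]
  | N'.+1, k'.+1 => [seq false :: c | c <- masks N' k] ++ [seq true :: c | c <- masks N' k']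
  end.

Lemma size_masks N k : size (masks N k) = 'C(N, k).
Proof.
elim: N k => [|N IH] [|k] //=; first by rewrite size_map IH !bin0.
by rewrite size_cat !size_map !IH binS.
Qed.

Lemma mem_masks N k c : (c \in masks N k) = (size c == N) && (count id c == k).
Proof.
have inj (x : bool) : injective (cons x) by move=> u v [].
have nin (x y : bool) u (r : seq bitseq) : x != y -> (x :: u \in [seq y :: c | c <- r]) = false.
  by move=> xy; apply/negbTE/mapP => -[d _ [e]]; rewrite e eqxx in xy.
elim: N k c => [|N IH] [|k] [|x c] //=.
- by apply/mapP => -[].
- by rewrite eqSS; case: x; [rewrite nin // andbF | rewrite (mem_map (inj false)) IH].
- by rewrite mem_cat; apply/negbTE; rewrite negb_or; apply/andP; split; apply/mapP => -[].
- rewrite mem_cat eqSS; case: x.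
    by rewrite nin // (mem_map (inj true)) IH add1n eqSS.
  by rewrite (nin false true) // orbF (mem_map (inj false)) IH.
Qed.

Lemma perm_mask (T : eqType) (w s1 s2 : seq T) : perm_eq w (s1 ++ s2) ->
  exists2 c, c \in masks (size w) (size s1) &
   perm_eq (mask c w) s1 /\ perm_eq (mask (map negb c) w) s2.
Proof.
elim: w s1 s2 => [|z w IH] s1 s2.
  rewrite perm_sym => /perm_nilP; by case: s1 => //= ->; exists [::].
move=> pw; have : z \in s1 ++ s2 by rewrite -(perm_mem pw) mem_head.
rewrite mem_cat => /orP[] zs.
  have ps := perm_to_rem zs.
  have pw' : perm_eq w (rem z s1 ++ s2).
    rewrite -(perm_cons z); apply: perm_trans pw _; rewrite -cat_cons.
    by apply: perm_cat.
  have [c cm [p1 p2]] := IH _ _ pw'.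
  exists (true :: c); last by split=> //=; rewrite perm_sym (perm_trans ps) // perm_cons perm_sym.
  by move: cm; rewrite !mem_masks /= eqSS (perm_size ps) /= add1n eqSS.
have ps := perm_to_rem zs.
have pw' : perm_eq w (s1 ++ rem z s2).
  rewrite -(perm_cons z); apply: perm_trans pw _; rewrite perm_sym -cat1s perm_catCA.
  by rewrite perm_cat2l perm_sym.
have [c cm [p1 p2]] := IH _ _ pw'.
exists (false :: c); last by split=> //=; rewrite perm_sym (perm_trans ps) // perm_cons perm_sym.
by move: cm; rewrite !mem_masks /= eqSS add0n.
Qed.

Lemma ler_term (R : numDomainType) (T : eqType) (r : seq T) (F : T -> R) x :
  (forall y, 0 <= F y) -> x \in r -> F x <= \sum_(y <- r) F y.
Proof.
move=> F0; elim: r => // y r IH; rewrite inE big_cons => /orP[/eqP ->|/IH h].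
  by rewrite lerDl sumr_ge0.
by rewrite (le_trans h) // lerDr.
Qed.

(** Integrating n factors [theta] yields n^n, whereas the block has only n! at its disposal; the
    ratio is a constant per particle. *)
Lemma expn_fact_le (R : realType) n : n%:R ^+ n <= expR 1 ^+ n * n`!%:R :> R.
Proof.
elim: n => [|n IH]; first by rewrite !expr0 mul1r.
case: n IH => [|n] IH.
  by rewrite !expr1 mulr1 (le_trans _ (expR_ge1Dx 1)) // lerDl.
have h : n.+2%:R ^+ n.+1 <= expR 1 * n.+1%:R ^+ n.+1 :> R.
  have e : n.+2%:R = n.+1%:R * (1 + n.+1%:R^-1) :> R.
    by rewrite mulrDr mulr1 divff ?pnatr_eq0 // natr1.
  rewrite e exprMn mulrC ler_wpM2r ?exprn_ge0 //.
  apply: (@le_trans _ _ (expR n.+1%:R^-1 ^+ n.+1)).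
    by rewrite lerXn2r ?nnegrE ?addr_ge0 ?invr_ge0 ?ler0n ?expR_ge0 ?expR_ge1Dx.
  by rewrite -expRM_natl divff ?pnatr_eq0.
have -> : n.+2%:R ^+ n.+2 = n.+2%:R * n.+2%:R ^+ n.+1 :> R by rewrite -exprS.
have -> : expR 1 ^+ n.+2 * n.+2`!%:R = n.+2%:R * (expR 1 * (expR 1 ^+ n.+1 * n.+1`!%:R)) :> R.
  by rewrite factS natrM mulrCA; congr (_ * _); rewrite mulrA -exprS.
by rewrite ler_wpM2l // (le_trans h) // ler_wpM2l ?expR_ge0.
Qed.

(** * The convolution bound *)

Section Conv.
Variables (R : realType) (Rad ell : R) (p : nat).
Hypothesis Rad_gt0 : 0 < Rad.
Hypothesis ell_gt0 : 0 < ell.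
Hypothesis p_gt0 : (0 < p)%N.
Notation mu := (@lebesgue_measure R).
Notation a0 := (a0 Rad ell).
Notation b := (pitch Rad ell p).
Notation Phi := (Phi Rad ell p).
Notation sqA := (sqA Rad ell p).
Notation g2 := (g2 Rad ell).
Notation bb := (bb p g2).
Notation Cn := (Cn p g2).
Notation isI := (isI Rad -oo%E +oo%E).

(** Squared norm of each orbital over the full cylinder. *)
Definition kappa : R := 2 * pi * Rad * Num.sqrt (ell ^+ 2 * pi).
Definition Jtheta : R := 2 * pi * Rad * Num.sqrt (2 * ell ^+ 2 * pi).

Let l2 : 0 < ell ^+ 2. Proof. by rewrite exprn_gt0. Qed.

Lemma kappa_gt0 : 0 < kappa.
Proof. by rewrite !mulr_gt0 ?pi_gt0 // sqrtr_gt0 mulr_gt0 ?pi_gt0. Qed.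

Lemma Jtheta_gt0 : 0 < Jtheta.
Proof. by rewrite !mulr_gt0 ?pi_gt0 // sqrtr_gt0 !mulr_gt0 ?pi_gt0. Qed.

Lemma xdomT : xdom -oo%E +oo%E = [set: R]%classic.
Proof. by apply/seteqP; split => x //= _; split; rewrite ?leNye ?leey. Qed.

(** Expectation of the test Gaussian at x0 in the normalized k-th orbital: the test factor
    multiplies the mass of that orbital by 1 + [qt]. *)
Definition qt (x0 : R) (k : nat) : R :=
  2 * pi * Rad * (\int[mu]_(x in [set: R]%classic) (gau (ell ^+ 2) (k%:R * a0) x * gau (ell ^+ 2) x0 x)) / kappa.

Lemma qt_ge0 x0 k : 0 <= qt x0 k.
Proof.
rewrite /qt divr_ge0 ?(ltW kappa_gt0) // mulr_ge0 //; first by rewrite !mulr_ge0 ?pi_ge0 // ltW.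
by apply: Rintegral_ge0 => x _; rewrite mulr_ge0 ?gau_ge0.
Qed.

Lemma gau_mul_int c x0 : gprop (fun x => gau (ell ^+ 2) c x * gau (ell ^+ 2) x0 x).
Proof.
apply: (@integrable_dom _ _ 1 (ell ^+ 2) c) => //.
  by apply: measurable_funM; exact: measurable_gau.
move=> x; rewrite mul1r ger0_norm ?mulr_ge0 ?gau_ge0 //.
by rewrite ler_piMr ?gau_ge0 // gau_le1.
Qed.

Lemma qt_diag m : qt (m%:R * a0) m = (Num.sqrt 2)^-1.
Proof.
rewrite /qt (_ : (fun x => _) = gau (ell ^+ 2 / 2) (m%:R * a0)); last first.
  apply/funext => x; rewrite /gau -expRD; congr expR; field.
  by rewrite gt_eqF.
have [_ ->] := integral_gau (m%:R * a0) (divr_gt0 l2 (ltr0n R 2)).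
have -> : ell ^+ 2 / 2 * pi = ell ^+ 2 * pi * 2^-1 by ring.
rewrite (sqrtrM 2^-1); last by rewrite mulr_ge0 ?pi_ge0 ?(ltW l2).
rewrite sqrtrV //.
have := kappa_gt0; rewrite /kappa; set P := 2 * pi * Rad; set S := Num.sqrt (ell ^+ 2 * pi) => PS.
by rewrite mulrA mulrAC divff ?mul1r // gt_eqF.
Qed.

Lemma isI_Phi N s (t : R -> R) M : measurable_fun [set: R]%classic t -> (forall x, 0 <= t x <= M) ->
  isI N (fun w => Phi (shiftx s w) * \prod_(z <- w) t z.1)
  (nsum (p * N) N (fun r => bb r ^+ 2 * tw (TT Rad ell s t -oo%E +oo%E) r)).
Proof.
move=> mt tM; have h := isI_Psi Rad_gt0 ell_gt0 p_gt0 s mt tM -oo%E +oo%E N.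
have A0 : sqA N ^+ 2 != 0 by rewrite expf_neq0 // gt_eqF // expR_gt0.
have := isIZ (sqA N ^+ 2)^-1 h; rewrite mulrA mulVf // mul1r; apply: isI_eq => w sw.
by rewrite /Phi size_map sw mulrA; congr (_ * _); exact: mulrC.
Qed.

Lemma isI_Phi1 N s : isI N (fun w => Phi (shiftx s w)) (kappa ^+ N * (N`!%:R * Cn N)).
Proof.
have m1 : measurable_fun [set: R]%classic (fun=> 1 : R) by exact: measurable_cst.
have h1 : forall x : R, (0 : R) <= 1 <= (1 : R) by move=> _; rewrite ler01 lexx.
have := isI_Phi N s m1 h1.
have -> : nsum (p * N) N (fun r => bb r ^+ 2 * tw (TT Rad ell s (fun=> 1) -oo%E +oo%E) r) =
   kappa ^+ N * (N`!%:R * Cn N).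
  rewrite /Cn /CT [N`!%:R * _]mulrC divfK ?pnatr_eq0 -?lt0n ?fact_gt0 // -nsumZ.
  apply: eq_nsum => r sr _; rewrite tw1 mulr1 mulrC; congr (_ * _).
  rewrite /tw -sr -prodr_const_seq; apply: eq_bigr => k _.
  rewrite /TT xdomT; under eq_Rintegral do rewrite mulr1.
  by have [_ ->] := integral_gau (k%:R * a0 + s) l2.
by apply: isI_eq => w _; rewrite big1 ?mulr1.
Qed.

Lemma isI_theta n N s : isI N (fun w => \prod_(z <- w) theta Rad ell p n (z.1 - s)) ((n%:R * Jtheta) ^+ N).
Proof.
pose f (i : 'I_n) x := gau (2 * ell ^+ 2) (i%:R * b + s) x.
have v0 : 0 < 2 * ell ^+ 2 by rewrite mulr_gt0.
have e : (fun x => theta Rad ell p n (x - s)) = (fun x => \sum_(i < n) 1 * f i x).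
  by apply/funext => x; apply: eq_bigr => i _; rewrite mul1r gau_shift.
have fi i : mu.-integrable [set: R]%classic (EFin \o f i) := (integral_gau _ v0).1.
have [g1 gE] := Rintegral_lincomb (index_enum 'I_n) (fun=> 1) measurableT fi.
have h : gprop (fun x => theta Rad ell p n (x - s)) by rewrite e.
have := isI_prod Rad -oo%E +oo%E N h; rewrite xdomT e gE.
under eq_bigr => i _ do rewrite mul1r (integral_gau _ v0).2.
rewrite sumr_const card_ord -[_ *+ n]mulr_natl /Jtheta.
by rewrite -(mulrA n%:R) [_ * (2 * pi * Rad)]mulrC.
Qed.

Variable kap : R.
Hypothesis kap_gt : b < kap.
Notation Kn := (Kn Rad ell p kap).
Notation Fcut := (Fcut Rad ell p).

Definition xleq (z z' : R * R) := z.1 <= z'.1.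

Lemma xsorted_sort w : xsorted (sort xleq w).
Proof.
move=> i j /andP[ji iN].
have tot : total xleq by move=> x y; exact: le_total.
have tr : transitive xleq by move=> x y z; exact: le_trans.
have rf : reflexive xleq by move=> x; exact: lexx.
have := sorted_leq_nth tr rf (0, 0) (sort_sorted tot w).
by move=> /(_ j i); rewrite !inE (leq_ltn_trans ji iN) iN => /(_ isT isT ji).
Qed.

Lemma Kn_ge0 n : 0 <= Kn n.
Proof.
apply: mulr_ge0; last exact: expR_ge0.
apply: mulr_ge0; last by apply: exprn_ge0; apply: mulr_ge0 => //; exact: expR_ge0.
apply: mulr_ge0; last exact: expR_ge0.
exact: sqr_ge0.
Qed.

(** Integrals run over unsorted configurations. The split found after sorting is one of the ways of
    choosing which particles form the three blocks; the sum over all choices is an upper bound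
    because its terms are nonnegative, and each term can be integrated. *)
Lemma Phi_pointwise_le w x0 k0 : (k0 < size w)%N -> k0%:R * b <= x0 <= k0.+1%:R * b ->
  Phi w * \prod_(z <- w) (1 + gau (ell ^+ 2) x0 z.1) <=
  \sum_(k1 <- index_iota 0 k0.+1) \sum_(k2 <- index_iota k0.+1 (size w).+1)
   \sum_(c <- masks (size w) k2) \sum_(d <- masks k2 k1)
    Kn (k2 - k1) * Fcut k1 k2 (mask d (mask c w)) (mask (map negb d) (mask c w)) (mask (map negb c) w).
Proof.
move=> k0w hx; set s := sort xleq w.
have pw : perm_eq w s by rewrite perm_sym perm_sort.
rewrite (Phi_perm p Rad_gt0 ell_gt0 pw) (perm_big _ pw) /=.
have k0s : (k0 < size s)%N by rewrite size_sort.
have [k1 [k2 [/andP[k10 k02] k2s h]]] :=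
  sorted_bound Rad_gt0 ell_gt0 p_gt0 kap_gt (@xsorted_sort w) k0s hx.
rewrite -/s in h k2s; apply: (le_trans h).
have k12 : (k1 <= k2)%N := ltnW (leq_ltn_trans k10 k02).
rewrite size_sort in k2s.
have pw2 : perm_eq w (take k2 s ++ drop k2 s) by rewrite cat_take_drop.
have [c cm [p1 p2]] := perm_mask pw2.
have pw3 : perm_eq (mask c w) (take k1 s ++ drop k1 (take k2 s)).
  by rewrite -(@take_takel _ k1 k2) // cat_take_drop.
have [d dm [q1 q2]] := perm_mask pw3.
rewrite size_takel ?size_sort // in cm.
rewrite size_takel ?size_sort ?(leq_trans k12) // (perm_size p1) size_takel ?size_sort // in dm.
have -> : Fcut k1 k2 (take k1 s) (drop k1 (take k2 s)) (drop k2 s) =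
  Fcut k1 k2 (mask d (mask c w)) (mask (map negb d) (mask c w)) (mask (map negb c) w).
  rewrite /Fcut -(Phi_perm p Rad_gt0 ell_gt0 q1) (perm_big _ q2) /=; congr (_ * _).
  by apply/esym; apply: Phi_perm => //; apply: perm_map.
have F0 k1' k2' (u v t : seq (R * R)) : 0 <= Kn (k2' - k1') * Fcut k1' k2' u v t.
  by rewrite mulr_ge0 ?Kn_ge0 ?Fcut_ge0.
apply: (@le_trans _ _ (\sum_(k2 <- index_iota k0.+1 (size w).+1)
   \sum_(c <- masks (size w) k2) \sum_(d <- masks k2 k1)
    Kn (k2 - k1) * Fcut k1 k2 (mask d (mask c w)) (mask (map negb d) (mask c w)) (mask (map negb c) w))).
  apply: (@le_trans _ _ (\sum_(c <- masks (size w) k2) \sum_(d <- masks k2 k1)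
    Kn (k2 - k1) * Fcut k1 k2 (mask d (mask c w)) (mask (map negb d) (mask c w)) (mask (map negb c) w))).
    apply: (@le_trans _ _ (\sum_(d <- masks k2 k1) Kn (k2 - k1) *
       Fcut k1 k2 (mask d (mask c w)) (mask (map negb d) (mask c w)) (mask (map negb c) w))).
      by apply: (ler_term (F := fun d => Kn (k2 - k1) * Fcut k1 k2 (mask d (mask c w))
       (mask (map negb d) (mask c w)) (mask (map negb c) w))).
    apply: (ler_term (F := fun c => \sum_(d <- masks k2 k1) Kn (k2 - k1) *
       Fcut k1 k2 (mask d (mask c w)) (mask (map negb d) (mask c w)) (mask (map negb c) w))) => //.
    by move=> y; apply: sumr_ge0.
  apply: (ler_term (F := fun k2 => \sum_(c <- masks (size w) k2) \sum_(d <- masks k2 k1)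
    Kn (k2 - k1) * Fcut k1 k2 (mask d (mask c w)) (mask (map negb d) (mask c w)) (mask (map negb c) w))).
    by move=> y; apply: sumr_ge0 => i _; apply: sumr_ge0.
  by rewrite mem_index_iota k02 ltnS.
apply: (ler_term (F := fun k1 => \sum_(k2 <- index_iota k0.+1 (size w).+1)
   \sum_(c <- masks (size w) k2) \sum_(d <- masks k2 k1)
    Kn (k2 - k1) * Fcut k1 k2 (mask d (mask c w)) (mask (map negb d) (mask c w)) (mask (map negb c) w))).
  by move=> y; apply: sumr_ge0 => i _; apply: sumr_ge0 => j _; apply: sumr_ge0.
by rewrite mem_index_iota.
Qed.

Lemma isI_Fcut N k1 k2 c d : c \in masks N k2 -> d \in masks k2 k1 ->
  isI N (fun w => Fcut k1 k2 (mask d (mask c w)) (mask (map negb d) (mask c w)) (mask (map negb c) w))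
  ((kappa ^+ k1 * (k1`!%:R * Cn k1)) * ((k2 - k1)%:R * Jtheta) ^+ (k2 - k1) *
   (kappa ^+ (N - k2) * ((N - k2)`!%:R * Cn (N - k2)))).
Proof.
rewrite !mem_masks => /andP[/eqP sc /eqP cc] /andP[/eqP sd /eqP cd].
have nc : count negb c = (N - k2)%N.
  by rewrite -sc -cc -(count_predC id c) addKn; apply: eq_count.
have nd : count negb d = (k2 - k1)%N.
  by rewrite -sd -cd -(count_predC id d) addKn; apply: eq_count.
have e0 (w : seq (R * R)) : shiftx 0 w = w.
  by rewrite /shiftx -[RHS]map_id; apply: eq_map => -[x y]; rewrite /= subr0.
have h1 := isI_Phi1 k1 0.
have h2 : isI (count negb d) (fun w => \prod_(z <- w) theta Rad ell p (k2 - k1) (z.1 - k1%:R * b))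
   (((k2 - k1)%:R * Jtheta) ^+ (k2 - k1)) by rewrite nd; exact: isI_theta.
have h3 := isI_Phi1 (N - k2) (k2%:R * b).
rewrite -{1}cd in h1; rewrite -{1}nc in h3.
have h12 := isI_mask h1 h2; rewrite {1}sd -{1}cc in h12.
have := isI_mask h12 h3; rewrite {1}sc; apply: isI_eq => w _.
by rewrite e0.
Qed.

Lemma int_bound N x0 k0 : (k0 < N)%N -> k0%:R * b <= x0 <= k0.+1%:R * b ->
  kappa ^+ N * nsum (p * N) N (fun r => bb r ^+ 2 * tw (fun k => 1 + qt x0 k) r) <=
  \sum_(k1 <- index_iota 0 k0.+1) \sum_(k2 <- index_iota k0.+1 N.+1)
   ('C(N, k2) * 'C(k2, k1))%:R * (Kn (k2 - k1) *
   ((kappa ^+ k1 * (k1`!%:R * Cn k1)) * ((k2 - k1)%:R * Jtheta) ^+ (k2 - k1) *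
   (kappa ^+ (N - k2) * ((N - k2)`!%:R * Cn (N - k2))))).
Proof.
move=> k0N hx.
pose t x := 1 + gau (ell ^+ 2) x0 x.
have mt : measurable_fun [set: R]%classic t.
  by apply: measurable_funD; [exact: measurable_cst|exact: measurable_gau].
have tM x : 0 <= t x <= 2.
  have := gau_le1 x0 x l2; have := gau_ge0 (ell ^+ 2) x0 x; rewrite /t; lra.
have h := isI_Phi N 0 mt tM.
have TE k : TT Rad ell 0 t -oo%E +oo%E k = kappa * (1 + qt x0 k).
  rewrite /TT xdomT /qt [RHS]mulrDr mulr1 [kappa * _]mulrC divfK ?gt_eqF ?kappa_gt0 //.
  rewrite /kappa -mulrDr; congr (_ * _).
  have [_ e1] := integral_gau (k%:R * a0) l2; rewrite -e1.
  under eq_Rintegral do rewrite addr0 /t mulrDr mulr1.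
  rewrite RintegralD //; first exact: (integral_gau _ l2).1.
  exact: gau_mul_int.
have e2 : nsum (p * N) N (fun r => bb r ^+ 2 * tw (TT Rad ell 0 t -oo%E +oo%E) r) =
  kappa ^+ N * nsum (p * N) N (fun r => bb r ^+ 2 * tw (fun k => 1 + qt x0 k) r).
  rewrite -nsumZ; apply: eq_nsum => r sr _; rewrite [RHS]mulrCA; congr (_ * _).
  rewrite /tw -sr -prodr_const_seq -big_split; apply: eq_bigr => k _; exact: TE.
rewrite e2 in h.
pose V k1 k2 := Kn (k2 - k1) *
   ((kappa ^+ k1 * (k1`!%:R * Cn k1)) * ((k2 - k1)%:R * Jtheta) ^+ (k2 - k1) *
   (kappa ^+ (N - k2) * ((N - k2)`!%:R * Cn (N - k2)))).
pose F k1 k2 c d w := Kn (k2 - k1) * Fcut k1 k2 (mask d (mask c w))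
   (mask (map negb d) (mask c w)) (mask (map negb c) w).
have h' : isI N (fun w => \sum_(k1 <- index_iota 0 k0.+1) \sum_(k2 <- index_iota k0.+1 N.+1)
   \sum_(c <- masks N k2 | c \in masks N k2) \sum_(d <- masks k2 k1 | d \in masks k2 k1) F k1 k2 c d w)
  (\sum_(k1 <- index_iota 0 k0.+1) \sum_(k2 <- index_iota k0.+1 N.+1)
   \sum_(c <- masks N k2 | c \in masks N k2) \sum_(d <- masks k2 k1 | d \in masks k2 k1) V k1 k2).
  apply: isI_sum => k1 _; apply: isI_sum => k2 _; apply: isI_sum => c cm; apply: isI_sum => d dm.
  by apply: isIZ; exact: isI_Fcut.
apply: le_trans (isI_le Rad_gt0 h h' _) _.
  move=> w sw; have := @Phi_pointwise_le w x0 k0; rewrite sw => /(_ k0N hx).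
  have -> : shiftx 0 w = w.
    by rewrite /shiftx -[RHS]map_id; apply: eq_map => -[x y]; rewrite /= subr0.
  move=> /le_trans; apply; rewrite le_eqVlt; apply/orP; left; apply/eqP.
  apply: eq_bigr => k1 _; apply: eq_bigr => k2 _; rewrite big_seq_cond.
  rewrite [RHS]big_seq_cond; apply: eq_big => [c|c _]; first by rewrite andbT andbb.
  by rewrite big_seq.
rewrite le_eqVlt; apply/orP; left; apply/eqP.
apply: eq_bigr => k1 _; apply: eq_bigr => k2 _.
have cst (T : eqType) (r : seq T) (v : R) : \sum_(c <- r | c \in r) v = (size r)%:R * v.
  rewrite -big_seq; elim: r => [|x r IH]; first by rewrite big_nil mul0r.
  by rewrite big_cons IH /= -natr1; ring.
by rewrite !cst !size_masks natrM -/(V k1 k2); ring.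
Qed.

End Conv.

Section ConvMain.
Variables (R : realType) (Rad ell : R) (p : nat).
Hypothesis Rad_gt0 : 0 < Rad.
Hypothesis ell_gt0 : 0 < ell.
Hypothesis p_gt0 : (0 < p)%N.
Notation b := (pitch Rad ell p).
Notation g2 := (g2 Rad ell).
Notation bb := (bb p g2).
Notation Cn := (Cn p g2).
Notation kappa := (kappa Rad ell).
Notation Jtheta := (Jtheta Rad ell).

Lemma conv_main (Q : R) : 0 < Q -> exists K, 0 <= K /\ forall N k0 x0, (k0 < N)%N ->
  k0%:R * b <= x0 <= k0.+1%:R * b ->
  nsum (p * N) N (fun r => bb r ^+ 2 * tw (fun k => 1 + qt Rad ell x0 k) r) / N`!%:R <=
  \sum_(k1 < k0.+1) \sum_(k0.+1 <= k2 < N.+1) K * Q ^+ (k2 - k1) * Cn k1 * Cn (N - k2).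
Proof.
move=> Q0; have b0 : 0 < b by exact: pitch_gt0.
have ka0 : 0 < kappa by exact: kappa_gt0.
have J0 : 0 < Jtheta by exact: Jtheta_gt0.
set C1 := C1 Rad ell p; have C0 : 0 < C1 by exact: expR_gt0.
(* All factors per particle of the block: 2 from the test function, [C1] from the interaction, the
   ratio of the one-particle integrals, and e from n^n against n!. None depends on [kap]. *)
pose G := 2 * C1 * (Jtheta / kappa) * expR 1.
have G0 : 0 < G by do !apply: mulr_gt0 => //; rewrite ?invr_gt0 ?expR_gt0.
(* Chosen so that the rate is at least G / Q; then G e^(-l) <= G / (1 + l) <= Q. *)
pose kap := b + G / Q * (16 * ell ^+ 2 / b).
have kap_gt : b < kap by rewrite ltrDl; apply: mulr_gt0; apply: divr_gt0 => //; rewrite mulr_gt0 ?exprn_gt0.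
set l := lam Rad ell p kap.
have lG : G / Q <= l.
  rewrite /l /lam /kap.
  have -> : b / 2 * (b + G / Q * (16 * ell ^+ 2 / b) - b / 2) / (8 * ell ^+ 2) =
     b ^+ 2 / (32 * ell ^+ 2) + G / Q by field; rewrite !gt_eqF.
  by rewrite lerDr divr_ge0 ?sqr_ge0 // mulr_ge0 // sqr_ge0.
have GQ : G * expR (- l) <= Q.
  rewrite expRN ler_pdivrMr ?expR_gt0 // mulrC -ler_pdivrMr //.
  by apply: (le_trans lG); apply: le_trans (expR_ge1Dx l); rewrite lerDr.
set A := Kcut Rad ell p kap ^+ 2 * Ktest Rad ell p kap.
have A0 : 0 <= A by rewrite mulr_ge0 ?sqr_ge0 // expR_ge0.
(* The factor [expR l] compensates for n particles having only n - 1 cuts between them. *)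
exists (A * expR l); split; first by rewrite mulr_ge0 // expR_ge0.
move=> N k0 x0 k0N hx; have h := int_bound Rad_gt0 ell_gt0 p_gt0 kap_gt k0N hx.
rewrite -(ler_pM2l (x := kappa ^+ N * N`!%:R)); last by rewrite mulr_gt0 ?exprn_gt0 ?ltr0n ?fact_gt0.
set S := nsum _ _ _ in h *; have fN : N`!%:R != 0 :> R by rewrite pnatr_eq0 -lt0n fact_gt0.
have -> : kappa ^+ N * N`!%:R * (S / N`!%:R) = kappa ^+ N * S by rewrite -mulrA [N`!%:R * _]mulrC divfK.
apply: (le_trans h); rewrite big_mkord mulr_sumr; apply: ler_sum => k1 _.
rewrite mulr_sumr; apply: ler_sum_nat => k2 /andP[k02 k2N].
have k10 : (k1 <= k0)%N by rewrite -ltnS ltn_ord.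
have k12 : (k1 < k2)%N by exact: leq_ltn_trans k10 k02.
rewrite ltnS in k2N.
set n := (k2 - k1)%N; have n0 : (0 < n)%N by rewrite subn_gt0.
have fE : N`!%:R = 'C(N, k2)%:R * ('C(k2, k1)%:R * (k1`!%:R * n`!%:R)) * (N - k2)`!%:R :> R.
  by rewrite -!natrM /n (bin_fact (ltnW k12)) -mulnA bin_fact.
have kE : kappa ^+ N = kappa ^+ k1 * kappa ^+ n * kappa ^+ (N - k2).
  by rewrite -!exprD /n (subnKC (ltnW k12)) subnKC.
have KE : Kn Rad ell p kap n = A * expR l * (2 * C1 * expR (- l)) ^+ n.
  rewrite /Kn -/A -/C1 -/l [in RHS]exprMn -mulrA -[RHS]mulrA; congr (_ * _).
  rewrite mulrCA; congr (_ * _); rewrite -expRM_natl -expRD; congr expR.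
  by rewrite -[in RHS](prednK n0) -natr1; ring.
rewrite KE fE kE natrM.
set cN := 'C(N, k2)%:R; set ck := 'C(k2, k1)%:R; set f1 := k1`!%:R; set f2 := (N - k2)`!%:R.
set e1 := kappa ^+ k1; set e2 := kappa ^+ (N - k2).
rewrite [X in X <= _](_ : _ = (cN * ck * f1 * f2 * (e1 * e2) * (A * expR l) * (Cn k1 * Cn (N - k2))) *
   ((2 * C1 * expR (- l)) ^+ n * (n%:R * Jtheta) ^+ n)); last by ring.
rewrite [X in _ <= X](_ : _ = (cN * ck * f1 * f2 * (e1 * e2) * (A * expR l) * (Cn k1 * Cn (N - k2))) *
   (n`!%:R * (kappa ^+ n * Q ^+ n))); last by ring.
apply: ler_wpM2l.
  have e10 : 0 <= e1 by rewrite exprn_ge0 // ltW.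
  have e20 : 0 <= e2 by rewrite exprn_ge0 // ltW.
  have l0 := expR_ge0 l; have c0 := Cn_ge0 p g2 k1; have c2 := Cn_ge0 p g2 (N - k2).
  apply: mulr_ge0; last exact: mulr_ge0 c0 c2.
  apply: mulr_ge0; last exact: mulr_ge0 A0 l0.
  apply: mulr_ge0; last exact: mulr_ge0 e10 e20.
  by rewrite /cN /ck /f1 /f2 -!natrM ler0n.
rewrite -exprMn (_ : 2 * C1 * expR (- l) * (n%:R * Jtheta) = 2 * C1 * expR (- l) * Jtheta * n%:R); last by ring.
rewrite exprMn.
have B0 : 0 <= 2 * C1 * expR (- l) * Jtheta 
  by apply: mulr_ge0; [apply: mulr_ge0; [apply: mulr_ge0 => //; exact: ltW|exact: expR_ge0]|exact: ltW].
apply: (@le_trans _ _ ((2 * C1 * expR (- l) * Jtheta) ^+ n * (expR 1 ^+ n * n`!%:R))).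
  by rewrite ler_wpM2l ?expn_fact_le // exprn_ge0.
rewrite mulrA -exprMn mulrC ler_wpM2l // -exprMn lerXn2r ?nnegrE //.
  by rewrite mulr_ge0 ?expR_ge0.
  by rewrite mulr_ge0 ?(ltW ka0) ?(ltW Q0).
apply: le_trans (ler_wpM2l (ltW ka0) GQ); rewrite le_eqVlt; apply/orP; left; apply/eqP.
by rewrite /G; field; rewrite gt_eqF.
Qed.

End ConvMain.

(** * Consequences of the convolution bound for Laughlin's function *)

Section Bridge.
Variables (R : realType) (Rad ell : R) (p : nat).
Hypothesis Rad_gt0 : 0 < Rad.
Hypothesis ell_gt0 : 0 < ell.
Hypothesis p_gt0 : (0 < p)%N.
Notation a0 := (a0 Rad ell).
Notation b := (pitch Rad ell p).
Notation g2 := (g2 Rad ell).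
Notation bb := (bb p g2).
Notation Cn := (Cn p g2).
Notation EX := (EX p g2).

Lemma tw_qt_ge x0 s : 1 <= tw (fun k => 1 + qt Rad ell x0 k) s.
Proof.
rewrite /tw; elim: s => [|k s IH]; first by rewrite big_nil.
by rewrite big_cons -[X in X <= _]mulr1; apply: ler_pM; rewrite ?ler01 // lerDl qt_ge0.
Qed.

Lemma renewal_Cn : exists r0 uinf c : R, [/\ 0 < r0 <= 1, 0 < uinf, 0 < c,
  (forall n, c <= Cn n * r0 ^+ n <= 1) &
  (forall e, 0 < e -> exists n0, forall n, (n0 <= n)%N -> `|Cn n * r0 ^+ n - uinf| <= e)].
Proof.
apply: (@renewal_limit R Cn (alphan p g2)).
- exact: Cn0.
- exact: Cn1.
- exact: Cn_ge1.
- by move=> n m; exact: Cn_super.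
- exact: alphan_ge0.
- by move=> n n0; exact: Cn_renewal.
move=> Q Q0; have [K [K0 h]] := conv_main Rad_gt0 ell_gt0 p_gt0 Q0.
exists K => N k0 k0N; have b0 : 0 <= b := ltW (pitch_gt0 Rad_gt0 ell_gt0 p_gt0).
have hx : k0%:R * b <= k0%:R * b <= k0.+1%:R * b by rewrite lexx ler_wpM2r // ler_nat.
apply: le_trans (h N k0 _ k0N hx); rewrite /Cn /CT ler_wpM2r ?invr_ge0 //.
by apply: le_nsum => s _ _; rewrite tw1 ler_wpM2l ?sqr_ge0 // tw_qt_ge.
Qed.

(** With the test Gaussian at the centre of orbital m, each particle in that orbital gains 1 +
    1/sqrt 2 >= 3/2. The convolution bound with Q = 1/2 is then summed by means of [Cn_super]. *)
Lemma moment_exp : exists2 B, 0 < B &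
  forall N m, EX N (fun s => (3 / 2) ^+ count_mem m s) <= B * Cn N.
Proof.
have h2 : 0 < (2^-1 : R) by rewrite invr_gt0.
have [K [K0 h]] := conv_main Rad_gt0 ell_gt0 p_gt0 h2.
exists (1 + 4 * K) => [|N m]; first by rewrite ltr_pwDl // mulr_ge0.
have C0 := Cn_ge0 p g2 N.
have [mN|mN] := leqP (p * N) m.
  apply: (@le_trans _ _ (Cn N)); last by rewrite ler_peMl // lerDl mulr_ge0.
  rewrite -EX1; apply: EX_le => s _ as_ _.
  rewrite (_ : count_mem m s = 0%N) ?expr0 //; apply/eqP; rewrite -leqn0 leqNgt -has_count.
  apply/hasPn => x xs; have := allP as_ x xs; rewrite /= => xN.
  by apply/eqP => e; rewrite e ltnNge mN in xN.
(* The lattice cell containing the centre of orbital m. Orbitals beyond p N are empty and were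
   treated before. *)
pose k0 := (m %/ p)%N; have k0N : (k0 < N)%N by rewrite ltn_divLR // mulnC.
have a00 : 0 <= a0 by rewrite divr_ge0 ?sqr_ge0 // ltW.
have hx : k0%:R * b <= m%:R * a0 <= k0.+1%:R * b.
  have e (k : nat) : k%:R * b = (k * p)%:R * a0 by rewrite natrM -mulrA.
  rewrite !e; apply/andP; split; apply: ler_wpM2r => //; rewrite ler_nat.
    exact: leq_trunc_div.
  by rewrite ltnW // ltn_ceil.
have s2 : 0 < Num.sqrt 2 :> R by rewrite sqrtr_gt0.
have q2 : 2^-1 <= (Num.sqrt 2)^-1 :> R.
  rewrite lef_pV2 ?posrE // -(ler_pXn2r (n := 2)) ?nnegrE ?(ltW s2) // sqr_sqrtr //.
  by rewrite -natrX ler_nat.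
apply: (@le_trans _ _ (nsum (p * N) N (fun r => bb r ^+ 2 *
   tw (fun k => 1 + qt Rad ell (m%:R * a0) k) r) / N`!%:R)).
  rewrite /EX /GT subn0 ler_wpM2r ?invr_ge0 //; apply: le_nsum => s _ _.
  rewrite tw1 mulr1 -expr2 /= ler_wpM2l ?sqr_ge0 //.
  rewrite /tw; elim: s => [|k s IH]; first by rewrite big_nil.
  rewrite big_cons /= exprD; apply: ler_pM => //; rewrite ?exprn_ge0 //.
  have := qt_ge0 Rad_gt0 ell_gt0 (m%:R * a0) k.
  case: eqP => [->|_]; last by rewrite expr0; lra.
  by rewrite expr1 qt_diag //; lra.
apply: (le_trans (h N k0 _ k0N hx)).
apply: (@le_trans _ _ (\sum_(k1 < k0.+1) \sum_(k0.+1 <= k2 < N.+1)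
   (K * Cn N) * (2^-1 ^+ (k0 - k1) * 2^-1 ^+ (k2 - k0)))).
  apply: ler_sum => k1 _; apply: ler_sum_nat => k2 /andP[k02 k2N].
  have k10 : (k1 <= k0)%N by rewrite -ltnS ltn_ord.
  have -> : (k2 - k1 = (k0 - k1) + (k2 - k0))%N by nlia.
  rewrite exprD; set x := 2^-1 ^+ _; set y := 2^-1 ^+ _.
  rewrite [X in X <= _](_ : _ = (K * (x * y)) * (Cn k1 * Cn (N - k2))); last by ring.
  rewrite [X in _ <= X](_ : _ = (K * (x * y)) * Cn N); last by ring.
  apply: ler_wpM2l; first by apply: mulr_ge0 => //; apply: mulr_ge0; apply: exprn_ge0; rewrite invr_ge0.
  apply: (le_trans (Cn_super _ p_gt0 _ _)).
  have e : (k1 + (N - k2) + (k2 - k1) = N)%N by nlia.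
  by rewrite -{2}e (le_trans _ (Cn_super _ p_gt0 _ _)) // ler_peMr ?Cn_ge0 ?Cn_ge1.
have -> : \sum_(k1 < k0.+1) \sum_(k0.+1 <= k2 < N.+1)
   (K * Cn N) * (2^-1 ^+ (k0 - k1) * 2^-1 ^+ (k2 - k0)) = (K * Cn N) *
   ((\sum_(k1 < k0.+1) 2^-1 ^+ (k0 - k1)) * \sum_(k0.+1 <= k2 < N.+1) 2^-1 ^+ (k2 - k0)).
  rewrite mulr_suml mulr_sumr; apply: eq_bigr => k1 _; rewrite !mulr_sumr.
  by [].
have g (M : nat) : \sum_(d < M) 2^-1 ^+ d <= 2 :> R.
  apply: le_trans (geo_sum_le M _) _; first by rewrite invr_ge0 ler0n /= invf_lt1 // ltr1n.
  by rewrite (_ : (1 - 2^-1)^-1 = 2 :> R) //; field.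
have s1 : \sum_(k1 < k0.+1) 2^-1 ^+ (k0 - k1) <= 2 :> R.
  apply: le_trans (g k0.+1); rewrite (reindex_inj rev_ord_inj) /=.
  by apply: ler_sum => i _; rewrite subSS subKn // -ltnS.
have s3 : \sum_(k0.+1 <= k2 < N.+1) 2^-1 ^+ (k2 - k0) <= 2 :> R.
  apply: le_trans (g (N - k0)%N.+1).
  rewrite -[in index_iota k0.+1 _](add0n k0.+1) big_addn big_mkord subSS big_ord_recl /=.
  rewrite -[X in X <= _]add0r lerD ?ler01 //; apply: ler_sum => i _.
  by rewrite (_ : i + k0.+1 - k0 = bump 0 i)%N // addnS -addSn addnK.
apply: (@le_trans _ _ (K * Cn N * (2 * 2))).
  apply: ler_wpM2l; first exact: mulr_ge0.
  by apply: ler_pM => //; apply: sumr_ge0 => i _; rewrite exprn_ge0 // invr_ge0.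
rewrite (_ : (1 + 4 * K) * Cn N = Cn N + K * Cn N * (2 * 2)); last by ring.
by rewrite lerDr.
Qed.

End Bridge.

(** * Density matrices in the bulk *)

Lemma pow_exp_le (R : realType) j : exists2 A : R, 0 < A & forall n : nat, n%:R ^+ j <= A * (3 / 2) ^+ n.
Proof.
pose d : R := (3 * j.+1%:R)^-1; have d0 : 0 < d by rewrite invr_gt0 mulr_gt0.
have dj : (1 + d) ^+ j <= 3 / 2.
  apply: (@le_trans _ _ (expR (1 / 3))).
    apply: (@le_trans _ _ (expR d ^+ j)).
      by rewrite lerXn2r ?nnegrE ?expR_ge0 ?expR_ge1Dx // addr_ge0 // ltW.
    rewrite -expRM_natl ler_expR /d -ler_pdivlMr ?invr_gt0 ?mulr_gt0 // invrK.
    have : j%:R <= j.+1%:R :> R by rewrite ler_nat.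
    by lra.
  have h := expR_ge1Dx (- (1 / 3) : R); rewrite expRN in h.
  have e0 := expR_gt0 (1 / 3 : R); rewrite -[X in X <= _]invrK -[3 / 2]invrK lef_pV2 ?posrE ?invr_gt0 //.
  by apply: le_trans h; lra.
exists (d ^- j) => [|n]; first by rewrite invr_gt0 exprn_gt0.
have nd : n%:R * d <= (1 + d) ^+ n.
  elim: n => [|n IH]; first by rewrite mul0r expr0.
  have one : 1 <= (1 + d) ^+ n by rewrite exprn_ege1 // lerDl ltW.
  by rewrite exprS -natr1; nra.
rewrite mulrC ler_pdivlMr ?exprn_gt0 // -exprMn.
apply: (@le_trans _ _ (((1 + d) ^+ n) ^+ j)).
  by rewrite lerXn2r ?nnegrE ?mulr_ge0 ?exprn_ge0 ?addr_ge0 // ltW.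
by rewrite exprAC lerXn2r ?nnegrE ?exprn_ge0 ?addr_ge0 // ltW.
Qed.

Lemma prod_le_sum_pow (R : realType) (T : Type) (x : T -> R) (ms : seq T) : (forall k, 0 <= x k) ->
  \prod_(k <- ms) x k <= 1 + \sum_(k <- ms) x k ^+ size ms.
Proof.
move=> x0; case: ms => [|k0 ms]; first by rewrite !big_nil addr0.
suff [y0 [hy0 [h1 h2]]] : exists y, 0 <= y /\ ((forall n, y ^+ n <= \sum_(k <- k0 :: ms) x k ^+ n) /\
    \prod_(k <- k0 :: ms) x k <= y ^+ size (k0 :: ms)).
  by apply: (le_trans h2); rewrite (le_trans (h1 _)) // lerDr.
elim: ms k0 => [|k ms IH] k0.
  by exists (x k0); split=> //; split=> [n|]; rewrite big_seq1.
have [y [y0 [h1 h2]]] := IH k; have [xy|yx] := leP (x k0) y.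
  exists y; split=> //; split=> [n|]; rewrite big_cons.
    by rewrite (le_trans (h1 n)) // lerDr exprn_ge0.
  by rewrite /= exprS; apply: ler_pM => //; apply: prodr_ge0.
exists (x k0); split=> //; split=> [n|]; rewrite big_cons.
  by rewrite lerDl sumr_ge0 // => i _; rewrite exprn_ge0.
rewrite /= exprS; apply: ler_pM => //; first by apply: prodr_ge0.
by apply: (le_trans h2); rewrite lerXn2r ?nnegrE // ltW.
Qed.

Lemma sum_seq_count (R : pzRingType) D (g : nat -> R) (s : seq nat) : all (ltn^~ D) s ->
  \sum_(x <- s) g x = \sum_(x < D) (count_mem (nat_of_ord x) s)%:R * g x.
Proof.
elim: s => [|x s IH] /=; first by rewrite big_nil big1 // => i _; rewrite mul0r.
move=> /andP[xD as_]; rewrite big_cons IH //.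
under [RHS]eq_bigr => i _ do rewrite natrD mulrDl.
rewrite big_split /=; congr (_ + _).
rewrite (bigD1 (Ordinal xD)) //= eqxx mul1r big1 ?addr0 // => i ix.
by rewrite (_ : x == i = false) ?mul0r //; apply/negbTE; apply: contra ix => /eqP e; apply/eqP/val_inj.
Qed.

Lemma sum_ltn m n : (\sum_(d < m) (d < n) = minn m n)%N.
Proof.
elim: m => [|m IH]; first by rewrite big_ord0 min0n.
by rewrite big_ord_recr /= IH; case: ltnP => h; lia.
Qed.

Lemma sq_sum_le (R : realType) (A E Q : R) : E ^+ 2 <= Q -> (A + E) ^+ 2 <= 2 * (A ^+ 2 + Q).
Proof. by move=> h; have := sqr_ge0 (A - E); nra. Qed.

Lemma dist_band (R : realType) (x y l h d : R) : l <= x <= h -> l <= y <= h -> h - l <= d -> `|x - y| <= d.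
Proof. by rewrite ler_norml; lra. Qed.

Lemma am_gm (R : realType) (t x z : R) : 0 < t -> x * z <= t / 2 * (x * x) + t^-1 / 2 * z ^+ 2.
Proof.
move=> t0; have := mulr_ge0 (ltW t0) (sqr_ge0 (x - t^-1 * z)).
have -> : t * (x - t^-1 * z) ^+ 2 = t * (x * x) - 2 * (x * z) + t^-1 * z ^+ 2.
  by field; rewrite gt_eqF.
by lra.
Qed.

Ltac plia := repeat match goal with
  | H : context [@Order.le] |- _ => clear H
  | H : context [@Order.lt] |- _ => clear H
  | H : context [muln] |- _ => clear H
  | H : context [mem] |- _ => clear H
  | H : context [GRing.mul] |- _ => clear H
  end; lia.

Lemma lt_cut (p x k W D : nat) : (W <= D)%N -> (x + p * D < p * (k + W))%N -> (x < p * k)%N.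
Proof.
move=> WD; rewrite mulnDr; have : (p * W <= p * D)%N by rewrite leq_mul2l WD orbT.
by move: (p * W)%N (p * D)%N (p * k)%N => a1 a2 a3; lia.
Qed.

Lemma geo_idx1 a b d n x : (a + b + d <= n)%N -> (x < b)%N -> (a + x < n)%N.
Proof. lia. Qed.

Lemma geo_idx2 a b d n x e : (a + b + d <= n)%N -> (x < b)%N -> (e <= d)%N ->
  (e + (b - x.+1) <= n - (a + x))%N.
Proof. lia. Qed.

(** For two systems displaced by c, the right window is put as far right as both allow; it then ends
    close to the right end of one of them, which leaves room for all letters in the common bulk. *)
Lemma windows_ex D0 w n N N' c : (2 * (D0 + w + n) < N)%N -> (c + 2 * (D0 + w + n) < N')%N ->
  exists kR, [/\ (D0 + w + n <= kR)%N, (kR + (D0 + w) <= N)%N, (kR + c + (D0 + w) <= N')%N &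
    (kR + (D0 + w))%N = N \/ (kR + c + (D0 + w))%N = N'].
Proof.
move=> h1 h2; exists (minn N (N' - c) - (D0 + w))%N.
by case: (leqP N (N' - c)) => h3; split; lia.
Qed.

Section Bulk.
Variables (R : realType) (p : nat) (g2 : R).
Hypothesis p_gt0 : (0 < p)%N.
Notation bb := (bb p g2).
Notation CT := (CT p g2).
Notation GT := (GT p g2).
Notation EX := (EX p g2).
Notation Cn := (Cn p g2).
Notation ren := (ren p).
Notation one := (fun=> 1 : R).
Notation cnt m := (fun s : seq nat => \prod_(k <- m) (count_mem k s)%:R : R).

Lemma one01 (k : nat) : (0 : R) <= 1 <= (1 : R).
Proof. by rewrite ler01 lexx. Qed.

Lemma Cn_gt0 N : 0 < Cn N. Proof. by apply: (lt_le_trans ltr01); exact: Cn_ge1. Qed.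

Lemma eq_GT tau N m m' X Y : (forall r, bb (m ++ r) * bb (m' ++ r) != 0 -> X r = Y r) ->
  GT tau N m m' X = GT tau N m m' Y.
Proof.
move=> XY; rewrite /GT; congr (_ / _); apply: eq_nsum => r _ _.
have [->|h] := eqVneq (bb (m ++ r) * bb (m' ++ r)) 0; first by rewrite !mul0r.
by rewrite XY.
Qed.

Lemma GTB tau N m m' X Y : GT tau N m m' (fun r => X r - Y r) = GT tau N m m' X - GT tau N m m' Y.
Proof.
rewrite /GT -mulrBl -nsumN -nsumD; congr (_ / _); apply: eq_nsum => r _ _.
by rewrite mulrBr.
Qed.

Lemma GTZ tau N m m' k X : GT tau N m m' (fun r => k * X r) = k * GT tau N m m' X.
Proof.
by rewrite /GT mulrA -nsumZ; congr (_ / _); apply: eq_nsum => r _ _; ring.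
Qed.

Lemma GT_sum tau N m m' (T : Type) (l : seq T) (F : T -> seq nat -> R) :
  GT tau N m m' (fun r => \sum_(i <- l) F i r) = \sum_(i <- l) GT tau N m m' (F i).
Proof.
rewrite /GT -mulr_suml -nsum_sum; congr (_ / _); apply: eq_nsum => r _ _.
by rewrite mulr_sumr.
Qed.

Lemma GT_marked N m (Z : seq nat -> R) : (size m <= N)%N -> symfun Z -> (forall s, 0 <= Z s) ->
  GT one N m m (fun r => Z (m ++ r)) <= EX N (fun s => cnt m s * Z s).
Proof.
move=> mN sZ Z0.
have E0 : 0 <= EX N (fun s => cnt m s * Z s).
  rewrite -(mul0r (EX N one)) -EXZ; apply: EX_le => s _ _ _.
  by rewrite mul0r mulr_ge0 // prodr_ge0.
have [am|nam] := boolP (all (ltn^~ (p * N)%N) m); last first.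
  rewrite (_ : GT _ _ _ _ _ = 0) //.
  rewrite /GT (eq_nsum (g := fun=> 0)) ?nsum0 ?mul0r // => r sr ar.
  rewrite (_ : bb (m ++ r) = 0) ?mul0r //; apply/eqP; apply: contraNT nam => /(bb_range p_gt0).
  by rewrite all_cat size_cat sr subnKC // => /andP[].
pose F s := bb s ^+ 2 * Z s.
have sF : symfun F by move=> s t st; rewrite /F (sZ _ _ st) !expr2 (symfun_bb p g2 [::] [::] st).
have F0 s : 0 <= F s by rewrite mulr_ge0 ?sqr_ge0.
have := @nsum_marked R (p * N) (size m) (N - size m) F m sF F0 am erefl.
rewrite subnK // => h.
have f0 k : (0 : R) < k`!%:R by rewrite ltr0n fact_gt0.
rewrite /EX /GT subn0 ler_pdivrMr // mulrAC ler_pdivlMr //.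
have -> : N`!%:R = (N ^_ size m)%:R * (N - size m)`!%:R :> R by rewrite -natrM ffact_fact.
rewrite mulrA ler_pM2r //; apply: le_trans (le_trans _ h) _.
  rewrite mulrC ler_wpM2l // le_eqVlt; apply/orP; left; apply/eqP; apply: eq_nsum => r _ _.
  by rewrite tw1 mulr1 -expr2.
rewrite le_eqVlt; apply/orP; left; apply/eqP; apply: eq_nsum => s _ _.
by rewrite /F tw1 mulr1 -expr2 mulrCA.
Qed.

(** The inequality 2 |x y| <= x^2 + y^2 for the two coefficients reduces an off-diagonal entry to
    two diagonal ones, hence to moments of occupation numbers. This is why Z must dominate X along
    both words. *)
Lemma GT_bound tau N m m' (X Z : seq nat -> R) : (forall k, 0 <= tau k <= 1) ->
  size m' = size m -> (size m <= N)%N -> symfun Z -> (forall s, 0 <= Z s) ->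
  (forall r, bb (m ++ r) * bb (m' ++ r) != 0 -> `|X r| <= Z (m ++ r) /\ `|X r| <= Z (m' ++ r)) ->
  `|GT tau N m m' X| <= (EX N (fun s => cnt m s * Z s) + EX N (fun s => cnt m' s * Z s)) / 2.
Proof.
move=> t01 sm mN sZ Z0 XZ.
apply: (@le_trans _ _ ((GT one N m m (fun r => Z (m ++ r)) + GT one N m' m' (fun r => Z (m' ++ r))) / 2)); last first.
  by rewrite ler_pM2r ?invr_gt0 // lerD // GT_marked // sm.
have f0 k : (0 : R) < k`!%:R by rewrite ltr0n fact_gt0.
rewrite /GT sm normrM normfV (ger0_norm (ltW (f0 _))) -mulrDl mulrAC.
rewrite ler_pM2r ?invr_gt0 //; apply: (le_trans (ler_norm_nsum _ _ _)).
rewrite -nsumD -nsumZr; apply: le_nsum => r _ _; rewrite !tw1 !mulr1.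
set x := bb (m ++ r); set y := bb (m' ++ r).
have [xy0|xy] := eqVneq (x * y) 0.
  by rewrite xy0 !mul0r normr0 mulr_ge0 // addr_ge0 // mulr_ge0 // -expr2 sqr_ge0.
have [h1 h2] := XZ r xy.
have tw01 : 0 <= tw tau r <= 1.
  rewrite /tw; elim: (r) => [|k r' IH]; first by rewrite big_nil ler01 lexx.
  by rewrite big_cons; have := t01 k; nra.
rewrite normrM normrM (ger0_norm (x := tw tau r)); last by case/andP: tw01.
apply: (@le_trans _ _ (`|x * y| * `|X r|)).
  by rewrite ler_wpM2r // ler_piMr // ; case/andP: tw01.
apply: (@le_trans _ _ ((x * x + y * y) / 2 * `|X r|)).
  rewrite ler_wpM2r // normrM; have := sqr_ge0 (`|x| - `|y|).
  have ex : `|x| ^+ 2 = x * x by rewrite real_normK ?num_real.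
  have ey : `|y| ^+ 2 = y * y by rewrite real_normK ?num_real.
  by rewrite sqrrB ex ey -mulr_natl; lra.
have := ler_wpM2l (sqr_ge0 x) h1; have := ler_wpM2l (sqr_ge0 y) h2; rewrite !expr2.
by lra.
Qed.

Variables (r0 uinf cu B0 : R).
Hypothesis r0_bd : 0 < r0 <= 1.
Hypothesis uinf_gt0 : 0 < uinf.
Hypothesis cu_gt0 : 0 < cu.
Hypothesis B0_gt0 : 0 < B0.
Notation u := (fun n : nat => Cn n * r0 ^+ n).
Hypothesis u_bd : forall n, cu <= u n <= 1.
Hypothesis u_lim : forall e : R, 0 < e -> exists n0, forall n, (n0 <= n)%N -> `|u n - uinf| <= e.
Hypothesis mom0 : forall N m, EX N (fun s => (3 / 2) ^+ count_mem m s) <= B0 * Cn N.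

Lemma mom_pow j : exists2 B, 0 < B & forall N m, EX N (fun s => (count_mem m s)%:R ^+ j) <= B * Cn N.
Proof.
have [A A0 h] := pow_exp_le R j; exists (A * B0) => [|N m]; first by rewrite mulr_gt0.
rewrite -mulrA; apply: le_trans (ler_wpM2l (ltW A0) (mom0 N m)).
by rewrite -EXZ; apply: EX_le => s _ _ _.
Qed.

Lemma mom_prod n : exists2 B, 0 < B & forall N ms, size ms = n -> EX N (cnt ms) <= B * Cn N.
Proof.
have [B Bp h] := mom_pow n; exists (1 + n%:R * B) => [|N ms sm].
  by rewrite ltr_pwDl // mulr_ge0 // ltW.
apply: (@le_trans _ _ (EX N (fun s => 1 + \sum_(k <- ms) (count_mem k s)%:R ^+ n))).
  by apply: EX_le => s _ _ _; rewrite -sm; apply: (prod_le_sum_pow (x := fun k => (count_mem k s)%:R)).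
rewrite EXD EX1 EX_sum mulrDl mul1r lerD2l.
rewrite -{2}sm; elim: ms {sm} => [|k ms IH] /=; first by rewrite big_nil !mul0r.
by rewrite big_cons -natr1 !mulrDl mul1r [X in _ <= X]addrC lerD.
Qed.

Lemma GT_bound1 n : exists2 B, 0 < B & forall tau N m m', (forall k, 0 <= tau k <= 1) ->
  size m = n -> size m' = n -> (n <= N)%N -> `|GT tau N m m' one| <= B * Cn N.
Proof.
have [B Bp h] := mom_prod n; exists B => // tau N m m' t01 sm sm' nN.
apply: le_trans (@GT_bound tau N m m' one one t01 _ _ _ _ _) _ => //; rewrite ?sm ?sm' //.
  by move=> r _; rewrite normr1.
have e m1 : EX N (fun s => cnt m1 s * one s) = EX N (cnt m1) by apply: eq_EX => s _ _ _; rewrite mulr1.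
by rewrite !e; have := h N m sm; have := h N m' sm'; lra.
Qed.

Lemma EX_ren1 N k : (k <= N)%N -> EX N (fun s => (ren k s)%:R) = Cn k * Cn (N - k).
Proof.
move=> kN; have := EX_ren g2 p_gt0 kN (leftfun1 R p k); rewrite EX1 => <-.
by apply: eq_EX => s _ _ _; rewrite mulr1.
Qed.

Lemma EX_ren2 N k l : (k <= l)%N -> (l <= N)%N ->
  EX N (fun s => (ren k s)%:R * (ren l s)%:R) = Cn k * Cn (l - k) * Cn (N - l).
Proof.
move=> kl lN; rewrite -(EX_ren1 kl) -(EX_ren g2 p_gt0 lN (leftfun_ren R p kl)).
by apply: eq_EX => s _ _ _; rewrite mulrC.
Qed.

(** Number of renewal points in a window, divided by w [uinf], which is approximately its expected
    value in the bulk. *)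
Definition Yw (k0 w : nat) (s : seq nat) : R := (w%:R * uinf)^-1 * \sum_(i < w) (ren (k0 + i) s)%:R.

Lemma Yw_bd k0 w s : (0 < w)%N -> 0 <= Yw k0 w s <= uinf^-1.
Proof.
move=> w0; have wu : 0 < w%:R * uinf by rewrite mulr_gt0 ?ltr0n.
rewrite /Yw; apply/andP; split.
  by apply: mulr_ge0; [rewrite invr_ge0 ltW|apply: sumr_ge0].
rewrite mulrC ler_pdivrMr //.
have -> : uinf^-1 * (w%:R * uinf) = w%:R by field; rewrite gt_eqF.
rewrite -[X in _ <= X%:R]card_ord -sumr_const; apply: ler_sum => i _.
by rewrite lern1 leq_b1.
Qed.

Lemma Yw_sym k0 w : symfun (Yw k0 w).
Proof.
by move=> s t st; rewrite /Yw; congr (_ * _); apply: eq_bigr => i _; rewrite (ren_sym p _ st).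
Qed.

Lemma u_rel eta : 0 < eta -> exists n0, forall n, (n0 <= n)%N -> uinf * (1 - eta) <= u n <= uinf * (1 + eta).
Proof.
move=> e0; have [n0 h] := u_lim (mulr_gt0 uinf_gt0 e0); exists n0 => n /h.
by rewrite ler_distl mulrBr mulrDr mulr1.
Qed.

Lemma ratio_bd eta a b n : 0 < eta <= 8^-1 ->
  uinf * (1 - eta) <= a <= uinf * (1 + eta) -> uinf * (1 - eta) <= b <= uinf * (1 + eta) ->
  uinf * (1 - eta) <= n <= uinf * (1 + eta) ->
  uinf * (1 - 3 * eta) <= a * b / n <= uinf * (1 + 4 * eta).
Proof.
move=> /andP[e0 e8] /andP[a1 a2] /andP[b1 b2] /andP[n1 n2].
have l0 : 0 < uinf * (1 - eta) by rewrite mulr_gt0 // subr_gt0; lra.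
have n0 : 0 < n by exact: lt_le_trans n1.
rewrite ler_pdivlMr // ler_pdivrMr //; apply/andP; split.
  apply: (@le_trans _ _ (uinf * (1 - eta) * (uinf * (1 - eta)))).
    apply: (@le_trans _ _ (uinf * (1 - 3 * eta) * (uinf * (1 + eta)))).
      by rewrite ler_wpM2l // mulr_ge0 ?(ltW uinf_gt0) //; lra.
    rewrite mulrACA [X in _ <= X]mulrACA ler_wpM2l ?mulr_ge0 ?(ltW uinf_gt0) //; nra.
  by apply: ler_pM => //; exact: ltW.
apply: (@le_trans _ _ (uinf * (1 + eta) * (uinf * (1 + eta)))).
  by apply: ler_pM => //; apply/ltW; apply: lt_le_trans l0 _.
apply: (@le_trans _ _ (uinf * (1 + 4 * eta) * (uinf * (1 - eta)))).
  rewrite mulrACA [X in _ <= X]mulrACA ler_wpM2l ?mulr_ge0 ?(ltW uinf_gt0) //; nra.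
by rewrite ler_wpM2l // mulr_ge0 ?(ltW uinf_gt0) //; lra.
Qed.

Lemma Cn_split N k l : (k + l <= N)%N ->
  Cn k * Cn l = Cn N * (u k * u l / u N) * r0 ^+ (N - k - l).
Proof.
move=> kl; have r00 : r0 != 0 by case/andP: r0_bd => /gt_eqF ->.
have C0 : Cn N != 0 by rewrite gt_eqF // Cn_gt0.
have -> : r0 ^+ N = r0 ^+ k * r0 ^+ l * r0 ^+ (N - k - l) by rewrite -!exprD; congr (_ ^+ _); nlia.
have h n : r0 ^+ n != 0 by rewrite expf_neq0.
by field; rewrite C0 !h.
Qed.

(** By [EX_ren2] two renewal indicators at distance at least n0 are almost uncorrelated. Each point
    of the window has at most 2 n0 nearer partners, which is negligible once w is large compared
    with n0. *)
Lemma window_var (delta : R) : 0 < delta -> exists w D, (0 < w)%N /\ forall N k0, (D <= k0)%N ->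
  (k0 + w + D <= N)%N -> EX N (fun s => (1 - Yw k0 w s) ^+ 2) <= delta * Cn N.
Proof.
(* The square expands to at most 1 - 2 (1 - 3 eta) + (1 + 8 eta) plus the near pairs, relative to
   [Cn N]; the 14 eta and the near pairs take half of delta each. *)
move=> d0; pose eta := Num.min 8^-1 (delta / 28).
have eta0 : 0 < eta by rewrite lt_min invr_gt0 ltr0n /= divr_gt0.
have eta8 : 0 < eta <= 8^-1 by rewrite eta0 ge_min lexx.
have etad : 28 * eta <= delta by rewrite mulrC -ler_pdivlMr // ge_min lexx orbT.
have [n0 hn] := u_rel eta0.
have [w w1 wp] : exists2 w, (0 < w)%N & 8 * n0%:R / (uinf * delta) <= w%:R.
  exists (Num.bound (8 * n0%:R / (uinf * delta))).+1 => //.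
  have h : 0 <= 8 * n0%:R / (uinf * delta) by rewrite divr_ge0 ?mulr_ge0 ?(ltW uinf_gt0) ?(ltW d0).
  by apply: le_trans (ltW (archi_boundP h)) _; rewrite ler_nat.
exists w, n0; split=> // N k0 Dk kN.
have w0 : 0 < w%:R :> R by rewrite ltr0n.
set a := (w%:R * uinf)^-1.
have au : a * (w%:R * uinf) = 1 by rewrite mulVf // gt_eqF // mulr_gt0.
have a0 : 0 < a by rewrite invr_gt0 mulr_gt0.
have CN := Cn_gt0 N.
pose f (d : nat) : R := (d < n0)%N%:R.
have e1 (i : 'I_w) : EX N (fun s => (ren (k0 + i) s)%:R) >= Cn N * (uinf * (1 - 3 * eta)).
  have iw := ltn_ord i.
  rewrite EX_ren1; last by nlia.
  rewrite (Cn_split (N := N)); last by nlia.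
  rewrite (_ : N - (k0 + i) - (N - (k0 + i)) = 0)%N; last by nlia.
  rewrite expr0 mulr1 ler_pM2l //.
  have i1 : (n0 <= k0 + i)%N by nlia.
  have i2 : (n0 <= N - (k0 + i))%N by nlia.
  have i3 : (n0 <= N)%N by nlia.
  by have /andP[] := ratio_bd eta8 (hn _ i1) (hn _ i2) (hn _ i3).
have e2le (i j : 'I_w) : (i <= j)%N -> EX N (fun s => (ren (k0 + i) s)%:R * (ren (k0 + j) s)%:R) <=
    Cn N * (uinf ^+ 2 * (1 + 8 * eta) + 2 * uinf * f (dst i j)).
  move=> ij; have iw := ltn_ord i; have jw := ltn_ord j.
  rewrite EX_ren2; [|by nlia..].
  rewrite (_ : k0 + j - (k0 + i) = dst i j)%N; last by rewrite /dst; nlia.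
  rewrite mulrAC (Cn_split (N := N)); last by nlia.
  rewrite (_ : N - (k0 + i) - (N - (k0 + j)) = dst i j)%N; last by rewrite /dst; nlia.
  rewrite -[X in X <= _]mulrA [r0 ^+ _ * _]mulrC -[X in X <= _]mulrA ler_pM2l //.
  have i1 : (n0 <= k0 + i)%N by nlia.
  have i2 : (n0 <= N - (k0 + j))%N by nlia.
  have i3 : (n0 <= N)%N by nlia.
  have /andP[v1 v2] := ratio_bd eta8 (hn _ i1) (hn _ i2) (hn _ i3).
  set v := _ / _ in v1 v2 *.
  have v0 : 0 <= v by apply: le_trans v1; rewrite mulr_ge0 ?(ltW uinf_gt0) //; case/andP: eta8; lra.
  have /andP[ud0 ud1] := u_bd (dst i j).
  rewrite /f; case: ltnP => hd; rewrite ?mulr1 ?mulr0 ?addr0.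
    apply: (@le_trans _ _ (uinf * (1 + 4 * eta) * 1)).
      by apply: ler_pM => //; apply: le_trans ud0; exact: ltW.
    have : 0 <= uinf ^+ 2 * (1 + 8 * eta) by rewrite mulr_ge0 ?sqr_ge0 //; lra.
    have : uinf * eta <= uinf * 8^-1 by rewrite ler_wpM2l ?(ltW uinf_gt0) //; case/andP: eta8.
    by lra.
  have /andP[_ ud2] := hn _ hd.
  apply: (@le_trans _ _ (uinf * (1 + 4 * eta) * (uinf * (1 + eta)))).
    by apply: ler_pM => //; apply: le_trans ud0; exact: ltW.
  rewrite mulrACA -expr2 ler_wpM2l ?sqr_ge0 //; case/andP: eta8; nra.
have e2 (i j : 'I_w) : EX N (fun s => (ren (k0 + i) s)%:R * (ren (k0 + j) s)%:R) <=
    Cn N * (uinf ^+ 2 * (1 + 8 * eta) + 2 * uinf * f (dst i j)).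
  have [ij|ji] := leqP i j; first exact: e2le.
  rewrite dst_sym; apply: le_trans (e2le j i (ltnW ji)).
  by rewrite le_eqVlt; apply/orP; left; apply/eqP; apply: eq_EX => s _ _ _; rewrite mulrC.
have -> : EX N (fun s => (1 - Yw k0 w s) ^+ 2) = Cn N +
   (- (2 * a)) * (\sum_(i < w) EX N (fun s => (ren (k0 + i) s)%:R)) +
   a ^+ 2 * (\sum_(i < w) \sum_(j < w) EX N (fun s => (ren (k0 + i) s)%:R * (ren (k0 + j) s)%:R)).
  under [\sum_(i < w) \sum_(j < w) _]eq_bigr => i _ do rewrite -EX_sum.
  rewrite -!EX_sum -!EXZ -EX1 -!EXD; apply: eq_EX => s _ _ _.
  rewrite /Yw -/a; set S := \sum_(i < w) _.
  have -> : \sum_(i < w) \sum_(j < w) (ren (k0 + i) s)%:R * (ren (k0 + j) s)%:R = S * S.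
    by rewrite mulr_suml; apply: eq_bigr => i _; rewrite mulr_sumr.
  by ring.
have b1 : w%:R * (Cn N * (uinf * (1 - 3 * eta))) <= \sum_(i < w) EX N (fun s => (ren (k0 + i) s)%:R).
  by rewrite -sum_cst; apply: ler_sum => i _.
have b2 : \sum_(i < w) \sum_(j < w) EX N (fun s => (ren (k0 + i) s)%:R * (ren (k0 + j) s)%:R) <=
   w%:R * (Cn N * (w%:R * (uinf ^+ 2 * (1 + 8 * eta)) + 2 * uinf * (n0%:R + n0%:R))).
  rewrite -sum_cst; apply: ler_sum => i _.
  apply: (@le_trans _ _ (\sum_(j < w) Cn N * (uinf ^+ 2 * (1 + 8 * eta) + 2 * uinf * f (dst i j)))).
    by apply: ler_sum => j _.
  rewrite -mulr_sumr ler_wpM2l ?(ltW CN) // big_split /= sum_cst lerD2l -mulr_sumr.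
  rewrite ler_wpM2l ?mulr_ge0 ?(ltW uinf_gt0) //; apply: sum_dst => [d|m]; first by rewrite /f.
  rewrite /f -natr_sum ler_nat.
  by rewrite sum_ltn geq_minr.
have h1 := ler_wpM2l (ltW a0) b1; have h2 := ler_wpM2l (sqr_ge0 a) b2.
have q1 : a * (w%:R * (Cn N * (uinf * (1 - 3 * eta)))) = Cn N * (1 - 3 * eta).
  have -> : Cn N * (1 - 3 * eta) = (a * (w%:R * uinf)) * (Cn N * (1 - 3 * eta)) by rewrite au mul1r.
  by ring.
have q2 : a ^+ 2 * (w%:R * (Cn N * (w%:R * (uinf ^+ 2 * (1 + 8 * eta)) + 2 * uinf * (n0%:R + n0%:R)))) =
   Cn N * (1 + 8 * eta + 4 * n0%:R * a).
  have -> : Cn N * (1 + 8 * eta + 4 * n0%:R * a) =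
     Cn N * ((a * (w%:R * uinf)) ^+ 2 * (1 + 8 * eta) + 4 * n0%:R * a * (a * (w%:R * uinf))).
    by rewrite au expr1n !mulr1 mul1r.
  by ring.
rewrite q1 in h1; rewrite q2 in h2.
have na : 4 * n0%:R * a <= delta / 2.
  rewrite ler_pdivrMr ?mulr_gt0 //; move: wp; rewrite ler_pdivrMr ?mulr_gt0 //.
  by lra.
have : Cn N * (14 * eta + 4 * n0%:R * a) <= Cn N * delta by rewrite ler_wpM2l ?(ltW CN) //; lra.
by lra.
Qed.

Lemma ren_lo k m r : all (leq (p * k)) m -> ren k (m ++ r) = ren k r.
Proof.
move=> am; rewrite /ren filter_cat count_cat.
have -> : seq.filter (ltn^~ (p * k)%N) m = [::].
  apply/eqP; rewrite -(negbK (_ == _)) -has_filter -all_predC.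
  by apply: sub_all am => x; rewrite /= -leqNgt.
rewrite (_ : count (ltn^~ (p * k)%N) m = 0%N) //; apply/eqP; rewrite -leqn0 leqNgt -has_count.
by rewrite -all_predC; apply: sub_all am => x; rewrite /= -leqNgt.
Qed.

Lemma ren_hi k m m' r : size m' = size m -> sumn m' = sumn m ->
  all (ltn^~ (p * k)%N) m -> all (ltn^~ (p * k)%N) m' -> ren k (m' ++ r) = ren k (m ++ r).
Proof.
move=> sm su am am'; rewrite /ren !filter_cat !count_cat !sumn_cat.
have e (t : seq nat) : all (ltn^~ (p * k)%N) t -> seq.filter (ltn^~ (p * k)%N) t = t by move/all_filterP.
by rewrite -!size_filter (e m) // (e m') // su sm.
Qed.

Lemma bb_sumn m m' r : size m' = size m -> bb (m ++ r) * bb (m' ++ r) != 0 -> sumn m' = sumn m.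
Proof.
move=> sm; rewrite mulf_eq0 negb_or => /andP[/bb_homog h1 /bb_homog h2].
move: h1 h2; rewrite !sumn_cat !size_cat sm => h1 h2; apply/eqP.
by rewrite -(eqn_add2r (sumn r)) h1 h2.
Qed.

Lemma sub_all_leq k k' m : (k <= k')%N -> all (leq (p * k')) m -> all (leq (p * k)) m.
Proof.
by move=> kk; apply: sub_all => x /= h; rewrite (leq_trans _ h) // leq_mul2l kk orbT.
Qed.

Lemma sub_all_ltn k k' m : (k <= k')%N -> all (ltn^~ (p * k)%N) m -> all (ltn^~ (p * k')%N) m.
Proof.
by move=> kk; apply: sub_all => x /= h; rewrite (leq_trans h) // leq_mul2l kk orbT.
Qed.

(** Inserting the two window densities costs |1 - Yw Yw|, small in mean square by [window_var],
    against products of occupation numbers with bounded second moments. The case of empty words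
    gives the same expansion for the normalization. *)
Lemma renewal_insertion n (delta : R) : 0 < delta -> exists w D, (0 < w)%N /\
  forall tau N m m' kL kR, (forall k, 0 <= tau k <= 1) -> (size m == n) || (size m == 0)%N ->
  size m' = size m -> (n <= N)%N -> (D <= kL)%N -> (kL + w + D <= N)%N -> (D <= kR)%N -> (kR + w + D <= N)%N ->
  all (leq (p * (kL + w))) m -> all (leq (p * (kL + w))) m' ->
  all (ltn^~ (p * kR)%N) m -> all (ltn^~ (p * kR)%N) m' ->
  `|GT tau N m m' one - (w%:R * uinf)^-1 ^+ 2 * \sum_(i < w) \sum_(j < w)
     GT tau N m m' (fun r => (ren (kL + i) (m ++ r))%:R * (ren (kR + j) (m ++ r))%:R)| <= delta * Cn N.
Proof.
move=> d0; have [B1 B1p hB1] := mom_prod (n + n); have [B2 B2p hB2] := mom_prod 0.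
pose B := B1 + B2; have Bp : 0 < B by rewrite addr_gt0.
have hB N ms : (size ms == n + n)%N || (size ms == 0)%N -> EX N (cnt ms) <= B * Cn N.
  have C0 := Cn_ge0 p g2 N; case/orP => /eqP h.
    by apply: (le_trans (hB1 N _ h)); rewrite ler_wpM2r // lerDl ltW.
  by apply: (le_trans (hB2 N _ h)); rewrite ler_wpM2r // lerDr ltW.
(* Weight in [am_gm]: the moments of order 2n then take delta / 2, and V is chosen so that the two
   window variances take the other half. *)
pose t := delta / B; have t0 : 0 < t by rewrite divr_gt0.
pose V := t^-1 * (2 + 2 / uinf ^+ 2).
have V0 : 0 < V by rewrite mulr_gt0 ?invr_gt0 // addr_gt0 // divr_gt0 // exprn_gt0.
have [w [D [w0 hv]]] := window_var (divr_gt0 d0 V0).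
exists w, D; split=> // tau N m m' kL kR t01 sm sm' nN DkL kLN DkR kRN aL aL' aR aR'.
have mN : (size m <= N)%N by case/orP: sm => /eqP ->.
set a := (w%:R * uinf)^-1.
pose Z s := `|1 - Yw kL w s * Yw kR w s|.
have Zsym : symfun Z by move=> s s' ss; rewrite /Z !(Yw_sym _ _ ss).
have -> : GT tau N m m' one - a ^+ 2 * \sum_(i < w) \sum_(j < w)
     GT tau N m m' (fun r => (ren (kL + i) (m ++ r))%:R * (ren (kR + j) (m ++ r))%:R) =
  GT tau N m m' (fun r => 1 - Yw kL w (m ++ r) * Yw kR w (m ++ r)).
  under [\sum_(i < w) _]eq_bigr => i _ do rewrite -GT_sum.
  rewrite -GT_sum -GTZ -GTB; apply: eq_GT => r _; rewrite /Yw -/a; congr (1 - _).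
  rewrite mulrACA -expr2; congr (_ * _); rewrite mulr_suml; apply: eq_bigr => i _.
  by rewrite mulr_sumr.
(* The windows lie to the left and to the right of all marked letters and both words have the same
   momentum, so the indicators cannot distinguish [m] from [m']. *)
have Zeq r : bb (m ++ r) * bb (m' ++ r) != 0 -> Z (m' ++ r) = Z (m ++ r).
  move=> h; have su := bb_sumn sm' h; rewrite /Z; congr (`| 1 - _ * _ |).
    rewrite /Yw; congr (_ * _); apply: eq_bigr => i _; rewrite !ren_lo //.
      by apply: sub_all_leq aL; rewrite leq_add2l ltnW.
    by apply: sub_all_leq aL'; rewrite leq_add2l ltnW.
  rewrite /Yw; congr (_ * _); apply: eq_bigr => i _; rewrite (@ren_hi _ m m') //.
    by apply: sub_all_ltn aR; rewrite leq_addr.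
  by apply: sub_all_ltn aR'; rewrite leq_addr.
apply: le_trans (@GT_bound tau N m m' _ Z t01 _ _ Zsym _ _) _ => //.
    by move=> s; exact: normr_ge0.
  by move=> r h; rewrite Zeq // /Z lexx.
suff H m1 : size m1 = size m -> EX N (fun s => cnt m1 s * Z s) <= delta * Cn N.
  by have := H _ erefl; have := H _ sm'; lra.
move=> s1.
apply: (@le_trans _ _ (EX N (fun s => t / 2 * cnt (m1 ++ m1) s +
    t^-1 * ((1 - Yw kL w s) ^+ 2 + (uinf^-1) ^+ 2 * (1 - Yw kR w s) ^+ 2)))).
  apply: EX_le => s _ _ _; rewrite big_cat /=; set x := \prod_(k <- m1) _.
  have /andP[yL0 yL1] := Yw_bd kL s w0.
  set yL := Yw kL w s in yL0 yL1 *; set yR := Yw kR w s.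
  have zz : Z s ^+ 2 <= 2 * ((1 - yL) ^+ 2 + (uinf^-1) ^+ 2 * (1 - yR) ^+ 2).
    rewrite /Z real_normK ?num_real // -/yL -/yR.
    have -> : 1 - yL * yR = (1 - yL) + yL * (1 - yR) by ring.
    have h1 : yL ^+ 2 * (1 - yR) ^+ 2 <= (uinf^-1) ^+ 2 * (1 - yR) ^+ 2.
      by rewrite ler_wpM2r ?sqr_ge0 // lerXn2r // nnegrE // invr_ge0 ltW.
    by rewrite -exprMn in h1; exact: sq_sum_le.
  have am : x * Z s <= t / 2 * (x * x) + t^-1 / 2 * Z s ^+ 2.
    exact: am_gm.
  apply: (le_trans am); rewrite lerD2l.
  have ti : 0 <= t^-1 by rewrite invr_ge0 ltW.
  apply: le_trans (_ : t^-1 / 2 * (2 * ((1 - yL) ^+ 2 + (uinf^-1) ^+ 2 * (1 - yR) ^+ 2)) <= _).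
    by rewrite ler_wpM2l // divr_ge0.
  by rewrite mulrA divfK.
rewrite EXD !EXZ EXD EXZ.
have b1 : t / 2 * EX N (cnt (m1 ++ m1)) <= delta / 2 * Cn N.
  have -> : delta / 2 * Cn N = t / 2 * (B * Cn N) by rewrite /t; field; rewrite gt_eqF.
  by apply: ler_wpM2l; [rewrite divr_ge0 // ltW|apply: hB; rewrite size_cat s1; case/orP: sm => /eqP ->; rewrite eqxx ?orbT].
have b2 := hv N kL DkL kLN; have b3 := hv N kR DkR kRN.
have b4 : t^-1 * (EX N (fun s => (1 - Yw kL w s) ^+ 2) + uinf^-1 ^+ 2 * EX N (fun s => (1 - Yw kR w s) ^+ 2))
   <= delta / 2 * Cn N.
  have -> : delta / 2 * Cn N = t^-1 * ((1 + uinf^-1 ^+ 2) * (delta / V * Cn N)).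
    rewrite /V; field; rewrite !gt_eqF //.
    by rewrite addr_gt0 // mulr_gt0 // exprn_gt0.
  rewrite ler_wpM2l ?invr_ge0 ?(ltW t0) // mulrDl mul1r lerD // ler_wpM2l ?sqr_ge0 //.
by lra.
Qed.

Lemma GT_factor tau N k k' m m' : size m' = size m -> (k + size m <= k')%N -> (k' <= N)%N ->
  all (leq (p * k)) m -> all (leq (p * k)) m' ->
  all (ltn^~ (p * k')%N) m -> all (ltn^~ (p * k')%N) m' ->
  GT tau N m m' (fun r => (ren k (m ++ r))%:R * (ren k' (m ++ r))%:R) =
  CT tau k * GT (fun x => tau (p * k + x)%N) (k' - k) [seq (x - p * k)%N | x <- m]
    [seq (x - p * k)%N | x <- m'] one * CT (fun x => tau (p * k' + x)%N) (N - k').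
Proof.
move=> sm kk kN am am' bm bm'.
have lf : leftfun p k' (fun r => (ren k (m ++ r))%:R : R).
  have kk' : (k <= k')%N by nlia.
  by split=> [s t st|r]; rewrite !ren_lo // ?(ren_sym p _ st) // ren_filter.
rewrite -GT_left // -GT_right //; last by nlia.
by apply: eq_GT => r _; rewrite mulrC.
Qed.

Definition GN N m m' : R := GT one N m m' one / Cn N.

Lemma GN_bound n : exists2 B, 0 < B & forall N m m', size m = n -> size m' = n -> (n <= N)%N ->
  `|GN N m m'| <= B.
Proof.
have [B Bp h] := GT_bound1 n; exists B => // N m m' sm sm' nN.
rewrite /GN normrM normfV (ger0_norm (ltW (Cn_gt0 N))) ler_pdivrMr ?Cn_gt0 // h //.
by move=> _; rewrite ler01 lexx.
Qed.

Lemma shift_map c (m : seq nat) k : [seq (x - p * (k + c))%N | x <- [seq (x + p * c)%N | x <- m]] =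
  [seq (x - p * k)%N | x <- m].
Proof.
by rewrite -map_comp; apply: eq_map => x /=; rewrite mulnDr subnDr.
Qed.

(** After insertion of the windows both density matrices are sums over the same inner blocks
    [H i j], which see neither the size of the system nor the displacement. The prefactors are
    ratios u u / u of values close to [uinf]. *)
Lemma GN_shift_close n (e : R) : (0 < n)%N -> 0 < e -> exists D, forall N N' c m m',
  size m = n -> size m' = n -> all (leq (p * D)) m -> all (leq (p * D)) m' ->
  all (fun x => x + p * D < p * N)%N m -> all (fun x => x + p * D < p * N)%N m' ->
  all (fun x => x + p * (c + D) < p * N')%N m -> all (fun x => x + p * (c + D) < p * N')%N m' ->
  `|GN N m m' - GN N' [seq (x + p * c)%N | x <- m] [seq (x + p * c)%N | x <- m']| <= e.
Proof.
move=> n0 e0; have [B Bp hB] := GT_bound1 n.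
pose eta := Num.min 8^-1 (e * uinf / (32 * B)).
have eta0 : 0 < eta by rewrite lt_min invr_gt0 ltr0n /= divr_gt0 ?mulr_gt0.
have eta8 : 0 < eta <= 8^-1 by rewrite eta0 ge_min lexx.
have etad : 8 * eta * B <= e * uinf / 4.
  have : eta <= e * uinf / (32 * B) by rewrite ge_min lexx orbT.
  rewrite ler_pdivlMr ?mulr_gt0 //; lra.
have e4 : 0 < e / 4 by rewrite divr_gt0.
have [n1 hn] := u_rel eta0; have [w [D0 [w0 hi]]] := renewal_insertion n e4.
exists (D0 + n1 + w + n)%N => N N' c m m' sm sm' am am' bm bm' cm cm'.
set D := (D0 + n1 + w + n)%N in am am' bm bm' cm cm'.
have [x0 [x0D x0N x0N']] : exists x, [/\ (p * D <= x)%N, (x + p * D < p * N)%N & (x + p * (c + D) < p * N')%N].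
  case: m sm am bm cm {am' bm' cm' sm' m'} => [|x m] /= sm; first by rewrite -sm in n0.
  by move=> /andP[h1 _] /andP[h2 _] /andP[h3 _]; exists x.
have ND : (2 * D < N)%N.
  rewrite -(ltn_pmul2l p_gt0); apply: leq_ltn_trans x0N; by rewrite mul2n -addnn mulnDr leq_add2r.
have ND' : (c + 2 * D < N')%N.
  rewrite -(ltn_pmul2l p_gt0); apply: leq_ltn_trans x0N'.
  by rewrite mul2n -addnn addnA mulnDr addnC leq_add2r.
have [kR [R1 R2 R3 R4]] := windows_ex ND ND'.
pose kL := (D0 + n1)%N; have kLE : kL = (D0 + n1)%N by [].
have lo : all (leq (p * (kL + w))) m by apply: sub_all_leq am; rewrite leq_addr.
have lo' : all (leq (p * (kL + w))) m' by apply: sub_all_leq am'; rewrite leq_addr.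
clearbody kL.
have hi_ (t : seq nat) : all (fun x => x + p * D < p * N)%N t ->
    all (fun x => x + p * (c + D) < p * N')%N t -> all (ltn^~ (p * kR)%N) t.
  move=> /allP h1 /allP h2; apply/allP => x xt; have := h1 x xt; have := h2 x xt.
  case: R4 => [<- _|<- + _]; first by apply: lt_cut; rewrite leq_addr.
  by rewrite -addnA; apply: lt_cut; rewrite leq_add2l leq_addr.
have up := hi_ m bm cm; have up' := hi_ m' bm' cm'.
clear hi_ am am' bm bm' cm cm' x0 x0D x0N x0N'.
set s := [seq (x + p * c)%N | x <- m]; set s' := [seq (x + p * c)%N | x <- m'].
have ss : size s = n by rewrite size_map. have ss' : size s' = n by rewrite size_map.
have shl (t : seq nat) k : all (leq (p * k)) t -> all (leq (p * (k + c))) [seq (x + p * c)%N | x <- t].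
  by rewrite all_map; apply: sub_all => x /= h; rewrite mulnDr leq_add2r.
have shr (t : seq nat) k : all (ltn^~ (p * k)%N) t -> all (ltn^~ (p * (k + c))%N) [seq (x + p * c)%N | x <- t].
  by rewrite all_map; apply: sub_all => x /= h; rewrite mulnDr ltn_add2r.
have nN : (n <= N)%N by plia.
have nN' : (n <= N')%N by plia.
have sm2 : (size m == n) || (size m == 0)%N by rewrite sm eqxx.
have ss2 : (size s == n) || (size s == 0)%N by rewrite ss eqxx.
have I1 := hi one N m m' kL kR one01 sm2 (etrans sm' (esym sm)) nN ltac:(plia) ltac:(plia) ltac:(plia) ltac:(plia) lo lo' up up'.
have I2 := hi one N' s s' (kL + c)%N (kR + c)%N one01 ss2 (etrans ss' (esym ss)) nN' ltac:(plia) ltac:(plia) ltac:(plia) ltac:(plia)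
  ltac:(by rewrite addnAC; exact: shl) ltac:(by rewrite addnAC; exact: shl) (shr _ _ up) (shr _ _ up').
pose H (i j : 'I_w) := r0 ^+ (kR + j - (kL + i)) * GT one (kR + j - (kL + i))
   [seq (x - p * (kL + i))%N | x <- m] [seq (x - p * (kL + i))%N | x <- m'] one.
have HB i j : `|H i j| <= B.
  have iw := ltn_ord i; have jw := ltn_ord j.
  rewrite /H normrM ger0_norm ?exprn_ge0 //; last by case/andP: r0_bd => /ltW.
  set L := (kR + j - (kL + i))%N.
  apply: (@le_trans _ _ (r0 ^+ L * (B * Cn L))).
    rewrite ler_wpM2l ?exprn_ge0 //; first by case/andP: r0_bd => /ltW.
    by apply: (hB _ _ _ _ one01); rewrite ?size_map // /L; plia.
  have /andP[_ u1] := u_bd L; have := ler_wpM2l (ltW Bp) u1; lra.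
have F1 (i j : 'I_w) : GT one N m m' (fun r => (ren (kL + i) (m ++ r))%:R * (ren (kR + j) (m ++ r))%:R) =
   Cn N * (u (kL + i)%N * u (N - (kR + j))%N / u N) * H i j.
  have iw := ltn_ord i; have jw := ltn_ord j.
  rewrite GT_factor ?sm ?sm' //; first last.
  - by apply: sub_all_ltn up'; rewrite leq_addr.
  - by apply: sub_all_ltn up; rewrite leq_addr.
  - by apply: sub_all_leq lo'; rewrite leq_add2l ltnW.
  - by apply: sub_all_leq lo; rewrite leq_add2l ltnW.
  - by plia.
  - by plia.
  rewrite mulrAC -/(Cn (kL + i)) -/(Cn (N - (kR + j))) (Cn_split (N := N)); last by plia.
  rewrite (_ : N - (kL + i) - (N - (kR + j)) = kR + j - (kL + i))%N; last by plia.
  by rewrite /H -!mulrA.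
have F2 (i j : 'I_w) : GT one N' s s' (fun r => (ren (kL + c + i) (s ++ r))%:R * (ren (kR + c + j) (s ++ r))%:R) =
   Cn N' * (u (kL + i + c)%N * u (N' - (kR + j + c))%N / u N') * H i j.
  have iw := ltn_ord i; have jw := ltn_ord j.
  rewrite !(addnAC _ c) GT_factor ?ss ?ss' //; first last.
  - by apply: shr; apply: sub_all_ltn up'; rewrite leq_addr.
  - by apply: shr; apply: sub_all_ltn up; rewrite leq_addr.
  - by apply: shl; apply: sub_all_leq lo'; rewrite leq_add2l ltnW.
  - by apply: shl; apply: sub_all_leq lo; rewrite leq_add2l ltnW.
  - by plia.
  - by plia.
  rewrite !shift_map mulrAC -/(Cn (kL + i + c)) -/(Cn (N' - (kR + j + c))) (Cn_split (N := N'));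
    last by plia.
  rewrite (_ : N' - (kL + i + c) - (N' - (kR + j + c)) = kR + j - (kL + i))%N; last by plia.
  rewrite (_ : kR + j + c - (kL + i + c) = kR + j - (kL + i))%N; last by rewrite subnDr.
  by rewrite /H -!mulrA.
set a := (w%:R * uinf)^-1 in I1 I2.
pose v1 (i j : 'I_w) := u (kL + i)%N * u (N - (kR + j))%N / u N.
pose v2 (i j : 'I_w) := u (kL + i + c)%N * u (N' - (kR + j + c))%N / u N'.
have J (K : nat) (t t' : seq nat) (v : 'I_w -> 'I_w -> R) :
   `|GT one K t t' one - a ^+ 2 * \sum_(i < w) \sum_(j < w) Cn K * v i j * H i j| <= e / 4 * Cn K ->
   `|GN K t t' - a ^+ 2 * \sum_(i < w) \sum_(j < w) v i j * H i j| <= e / 4.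
  have C0 := Cn_gt0 K.
  have -> : \sum_(i < w) \sum_(j < w) Cn K * v i j * H i j = Cn K * \sum_(i < w) \sum_(j < w) v i j * H i j.
    rewrite mulr_sumr; apply: eq_bigr => i _; rewrite mulr_sumr; apply: eq_bigr => j _.
    by rewrite mulrA.
  set S := \sum_(i < w) _; move=> h.
  have -> : GN K t t' - a ^+ 2 * S = (GT one K t t' one - a ^+ 2 * (Cn K * S)) / Cn K.
    by rewrite /GN; field; rewrite gt_eqF.
  by rewrite normrM normfV (ger0_norm (ltW C0)) ler_pdivrMr.
have J1 : `|GN N m m' - a ^+ 2 * \sum_(i < w) \sum_(j < w) v1 i j * H i j| <= e / 4.
  by apply: J; under eq_bigr => i _ do under eq_bigr => j _ do rewrite -F1.
have J2 : `|GN N' s s' - a ^+ 2 * \sum_(i < w) \sum_(j < w) v2 i j * H i j| <= e / 4.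
  by apply: J; under eq_bigr => i _ do under eq_bigr => j _ do rewrite -F2.
have J3 : `|a ^+ 2 * \sum_(i < w) \sum_(j < w) v1 i j * H i j -
    a ^+ 2 * \sum_(i < w) \sum_(j < w) v2 i j * H i j| <= e / 4.
  rewrite -mulrBr -sumrB normrM ger0_norm ?sqr_ge0 //.
  apply: (@le_trans _ _ (a ^+ 2 * (w%:R * (w%:R * (8 * eta * uinf * B))))).
    rewrite ler_wpM2l ?sqr_ge0 // (le_trans (ler_norm_sum _ _ _)) // -sum_cst; apply: ler_sum => i _.
    rewrite -sumrB (le_trans (ler_norm_sum _ _ _)) // -sum_cst; apply: ler_sum => j _.
    have iw := ltn_ord i; have jw := ltn_ord j.
    rewrite -mulrBl normrM; apply: ler_pM => //.
    have r1 : uinf * (1 - 3 * eta) <= v1 i j <= uinf * (1 + 4 * eta).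
      by apply: ratio_bd => //; apply: hn; plia.
    have r2 : uinf * (1 - 3 * eta) <= v2 i j <= uinf * (1 + 4 * eta).
      by apply: ratio_bd => //; apply: hn; plia.
    apply: dist_band r1 r2 _.
    rewrite (_ : _ - _ = 7 * (eta * uinf)); last by ring.
    by rewrite -mulrA ler_wpM2r ?ler_nat // mulr_ge0 ?(ltW eta0) ?(ltW uinf_gt0).
  have wp : 0 < w%:R :> R by rewrite ltr0n.
  have -> : a ^+ 2 * (w%:R * (w%:R * (8 * eta * uinf * B))) = 8 * eta * B / uinf.
    by rewrite /a; field; rewrite !gt_eqF.
  by rewrite ler_pdivrMr //; lra.
move: J1 J2 J3; rewrite !ler_norml; lra.
Qed.

Lemma tw_ge (sigma : nat -> R) r : (forall k, 0 <= sigma k <= 1) ->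
  0 <= tw sigma r <= 1 /\ 1 - tw sigma r <= \sum_(x <- r) (1 - sigma x).
Proof.
move=> s01; rewrite /tw; elim: r => [|k r [IH1 IH2]]; first by rewrite !big_nil; split; lra.
by rewrite !big_cons; have := s01 k; split; nra.
Qed.

(** A word loses at most the sum of the defects 1 - sigma of its letters, and the sum over the
    letters acts as one more marked particle; hence the moment of order n + 1. *)
Lemma GT_tau n : exists2 B, 0 < B & forall (sigma : nat -> R) M m m' S, (forall k, 0 <= sigma k <= 1) ->
  size m = n -> size m' = n -> (n <= M)%N -> \sum_(x < p * M) (1 - sigma x) <= S ->
  `|GT sigma M m m' one - GT one M m m' one| <= B * S * Cn M.
Proof.
have [B Bp hB] := mom_prod n.+1; exists B => // sigma M m m' S s01 sm sm' nM hS.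
have s1 k : 0 <= 1 - sigma k by have /andP[_] := s01 k; rewrite subr_ge0.
pose Z (s : seq nat) := \sum_(x <- s) (1 - sigma x).
have Zsym : symfun Z by move=> s t st; apply: perm_big.
have Z0 s : 0 <= Z s by apply: sumr_ge0.
have -> : GT sigma M m m' one - GT one M m m' one = GT one M m m' (fun r => tw sigma r - 1).
  rewrite GTB; congr (_ - _); rewrite /GT; congr (_ / _); apply: eq_nsum => r _ _.
  by rewrite tw1 !mulr1.
apply: le_trans (@GT_bound one M m m' _ Z one01 _ _ Zsym Z0 _) _; rewrite ?sm ?sm' //.
  move=> r _; have [/andP[_ t1] t2] := tw_ge r s01.
  rewrite ler0_norm ?subr_le0 // opprB /Z !big_cat /=.
  by split; apply: (le_trans t2); rewrite lerDr sumr_ge0.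
suff H m1 : size m1 = n -> EX M (fun s => cnt m1 s * Z s) <= B * S * Cn M.
  by have := H _ sm; have := H _ sm'; lra.
move=> sm1; have C0 := Cn_ge0 p g2 M.
have -> : EX M (fun s => cnt m1 s * Z s) = \sum_(x < p * M) (1 - sigma x) * EX M (cnt (nat_of_ord x :: m1)).
  under [RHS]eq_bigr => x _ do rewrite -EXZ.
  rewrite -EX_sum; apply: eq_EX => s ss as_ _.
  rewrite /Z (sum_seq_count _ as_) mulr_sumr; apply: eq_bigr => x _.
  by rewrite big_cons; ring.
apply: (@le_trans _ _ (\sum_(x < p * M) (1 - sigma x) * (B * Cn M))).
  by apply: ler_sum => x _; rewrite ler_wpM2l // hB //= sm1.
rewrite -mulr_suml (_ : B * S * Cn M = S * (B * Cn M)); last by ring.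
by rewrite ler_wpM2r // mulr_ge0 // ltW.
Qed.

Lemma geo_two (c0 q : R) (tau : nat -> R) N k L D : 0 <= c0 -> 0 <= q < 1 ->
  (forall x, (x < p * N)%N -> 1 - tau x <= c0 * (q ^+ x + q ^+ (p * N - x))) ->
  (D <= k)%N -> (k + L + D <= N)%N ->
  \sum_(x < p * L) (1 - tau (p * k + x)%N) <= c0 * (2 * q ^+ D / (1 - q)).
Proof.
move=> c00 q01 ht Dk kN; have /andP[q0 q1] := q01.
have pk : (D <= p * k)%N by rewrite (leq_trans Dk) // leq_pmull.
have kE : (p * k + p * L + p * D <= p * N)%N by rewrite -!mulnDr leq_mul2l kN orbT.
have pD : (D <= p * D)%N by rewrite leq_pmull.
apply: (@le_trans _ _ (\sum_(x < p * L) c0 * (q ^+ D * q ^+ x + q ^+ D * q ^+ (p * L - x.+1)))).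
  apply: ler_sum => x _; have xL := ltn_ord x.
  apply: (le_trans (ht _ _)); first exact: geo_idx1 kE xL.
  rewrite ler_wpM2l // -!exprD; apply: lerD; rewrite ler_wiXn2l ?(ltW q1) //.
    by rewrite leq_add2r.
  exact: geo_idx2 kE xL pD.
rewrite -mulr_sumr ler_wpM2l // big_split /= -!mulr_sumr -mulrDr.
rewrite -mulrA mulrCA ler_wpM2l ?exprn_ge0 //.
have g := geo_sum_le (p * L) q01.
have -> : \sum_(i < p * L) q ^+ (p * L - i.+1) = \sum_(i < p * L) q ^+ i.
  by rewrite (reindex_inj rev_ord_inj) /=; apply: eq_bigr => i _; rewrite subnSK // subKn // ltnW.
by lra.
Qed.

(** Jensen's inequality: the weight is at least exp(-X) with X the sum of (1 - tau) / tmin over the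
    letters. X has bounded mean, because the defects are summable from both edges and occupation
    numbers have bounded means. *)
Lemma CT_lower (c0 q tmin : R) : 0 <= c0 -> 0 <= q < 1 -> 0 < tmin -> exists2 ct, 0 < ct &
  forall tau N, (forall k, 0 <= tau k <= 1) -> (forall k, (k < p * N)%N -> tmin <= tau k) ->
  (forall x, (x < p * N)%N -> 1 - tau x <= c0 * (q ^+ x + q ^+ (p * N - x))) ->
  ct * Cn N <= CT tau N.
Proof.
move=> c00 q01 t0; have [B Bp hB] := mom_prod 1.
(* Bound on the mean of X; the exponential is replaced by its tangent at -a. *)
pose a := c0 * (2 * q ^+ 0 / (1 - q)) * B / tmin.
exists (expR (- a)) => [|tau N t01 ht hq]; first exact: expR_gt0.
have C0 := Cn_ge0 p g2 N.
have CTE : CT tau N = EX N (tw tau).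
  by rewrite /CT /EX /GT subn0; congr (_ / _); apply: eq_nsum => s _ _; rewrite tw1 mulr1 expr2.
pose X (s : seq nat) := \sum_(x <- s) (1 - tau x) / tmin.
have EXX : EX N X <= a * Cn N.
  have -> : EX N X = \sum_(x < p * N) ((1 - tau x) / tmin) * EX N (cnt [:: nat_of_ord x]).
    under [RHS]eq_bigr => x _ do rewrite -EXZ.
    rewrite -EX_sum; apply: eq_EX => s ss as_ _; rewrite /X (sum_seq_count _ as_).
    by apply: eq_bigr => x _; rewrite big_seq1 mulrC.
  apply: (@le_trans _ _ (\sum_(x < p * N) ((1 - tau x) / tmin) * (B * Cn N))).
    apply: ler_sum => x _; rewrite ler_wpM2l // ?hB //.
    by rewrite divr_ge0 ?(ltW t0) // subr_ge0; have /andP[] := t01 x.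
  rewrite -mulr_suml -mulr_suml.
  have g : \sum_(x < p * N) (1 - tau x) <= c0 * (2 * q ^+ 0 / (1 - q)).
    have := @geo_two c0 q tau N 0 N 0 c00 q01 hq (leq0n _); rewrite add0n addn0 muln0 => /(_ (leqnn _)).
    by under eq_bigr => x _ do rewrite add0n.
  have -> : a * Cn N = c0 * (2 * q ^+ 0 / (1 - q)) / tmin * (B * Cn N) by rewrite /a; ring.
  apply: ler_wpM2r; first by rewrite mulr_ge0 // ltW.
  by apply: ler_wpM2r => //; rewrite invr_ge0 ltW.
rewrite CTE; apply: (@le_trans _ _ (EX N (fun s => expR (- a) * (1 + a) + (- expR (- a)) * X s))).
  rewrite EXD !EXZ.
  have -> : EX N (fun=> 1 + a) = (1 + a) * Cn N.
    by rewrite -EX1 -EXZ; apply: eq_EX => s _ _ _; rewrite mulr1.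
  have := ler_wpM2l (expR_ge0 (- a)) EXX; lra.
apply: EX_le => s ss as_ _.
have e1 (x : R) : tmin <= x <= 1 -> expR (- ((1 - x) / tmin)) <= x.
  move=> /andP[x1 x2]; have x0 : 0 < x by exact: lt_le_trans x1.
  rewrite expRN -[X in _ <= X]invrK lef_pV2 ?posrE ?invr_gt0 ?expR_gt0 //.
  apply: le_trans (expR_ge1Dx _).
  have -> : x^-1 = 1 + (1 - x) / x by field; rewrite gt_eqF.
  by rewrite lerD2l ler_wpM2l ?subr_ge0 // lef_pV2 ?posrE.
apply: (@le_trans _ _ (expR (- X s))).
  have -> : - X s = - a + (- (X s - a)) by ring.
  rewrite expRD; have := ler_wpM2l (expR_ge0 (- a)) (expR_ge1Dx (- (X s - a))); lra.
rewrite /X -sumrN expR_sum /tw !big_seq; apply: ler_prod => x xs.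
rewrite expR_ge0 /= e1 // ht; last exact: (allP as_ x xs).
by have /andP[] := t01 x.
Qed.

(** With windows between the edges and the marked letters, the outer factors depend on the domain
    but are common to the density matrix and to the normalization. In the inner blocks the masses
    are almost 1, so there the ratio is that of the full cylinder, to which [GN_shift_close]
    applies. *)
Lemma tau_bulk n (e c0 q ct : R) : (0 < n)%N -> 0 < e -> 0 <= c0 -> 0 <= q < 1 -> 0 < ct ->
  exists D, forall tau N m m', (forall k, 0 <= tau k <= 1) ->
  (forall x, (x < p * N)%N -> 1 - tau x <= c0 * (q ^+ x + q ^+ (p * N - x))) ->
  ct * Cn N <= CT tau N -> size m = n -> size m' = n ->
  all (leq (p * D)) m -> all (leq (p * D)) m' ->
  all (fun x => x + p * D < p * N)%N m -> all (fun x => x + p * D < p * N)%N m' ->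
  `|GT tau N m m' one / CT tau N - GN N m m'| <= e.
Proof.
move=> n0 e0 c00 q01 ct0; have /andP[q0 q1] := q01.
have [Bg Bg0 hBg] := GN_bound n; have [B Bp hB] := GT_tau n; have [B' Bp' hB'] := GT_tau 0.
pose delta := Num.min 1 (e * ct / (2 * (1 + Bg))).
have Bg1 : 0 < 1 + Bg by rewrite addr_gt0.
have d0 : 0 < delta by rewrite lt_min ltr01 /= divr_gt0 ?mulr_gt0.
have d1 : delta <= 1 by rewrite ge_min lexx.
have d2 : delta * (1 + Bg) <= e * ct / 2.
  have : delta <= e * ct / (2 * (1 + Bg)) by rewrite ge_min lexx orbT.
  by rewrite ler_pdivlMr ?mulr_gt0 //; lra.
(* The final division is by a normalization that is at least [ct * Cn N]. The inner blocks
   contribute 4 e2 and the two insertions delta (1 + Bg), half of the error each. *)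
pose e2 := e * ct / 8; have e20 : 0 < e2 by rewrite divr_gt0 ?mulr_gt0.
pose S := Num.min (2^-1 / B') (e2 / 2 / (B + Bg * B')).
have BB : 0 < B + Bg * B' by rewrite addr_gt0 // mulr_gt0.
have S0 : 0 < S.
  have h2 : 0 < (2 : R)^-1 by rewrite invr_gt0.
  by rewrite lt_min; apply/andP; split; [exact: divr_gt0 h2 Bp'|exact: divr_gt0 (mulr_gt0 e20 h2) BB].
have S1 : B' * S <= 2^-1.
  have : S <= 2^-1 / B' by rewrite ge_min lexx.
  by rewrite ler_pdivlMr // mulrC.
have S2 : B * S + Bg * (B' * S) <= e2 / 2.
  have : S <= e2 / 2 / (B + Bg * B') by rewrite ge_min lexx orbT.
  by rewrite ler_pdivlMr //; lra.
have [D7 h7] := @GN_shift_close n (e2 / 2) n0 (divr_gt0 e20 (ltr0n _ 2)).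
have [w [D0 [w0 hi]]] := renewal_insertion n d0.
have qS : 0 < S * (1 - q) / (2 * (c0 + 1)) by rewrite divr_gt0 ?mulr_gt0 ?subr_gt0 // ltr_wpDl.
have [D1 hD1] := geo_small q01 qS.
pose kL := (D0 + D1)%N.
have hS : c0 * (2 * q ^+ kL / (1 - q)) <= S.
  have := hD1 kL (leq_addl _ _); rewrite ler_pdivlMr; last by rewrite mulr_gt0 // ltr_wpDl.
  have qk : 0 <= q ^+ kL by rewrite exprn_ge0.
  move=> h; rewrite mulrA ler_pdivrMr ?subr_gt0 //; lra.
exists (kL + w + D7 + n)%N => tau N m m' t01 ht hct sm sm' am am' bm bm'.
set D := (kL + w + D7 + n)%N in am am' bm bm'.
have ND : (D + D < N)%N.
  case: m sm am bm {am' bm' sm' m'} => [|x m] /= sm; first by rewrite -sm in n0.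
  move=> /andP[h1 _] /andP[h2 _].
  rewrite -(ltn_pmul2l p_gt0); apply: leq_ltn_trans h2; by rewrite mulnDr leq_add2r.
have kLE : (D0 <= kL)%N by rewrite leq_addr.
move: kL hS @D am am' bm bm' ND kLE => kL hS D am am' bm bm' ND kLE.
have [kR kRE] : exists kR, (kR + (kL + w))%N = N 
  by exists (N - (kL + w))%N; rewrite subnK //; rewrite /D in ND; plia.
have lo2 (t : seq nat) : all (leq (p * D)) t -> all (leq (p * (kL + w + D7))) t.
  by apply: sub_all_leq; rewrite leq_addr.
have up2 (t : seq nat) : all (fun x => x + p * D < p * N)%N t -> all (fun x => x + p * D7 < p * kR)%N t.
  apply: sub_all => x /=; rewrite -kRE => h; apply: (@lt_cut p _ kR (kL + w) (kL + w)) => //.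
  apply: leq_ltn_trans h; rewrite -addnA -mulnDr leq_add2l leq_mul2l /D; apply/orP; right; plia.
have lo := lo2 _ am; have lo' := lo2 _ am'; have up := up2 _ bm; have up' := up2 _ bm'.
have {}ND : (kL + w + D7 + n + (kL + w + D7 + n) < N)%N by [].
clear lo2 up2 am am' bm bm' D.
have upw (t : seq nat) : all (fun x => x + p * D7 < p * kR)%N t -> all (ltn^~ (p * kR)%N) t.
  by apply: sub_all => x /= h; apply: leq_ltn_trans h; rewrite leq_addr.
have low (t : seq nat) : all (leq (p * (kL + w + D7))) t -> all (leq (p * (kL + w))) t.
  by apply: sub_all_leq; rewrite leq_addr.
have nN : (n <= N)%N by plia.
have sm2 : (size m == n) || (size m == 0)%N by rewrite sm eqxx.
have C0 := Cn_gt0 N.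
have I1 := hi tau N m m' kL kR t01 sm2 (etrans sm' (esym sm)) nN ltac:(plia) ltac:(plia) ltac:(plia) ltac:(plia)
  (low _ lo) (low _ lo') (upw _ up) (upw _ up').
(* The normalization is expanded with the same windows, so that it can be compared term by term. *)
have I2 := hi tau N [::] [::] kL kR t01 (orbT _) erefl nN ltac:(plia) ltac:(plia) ltac:(plia) ltac:(plia) isT isT isT isT.
set a := (w%:R * uinf)^-1 in I1 I2.
pose sg (i : 'I_w) x := tau (p * (kL + i) + x)%N.
pose A (i : 'I_w) := CT tau (kL + i).
pose E (j : 'I_w) := CT (fun x => tau (p * (kR + j) + x)%N) (N - (kR + j)).
pose L (i j : 'I_w) := (kR + j - (kL + i))%N.
pose g := GN N m m'.
have gB : `|g| <= Bg by apply: hBg.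
have lw (t : seq nat) (i : 'I_w) : all (leq (p * (kL + w + D7))) t -> all (leq (p * (kL + i))) t.
  by apply: sub_all_leq; have := ltn_ord i; plia.
have uw (t : seq nat) (j : 'I_w) : all (fun x => x + p * D7 < p * kR)%N t -> all (ltn^~ (p * (kR + j))%N) t.
  by move=> /upw; apply: sub_all_ltn; rewrite leq_addr.
have t0 k : 0 <= tau k by have /andP[] := t01 k.
(* The error is first obtained relative to [Cn] of the inner block; S is so small that this is at
   most twice the mass [CT] of the block in the domain. *)
have key (i j : 'I_w) : `|GT (sg i) (L i j) [seq (x - p * (kL + i))%N | x <- m]
    [seq (x - p * (kL + i))%N | x <- m'] one - g * CT (sg i) (L i j)| <= 2 * e2 * CT (sg i) (L i j).
  have iw := ltn_ord i; have jw := ltn_ord j.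
  set K := L i j; set s := [seq _ | x <- m]; set s' := [seq _ | x <- m'].
  have nK : (n <= K)%N by rewrite /K /L; plia.
  have CK := Cn_gt0 K.
  have sS : \sum_(x < p * K) (1 - sg i x) <= S.
    apply: le_trans hS; apply: (@geo_two c0 q tau N (kL + i) K kL) => //; first by rewrite leq_addr.
    by rewrite /K /L; plia.
  have s01 k : 0 <= sg i k <= 1 by exact: t01.
  have b1 := hB (sg i) K s s' S s01 ltac:(by rewrite size_map) ltac:(by rewrite size_map) nK sS.
  have b2 := hB' (sg i) K [::] [::] S s01 erefl erefl (leq0n _) sS.
  rewrite !GT_nil -/(Cn K) in b2.
  have b3 : `|GN K s s' - g| <= e2 / 2.
    have mE (t : seq nat) : all (leq (p * (kL + w + D7))) t ->
        [seq (x + p * (kL + i))%N | x <- [seq (x - p * (kL + i))%N | x <- t]] = t.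
      move=> /(lw _ i)/allP ht'; rewrite -map_comp -[RHS]map_id; apply/eq_in_map => x xt /=.
      by rewrite subnK // ht'.
    have al (t : seq nat) : all (leq (p * (kL + w + D7))) t ->
        all (leq (p * D7)) [seq (x - p * (kL + i))%N | x <- t].
      rewrite all_map; apply: sub_all => x /= h; rewrite leq_subRL; last first.
        by apply: leq_trans h; rewrite leq_mul2l; apply/orP; right; plia.
      by apply: leq_trans h; rewrite -mulnDr leq_mul2l; apply/orP; right; plia.
    have au (t : seq nat) : all (leq (p * (kL + w + D7))) t -> all (fun x => x + p * D7 < p * kR)%N t ->
        all (fun x => x + p * D7 < p * K)%N [seq (x - p * (kL + i))%N | x <- t].
      move=> /allP h1 /allP h2; rewrite all_map; apply/allP => x xt /=.
      have x1 : (p * (kL + i) <= x)%N.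
        by apply: leq_trans (h1 x xt); rewrite leq_mul2l; apply/orP; right; plia.
      rewrite -(ltn_add2r (p * (kL + i))) addnAC subnK //.
      apply: leq_trans (h2 x xt) _; rewrite -mulnDr leq_mul2l; apply/orP; right; rewrite /K /L; plia.
    have av (t : seq nat) : all (leq (p * (kL + w + D7))) t -> all (fun x => x + p * D7 < p * kR)%N t ->
        all (fun x => x + p * (kL + i + D7) < p * N)%N [seq (x - p * (kL + i))%N | x <- t].
      move=> /allP h1 /allP h2; rewrite all_map; apply/allP => x xt /=.
      have x1 : (p * (kL + i) <= x)%N.
        by apply: leq_trans (h1 x xt); rewrite leq_mul2l; apply/orP; right; plia.
      rewrite (mulnDr p (kL + i) D7) addnA subnK //; apply: leq_trans (h2 x xt) _.
      by rewrite leq_mul2l; apply/orP; right; plia.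
    have := h7 K N (kL + i)%N s s' ltac:(by rewrite size_map) ltac:(by rewrite size_map)
      (al _ lo) (al _ lo') (au _ lo up) (au _ lo' up') (av _ lo up) (av _ lo' up').
    by rewrite !mE.
  have GE : GT one K s s' one = Cn K * GN K s s' by rewrite /GN mulrC divfK // gt_eqF.
  have b4 : `|GT (sg i) K s s' one - g * CT (sg i) K| <= e2 * Cn K.
    have -> : GT (sg i) K s s' one - g * CT (sg i) K = (GT (sg i) K s s' one - GT one K s s' one) +
       Cn K * (GN K s s' - g) - g * (CT (sg i) K - Cn K) by rewrite GE; ring.
    apply: le_trans (ler_normB _ _) _; apply: le_trans (lerD (ler_normD _ _) (lexx _)) _.
    rewrite (normrM (Cn K)) (normrM g) (ger0_norm (ltW CK)).
    have z1 := ler_wpM2l (ltW CK) b3.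
    have z2 : `|g| * `|CT (sg i) K - Cn K| <= Bg * (B' * S * Cn K) by apply: ler_pM.
    have := ler_wpM2r (ltW CK) S2; lra.
  apply: (le_trans b4).
  have : Cn K <= 2 * CT (sg i) K.
    move: b2; rewrite ler_norml => /andP[b2 _]; have := ler_wpM2r (ltW CK) S1; lra.
  by move=> /(ler_wpM2l (ltW e20)); lra.
pose T1 := a ^+ 2 * \sum_(i < w) \sum_(j < w) A i * GT (sg i) (L i j) [seq (x - p * (kL + i))%N | x <- m]
    [seq (x - p * (kL + i))%N | x <- m'] one * E j.
pose T2 := a ^+ 2 * \sum_(i < w) \sum_(j < w) A i * CT (sg i) (L i j) * E j.
have J1 : `|GT tau N m m' one - T1| <= delta * Cn N.
  apply: le_trans I1; rewrite le_eqVlt; apply/orP; left; apply/eqP; congr (`| _ - _ * _ |).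
  apply: eq_bigr => i _; apply: eq_bigr => j _.
  have iw := ltn_ord i; have jw := ltn_ord j; apply/esym; apply: GT_factor.
  - by rewrite sm sm'.
  - by rewrite sm; plia.
  - by plia.
  - exact: lw.
  - exact: lw.
  - exact: uw.
  - exact: uw.
have J2 : `|CT tau N - T2| <= delta * Cn N.
  apply: le_trans I2; rewrite GT_nil le_eqVlt; apply/orP; left; apply/eqP; congr (`| _ - _ * _ |).
  apply: eq_bigr => i _; apply: eq_bigr => j _.
  have iw := ltn_ord i; have jw := ltn_ord j; rewrite GT_factor //=.
  - by rewrite GT_nil.
  - by plia.
  - by plia.
have J3 : `|T1 - g * T2| <= 2 * e2 * T2.
  have -> : T1 - g * T2 = a ^+ 2 * \sum_(i < w) \sum_(j < w) A i * (GT (sg i) (L i j)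
     [seq (x - p * (kL + i))%N | x <- m] [seq (x - p * (kL + i))%N | x <- m'] one - g * CT (sg i) (L i j)) * E j.
    rewrite /T1 /T2 mulrCA -mulrBr; congr (_ * _); rewrite mulr_sumr -sumrB; apply: eq_bigr => i _.
    by rewrite mulr_sumr -sumrB; apply: eq_bigr => j _; ring.
  rewrite /T2 mulrCA normrM (ger0_norm (sqr_ge0 a)) ler_wpM2l ?sqr_ge0 // mulr_sumr.
  apply: le_trans (ler_norm_sum _ _ _) _; apply: ler_sum => i _; rewrite mulr_sumr.
  apply: le_trans (ler_norm_sum _ _ _) _; apply: ler_sum => j _.
  have A0 : 0 <= A i by apply: CT_ge0.
  have E0 : 0 <= E j by apply: CT_ge0 => x; exact: t0.
  rewrite (normrM _ (E j)) (normrM (A i)) (ger0_norm A0) (ger0_norm E0).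
  have -> : 2 * e2 * (A i * CT (sg i) (L i j) * E j) = A i * (2 * e2 * CT (sg i) (L i j)) * E j by ring.
  by rewrite ler_wpM2r // ler_wpM2l.
have CTN : CT tau N <= Cn N.
  rewrite /Cn /CT ler_wpM2r ?invr_ge0 //; apply: le_nsum => s _ _.
  by rewrite ler_wpM2l ?sqr_ge0 // tw1; have [/andP[]] := tw_ge s t01.
have CTp : 0 < CT tau N by apply: lt_le_trans hct; rewrite mulr_gt0.
have main : `|GT tau N m m' one - g * CT tau N| <= e * ct * Cn N.
  have -> : GT tau N m m' one - g * CT tau N =
    (GT tau N m m' one - T1) + (T1 - g * T2) - g * (CT tau N - T2) by ring.
  apply: le_trans (ler_normB _ _) _; apply: le_trans (lerD (ler_normD _ _) (lexx _)) _.
  rewrite (normrM g).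
  have z1 : `|g| * `|CT tau N - T2| <= Bg * (delta * Cn N) by apply: ler_pM.
  have z2 : T2 <= 2 * Cn N.
    move: J2; rewrite ler_norml => /andP[z _]; have := ler_wpM2r (ltW C0) d1; lra.
  have z3 : 2 * e2 * T2 <= 2 * e2 * (2 * Cn N) by rewrite ler_wpM2l // mulr_ge0 // ltW.
  have z4 := ler_wpM2r (ltW C0) d2.
  have z5 : 2 * e2 * (2 * Cn N) = e * ct / 2 * Cn N by rewrite /e2; field.
  by lra.
have -> : GT tau N m m' one / CT tau N - GN N m m' = (GT tau N m m' one - g * CT tau N) / CT tau N.
  by rewrite /g; field; rewrite gt_eqF.
rewrite normrM normfV (ger0_norm (ltW CTp)) ler_pdivrMr // (le_trans main) //.
by rewrite -mulrA ler_wpM2l // ltW.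
Qed.

End Bulk.

(** * From orbitals to the cylinder *)

Section ComplexNorm.
Variable R : realType.
Notation RtoC := (@real_complex R).
Notation normc := (@Normc.normc R).
Local Arguments conjc : simpl never.

Lemma normc_conj (z : R[i]) : normc (conjc z) = normc z.
Proof. by case: z => x y; rewrite /Normc.normc /conjc sqrrN. Qed.

Lemma normcR (x : R) : normc (RtoC x) = `|x|.
Proof. by rewrite /Normc.normc /= expr0n /= addr0 sqrtr_sqr. Qed.

Lemma normc_0 : normc (0 : R[i]) = 0.
Proof. exact: Normc.normc0. Qed.

Lemma le_normc_nsum D N (f : seq nat -> R[i]) : normc (nsum D N f) <= nsum D N (fun m => normc (f m)).
Proof.
rewrite !nsum_words; elim: (words D N) => [|m l IH]; first by rewrite !big_nil normc_0.
by rewrite !big_cons (le_trans (le_normcD _ _)) // lerD2l.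
Qed.

Lemma Re_le_normc (z : R[i]) : `|complex.Re z| <= normc z.
Proof. by case: z => x y /=; rewrite -sqrtr_sqr ler_wsqrtr // lerDl sqr_ge0. Qed.

Lemma Im_le_normc (z : R[i]) : `|complex.Im z| <= normc z.
Proof. by case: z => x y /=; rewrite -sqrtr_sqr ler_wsqrtr // lerDr sqr_ge0. Qed.

Lemma normc_le (z : R[i]) : normc z <= `|complex.Re z| + `|complex.Im z|.
Proof.
case: z => x y /=; rewrite -(@ler_pXn2r _ 2) ?nnegrE ?sqrtr_ge0 ?addr_ge0 //.
rewrite sqr_sqrtr ?addr_ge0 ?sqr_ge0 // sqrrD !real_normK ?num_real //.
by rewrite -addrA lerD2l lerDr mulrn_wge0 // mulr_ge0.
Qed.

Lemma normcB_le (x y z : R[i]) : normc (x - z) <= normc (x - y) + normc (y - z).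
Proof. by rewrite (_ : x - z = (x - y) + (y - z)) ?le_normcD //; ring. Qed.

Lemma normcBC (x y : R[i]) : normc (x - y) = normc (y - x).
Proof. by rewrite -normcN opprB. Qed.

Lemma cauchy_real (v : nat -> R) : (forall e, 0 < e -> exists T, forall t, (T <= t)%N -> `|v t - v T| <= e) ->
  exists L, forall e, 0 < e -> exists T, forall t, (T <= t)%N -> `|v t - L| <= e.
Proof.
move=> h; have : cvg (v @ \oo)%classic.
  apply/cauchy_cvgP; apply: cauchy_exP => e e0.
  have [T hT] := h (e / 2) ltac:(by rewrite divr_gt0).
  exists (v T); exists T => // t /= Tt; rewrite /ball /= distrC.
  by apply: (le_lt_trans (hT t Tt)); rewrite gtr_pMr // invf_lt1 // ltr1n.
move=> /cvg_ex[L /cvgrPdist_le hL]; exists L => e e0.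
by have [T _ hT] := hL e e0; exists T => t Tt; rewrite distrC; exact: hT.
Qed.

Lemma cauchy_complex (v : nat -> R[i]) :
  (forall e, 0 < e -> exists T, forall t, (T <= t)%N -> normc (v t - v T) <= e) ->
  exists L, forall e, 0 < e -> exists T, forall t, (T <= t)%N -> normc (v t - L) <= e.
Proof.
move=> h.
have ReB (x y : R[i]) : complex.Re (x - y) = complex.Re x - complex.Re y by case: x; case: y.
have ImB (x y : R[i]) : complex.Im (x - y) = complex.Im x - complex.Im y by case: x; case: y.
have [L1 h1] : exists L, forall e, 0 < e -> exists T, forall t, (T <= t)%N -> `|complex.Re (v t) - L| <= e.
  apply: cauchy_real => e /h[T hT]; exists T => t /hT; rewrite -ReB.
  exact: le_trans (Re_le_normc _).
have [L2 h2] : exists L, forall e, 0 < e -> exists T, forall t, (T <= t)%N -> `|complex.Im (v t) - L| <= e.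
  apply: cauchy_real => e /h[T hT]; exists T => t /hT; rewrite -ImB.
  exact: le_trans (Im_le_normc _).
exists (Complex L1 L2) => e e0; have e2 : 0 < e / 2 by rewrite divr_gt0.
have [T1 k1] := h1 _ e2; have [T2 k2] := h2 _ e2; exists (maxn T1 T2) => t.
rewrite geq_max => /andP[t1 t2]; apply: (le_trans (normc_le _)); rewrite ReB ImB /=.
by rewrite [e]splitr lerD ?k1 ?k2.
Qed.

End ComplexNorm.

(** * Sums over orbitals and the decay of the orbitals *)

Section Sums.
Variables (R : realType) (Rad ell : R) (p : nat).
Hypothesis Rad_gt0 : 0 < Rad.
Hypothesis ell_gt0 : 0 < ell.
Hypothesis p_gt0 : (0 < p)%N.
Notation RtoC := (@real_complex R).
Notation normc := (@Normc.normc R).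
Notation a0 := (a0 Rad ell).
Notation psi := (psi Rad ell).
Local Arguments conjc : simpl never.

Lemma a0_gt0 : 0 < a0. Proof. by rewrite divr_gt0 // exprn_gt0. Qed.

(** Exponential envelope of an orbital, from t^2 / 2 >= t - 1/2. It uses only half of the linear
    decay; the other half remains available as the small factor in [gau_chi_far]. *)
Definition chi (y : R) : R := expR (1 / 2) * expR (- (`|y| / (2 * ell))).

Lemma chi_ge0 y : 0 <= chi y. Proof. by rewrite mulr_ge0 ?expR_ge0. Qed.

Lemma gau_chi_far (delta c x : R) : delta <= `|x - c| ->
  gau (2 * ell ^+ 2) c x <= expR (- (delta / (2 * ell))) * chi (x - c).
Proof.
move=> h; rewrite /gau /chi -!expRD ler_expR.
have -> : - (x - c) ^+ 2 / (2 * ell ^+ 2) = - (`|x - c| / ell) ^+ 2 / 2.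
  by rewrite expr_div_n real_normK ?num_real //; field; rewrite gt_eqF.
have e1 y : y / (2 * ell) = y / ell / 2 by field; rewrite gt_eqF.
rewrite !e1; have : delta / ell <= `|x - c| / ell by rewrite ler_pM2r ?invr_gt0.
have := sqr_ge0 (`|x - c| / ell - 1); rewrite sqrrB1; lra.
Qed.

Lemma gau_chi c x : gau (2 * ell ^+ 2) c x <= chi (x - c).
Proof.
by have := @gau_chi_far 0 c x (normr_ge0 _); rewrite mul0r oppr0 expR0 mul1r.
Qed.

Definition qchi : R := expR (- (a0 / (2 * ell))).
Definition Wchi : R := expR (1 / 2) * qchi^-1 * ((1 - qchi)^-1 + (1 - qchi)^-1).

Lemma qchi_bd : 0 < qchi < 1.
Proof. by rewrite expR_gt0 /= -expR0 ltr_expR oppr_lt0 divr_gt0 ?a0_gt0 // mulr_gt0. Qed.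

Lemma Wchi_gt0 : 0 < Wchi.
Proof.
have /andP[q0 q1] := qchi_bd; have h : 0 < (1 - qchi)^-1 by rewrite invr_gt0 subr_gt0.
apply: mulr_gt0; last exact: addr_gt0.
by apply: mulr_gt0; [exact: expR_gt0|rewrite invr_gt0].
Qed.

(** One spacing is given up because x lies between two centres; this is the origin of [qchi^-1] in
    [Wchi]. Left of all centres the index 0 serves. *)
Lemma nearest_ex (x : R) : exists M0 : nat, forall M : nat, ((dst M0 M)%:R - 1) * a0 <= `|x - M%:R * a0|.
Proof.
have a00 := a0_gt0; have [x0|x0] := leP x 0.
  exists 0%N => M; rewrite /dst sub0n add0n subn0 distrC.
  apply: le_trans (ler_norm _); rewrite mulrBl mul1r; lra.
have ex : exists n, x < n%:R * a0.
  exists (Num.bound (x / a0)); rewrite -ltr_pdivrMr //.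
  by apply: archi_boundP; rewrite divr_ge0 // ltW.
case: (ex_minnP ex) => n nx nmin.
have n0 : (0 < n)%N by case: n nx {nmin} => //; rewrite mul0r => /(lt_trans x0); rewrite ltxx.
exists n.-1 => M; have nl : n.-1%:R * a0 <= x.
  by rewrite leNgt; apply/negP => /nmin; rewrite -ltnS prednK // ltnn.
have [Mn|nM] := leqP n.-1 M.
  rewrite distrC; apply: le_trans (ler_norm _).
  rewrite (_ : dst n.-1 M = (M - n.-1)%N); last by rewrite /dst; nlia.
  rewrite natrB //; have : n%:R = n.-1%:R + 1 :> R by rewrite natr1 prednK.
  by move=> e; rewrite e in nx; lra.
apply: le_trans (ler_norm _); rewrite (_ : dst n.-1 M = (n.-1 - M)%N); last by rewrite /dst; nlia.
by rewrite natrB ?(ltnW nM) //; lra.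
Qed.

Lemma chi_sum (x : R) D : \sum_(M < D) chi (x - M%:R * a0) <= Wchi.
Proof.
have /andP[q0 q1] := qchi_bd; have [M0 hM] := nearest_ex x.
apply: (@le_trans _ _ (\sum_(M < D) expR (1 / 2) * qchi^-1 * qchi ^+ dst M0 M)).
  apply: ler_sum => M _; rewrite /chi -[X in _ <= X]mulrA ler_wpM2l ?expR_ge0 //.
  rewrite /qchi -expRN -expRM_natl -expRD ler_expR opprK.
  have -> : a0 / (2 * ell) + (dst M0 M)%:R * - (a0 / (2 * ell)) = - (((dst M0 M)%:R - 1) * a0 / (2 * ell)) by ring.
  by rewrite lerN2 ler_wpM2r ?hM // invr_ge0 mulr_ge0 // ltW.
rewrite -mulr_sumr ler_wpM2l //; first by apply: mulr_ge0; rewrite ?expR_ge0 // invr_ge0 ltW.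
apply: (sum_dst (f := fun d => qchi ^+ d)) => [d|m]; first by rewrite exprn_ge0 // ltW.
by apply: geo_sum_le; rewrite (ltW q0).
Qed.

Definition psiS (c : R) (zs : seq (R * R)) (m : seq nat) : R[i] :=
  \prod_(x <- zip zs m) psi (x.2%:R - c) x.1.

Definition chiS (c : R) (zs : seq (R * R)) (m : seq nat) : R :=
  \prod_(x <- zip zs m) chi (x.1.1 - (x.2%:R - c) * a0).

Lemma chiS_ge0 c zs m : 0 <= chiS c zs m.
Proof. by apply: prodr_ge0 => x _; exact: chi_ge0. Qed.

Lemma normc_psi k z : normc (psi k z) = gau (2 * ell ^+ 2) (k * a0) z.1.
Proof. by rewrite /psi Normc.normcM normc_cis mulr1 normcR ger0_norm ?gau_ge0. Qed.

Definition inwin (lo hi : nat) := fun k : nat => (lo <= k < hi)%N.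

Lemma psiS_bound (c delta : R) lo hi zs m : size m = size zs ->
  (forall z, z \in zs -> (lo%:R - c) * a0 + delta <= z.1 <= (hi%:R - c) * a0 - delta) ->
  normc (psiS c zs m) <= chiS c zs m /\
  (~~ all (inwin lo hi) m -> normc (psiS c zs m) <= expR (- (delta / (2 * ell))) * chiS c zs m).
Proof.
have a00 := a0_gt0; rewrite /psiS /chiS; elim: zs m => [|z zs IH] [|k m] //= sm hz.
  by rewrite !big_nil normc_1; split.
case: sm => sm; have [h1 h2] := IH m sm (fun z' h => hz z' (mem_behead (s := z :: zs) h)).
rewrite !big_cons Normc.normcM normc_psi /=.
have n0 := normc_ge0 (\prod_(j <- zip zs m) psi (j.2%:R - c) j.1).
have g0 := gau_ge0 (2 * ell ^+ 2) ((k%:R - c) * a0) z.1.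
have gc := gau_chi ((k%:R - c) * a0) z.1.
split; first by apply: ler_pM.
rewrite negb_and => /orP[kw|am]; last by rewrite [X in _ <= X]mulrCA; apply: ler_pM => //; exact: h2.
rewrite mulrA; apply: ler_pM => //; apply: gau_chi_far.
have /andP[z1 z2] := hz z (mem_head _ _).
move: kw; rewrite /inwin negb_and -ltnNge -leqNgt => /orP[kl|kh].
  apply: le_trans (ler_norm _).
  have : k%:R * a0 <= lo%:R * a0 by rewrite ler_wpM2r ?(ltW a00) // ler_nat ltnW.
  by lra.
rewrite distrC; apply: le_trans (ler_norm _).
have : hi%:R * a0 <= k%:R * a0 by rewrite ler_wpM2r ?(ltW a00) // ler_nat.
by lra.
Qed.

Lemma chiS_sum c zs D : nsum D (size zs) (chiS c zs) <= Wchi ^+ size zs.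
Proof.
rewrite /chiS (nsum_prod D (fun (z : R * R) (k : nat) => chi (z.1 - (k%:R - c) * a0)) zs).
rewrite -prodr_const_seq; apply: ler_prod => z _; apply/andP; split.
  by apply: sumr_ge0 => i _; exact: chi_ge0.
apply: le_trans (chi_sum (z.1 + c * a0) D); apply: ler_sum => i _.
by rewrite le_eqVlt; apply/orP; left; apply/eqP; congr (chi _); ring.
Qed.

(** The parameter c places the origin: orbital x acts with momentum x - c, so systems of different
    sizes can be viewed from a common point. *)
Definition Fsum (D : nat) (c : R) (G : seq nat -> seq nat -> R) (zs zs' : seq (R * R)) : R[i] :=
  nsum D (size zs) (fun m => nsum D (size zs) (fun m' =>
    psiS c zs m * conjc (psiS c zs' m') * RtoC (G m m'))).

(** Words within [lo, hi) contribute the bulk error e. A letter outside is the label of an orbital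
    at distance at least delta from its particle, so there the crude bound B comes with an
    exponentially small factor. *)
Lemma Fsum_diff D c (G1 G2 : seq nat -> seq nat -> R) zs zs' lo hi (delta e B : R) :
  size zs' = size zs -> 0 <= e -> 0 <= B ->
  (forall m m', size m = size zs -> size m' = size zs -> `|G1 m m' - G2 m m'| <= B) ->
  (forall m m', size m = size zs -> size m' = size zs -> all (inwin lo hi) m -> all (inwin lo hi) m' ->
    `|G1 m m' - G2 m m'| <= e) ->
  (forall z, z \in zs -> (lo%:R - c) * a0 + delta <= z.1 <= (hi%:R - c) * a0 - delta) ->
  (forall z, z \in zs' -> (lo%:R - c) * a0 + delta <= z.1 <= (hi%:R - c) * a0 - delta) ->
  normc (Fsum D c G1 zs zs' - Fsum D c G2 zs zs') <=
  (e + B * expR (- (delta / (2 * ell)))) * (Wchi ^+ size zs * Wchi ^+ size zs).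
Proof.
move=> szs e0 B0 GB Ge hz hz'; set n := size zs; set E := expR _.
have E0 : 0 <= E by exact: expR_ge0.
rewrite /Fsum -/n.
have -> : nsum D n (fun m => nsum D n (fun m' => psiS c zs m * conjc (psiS c zs' m') * RtoC (G1 m m'))) -
   nsum D n (fun m => nsum D n (fun m' => psiS c zs m * conjc (psiS c zs' m') * RtoC (G2 m m'))) =
   nsum D n (fun m => nsum D n (fun m' => psiS c zs m * conjc (psiS c zs' m') * RtoC (G1 m m' - G2 m m'))).
  rewrite -nsumN -nsumD; apply: eq_nsum => m _ _; rewrite -nsumN -nsumD; apply: eq_nsum => m' _ _.
  by rewrite rmorphB; ring.
apply: le_trans (le_normc_nsum _ _ _) _.
apply: (@le_trans _ _ (nsum D n (fun m => nsum D n (fun m' => (e + B * E) * (chiS c zs m * chiS c zs' m'))))).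
  apply: le_nsum => m sm _; apply: le_trans (le_normc_nsum _ _ _) _; apply: le_nsum => m' sm' _.
  rewrite !Normc.normcM normc_conj normcR.
  have [a1 a2] := psiS_bound sm hz; have [b1 b2] := psiS_bound (etrans sm' (esym szs)) hz'.
  have c1 := chiS_ge0 c zs m; have c2 := chiS_ge0 c zs' m'.
  have n1 := normc_ge0 (psiS c zs m); have n2 := normc_ge0 (psiS c zs' m').
  have cc := mulr_ge0 c1 c2.
  have [w1|w1] := boolP (all (inwin lo hi) m); last first.
    apply: (@le_trans _ _ (E * chiS c zs m * chiS c zs' m' * B)).
      apply: ler_pM; [exact: mulr_ge0|exact: normr_ge0| |exact: GB].
      by apply: ler_pM => //; exact: a2.
    rewrite mulrDl (_ : E * chiS c zs m * chiS c zs' m' * B = B * E * (chiS c zs m * chiS c zs' m')); last by ring.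
    by rewrite lerDr mulr_ge0.
  have [w2|w2] := boolP (all (inwin lo hi) m'); last first.
    apply: (@le_trans _ _ (chiS c zs m * (E * chiS c zs' m') * B)).
      apply: ler_pM; [exact: mulr_ge0|exact: normr_ge0| |exact: GB].
      by apply: ler_pM => //; exact: b2.
    rewrite mulrDl (_ : chiS c zs m * (E * chiS c zs' m') * B = B * E * (chiS c zs m * chiS c zs' m')); last by ring.
    by rewrite lerDr mulr_ge0.
  apply: (@le_trans _ _ (chiS c zs m * chiS c zs' m' * e)).
    apply: ler_pM; [exact: mulr_ge0|exact: normr_ge0| |exact: Ge].
    by apply: ler_pM.
  by rewrite mulrDl [X in X <= _]mulrC lerDl mulr_ge0 // mulr_ge0.
rewrite (eq_nsum (g := fun m => (e + B * E) * (chiS c zs m * nsum D n (chiS c zs')))); last first.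
  by move=> m _ _; rewrite nsumZ nsumZ.
rewrite nsumZ nsumZr ler_wpM2l ?addr_ge0 ?mulr_ge0 //.
have s1 := chiS_sum c zs D; have s2 := chiS_sum c zs' D; rewrite szs -/n in s1 s2.
by apply: ler_pM => //; apply: nsum_ge0 => m _ _; exact: chiS_ge0.
Qed.

Lemma Fsum_bound D c (G : seq nat -> seq nat -> R) zs zs' (B : R) : size zs' = size zs -> 0 <= B ->
  (forall m m', size m = size zs -> size m' = size zs -> `|G m m'| <= B) ->
  normc (Fsum D c G zs zs') <= B * (Wchi ^+ size zs * Wchi ^+ size zs).
Proof.
move=> szs B0 GB; set n := size zs; apply: le_trans (le_normc_nsum _ _ _) _.
have hz (t : seq (R * R)) m : size m = size t -> normc (psiS c t m) <= chiS c t m.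
  rewrite /psiS /chiS; elim: t m => [|z t IH] [|k m] //=; first by rewrite !big_nil normc_1.
  case=> sm; rewrite !big_cons Normc.normcM normc_psi; apply: ler_pM; rewrite ?gau_ge0 ?normc_ge0 //.
    exact: gau_chi.
  exact: IH.
apply: (@le_trans _ _ (nsum D n (fun m => nsum D n (fun m' => B * (chiS c zs m * chiS c zs' m'))))).
  apply: le_nsum => m sm _; apply: le_trans (le_normc_nsum _ _ _) _; apply: le_nsum => m' sm' _.
  rewrite !Normc.normcM normc_conj normcR mulrC; apply: ler_pM; rewrite ?normr_ge0 //.
  - by rewrite mulr_ge0 ?normc_ge0.
  - exact: GB.
  - by apply: ler_pM; rewrite ?normc_ge0 // hz // sm' szs.
rewrite (eq_nsum (g := fun m => B * (chiS c zs m * nsum D n (chiS c zs')))); last first.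
  by move=> m _ _; rewrite nsumZ nsumZ.
rewrite nsumZ nsumZr ler_wpM2l //.
have s1 := chiS_sum c zs D; have s2 := chiS_sum c zs' D; rewrite szs -/n in s1 s2.
by apply: ler_pM => //; apply: nsum_ge0 => m _ _; exact: chiS_ge0.
Qed.

Lemma psiS_shift (c d : nat) zs m : psiS c%:R zs m = psiS (c + d)%:R zs [seq (x + d)%N | x <- m].
Proof.
rewrite /psiS; elim: zs m => [|z zs IH] [|k m] //=; rewrite ?big_nil // !big_cons IH /=.
have -> : (k + d)%:R - (c + d)%:R = k%:R - c%:R :> R by rewrite !natrD opprD addrACA subrr addr0.
by [].
Qed.

(* Shifts the orbital indices by d, so that systems of different sizes can be
   compared inside one sum over words. *)
Definition Gext (d D : nat) (G : seq nat -> seq nat -> R) (M M' : seq nat) : R :=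
  if [&& all (leq d) M, all (ltn^~ (d + D)%N) M, all (leq d) M' & all (ltn^~ (d + D)%N) M']
  then G [seq (x - d)%N | x <- M] [seq (x - d)%N | x <- M'] else 0.

Lemma nsum_ext (K : nmodType) D d D' n (f : seq nat -> K) : (d + D <= D')%N ->
  nsum D n f = nsum D' n (fun M => if all (leq d) M && all (ltn^~ (d + D)%N) M
    then f [seq (x - d)%N | x <- M] else 0).
Proof.
move=> dD; rewrite -(nsum_shift D d) (@nsum_widen _ (d + D) D') //; last first.
  by move=> m _ h; rewrite (negbTE h) andbF.
by apply: eq_nsum => m _ ->; rewrite andbT.
Qed.

Lemma Fsum_embed D (c d : nat) D' G zs zs' : (d + D <= D')%N ->
  Fsum D c%:R G zs zs' = Fsum D' (c + d)%:R (Gext d D G) zs zs'.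
Proof.
move=> dD; rewrite /Fsum (nsum_ext _ _ dD); apply: eq_nsum => M _ _.
have kk (t : seq nat) : all (leq d) t -> [seq (x + d)%N | x <- [seq (x - d)%N | x <- t]] = t.
  move=> /allP h; rewrite -map_comp -[RHS]map_id; apply/eq_in_map => x xt /=.
  by rewrite subnK // h.
case: ifP => [/andP[h1 h2]|h]; last first.
  rewrite (eq_nsum (g := fun=> 0)) ?nsum0 // => M' _ _.
  by rewrite /Gext andbA h rmorph0 mulr0.
rewrite (nsum_ext _ _ dD); apply: eq_nsum => M' _ _; rewrite /Gext h1 h2 /=.
case: ifP => [/andP[h3 h4]|h]; last by rewrite rmorph0 mulr0.
by rewrite !(psiS_shift c d) !kk.
Qed.

End Sums.

(** * The infinite-volume family and its periodicity *)

Section Family.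
Variables (R : realType) (Rad ell : R) (p : nat).
Hypothesis Rad_gt0 : 0 < Rad.
Hypothesis ell_gt0 : 0 < ell.
Hypothesis p_gt0 : (0 < p)%N.
Notation RtoC := (@real_complex R).
Notation normc := (@Normc.normc R).
Notation a0 := (a0 Rad ell).
Notation psi := (psi Rad ell).
Notation g2 := (g2 Rad ell).
Notation GN := (GN p g2).
Notation GT := (GT p g2).
Notation Cn := (Cn p g2).
Notation one := (fun=> 1 : R).
Notation kappa := (kappa Rad ell).
Notation Wchi := (Wchi Rad ell).
Notation Fsum := (Fsum Rad ell).
Local Arguments conjc : simpl never.

Lemma GT_bound_laughlin n : exists2 B : R, 0 < B & forall tau N m m', (forall k, 0 <= tau k <= 1) ->
  size m = n -> size m' = n -> (n <= N)%N -> `|GT tau N m m' one| <= B * Cn N.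
Proof. by have [B0 B00 m0] := moment_exp Rad_gt0 ell_gt0 p_gt0; exact: GT_bound1 B00 m0 n. Qed.

Lemma GN_bound_laughlin n : exists2 B : R, 0 < B & forall N m m', size m = n -> size m' = n -> (n <= N)%N ->
  `|GN N m m'| <= B.
Proof. by have [B0 B00 m0] := moment_exp Rad_gt0 ell_gt0 p_gt0; exact: GN_bound B00 m0 n. Qed.

Lemma GN_shift_close_laughlin n (e : R) : (0 < n)%N -> 0 < e -> exists D, forall N N' c m m',
  size m = n -> size m' = n -> all (leq (p * D)) m -> all (leq (p * D)) m' ->
  all (fun x => x + p * D < p * N)%N m -> all (fun x => x + p * D < p * N)%N m' ->
  all (fun x => x + p * (c + D) < p * N')%N m -> all (fun x => x + p * (c + D) < p * N')%N m' ->
  `|GN N m m' - GN N' [seq (x + p * c)%N | x <- m] [seq (x + p * c)%N | x <- m']| <= e.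
Proof.
move=> n0 e0; have [B0 B00 m0] := moment_exp Rad_gt0 ell_gt0 p_gt0.
have [r0 [uinf [cu [h1 h2 h3 h4 h5]]]] := renewal_Cn Rad_gt0 ell_gt0 p_gt0.
exact: (GN_shift_close p_gt0 h1 h2 h3 B00 h4 h5 m0 n0 e0).
Qed.

(** N particles seen from p j become a part of 2 t particles seen from p t once their orbitals are
    shifted by p (t - j); the conditions on j and t say that this part fits in. *)
Lemma Fsum_compare n (e : R) : (0 < n)%N -> 0 < e -> exists DD (B : R), 0 < B /\
  forall N j t zs zs' (delta : R), (n <= N)%N -> (j <= t)%N -> (N + (t - j) <= 2 * t)%N ->
  size zs = n -> size zs' = n ->
  (forall z, z \in zs ++ zs' ->
    ((p * DD)%:R - (p * j)%:R) * a0 + delta <= z.1 <= ((p * N)%:R - (p * DD)%:R - (p * j)%:R) * a0 - delta) ->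
  normc (Fsum (p * N) (p * j)%:R (GN N) zs zs' - Fsum (p * (2 * t)) (p * t)%:R (GN (2 * t)) zs zs') <=
  (e + 2 * B * expR (- (delta / (2 * ell)))) * (Wchi ^+ n * Wchi ^+ n).
Proof.
move=> n0 e0; have [DD hD] := GN_shift_close_laughlin n0 e0; have [B B0 hB] := GN_bound_laughlin n.
exists DD, B; split=> // N j t zs zs' delta nN jt Nt szs szs' hz.
have a00 : 0 <= a0 by rewrite ltW // a0_gt0.
pose d := (p * (t - j))%N.
have dE : (p * j + d = p * t)%N by rewrite /d -mulnDr subnKC.
have dN : (d + p * N <= p * (2 * t))%N by rewrite /d -mulnDr leq_mul2l addnC Nt orbT.
rewrite (Fsum_embed _ _ (p * j) (GN N) zs zs' dN) dE -szs.
have dR : d%:R = (p * t)%:R - (p * j)%:R :> R by rewrite -dE natrD addrC addKr.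
pose lo := (d + p * DD)%N; pose hi := (d + p * (N - DD))%N.
have n2t : (n <= 2 * t)%N by apply: leq_trans Nt; rewrite (leq_trans nN) // leq_addr.
have hiR : (p * N)%:R - (p * DD)%:R <= (p * (N - DD))%:R :> R.
  have [h|h] := leqP DD N; first by rewrite mulnBr natrB // leq_mul2l h orbT.
  have -> : (N - DD = 0)%N by apply/eqP; rewrite subn_eq0 ltnW.
  by rewrite muln0 subr_le0 ler_nat leq_mul2l ltnW ?orbT.
have win (z : R * R) : z \in zs ++ zs' ->
    (lo%:R - (p * t)%:R) * a0 + delta <= z.1 <= (hi%:R - (p * t)%:R) * a0 - delta.
  move=> /hz /andP[z1 z2]; rewrite /lo /hi !natrD dR; apply/andP; split.
    by apply: le_trans z1; rewrite lerD2r ler_wpM2r //; lra.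
  by apply: (le_trans z2); rewrite lerD2r ler_wpM2r //; lra.
apply: (@Fsum_diff _ _ _ _ Rad_gt0 ell_gt0 p_gt0 _ _ _ _ _ _ lo hi).
- by rewrite szs.
- exact: ltW.
- by rewrite mulr_ge0 // ltW.
- move=> m m'; rewrite szs => sm sm'; apply: le_trans (ler_normB _ _) _.
  rewrite (_ : 2 * B = B + B); last by ring.
  apply: lerD; last exact: hB.
  rewrite /Gext; case: ifP => _; last by rewrite normr0 ltW.
  by apply: hB; rewrite ?size_map.
- move=> m m'; rewrite szs => sm sm' am am'.
  have key (s : seq nat) : all (inwin lo hi) s -> [/\ all (leq d) s, all (ltn^~ (d + p * N)%N) s,
     all (leq (p * DD)) [seq (x - d)%N | x <- s] & all (fun x => x + p * DD < p * N)%N [seq (x - d)%N | x <- s]].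
    move=> /allP h; have h' x : x \in s -> [/\ (d <= x)%N, (x < d + p * N)%N, (p * DD <= x - d)%N & (x - d + p * DD < p * N)%N].
      move=> /h /andP[]; rewrite /lo /hi mulnBr.
      by move: (p * DD)%N (p * N)%N (d) => u v w *; split; plia.
    by split; rewrite ?all_map; apply/allP => x xs; have [] := h' x xs.
  have [a1 a2 a3 a4] := key _ am; have [b1 b2 b3 b4] := key _ am'.
  rewrite /Gext a1 a2 b1 b2 /=.
  have kk (s : seq nat) : all (leq d) s -> [seq (x + p * (t - j))%N | x <- [seq (x - d)%N | x <- s]] = s.
    move=> /allP h; rewrite -map_comp -[RHS]map_id; apply/eq_in_map => x xt /=.
    by rewrite subnK // h.
  have up (s : seq nat) : all (fun x => x + p * DD < p * N)%N s ->
      all (fun x => x + p * (t - j + DD) < p * (2 * t))%N s.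
    apply: sub_all => x /= h; apply: leq_trans dN; rewrite -/d (mulnDr p) -/d addnCA -addnS leq_add2l.
    exact: h.
  have := hD N (2 * t)%N (t - j)%N [seq (x - d)%N | x <- m] [seq (x - d)%N | x <- m'].
  rewrite !kk // !size_map; apply=> //; exact: up.
- by move=> z zz; apply: win; rewrite mem_cat zz.
- by move=> z zz; apply: win; rewrite mem_cat zz orbT.
Qed.

Lemma exp_small (B e : R) : 0 < B -> 0 < e -> exists d0, forall d, d0 <= d ->
  2 * B * expR (- (d / (2 * ell))) <= e.
Proof.
move=> B0 e0; exists (2 * ell * (2 * B / e)) => d hd.
rewrite expRN ler_pdivrMr ?expR_gt0 // -ler_pdivrMl //.
apply: (@le_trans _ _ (d / (2 * ell))); first by rewrite ler_pdivlMr ?mulr_gt0 // mulrC [e^-1 * _]mulrC.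
by apply: le_trans (expR_ge1Dx _); rewrite lerDr.
Qed.

(* 2t particles, seen from the middle of the system. *)
Definition Rt (t : nat) (zs zs' : seq (R * R)) : R[i] :=
  RtoC (kappa ^- size zs) * Fsum (p * (2 * t)) (p * t)%:R (GN (2 * t)) zs zs'.

Definition Kap (n : nat) : R := kappa ^- n * (Wchi ^+ n * Wchi ^+ n).

Lemma Kap_gt0 n : 0 < Kap n.
Proof.
have W0 := Wchi_gt0 Rad_gt0 ell_gt0; apply: mulr_gt0; last by apply: mulr_gt0; exact: exprn_gt0.
by rewrite invr_gt0 exprn_gt0 // kappa_gt0.
Qed.

Lemma normc_kap n (z : R[i]) : normc (RtoC (kappa ^- n) * z) = kappa ^- n * normc z.
Proof.
by rewrite Normc.normcM normcR ger0_norm // invr_ge0 exprn_ge0 // ltW // kappa_gt0.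
Qed.

Lemma kap_pos n : 0 < kappa ^- n :> R.
Proof. by rewrite invr_gt0 exprn_gt0 // kappa_gt0. Qed.

Lemma xbound (s : seq (R * R)) : exists2 X : R, 0 <= X & forall z, z \in s -> - X <= z.1 <= X.
Proof.
exists (\sum_(z <- s) `|z.1|) => [|z zs]; first by apply: sumr_ge0.
by rewrite -ler_norml; apply: (ler_term (F := fun z : R * R => `|z.1|)).
Qed.

Lemma large_t (DD k : nat) (X d0 : R) : exists T : nat, (k <= T)%N /\
  forall t, (T <= t)%N -> d0 <= ((p * t)%:R - (p * DD)%:R) * a0 - X.
Proof.
have a00 := a0_gt0 Rad_gt0 ell_gt0.
pose x := `|(d0 + X) / a0| + (p * DD)%:R.
exists (maxn k (Num.bound x)); split=> [|t]; first exact: leq_maxl.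
rewrite geq_max => /andP[_ xt].
have h : x <= (p * t)%:R.
  apply: le_trans (ltW (archi_boundP _)) _; first by rewrite addr_ge0.
  by rewrite ler_nat (leq_trans xt) // leq_pmull.
rewrite lerBrDr -ler_pdivrMr //; have := ler_norm ((d0 + X) / a0); rewrite /x in h; lra.
Qed.

Lemma Rt_compare n (e : R) : (0 < n)%N -> 0 < e -> exists DD (d0 : R),
  forall N j t zs zs' (delta : R), (n <= N)%N -> (j <= t)%N -> (N + (t - j) <= 2 * t)%N ->
  size zs = n -> size zs' = n -> d0 <= delta ->
  (forall z, z \in zs ++ zs' ->
    ((p * DD)%:R - (p * j)%:R) * a0 + delta <= z.1 <= ((p * N)%:R - (p * DD)%:R - (p * j)%:R) * a0 - delta) ->
  normc (RtoC (kappa ^- n) * Fsum (p * N) (p * j)%:R (GN N) zs zs' - Rt t zs zs') <= e.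
Proof.
move=> n0 e0; have K0 := Kap_gt0 n.
have e1 : 0 < e / (2 * Kap n) by rewrite divr_gt0 // mulr_gt0.
have [DD [B [B0 h]]] := Fsum_compare n0 e1; have [d0 hd] := exp_small B0 e1.
exists DD, d0 => N j t zs zs' delta nN jt Nt szs szs' hdelta hz.
rewrite /Rt szs -mulrBr normc_kap.
apply: le_trans (ler_wpM2l (ltW (kap_pos n)) (h N j t zs zs' delta nN jt Nt szs szs' hz)) _.
rewrite mulrCA -/(Kap n) -ler_pdivlMr //.
rewrite (_ : e / Kap n = e / (2 * Kap n) + e / (2 * Kap n)); last by field; rewrite gt_eqF.
by rewrite lerD2l; exact: hd.
Qed.

Lemma Rt_cauchy zs zs' : (0 < size zs)%N -> size zs' = size zs ->
  forall e, 0 < e -> exists T, forall t, (T <= t)%N -> normc (Rt t zs zs' - Rt T zs zs') <= e.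
Proof.
move=> s0 szs e e0; have [DD [d0 h]] := Rt_compare s0 e0.
have [X X0 hX] := xbound (zs ++ zs'); have [T [kT hT]] := large_t DD (size zs) X d0.
exists T => t Tt; rewrite normcBC.
apply: (h (2 * T)%N T t zs zs' (((p * T)%:R - (p * DD)%:R) * a0 - X)) => //.
- by rewrite (leq_trans kT) // leq_pmull.
- by nlia.
- exact: hT.
- move=> z /hX; rewrite (mulnA p) (mulnC p 2) -mulnA natrM; lra.
Qed.

Lemma limit_family_ex : exists rho : seq (R * R) -> seq (R * R) -> R[i], forall zs zs',
  (0 < size zs)%N -> size zs' = size zs ->
  forall e, 0 < e -> exists T, forall t, (T <= t)%N -> normc (Rt t zs zs' - rho zs zs') <= e.
Proof.
pose P (x : seq (R * R) * seq (R * R)) (L : R[i]) := (0 < size x.1)%N -> size x.2 = size x.1 ->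
  forall e, 0 < e -> exists T, forall t, (T <= t)%N -> normc (Rt t x.1 x.2 - L) <= e.
have [f hf] : {f : seq (R * R) * seq (R * R) -> R[i] & forall x, P x (f x)}.
  apply: boolp.choice => x; rewrite /P; have [h1|h1] := boolP (0 < size x.1)%N; last by exists 0.
  have [h2|h2] := eqVneq (size x.2) (size x.1); last by exists 0 => _ h; rewrite h eqxx in h2.
  by have [L hL] := cauchy_complex (Rt_cauchy h1 h2); exists L.
by exists (fun zs zs' => f (zs, zs')) => zs zs'; exact: (hf (zs, zs')).
Qed.

Variable rho : seq (R * R) -> seq (R * R) -> R[i].
Hypothesis rhoP : forall zs zs', (0 < size zs)%N -> size zs' = size zs ->
  forall e, 0 < e -> exists T, forall t, (T <= t)%N -> normc (Rt t zs zs' - rho zs zs') <= e.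

(** The finite system is seen from its left end, j = 0, so the reference system of 2 t particles
    extends far to its left and t must be at least N. *)
Lemma rho_close n (e : R) : (0 < n)%N -> 0 < e -> exists D : R, forall N zs zs' d,
  (n <= N)%N -> size zs = n -> size zs' = n -> D <= d ->
  (forall z, z \in zs ++ zs' -> d <= z.1 <= (p * N)%:R * a0 - d) ->
  normc (RtoC (kappa ^- n) * Fsum (p * N) 0 (GN N) zs zs' - rho zs zs') <= e.
Proof.
move=> n0 e0; have e2 : 0 < e / 2 by rewrite divr_gt0.
have [DD [d0 h]] := Rt_compare n0 e2.
exists (d0 + (p * DD)%:R * a0) => N zs zs' d nN szs szs' hd hz.
have [T hT] := @rhoP zs zs' ltac:(by rewrite szs) (etrans szs' (esym szs)) _ e2.
pose t := maxn T N; apply: le_trans (normcB_le _ (Rt t zs zs') _) _.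
rewrite [e]splitr; apply: lerD; last by apply: hT; exact: leq_maxl.
have := h N 0%N t zs zs' (d - (p * DD)%:R * a0) nN (leq0n _).
rewrite muln0; apply=> //.
- by rewrite subn0 mul2n -addnn leq_add2r leq_maxr.
- lra.
- by move=> z /hz; lra.
Qed.

Lemma rho_bound n : (0 < n)%N -> exists2 B : R, 0 < B & forall zs zs', size zs = n -> size zs' = n ->
  normc (rho zs zs') <= B.
Proof.
move=> n0; have [B B0 hB] := GN_bound_laughlin n; have K0 := Kap_gt0 n.
exists (B * Kap n + 1) => [|zs zs' szs szs']; first by rewrite addr_gt0 // mulr_gt0.
have o1 : (0 : R) < 1 := ltr01.
have [T hT] := @rhoP zs zs' ltac:(by rewrite szs) (etrans szs' (esym szs)) _ o1.
pose t := maxn T n; have := hT t (leq_maxl _ _); rewrite normcBC => h.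
rewrite (_ : rho zs zs' = (rho zs zs' - Rt t zs zs') + Rt t zs zs'); last by ring.
apply: le_trans (le_normcD _ _) _; rewrite addrC; apply: lerD => //.
rewrite /Rt szs normc_kap /Kap mulrCA ler_wpM2l ?(ltW (kap_pos n)) // -szs.
apply: (Fsum_bound Rad_gt0 ell_gt0 p_gt0) => //; rewrite ?szs // ?(ltW B0) // => m m' sm sm'.
by apply: hB => //; rewrite (leq_trans (leq_maxr T n)) // leq_pmull.
Qed.

Lemma psi_shift k (z : R * R) : psi k (z.1 - p%:R * ell ^+ 2 / Rad, z.2) * uphase Rad (p%:R * z.2) =
  psi (k + p%:R) z.
Proof.
rewrite /psi /= gau_shift (_ : uphase Rad (p%:R * z.2) = cis (p%:R * z.2 / Rad)) //.
rewrite -mulrA -cisD.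
have -> : (k + p%:R) * a0 = k * a0 + p%:R * ell ^+ 2 / Rad by rewrite /a0 mulrDl !mulrA.
by have -> : (k + p%:R) * (z.2 / Rad) = k * (z.2 / Rad) + p%:R * z.2 / Rad by rewrite mulrDl !mulrA.
Qed.

Lemma psiS_periods c (zs : seq (R * R)) m : size m = size zs ->
  (\prod_(z <- zs) uphase Rad (p%:R * z.2)) * psiS Rad ell c (shiftx (p%:R * ell ^+ 2 / Rad) zs) m =
  psiS Rad ell (c - p%:R) zs m.
Proof.
rewrite /psiS; elim: zs m => [|z zs IH] [|k m] //= sm; first by rewrite !big_nil mulr1.
case: sm => sm; rewrite !big_cons /= -(IH m sm) (_ : k%:R - (c - p%:R) = k%:R - c + p%:R); last by ring.
by rewrite -psi_shift; ring.
Qed.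

Lemma Fsum_periods D c G (zs zs' : seq (R * R)) : size zs' = size zs ->
  (\prod_(z <- zs) uphase Rad (p%:R * z.2)) *
  Fsum D c G (shiftx (p%:R * ell ^+ 2 / Rad) zs) (shiftx (p%:R * ell ^+ 2 / Rad) zs') *
  (\prod_(z <- zs') conjc (uphase Rad (p%:R * z.2))) = Fsum D (c - p%:R) G zs zs'.
Proof.
move=> szs; rewrite /Fsum size_map -nsumZ -nsumZr; apply: eq_nsum => m sm _.
rewrite -nsumZ -nsumZr; apply: eq_nsum => m' sm' _.
rewrite -(psiS_periods c sm) -(psiS_periods c (etrans sm' (esym szs))) conjcM.
have -> : conjc (\prod_(z <- zs') uphase Rad (p%:R * z.2)) = \prod_(z <- zs') conjc (uphase Rad (p%:R * z.2)).
  elim: zs' {szs sm'} => [|z s IH]; last by rewrite !big_cons conjcM IH.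
  by rewrite !big_nil -(rmorph1 RtoC) conjcR.
by ring.
Qed.

Lemma normc_uphase (s : seq (R * R)) : normc (\prod_(z <- s) uphase Rad (p%:R * z.2)) = 1.
Proof. by rewrite normc_prod big1 // => z _; exact: normc_cis. Qed.

Lemma normc_uphaseC (s : seq (R * R)) : normc (\prod_(z <- s) conjc (uphase Rad (p%:R * z.2))) = 1.
Proof. by rewrite normc_prod big1 // => z _; rewrite normc_conj; exact: normc_cis. Qed.

(** The phases and the translation raise every momentum by p, that is, they move the origin of the
    system of 2 t particles from p t to p (t - 1). In the limit both origins are infinitely deep in
    the bulk. *)
Lemma rho_periodic : periodic_family Rad ell p (fun _ => rho).
Proof.
move=> n zs zs' n0 szs szs' _ _; set b := p%:R * ell ^+ 2 / Rad.
set U := \prod_(z <- zs) _; set U' := \prod_(z <- zs') _.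
apply/eqP; rewrite -subr_eq0; apply/eqP; apply: Normc.eq0_normc; apply/eqP.
rewrite eq_le normc_ge0 andbT; apply/ler_addgt0Pr => e e0; rewrite add0r.
have e3 : 0 < e / 3 by rewrite divr_gt0.
have [DD [d0 h]] := Rt_compare n0 e3.
have ss : (0 < size (shiftx b zs))%N by rewrite size_map szs.
have [T1 h1] := @rhoP (shiftx b zs) (shiftx b zs') ss ltac:(by rewrite !size_map szs szs') _ e3.
have [T2 h2] := @rhoP zs zs' ltac:(by rewrite szs) (etrans szs' (esym szs)) _ e3.
have [X X0 hX] := xbound (zs ++ zs').
have [T3 [kT3 hT3]] := large_t DD n (X + p%:R * a0) d0.
pose t := (maxn (maxn T1 T2) T3).+1.
have t1 : (T1 <= t)%N by rewrite ltnW // ltnS -maxnA leq_maxl.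
have t2 : (T2 <= t.+1)%N by rewrite ltnW // ltnS ltnW // ltnS (leq_trans (leq_maxr T1 T2)) // leq_maxl.
have t3 : (T3 <= t)%N by rewrite ltnW // ltnS leq_maxr.
have q1 : normc (U * rho (shiftx b zs) (shiftx b zs') * U' - U * Rt t (shiftx b zs) (shiftx b zs') * U') <= e / 3.
  have -> : U * rho (shiftx b zs) (shiftx b zs') * U' - U * Rt t (shiftx b zs) (shiftx b zs') * U' =
    U * (rho (shiftx b zs) (shiftx b zs') - Rt t (shiftx b zs) (shiftx b zs')) * U' by ring.
  rewrite !Normc.normcM normc_uphase normc_uphaseC mul1r mulr1 normcBC; exact: h1.
have q2 : normc (U * Rt t (shiftx b zs) (shiftx b zs') * U' - Rt t.+1 zs zs') <= e / 3.
  have -> : U * Rt t (shiftx b zs) (shiftx b zs') * U' =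
      RtoC (kappa ^- n) * Fsum (p * (2 * t)) (p * t.-1)%:R (GN (2 * t)) zs zs'.
    have -> : (p * t.-1)%:R = (p * t)%:R - p%:R :> R by rewrite /t /= mulnS natrD addrAC subrr add0r.
    rewrite -(Fsum_periods _ _ _ (etrans szs' (esym szs))) /Rt size_map szs -/U -/U' -/b.
    by ring.
  (* Seen from p (t - 1), the system of 2 t particles reaches too far to the right for [Rt t];
     [Rt t.+1] is the first into which it fits. *)
  apply: (h (2 * t)%N t.-1 t.+1 zs zs' (((p * t)%:R - (p * DD)%:R) * a0 - (X + p%:R * a0))) => //.
  - by rewrite (leq_trans kT3) // (leq_trans t3) // leq_pmull.
  - by rewrite /t; nlia.
  - by rewrite /t; nlia.
  - exact: hT3.
  - move=> z /hX; have -> : (p * t.-1)%:R = (p * t)%:R - p%:R :> R.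
      by rewrite /t /= mulnS natrD addrAC subrr add0r.
    have -> : (p * (2 * t))%:R = 2 * (p * t)%:R :> R by rewrite mulnCA natrM.
    have : 0 <= p%:R * a0 by rewrite mulr_ge0 // ltW // a0_gt0.
    move: (p * t)%:R (p * DD)%:R p%:R a0 => u v w aa; lra.
have q3 := h2 t.+1 t2.
apply: le_trans (normcB_le _ (U * Rt t (shiftx b zs) (shiftx b zs') * U') _) _.
rewrite (_ : e = e / 3 + (e / 3 + e / 3)); last by field.
apply: lerD => //; apply: le_trans (normcB_le _ (Rt t.+1 zs zs') _) _; exact: lerD.
Qed.

End Family.

(** One rate must serve all n although smallness is only known for each n separately. Dividing by w
    n = 2^n (1 + |Bd n|) makes all large n uniformly small, and the finitely many others are handled
    by the second hypothesis. *)
Lemma eps_exists (R : realType) (P : nat -> R -> R -> Prop) (Bd : nat -> R) :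
  (forall n d v, P n d v -> 0 <= v <= Bd n) ->
  (forall n e, 0 < e -> exists D, forall d v, D <= d -> P n d v -> v <= e) ->
  exists (eps : R -> R) (K : nat -> R), (eps d @[d --> +oo] --> (0 : R))%classic /\
    forall n d v, P n d v -> v <= K n * eps d.
Proof.
move=> hB hP; pose w n : R := 2 ^+ n * (1 + `|Bd n|).
have w0 n : 0 < w n by rewrite mulr_gt0 ?exprn_gt0 // ltr_pwDl.
pose S d := [set x : R | x = 0 \/ exists n v, P n d v /\ x = v / w n]%classic.
have vw n d v : P n d v -> v / w n <= 2 ^- n.
  move=> /hB /andP[v0 vB]; rewrite /w invfM mulrCA ler_piMr ?invr_ge0 ?exprn_ge0 //.
  rewrite ler_pdivrMr ?ltr_pwDl // mul1r; have := ler_norm (Bd n); lra.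
have two1 n : 2 ^- n <= 1 :> R by rewrite invf_le1 ?exprn_gt0 // exprn_ege1 // ler1n.
have ubS d : ubound (S d) 1.
  move=> x [-> //|[n [v [/vw h ->]]]]; exact: le_trans h (two1 n).
have neS d : (S d !=set0)%classic by exists 0; left.
have supS d x : S d x -> x <= sup (S d).
  by move=> Sx; apply: ub_le_sup => //; exists 1.
exists (fun d => sup (S d)), w; split; last first.
  move=> n d v Pv; rewrite mulrC -ler_pdivrMr //; apply: supS; right; by exists n, v.
apply/cvgrPdist_le => e e0.
have [n1 hn1] : exists n1, 2 ^- n1 <= e.
  have [n1 hn] := @geo_small R 2^-1 e ltac:(lra) e0; exists n1.
  by have := hn n1 (leqnn _); rewrite exprVn.
have [D hD] : exists D, forall n d v, (n < n1)%N -> D <= d -> P n d v -> v <= e.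
  elim: n1 {hn1} => [|k [D hD]]; first by exists 0.
  have [D1 h1] := hP k e e0; exists (`|D| + `|D1|) => n d v; rewrite ltnS leq_eqVlt => /orP[/eqP->|nk] Dd.
    by apply: h1; apply: le_trans Dd; rewrite (le_trans (ler_norm _)) // lerDr.
  by apply: hD => //; apply: le_trans Dd; rewrite (le_trans (ler_norm _)) // lerDl.
exists D; split; first exact: num_real.
move=> d Dd; rewrite sub0r normrN ger0_norm; last by apply: supS; left.
apply: ge_sup => // x [-> |[n [v [Pv ->]]]]; first exact: ltW.
have [nn|nn] := ltnP n n1.
  have vn := hD n d v nn (ltW Dd) Pv; have /andP[v0 _] := hB _ _ _ Pv.
  apply: le_trans vn; rewrite ler_pdivrMr // ler_peMr //.
  by rewrite /w; apply: mulr_ege1; rewrite ?exprn_ege1 ?ler1n // lerDl.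
apply: (le_trans (vw _ _ _ Pv)); apply: le_trans hn1.
by rewrite lef_pV2 ?posrE ?exprn_gt0 // ler_weXn2l // ler1n.
Qed.

(** * Finite domains *)

Section Finite.
Variables (R : realType) (Rad ell : R) (p : nat).
Hypothesis Rad_gt0 : 0 < Rad.
Hypothesis ell_gt0 : 0 < ell.
Hypothesis p_gt0 : (0 < p)%N.
Notation RtoC := (@real_complex R).
Notation normc := (@Normc.normc R).
Notation a0 := (a0 Rad ell).
Notation g2 := (g2 Rad ell).
Notation GN := (GN p g2).
Notation CT := (CT p g2).
Notation GT := (GT p g2).
Notation Cn := (Cn p g2).
Notation one := (fun=> 1 : R).
Notation kappa := (kappa Rad ell).
Notation Fsum := (Fsum Rad ell).
Notation mu := (@lebesgue_measure R).
Local Arguments conjc : simpl never.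

Lemma CT_lower_laughlin (c0 q tmin : R) : 0 <= c0 -> 0 <= q < 1 -> 0 < tmin ->
  exists2 ct : R, 0 < ct & forall (tau : nat -> R) N, (forall k, 0 <= tau k <= 1) ->
  (forall k, (k < p * N)%N -> tmin <= tau k) ->
  (forall x, (x < p * N)%N -> 1 - tau x <= c0 * (q ^+ x + q ^+ (p * N - x))) ->
  ct * Cn N <= CT tau N.
Proof.
by have [B0 B00 m0] := moment_exp Rad_gt0 ell_gt0 p_gt0; exact: (CT_lower p_gt0 B00 m0).
Qed.

Lemma tau_bulk_laughlin n (e c0 q ct : R) : (0 < n)%N -> 0 < e -> 0 <= c0 -> 0 <= q < 1 -> 0 < ct ->
  exists D, forall (tau : nat -> R) N m m', (forall k, 0 <= tau k <= 1) ->
  (forall x, (x < p * N)%N -> 1 - tau x <= c0 * (q ^+ x + q ^+ (p * N - x))) ->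
  ct * Cn N <= CT tau N -> size m = n -> size m' = n ->
  all (leq (p * D)) m -> all (leq (p * D)) m' ->
  all (fun x => x + p * D < p * N)%N m -> all (fun x => x + p * D < p * N)%N m' ->
  `|GT tau N m m' one / CT tau N - GN N m m'| <= e.
Proof.
move=> n0 e0; have [B0 B00 m0] := moment_exp Rad_gt0 ell_gt0 p_gt0.
have [r0 [uinf [cu [h1 h2 h3 h4 h5]]]] := renewal_Cn Rad_gt0 ell_gt0 p_gt0.
exact: (tau_bulk p_gt0 h1 h2 h3 B00 h4 h5 m0 n0 e0).
Qed.

(* Mass of the normalized k-th orbital in [a, b] x [0, 2 pi R]. *)
Definition tauD (a b : \bar R) (k : nat) : R := TT Rad ell 0 (fun=> 1) a b k / kappa.

Lemma tw_TT a b r : tw (TT Rad ell 0 (fun=> 1) a b) r = kappa ^+ size r * tw (tauD a b) r.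
Proof.
rewrite /tw; elim: r => [|x r IH]; first by rewrite !big_nil mulr1.
have e x0 : TT Rad ell 0 (fun=> 1) a b x0 = kappa * tauD a b x0.
  by rewrite /tauD mulrC divfK // gt_eqF // kappa_gt0.
rewrite !big_cons IH e exprS; ring.
Qed.

Lemma psiprodE zs m : psiprod Rad ell zs m = psiS Rad ell 0 zs m.
Proof. by rewrite /psiprod /psiS; apply: eq_bigr => x _; rewrite subr0. Qed.

Lemma cancel_weights (S kn kl Fq lf G c : R) : S != 0 -> kn != 0 -> kl != 0 -> Fq != 0 -> lf != 0 ->
  Fq / (S * (kn * kl * (c * (Fq * lf)))) * (S * (kl * (G * lf))) = kn^-1 * (G / c).
Proof.
(* For a vanishing normalization both quotients are 0, the inverse of 0 being 0. *)
move=> S0 k0 l0 F0 f0; have [->|c0] := eqVneq c 0.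
  by rewrite mul0r !mulr0 invr0 mulr0 mul0r !mulr0.
by field; do ?(apply/andP; split).
Qed.

(** Factorials, reference energy and orbital norms cancel against the norm of the state, except for
    one factor [kappa] for each of the n marked particles. *)
Lemma rhoN_Fsum a b N zs zs' : (size zs <= N)%N -> size zs' = size zs ->
  rhoN Rad ell p N a b zs zs' = RtoC (kappa ^- size zs) *
  Fsum (p * N) 0 (fun m m' => GT (tauD a b) N m m' one / CT (tauD a b) N) zs zs'.
Proof.
move=> sN szs; rewrite /rhoN; set n := size zs; set l := (N - n)%N.
have Nl : (size zs + l)%N = N by rewrite /l subnKC.
have mt : measurable_fun [set: R]%classic (fun=> 1 : R) by exact: measurable_cst.
have tM (x : R) : 0 <= (fun=> 1 : R) x <= 1 by rewrite ler01 lexx.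
have s0 (s : seq (R * R)) : shiftx 0 s = s.
  by rewrite /shiftx -[RHS]map_id; apply: eq_map => -[x y] /=; rewrite subr0.
have k0 : kappa != 0 by rewrite gt_eqF // kappa_gt0.
have := repI_Psi Rad_gt0 ell_gt0 p_gt0 0 mt tM a b l szs; cbv zeta; rewrite Nl => h.
have -> : ciint Rad a b l (fun w => Psi Rad ell p (zs ++ w) * conjc (Psi Rad ell p (zs' ++ w))) =
    RtoC (sqA Rad ell p N ^+ 2) * nsum (p * N) n (fun m => nsum (p * N) n (fun m' =>
      psiS Rad ell 0 zs m * conjc (psiS Rad ell 0 zs' m') *
      RtoC (kappa ^+ l * (GT (tauD a b) N m m' one * l`!%:R)))).
  transitivity (ciint Rad a b l (fun w => Psi Rad ell p (shiftx 0 (zs ++ w)) *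
      conjc (Psi Rad ell p (shiftx 0 (zs' ++ w))) * RtoC (\prod_(z <- w) (fun=> 1 : R) z.1))).
    by congr (ciint _ _ _ _ _); apply/funext => w; rewrite !s0 big1 // rmorph1 mulr1.
  rewrite (repI_ciint Rad_gt0 h) !s0; congr (_ * _).
  apply: eq_nsum => m sm _; apply: eq_nsum => m' _ _; rewrite !psiprodE; congr (_ * RtoC _).
  rewrite /GT sm -/n -/l divfK ?pnatr_eq0 -?lt0n ?fact_gt0 // -nsumZ.
  by apply: eq_nsum => r sr _; rewrite tw_TT sr mulr1 mulrCA.
have -> : normsq_Psi Rad ell p N a b = sqA Rad ell p N ^+ 2 * (kappa ^+ n * kappa ^+ l *
    (CT (tauD a b) N * (N ^_ n * l`!)%:R)).
  rewrite ffact_fact // -exprD Nl.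
  transitivity (iint Rad a b N (fun w => normc (Psi Rad ell p (shiftx 0 w)) ^+ 2 * \prod_(z <- w) (fun=> 1 : R) z.1)).
    by rewrite /normsq_Psi; congr (iint _ _ _ _ _); apply/funext => w; rewrite s0 big1 // mulr1.
  rewrite (isI_iint Rad_gt0 (isI_Psi Rad_gt0 ell_gt0 p_gt0 0 mt tM a b N)); congr (_ * _).
  rewrite /CT divfK ?pnatr_eq0 -?lt0n ?fact_gt0 // -nsumZ.
  by apply: eq_nsum => r sr _; rewrite tw_TT sr mulrCA.
rewrite -ffact_factd // /Fsum -/n -!nsumZ; apply: eq_nsum => m sm _.
rewrite -!nsumZ; apply: eq_nsum => m' sm' _.
set A := psiS _ _ _ _ _; set B := conjc _.
set u : R := (N ^_ n)%:R / _; set S := sqA _ _ _ _ ^+ 2; set v := kappa ^+ l * _; set G := _ / _.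
have key : u * (S * v) = kappa ^- n * G.
  rewrite /u /v /G natrM; apply: cancel_weights; rewrite ?expf_neq0 ?gt_eqF ?expR_gt0 ?kappa_gt0 //.
  by rewrite ltr0n ffact_gt0.
transitivity (A * B * RtoC (u * (S * v))); first by rewrite !rmorphM /=; ring.
by rewrite key rmorphM /=; ring.
Qed.

Definition Ig : R := Num.sqrt (ell ^+ 2 * pi).

Lemma ell2_gt0 : 0 < ell ^+ 2. Proof. by rewrite exprn_gt0. Qed.

Lemma Ig_gt0 : 0 < Ig.
Proof. by rewrite sqrtr_gt0 mulr_gt0 ?pi_gt0 // ell2_gt0. Qed.

Lemma tauE a b k : tauD a b k =
  (\int[mu]_(x in xdom a b) gau (ell ^+ 2) (k%:R * a0) x)%R / Ig.
Proof.
rewrite /tauD /TT /kappa -/Ig addr0.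
have -> : (\int[mu]_(x in xdom a b) (gau (ell ^+ 2) (k%:R * a0) x * 1))%R =
  (\int[mu]_(x in xdom a b) gau (ell ^+ 2) (k%:R * a0) x)%R by apply: eq_Rintegral => x _; rewrite mulr1.
by rewrite invfM mulrACA divff ?mul1r // gt_eqF // mulr_gt0 // mulr_gt0 // pi_gt0.
Qed.

Lemma gau_mask (v c : R) (D : set R) : 0 < v -> measurable D ->
  mu.-integrable [set: R]%classic (EFin \o (fun x => gau v c x * \1_D x)) /\
  (\int[mu]_(x in D) gau v c x = \int[mu]_x (gau v c x * \1_D x))%R.
Proof.
move=> v0 mD; split.
  apply: (@integrable_dom _ _ 1 v c v0); first by apply: measurable_funM; [exact: measurable_gau|exact: measurable_indic].
  move=> x; rewrite mul1r indicE normrM ger0_norm ?gau_ge0 // ler_piMr ?gau_ge0 //.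
  by case: (_ \in _); rewrite ?normr1 ?normr0.
rewrite Rintegral_mkcond; apply: eq_Rintegral => x _.
by rewrite patchE indicE; case: (_ \in _); rewrite ?mulr1 ?mulr0.
Qed.

Lemma tau01 a b k : 0 <= tauD a b k <= 1.
Proof.
have I0 := Ig_gt0; have v0 := ell2_gt0; rewrite tauE; apply/andP; split.
  by apply: mulr_ge0; [apply: Rintegral_ge0 => x _; exact: gau_ge0|rewrite invr_ge0 ltW].
rewrite ler_pdivrMr // mul1r.
have [i1 ->] := gau_mask (k%:R * a0) v0 (measurable_xdom a b).
have [i2 e2] := integral_gau (k%:R * a0) v0; rewrite /Ig -e2.
apply: le_Rintegral => // x _; rewrite indicE ler_piMr ?gau_ge0 //; by case: (_ \in _).
Qed.

(** * Orbital masses in a domain with ends near those of the droplet *)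

Section Domain.
Variables (C : R) (a b : \bar R) (N : nat).
Hypothesis aC : (a <= C%:E)%E.
Hypothesis bC : (((p * N)%:R * a0 - C)%:E <= b)%E.

Definition qtau : R := expR (- (a0 / ell)).
Definition ctau : R := expR (1 / 2 + C / ell).

Lemma qtau_bd : 0 <= qtau < 1.
Proof. by rewrite expR_ge0 /= -expR0 ltr_expR oppr_lt0 divr_gt0 // a0_gt0. Qed.

(** Half of the exponent gives the decay in the distance from the centre to the nearer end of the
    domain, by u^2 / 2 >= |u| - 1/2; the other half stays as an integrable Gaussian. The 1/2 and the
    offset C of the ends make up [ctau]. *)
Lemma gau_outside (k : nat) x : (k <= p * N)%N -> ~ xdom a b x ->
  gau (ell ^+ 2) (k%:R * a0) x <= ctau * (qtau ^+ k + qtau ^+ (p * N - k)) * gau (2 * ell ^+ 2) (k%:R * a0) x.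
Proof.
move=> kN nx; have l0 : ell != 0 by rewrite gt_eqF.
set c := k%:R * a0; pose u := (x - c) / ell.
have key (X Y y : R) : 0 <= X -> 0 <= Y -> X = expR y -> - (u ^+ 2 / 2) <= 1 / 2 + C / ell + y ->
    gau (ell ^+ 2) c x <= ctau * (X + Y) * gau (2 * ell ^+ 2) c x.
  move=> X0 Y0 Xe h; apply: (@le_trans _ _ (ctau * X * gau (2 * ell ^+ 2) c x)); last first.
    by rewrite ler_wpM2r ?gau_ge0 // ler_wpM2l ?expR_ge0 // lerDl.
  rewrite Xe /ctau /gau -!expRD ler_expR.
  have -> : - (x - c) ^+ 2 / ell ^+ 2 = - u ^+ 2 by rewrite /u expr_div_n mulNr.
  have -> : - (x - c) ^+ 2 / (2 * ell ^+ 2) = - u ^+ 2 / 2 by rewrite /u expr_div_n; field.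
  by lra.
have qX n : qtau ^+ n = expR (- (n%:R * a0 / ell)).
  by rewrite /qtau -expRM_natl; congr expR; ring.
have q0 n : 0 <= qtau ^+ n by rewrite exprn_ge0 // expR_ge0.
have [xC|Cx] := leP x C.
  apply: (key _ _ _ (q0 _) (q0 _) (qX k)).
  have : u <= C / ell - k%:R * a0 / ell by rewrite /u -mulrBl ler_pM2r ?invr_gt0 // lerB.
  by have := sqr_ge0 (u + 1); rewrite sqrrD1; lra.
have xb : (p * N)%:R * a0 - C <= x.
  rewrite leNgt; apply/negP => h; apply: nx; split.
    by apply: (le_trans aC); rewrite lee_fin ltW.
  by apply: le_trans bC; rewrite lee_fin ltW.
rewrite [qtau ^+ k + _]addrC; apply: (key _ _ _ (q0 _) (q0 _) (qX _)).
have : (p * N)%:R * a0 / ell - C / ell - k%:R * a0 / ell <= u.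
  by rewrite /u -!mulrBl ler_pM2r ?invr_gt0 // lerB.
rewrite natrB // mulrBl mulrBl; have := sqr_ge0 (u - 1); rewrite sqrrB1; lra.
Qed.

Lemma tau_tail (k : nat) : (k < p * N)%N ->
  1 - tauD a b k <= ctau * Num.sqrt 2 * (qtau ^+ k + qtau ^+ (p * N - k)).
Proof.
move=> kN; have I0 := Ig_gt0; have v0 := ell2_gt0; rewrite tauE.
have v2 : 0 < 2 * ell ^+ 2 by rewrite mulr_gt0.
set c := k%:R * a0; set E := qtau ^+ k + _.
have [i1 ->] := gau_mask c v0 (measurable_xdom a b).
have [i2 e2] := integral_gau c v0; have [i3 e3] := integral_gau c v2.
have e1 : 1 = (\int[mu]_x gau (ell ^+ 2) c x)%R / Ig by rewrite e2 divff // gt_eqF.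
rewrite [X in X - _ <= _]e1 -mulrBl ler_pdivrMr // -RintegralB //.
have -> : ctau * Num.sqrt 2 * E * Ig = ctau * E * (\int[mu]_x gau (2 * ell ^+ 2) c x)%R.
  by rewrite e3 -[2 * _ * pi]mulrA sqrtrM ?ler0n // -/Ig; ring.
have cE : 0 <= ctau * E.
  by apply: mulr_ge0; rewrite ?expR_ge0 // addr_ge0 // exprn_ge0 // expR_ge0.
rewrite -RintegralZl //; apply: le_Rintegral => //.
- apply: (@integrable_dom _ _ 1 (ell ^+ 2) c v0).
    apply: measurable_funB; first exact: measurable_gau.
    apply: measurable_funM; first exact: measurable_gau.
    by apply: measurable_indic; exact: measurable_xdom.
  move=> x; rewrite mul1r indicE; case: (_ \in _); first by rewrite mulr1 subrr normr0 gau_ge0.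
  by rewrite mulr0 subr0 ger0_norm ?gau_ge0.
- apply: (@integrable_dom _ _ (ctau * E) (2 * ell ^+ 2) c v2).
    by apply: measurable_funM; [exact: measurable_cst|exact: measurable_gau].
  by move=> x; rewrite ger0_norm //; apply: mulr_ge0 => //; exact: gau_ge0.
move=> x _; rewrite indicE; have [xD|xD] := boolP (x \in xdom a b).
  by rewrite mulr1 subrr; apply: mulr_ge0 => //; exact: gau_ge0.
rewrite mulr0 subr0; apply: gau_outside; first exact: ltnW.
by move=> h; move/negP: xD; apply; exact: mem_set.
Qed.

(** Smallest value of the Gaussian on a unit interval inside the domain that stays within |C| + 1 of
    the centre; such an interval exists once the domain is long enough. *)
Definition tmin : R := expR (- ((`|C| + 1) ^+ 2 / ell ^+ 2)) / Ig.

Lemma tmin_gt0 : 0 < tmin.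
Proof. by rewrite divr_gt0 ?expR_gt0 ?Ig_gt0. Qed.

Lemma tau_min (k : nat) : 2 * `|C| + 1 <= (p * N)%:R * a0 -> (k < p * N)%N -> tmin <= tauD a b k.
Proof.
move=> big kN; have I0 := Ig_gt0; have v0 := ell2_gt0; have a00 := a0_gt0 Rad_gt0 ell_gt0.
rewrite tauE /tmin ler_pM2r ?invr_gt0 //; set c := k%:R * a0; set g := expR _; set L := (p * N)%:R * a0.
have c0 : 0 <= c by rewrite mulr_ge0 // ltW.
have cL : c <= L by rewrite ler_pM2r // ler_nat ltnW.
have CC := ler_norm C; have CN := ler_normr C (- C); have C00 := normr_ge0 C.
have [y y1 y2] : exists2 y, `|C| <= y <= L - `|C| - 1 & - (`|C| + 1) <= y - c <= `|C|.
  have [h1|h1] := leP c `|C|; first by exists `|C|; rewrite -/L in big; lra.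
  have [h2|h2] := leP c (L - `|C| - 1); first by exists c; lra.
  by exists (L - `|C| - 1); rewrite -/L in big; lra.
pose J := `[y, y + 1]%classic; have mJ : measurable J by exact: measurable_itv.
have [i1 ->] := gau_mask c v0 (measurable_xdom a b).
have gle x : g * \1_J x <= gau (ell ^+ 2) c x * \1_(xdom a b) x.
  rewrite !indicE; have [|_] := boolP (x \in J); last first.
    by rewrite mulr0 mulr_ge0 ?gau_ge0 //; case: (_ \in _).
  rewrite inE /J /= in_itv /= => xJ.
  have -> : x \in xdom a b.
    rewrite inE; split.
      by apply: (le_trans aC); rewrite lee_fin; lra.
    by apply: le_trans bC; rewrite lee_fin -/L; lra.
  rewrite !mulr1 /g /gau ler_expR mulNr lerN2 ler_pM2r ?invr_gt0 //.
  by rewrite -(real_normK (num_real (x - c))) ler_pXn2r ?nnegrE ?addr_ge0 // ler_norml; lra.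
have iJ : mu.-integrable [set: R]%classic (EFin \o (fun x => g * \1_J x)).
  apply: (@integrable_dom _ _ 1 (ell ^+ 2) c v0).
    by apply: measurable_funM; [exact: measurable_cst|exact: measurable_indic].
  move=> x; rewrite mul1r ger0_norm; last by rewrite mulr_ge0 ?expR_ge0 // indicE; case: (_ \in _).
  apply: (le_trans (gle x)); rewrite indicE ler_piMr ?gau_ge0 //; by case: (_ \in _).
have -> : g = (\int[mu]_x (g * \1_J x))%R.
  transitivity ((\int[mu]_(x in J) g)%R).
    have J1 : mu J = 1%E.
      by rewrite /J lebesgue_measure_itv /= lte_fin ltrDl ltr01 -EFinB (_ : y + 1 - y = 1) //; ring.
    rewrite Rintegral_cst // -[LHS]mulr1; congr (g * _).
    exact: (esym (congr1 fine J1)).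
  rewrite Rintegral_mkcond; apply: eq_Rintegral => x _.
  by rewrite patchE indicE; case: (_ \in _); rewrite ?mulr1 ?mulr0.
by apply: le_Rintegral => // x _; exact: gle.
Qed.

End Domain.
End Finite.

(** * Approximation of the finite-volume correlation functions, uniformly in the domain *)

Section Approximation.
Variables (R : realType) (Rad ell : R) (p : nat).
Hypothesis Rad_gt0 : 0 < Rad.
Hypothesis ell_gt0 : 0 < ell.
Hypothesis p_gt0 : (0 < p)%N.
Notation RtoC := (@real_complex R).
Notation normc := (@Normc.normc R).
Notation a0 := (a0 Rad ell).
Notation g2 := (g2 Rad ell).
Notation GN := (GN p g2).
Notation CT := (CT p g2).
Notation GT := (GT p g2).
Notation Cn := (Cn p g2).
Notation one := (fun=> 1 : R).
Notation kappa := (kappa Rad ell).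
Notation Wchi := (Wchi Rad ell).
Notation Fsum := (Fsum Rad ell).
Notation Kap := (Kap Rad ell).
Notation tauD := (tauD Rad ell).
Local Arguments conjc : simpl never.

Variables (C : R) (a b : nat -> \bar R).
Hypothesis aC : forall N, (a N <= C%:E)%E.
Hypothesis bC : forall N, (((p * N)%:R * a0 - C)%:E <= b N)%E.

Notation tau N := (tauD (a N) (b N)).

(** Small N are left out: the interval [a, b] may then be empty, since a may be C and b may be
    smaller. *)
Lemma CT_tau_lower : exists2 ct : R, 0 < ct & exists N0 : nat, forall N, (N0 <= N)%N -> ct * Cn N <= CT (tau N) N.
Proof.
have a00 := a0_gt0 Rad_gt0 ell_gt0.
have c00 : 0 <= ctau ell C * Num.sqrt 2 by rewrite mulr_ge0 ?expR_ge0 ?sqrtr_ge0.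
have [ct ct0 h] := CT_lower_laughlin Rad_gt0 ell_gt0 p_gt0 c00 (qtau_bd Rad_gt0 ell_gt0) (tmin_gt0 ell_gt0 C).
exists ct => //; exists (Num.bound ((2 * `|C| + 1) / a0)) => N NN; apply: h => [k|k kN|k kN].
- exact: tau01.
- apply: tau_min => //; rewrite -ler_pdivrMr //.
  apply: le_trans (ltW (archi_boundP _)) _; first by apply: divr_ge0; [rewrite addr_ge0 ?mulr_ge0|exact: ltW].
  by rewrite ler_nat (leq_trans NN) // leq_pmull.
- exact: tau_tail.
Qed.

Lemma weight_ratio (G B ct C0 T : R) : 0 < ct -> 0 < C0 -> 0 <= B -> ct * C0 <= T -> `|G| <= B * C0 -> `|G / T| <= B / ct.
Proof.
move=> c0 C00 B0 h1 h2; have T0 : 0 < T by apply: lt_le_trans h1; exact: mulr_gt0.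
rewrite normrM normfV (ger0_norm (ltW T0)) ler_pdivrMr //; apply: (le_trans h2).
by rewrite mulrAC -mulrA ler_wpM2l // ler_pdivlMr // mulrC.
Qed.

Lemma rhoN_bound n : (0 < n)%N -> exists2 B : R, 0 < B & forall N zs zs', (n <= N)%N -> size zs = n -> size zs' = n ->
  normc (rhoN Rad ell p N (a N) (b N) zs zs') <= B.
Proof.
move=> n0; have [B B0 hB] := GT_bound_laughlin Rad_gt0 ell_gt0 p_gt0 n; have [ct ct0 [N0 hc]] := CT_tau_lower.
have K0 := Kap_gt0 Rad_gt0 ell_gt0 n.
(* The finitely many N below [N0] have no common lower bound on the norm; their individual bounds
   are simply added. *)
pose M := B / ct + \sum_(i <- iota 0 N0) B * Cn i * `|(CT (tau i) i)^-1|.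
have C0 N := Cn_gt0 g2 p_gt0 N.
have t0 i : 0 <= B * Cn i * `|(CT (tau i) i)^-1| by rewrite mulr_ge0 // mulr_ge0 // ltW.
have M1 : 0 < B / ct by rewrite divr_gt0.
have M2 : 0 <= \sum_(i <- iota 0 N0) B * Cn i * `|(CT (tau i) i)^-1| by apply: sumr_ge0.
exists (M * Kap n); first by rewrite mulr_gt0 // ltr_pwDl.
move=> N zs zs' nN szs szs'; rewrite rhoN_Fsum ?szs // normc_kap // /Kap mulrCA.
rewrite ler_wpM2l ?(ltW (kap_pos Rad_gt0 ell_gt0 n)) // -szs.
apply: (Fsum_bound Rad_gt0 ell_gt0 p_gt0); rewrite ?szs //; first by rewrite addr_ge0 // ltW.
move=> m m' sm sm'; have hG := hB (tau N) N m m' (fun k => tau01 Rad_gt0 ell_gt0 _ _ k) sm sm' nN.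
have [NN|NN] := leqP N0 N.
  apply: (@le_trans _ _ (B / ct)); last by rewrite lerDl.
  exact: (weight_ratio ct0 (C0 N) (ltW B0) (hc N NN) hG).
apply: (@le_trans _ _ (B * Cn N * `|(CT (tau N) N)^-1|)); first by rewrite normrM ler_wpM2r.
apply: (@le_trans _ _ (\sum_(i <- iota 0 N0) B * Cn i * `|(CT (tau i) i)^-1|)); last by rewrite lerDr ltW.
by apply: (ler_term (F := fun i => B * Cn i * `|(CT (tau i) i)^-1|)) => //; rewrite mem_iota.
Qed.

Variable rho : seq (R * R) -> seq (R * R) -> R[i].
Hypothesis rhoP : forall zs zs', (0 < size zs)%N -> size zs' = size zs ->
  forall e, 0 < e -> exists T, forall t, (T <= t)%N -> normc (Rt Rad ell p t zs zs' - rho zs zs') <= e.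

Lemma rhoN_close n (e : R) : (0 < n)%N -> 0 < e -> exists D : R, forall N zs zs' d,
  (n <= N)%N -> size zs = n -> size zs' = n -> D <= d ->
  (forall z, z \in zs ++ zs' -> d <= z.1 <= (p * N)%:R * a0 - d) ->
  normc (rhoN Rad ell p N (a N) (b N) zs zs' - rho zs zs') <= e.
Proof.
move=> n0 e0; have a00 := a0_gt0 Rad_gt0 ell_gt0; have K0 := Kap_gt0 Rad_gt0 ell_gt0 n.
have e2 : 0 < e / 2 by rewrite divr_gt0.
have [D1 h1] := rho_close Rad_gt0 ell_gt0 p_gt0 rhoP n0 e2.
have [B B0 hB] := GT_bound_laughlin Rad_gt0 ell_gt0 p_gt0 n; have [B' B'0 hB'] := GN_bound_laughlin Rad_gt0 ell_gt0 p_gt0 n.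
have [ct ct0 [N0 hc]] := CT_tau_lower.
have e1 : 0 < e / 2 / (2 * Kap n) by rewrite divr_gt0 // mulr_gt0.
have c00 : 0 <= ctau ell C * Num.sqrt 2 by rewrite mulr_ge0 ?expR_ge0 ?sqrtr_ge0.
have [DD hD] := tau_bulk_laughlin Rad_gt0 ell_gt0 p_gt0 n0 e1 c00 (qtau_bd Rad_gt0 ell_gt0) ct0.
pose M := B / ct + B'; have M0 : 0 < M by rewrite addr_gt0 // divr_gt0.
have [d0 hd] := exp_small ell_gt0 M0 e1.
have pD : 0 <= (p * DD)%:R * a0 by rewrite mulr_ge0 // ltW.
have pN0 : 0 <= (p * N0)%:R * a0 by rewrite mulr_ge0 // ltW.
have D1a := ler_norm D1; have d0a := ler_norm d0; have D1b := normr_ge0 D1; have d0b := normr_ge0 d0.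
exists (`|D1| + `|d0| + (p * DD)%:R * a0 + (p * N0)%:R * a0) => N zs zs' d nN szs szs' dd hz.
(* A point at depth d from both ends forces the system to have length at least 2 d. *)
have NN : (N0 <= N)%N.
  have [z zz] : exists z, z \in zs by case: (zs) szs n0 => [<-//|z s _ _]; exists z; exact: mem_head.
  have := hz z ltac:(by rewrite mem_cat zz) => /andP[z1 z2].
  have : (p * N0)%:R * a0 <= (p * N)%:R * a0 by lra.
  by rewrite ler_pM2r // ler_nat leq_pmul2l.
apply: le_trans (normcB_le _ (RtoC (kappa ^- n) * Fsum (p * N) 0 (GN N) zs zs') _) _.
rewrite [e]splitr; apply: lerD; last by apply: (h1 N zs zs' d) => //; lra.
rewrite rhoN_Fsum ?szs // -mulrBr normc_kap //.
pose lo := (p * DD)%N; pose hi := (p * (N - DD))%N; pose delta := d - (p * DD)%:R * a0.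
have hiR : (p * N)%:R - (p * DD)%:R <= hi%:R :> R.
  have [h|h] := leqP DD N; first by rewrite /hi mulnBr natrB // leq_mul2l h orbT.
  rewrite /hi; have -> : (N - DD = 0)%N by apply/eqP; rewrite subn_eq0 ltnW.
  by rewrite muln0 subr_le0 ler_nat leq_mul2l ltnW ?orbT.
have hia : (p * N)%:R * a0 - (p * DD)%:R * a0 <= hi%:R * a0 by rewrite -mulrBl ler_pM2r.
have win (z : R * R) : z \in zs ++ zs' -> (lo%:R - 0) * a0 + delta <= z.1 <= (hi%:R - 0) * a0 - delta.
  by move=> /hz /andP[z1 z2]; rewrite !subr0 /lo /delta; apply/andP; split; lra.
have key : normc (Fsum (p * N) 0 (fun m m' => GT (tau N) N m m' one / CT (tau N) N) zs zs' - Fsum (p * N) 0 (GN N) zs zs')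
    <= (e / 2 / (2 * Kap n) + M * expR (- (delta / (2 * ell)))) * (Wchi ^+ size zs * Wchi ^+ size zs).
  apply: (@Fsum_diff _ _ _ _ Rad_gt0 ell_gt0 p_gt0 _ _ _ _ _ _ lo hi).
  - by rewrite szs.
  - exact: ltW.
  - exact: ltW.
  - move=> m m'; rewrite szs => sm sm'; apply: le_trans (ler_normB _ _) _; apply: lerD; last exact: hB'.
    apply: (weight_ratio ct0 (Cn_gt0 g2 p_gt0 N) (ltW B0) (hc N NN)).
    by apply: hB => // k; exact: tau01.
  - move=> m m'; rewrite szs => sm sm' am am'.
    have inlo (s : seq nat) : all (inwin lo hi) s -> all (leq (p * DD)) s.
      by apply: sub_all => x /andP[].
    have inhi (s : seq nat) : all (inwin lo hi) s -> all (fun x => x + p * DD < p * N)%N s.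
      apply: sub_all => x /andP[_]; rewrite /hi mulnBr.
      by move: (p * DD)%N (p * N)%N => u v *; plia.
    apply: hD => //; try exact: inlo; try exact: inhi; first by move=> k; exact: tau01.
      by move=> x xN; exact: tau_tail.
    exact: hc.
  - by move=> z zz; apply: win; rewrite mem_cat zz.
  - by move=> z zz; apply: win; rewrite mem_cat zz orbT.
apply: le_trans (ler_wpM2l (ltW (kap_pos Rad_gt0 ell_gt0 n)) key) _.
rewrite szs mulrCA -/(Kap n) -ler_pdivlMr //.
rewrite (_ : e / 2 / Kap n = e / 2 / (2 * Kap n) + e / 2 / (2 * Kap n)); last by field; rewrite gt_eqF.
rewrite lerD2l; apply: le_trans (hd delta _); last by rewrite /delta; lra.
by rewrite ler_pM2r ?expR_gt0 // ler_peMl ?(ltW M0) // ler1n.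
Qed.

Lemma rho_approximates : approximates Rad ell p a b (fun _ => rho).
Proof.
have Na N : N%:R * p%:R * ell ^+ 2 / Rad = (p * N)%:R * a0 by rewrite /a0 natrM; ring.
pose P (n : nat) (d v : R) := exists N zs zs', [/\ (1 <= n)%N, (n <= N)%N, size zs = n /\ size zs' = n,
  (forall z, z \in zs ++ zs' -> d <= z.1 <= (p * N)%:R * a0 - d) &
  v = normc (rhoN Rad ell p N (a N) (b N) zs zs' - rho zs zs')].
have [Bd hBd] : {Bd : nat -> R & forall n, (forall d v, P n d v -> 0 <= v <= Bd n)}.
  apply: (@boolp.choice _ _ (fun n B => forall d v, P n d v -> 0 <= v <= B)) => n; have [n0|n0] := posnP n.
    by exists 0 => d v [N [zs [zs' []]]]; rewrite n0.
  have [B1 _ h1] := rhoN_bound n0; have [B2 _ h2] := rho_bound Rad_gt0 ell_gt0 p_gt0 rhoP n0.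
  exists (B1 + B2) => d v [N [zs [zs' [_ nN [szs szs'] _ ->]]]]; rewrite normc_ge0 /=.
  apply: le_trans (le_normcD _ _) _; rewrite normcN; apply: lerD; [exact: h1|exact: h2].
have hsm n e : 0 < e -> exists D, forall d v, D <= d -> P n d v -> v <= e.
  move=> e0; have [n0|n0] := posnP n.
    by exists 0 => d v _ [N [zs [zs' []]]]; rewrite n0.
  have [D hD] := rhoN_close n0 e0; exists D => d v Dd [N [zs [zs' [_ nN [szs szs'] hz ->]]]].
  exact: (hD N zs zs' d).
have [eps [K [h1 h2]]] := eps_exists hBd hsm; exists eps, K; split=> // n N d zs zs' n1 nN d0 szs szs' hz hz'.
apply: h2; exists N, zs, zs'; split=> // z; rewrite mem_cat -Na => /orP[/hz[]|/hz'[]] //.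
Qed.

End Approximation.

(** * Uniqueness *)

Section Uniqueness.
Variables (R : realType) (Rad ell : R) (p : nat).
Hypothesis Rad_gt0 : 0 < Rad.
Hypothesis ell_gt0 : 0 < ell.
Hypothesis p_gt0 : (0 < p)%N.
Notation normc := (@Normc.normc R).
Local Notation per := (p%:R * ell ^+ 2 / Rad).

Lemma shiftx_shiftx (s t : R) zs : shiftx s (shiftx t zs) = shiftx (t + s) zs.
Proof. by rewrite /shiftx -map_comp; apply: eq_map => z /=; rewrite opprD addrA. Qed.

Lemma shiftx_cyl (s : R) zs : (forall z, z \in zs -> in_cyl Rad z) -> forall z, z \in shiftx s zs -> in_cyl Rad z.
Proof. by move=> h z /mapP[w /h hw ->]. Qed.

(** The phases have modulus 1 and are the same for both families, so their distance is unchanged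
    when all points are moved by whole periods. *)
Lemma periodic_dist (r r' : nat -> seq (R * R) -> seq (R * R) -> R[i]) n zs zs' (k : nat) :
  periodic_family Rad ell p r -> periodic_family Rad ell p r' ->
  (1 <= n)%N -> size zs = n -> size zs' = n ->
  (forall z, z \in zs -> in_cyl Rad z) -> (forall z, z \in zs' -> in_cyl Rad z) ->
  normc (r n (shiftx (- (k%:R * per)) zs) (shiftx (- (k%:R * per)) zs') -
         r' n (shiftx (- (k%:R * per)) zs) (shiftx (- (k%:R * per)) zs')) = normc (r n zs zs' - r' n zs zs').
Proof.
move=> pr pr' n1 szs szs' hz hz'; elim: k => [|k IH].
  have s0 (s : seq (R * R)) : shiftx (- (0%:R * per)) s = s.
    by rewrite /shiftx -[RHS]map_id; apply: eq_map => -[x y] /=; rewrite mul0r opprK addr0.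
  by rewrite !s0.
rewrite -IH; set ws := shiftx (- (k.+1%:R * per)) zs; set ws' := shiftx (- (k.+1%:R * per)) zs'.
have e (s : seq (R * R)) : shiftx (- (k%:R * per)) s = shiftx per (shiftx (- (k.+1%:R * per)) s).
  by rewrite shiftx_shiftx; congr shiftx; rewrite -natr1; ring.
rewrite !e -/ws -/ws'.
have sw : size ws = n by rewrite size_map. have sw' : size ws' = n by rewrite size_map.
have cw := @shiftx_cyl (- (k.+1%:R * per)) _ hz; have cw' := @shiftx_cyl (- (k.+1%:R * per)) _ hz'.
rewrite -(pr n ws ws') // -(pr' n ws ws') // -mulrBl -mulrBr !Normc.normcM.
by rewrite normc_uphase normc_uphaseC mul1r mulr1.
Qed.

(** Moving the points right by k periods brings them to the middle of the system of 2 k particles.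
    There both families are close to the same finite-volume function, with an error that vanishes as
    k grows. *)
Lemma family_unique (C : R) (a b : nat -> \bar R) (r r' : nat -> seq (R * R) -> seq (R * R) -> R[i]) :
  periodic_family Rad ell p r -> periodic_family Rad ell p r' -> admissible_domains Rad ell p C a b ->
  approximates Rad ell p a b r -> approximates Rad ell p a b r' ->
  forall n zs zs', (1 <= n)%N -> size zs = n -> size zs' = n ->
  (forall z, z \in zs -> in_cyl Rad z) -> (forall z, z \in zs' -> in_cyl Rad z) -> r n zs zs' = r' n zs zs'.
Proof.
move=> pr pr' adm [eps [K [ce he]]] [eps' [K' [ce' he']]] n zs zs' n1 szs szs' hz hz'.
have per0 : 0 < per by rewrite divr_gt0 // mulr_gt0 ?ltr0n // exprn_gt0.
apply/eqP; rewrite -subr_eq0; apply/eqP; apply: Normc.eq0_normc; apply/eqP.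
rewrite eq_le normc_ge0 andbT; apply/ler_addgt0Pr => e e0; rewrite add0r.
have small (ep : R -> R) (L : R) : (ep d @[d --> +oo] --> (0 : R))%classic ->
    exists M : R, forall d, M < d -> L * ep d <= e / 2.
  move=> /cvgrPdist_le /(_ (e / 2 / (1 + `|L|))) [].
    by rewrite !divr_gt0 // ltr_pwDl.
  move=> M [_ hM]; exists M => d /hM; rewrite sub0r normrN => h.
  apply: le_trans (ler_norm _) _; rewrite normrM.
  apply: (@le_trans _ _ ((1 + `|L|) * `|ep d|)); first by rewrite ler_wpM2r // lerDr.
  by rewrite mulrC -ler_pdivlMr // ltr_pwDl.
have [M hM] := small _ (K n) ce; have [M' hM'] := small _ (K' n) ce'.
have [X X0 hX] := xbound (zs ++ zs').
(* Makes the depth d exceed M and M', where both errors are below e / 2, and |C|, so that the moved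
   points lie in the domain. *)
pose Y := `|M| + `|M'| + `|C| + X + 1.
have Y0 : 0 <= Y by rewrite !addr_ge0.
pose k := maxn n (Num.bound (Y / per)).
have kY : Y <= k%:R * per.
  rewrite -ler_pdivrMr //; apply: le_trans (ltW (archi_boundP _)) _; first by rewrite divr_ge0 // ltW.
  by rewrite ler_nat leq_maxr.
rewrite -(periodic_dist k pr pr' n1 szs szs' hz hz'); set ws := shiftx _ zs; set ws' := shiftx _ zs'.
pose N := (2 * k)%N; pose d := k%:R * per - X.
have NE : N%:R * p%:R * ell ^+ 2 / Rad = 2 * (k%:R * per) by rewrite /N natrM; ring.
have m1 := ler_norm M; have m2 := ler_norm M'; have m3 := ler_norm C; have m4 := ler_norm (- C).
have m5 := normr_ge0 M; have m6 := normr_ge0 M'; have m7 := normr_ge0 C.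
rewrite normrN in m4; rewrite /Y in kY.
have [aN bN] := adm N; rewrite NE in bN.
have win z : z \in ws ++ ws' -> in_Lambda Rad (a N) (b N) z /\ d <= z.1 <= N%:R * p%:R * ell ^+ 2 / Rad - d.
  rewrite NE -map_cat => /mapP[w wz ->] /=; have wX := hX w wz; split; last by rewrite opprK /d; lra.
  split; last by move: wz; rewrite mem_cat => /orP[/hz|/hz'].
  split=> /=; rewrite opprK.
    by apply: (le_trans aN); rewrite lee_fin; lra.
  by apply: le_trans bN; rewrite lee_fin; lra.
have nN : (n <= N)%N by rewrite /N (leq_trans (leq_maxl n (Num.bound (Y / per)))) // leq_pmull.
have sw : size ws = n by rewrite size_map. have sw' : size ws' = n by rewrite size_map.
have d0 : 0 < d by rewrite /d; lra.
have w1 z : z \in ws -> in_Lambda Rad (a N) (b N) z /\ d <= z.1 <= N%:R * p%:R * ell ^+ 2 / Rad - d.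
  by move=> zw; apply: win; rewrite mem_cat zw.
have w2 z : z \in ws' -> in_Lambda Rad (a N) (b N) z /\ d <= z.1 <= N%:R * p%:R * ell ^+ 2 / Rad - d.
  by move=> zw; apply: win; rewrite mem_cat zw orbT.
have g1 := he n N d ws ws' n1 nN d0 sw sw' w1 w2; have g2 := he' n N d ws ws' n1 nN d0 sw sw' w1 w2.
apply: le_trans (normcB_le _ (rhoN Rad ell p N (a N) (b N) ws ws') _) _.
rewrite [e]splitr normcBC; apply: lerD.
  by apply: (le_trans g1); apply: hM; rewrite /d; lra.
by apply: (le_trans g2); apply: hM'; rewrite /d; lra.
Qed.

End Uniqueness.

Theorem theorem2p1 (R : realType) (Rad ell : R) (p : nat) (C : R) :
  0 < Rad -> 0 < ell -> (1 <= p)%N ->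
  exists rho : nat -> seq (R * R) -> seq (R * R) -> R[i],
    periodic_family Rad ell p rho /\
    (forall a b : nat -> \bar R,
        admissible_domains Rad ell p C a b -> approximates Rad ell p a b rho) /\
    (forall rho' : nat -> seq (R * R) -> seq (R * R) -> R[i],
        periodic_family Rad ell p rho' ->
        forall a b : nat -> \bar R,
          admissible_domains Rad ell p C a b -> approximates Rad ell p a b rho' ->
          forall (n : nat) (zs zs' : seq (R * R)),
            (1 <= n)%N -> size zs = n -> size zs' = n ->
            (forall z, z \in zs -> in_cyl Rad z) ->
            (forall z, z \in zs' -> in_cyl Rad z) ->
            rho' n zs zs' = rho n zs zs').
Proof.
move=> Rad0 ell0 p0; have [rho rhoP] := limit_family_ex Rad0 ell0 p0.
have pr := rho_periodic Rad0 ell0 p0 rhoP.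
have ap (a b : nat -> \bar R) : admissible_domains Rad ell p C a b -> approximates Rad ell p a b (fun _ => rho).
  move=> adm; apply: (rho_approximates Rad0 ell0 p0 (C := C)) => // N; have [aN bN] := adm N => //.
  by rewrite (_ : (p * N)%:R * _ = N%:R * p%:R * ell ^+ 2 / Rad) // /a0 natrM; ring.
exists (fun _ => rho); split=> //; split=> // rho' pr' a b adm ap' n zs zs' n1 szs szs' hz hz'.
exact: (family_unique Rad0 ell0 p0 pr' pr adm ap' (ap a b adm)).
Qed.
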